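(* Let $A,S$ be non-negative random variables with $\mathbb{E}[A]=\mathbb{E}[S]=1$ and let $\alpha\in(1,2)$. Suppose that there exists $C_A\in(0,\infty)$ with $\lim_{x\to\infty}x^{\alpha}\mathbb{P}(A>x)=C_A$; that there exists $\epsilon\in(0,1]$ with $\mathbb{E}[S^{1+\epsilon}]<\infty$; and that for each fixed $B>0$, $Q^n_{A,S,B,\alpha}(\infty)$ and $W^n_{A,S,B,\alpha}(\infty)$ exist for all sufficiently large $n$. Then for every $B>0$, $$\limsup_{x\to\infty}x^{-1}\log\Big(\limsup_{n\to\infty}\mathbb{P}\big(n^{-\frac1\alpha}L^n_{A,S,B,\alpha}(\infty)>x\big)\Big)\le-\Big(\frac{B}{C_A\,\alpha\,\Gamma(-\alpha)}\Big)^{\frac1{\alpha-1}}.$$ If in addition $S$ is deterministic, then $$\liminf_{x\to\infty}x^{-1}\log\Big(\liminf_{n\to\infty}\mathbb{P}\big(n^{-\frac1\alpha}L^n_{A,S,B,\alpha}(\infty)>x\big)\Big)=\limsup_{x\to\infty}x^{-1}\log\Big(\limsup_{n\to\infty}\mathbb{P}\big(n^{-\frac1\alpha}L^n_{A,S,B,\alpha}(\infty)>x\big)\Big)=-\Big(\frac{B}{C_A\,\alpha\,\Gamma(-\alpha)}\Big)^{\frac1{\alpha-1}}.$$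
   Context: For $B>0$, $\alpha>1$ and an integer $n>B^{\frac{\alpha}{\alpha-1}}$, let $\lambda_{n,B,\alpha}=n-Bn^{1/\alpha}$, and let $\mathcal{Q}^n_{A,S,B,\alpha}$ be the first-come-first-served (FCFS) $GI/GI/n$ queue ($n$ identical parallel servers, infinite waiting room) with i.i.d. inter-arrival times distributed as $A/\lambda_{n,B,\alpha}$ and i.i.d. processing times distributed as $S$, independent of the arrivals. If, for any given initial condition, the total number of jobs in the system (in service plus waiting) converges in distribution as time goes to infinity to a (finite) random variable $Q^n_{A,S,B,\alpha}(\infty)$ whose law does not depend on the initial condition, we say that $Q^n_{A,S,B,\alpha}(\infty)$ exists; then $L^n_{A,S,B,\alpha}(\infty)=\big(Q^n_{A,S,B,\alpha}(\infty)-n\big)^+$ is the steady-state number of jobs waiting in queue. Similarly, if for any initial condition the waiting time (time between arrival and start of processing) of the $j$th arriving job converges in distribution as $j\to\infty$ to a random variable $W^n_{A,S,B,\alpha}(\infty)$ whose law does not depend on the initial condition, we say that $W^n_{A,S,B,\alpha}(\infty)$ exists. $\Gamma$ is the Gamma function, extended to negative non-integers by $\Gamma(-t)=\pi\big(-t\,\Gamma(t)\sin(\pi t)\big)^{-1}$ for non-integer $t>0$. *)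

(* Defs.v *)
From HB Require Import structures.
From mathcomp Require Import all_boot all_order all_algebra.
From mathcomp Require Import all_classical all_reals all_analysis.
Set Implicit Arguments.
Unset Strict Implicit.
Unset Printing Implicit Defensive.
Import Order.TTheory GRing.Theory Num.Theory.
Import numFieldNormedType.Exports.

Local Open Scope classical_set_scope.
Local Open Scope ring_scope.

Definition euler_gamma (R : realType) (t : R) : R :=
  Rintegral lebesgue_measure `]0, +oo[%classic
    (fun u : R => u `^ (t - 1) * expR (- u)).

(* For a negative non-integer z = - t this is
   Gamma(- t) = pi / (- t * Gamma(t) * sin(pi t)); the values at 0 and at
   the negative integers, the poles of Gamma, are meaningless. *)
Definition Gamma (R : realType) (z : R) : R :=
  if 0 < z then euler_gamma z
  else pi / (z * euler_gamma (- z) * sin (pi * - z)).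

Definition mutually_independent d (Omega : measurableType d) (R : realType)
    (P : probability Omega R) (I : choiceType) (X : I -> {RV P >-> R}) : Prop :=
  forall (s : seq I) (E : I -> set R), uniq s -> (forall i, measurable (E i)) ->
    P (\bigcap_(i in [set` s]) (X i @^-1` E i)) =
    (\prod_(i <- s) P (X i @^-1` E i))%E.

(* The two random variables may live on different probability spaces. *)
Definition same_law d d' (Omega : measurableType d) (Omega' : measurableType d')
    (R : realType) (P : probability Omega R) (P' : probability Omega' R)
    (X : {RV P >-> R}) (Y : {RV P' >-> R}) : Prop :=
  forall E : set R, measurable E -> distribution P X E = distribution P' Y E.

(* The X i may take infinite values, but the limit law mu lives on R, so no
   mass escapes to infinity; x is a continuity point of the distribution
   function of mu exactly when it is not an atom. *)
Definition cvg_in_distribution d (Omega : measurableType d) (R : realType)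
    (P : probability Omega R) (T : Type) (X : T -> Omega -> \bar R)
    (F : set_system T) (mu : probability R R) : Prop :=
  forall x : R, mu [set x] = 0%E ->
    P [set w | (X i w <= x%:E)%E] @[i --> F] --> mu `]-oo, x]%classic.

(* A and S are i.i.d. copies of A0 and S0, and the whole family made of the
   two sequences is mutually independent. *)
Definition GI_primitives d0 d (Omega0 : measurableType d0)
    (Omega : measurableType d) (R : realType) (P0 : probability Omega0 R)
    (P : probability Omega R) (A0 S0 : {RV P0 >-> R})
    (A S : nat -> {RV P >-> R}) : Prop :=
  [/\ forall j, same_law (A j) A0,
      forall j, same_law (S j) S0 &
      mutually_independent
        (fun i : nat + nat => match i with inl j => A j | inr j => S j end)].

(* State of the queue at time 0: the time to the first arrival, the residual
   processing times of the jobs in service, and the number of jobs waiting.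
   The waiting jobs have not started: their processing times are fresh copies
   of S. *)
Record initial_condition (R : realType) := InitialCondition {
  first_arrival : R;
  residuals : seq R;
  waiting : nat }.

Definition admissible (R : realType) (n : nat) (c : initial_condition R) : bool :=
  [&& 0 <= first_arrival c,
      all (fun r => 0 <= r) (residuals c),
      (size (residuals c) <= n)%N &
      (0 < waiting c)%N ==> (size (residuals c) == n)].

Section sample_path.
Context {R : realType}.
Variables (n : nat) (c : initial_condition R).
(* interarrival times after the first arrival, and processing times *)
Variables (T V : nat -> R).

(* The jobs not in service at time 0 are numbered in the order in which they
   are served: those waiting at time 0 first, then the arrivals. *)
Definition arrival (j : nat) : R :=
  if (j < waiting c)%N then 0
  else first_arrival c + \sum_(0 <= i < (j - waiting c)%N) T i.

(* Times at which the n servers become free of the jobs present at time 0 and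
   of jobs 0, ..., j-1, in nondecreasing order. Job j goes to the server that
   is free first. *)
Fixpoint free_times (j : nat) : seq R :=
  if j is i.+1 then
    let f := free_times i in
    sort <=%R (Num.max (arrival i) (head 0 f) + V i :: behead f)
  else sort <=%R (residuals c ++ nseq (n - size (residuals c)) 0).

Definition start (j : nat) : R := Num.max (arrival j) (head 0 (free_times j)).

Definition departure (j : nat) : R := start j + V j.

Definition number_in_system (t : R) : \bar R :=
  ((count (fun r => (t < r)%R) (residuals c))%:R%:E +
   \sum_(0 <= j <oo) ((arrival j <= t < departure j)%R%:R)%:E)%E.

Definition waiting_time (j : nat) : R :=
  start (waiting c + j)%N - arrival (waiting c + j)%N.

End sample_path.

Definition arrival_rate (R : realType) (B alpha : R) (n : nat) : R :=
  n%:R - B * n%:R `^ alpha^-1.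

Section steady_state.
Context d (Omega : measurableType d) (R : realType).
Variables (P : probability Omega R) (A S : nat -> {RV P >-> R}).
Variables (B alpha : R) (n : nat).

Definition interarrival (w : Omega) (j : nat) : R :=
  A j w / arrival_rate B alpha n.

Definition processing (w : Omega) (j : nat) : R := S j w.

Definition steady_state_Q (mu : probability R R) : Prop :=
  forall c : initial_condition R, admissible n c ->
    cvg_in_distribution P
      (fun (t : R) w => number_in_system n c (interarrival w) (processing w) t)
      (pinfty_nbhs R) mu.

Definition steady_state_W (mu : probability R R) : Prop :=
  forall c : initial_condition R, admissible n c ->
    cvg_in_distribution P
      (fun (j : nat) w =>
         (waiting_time n c (interarrival w) (processing w) j)%:E)
      \oo mu.

Definition steady_state_Q_exists : Prop :=
  exists mu : probability R R, steady_state_Q mu.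

Definition steady_state_W_exists : Prop :=
  exists mu : probability R R, steady_state_W mu.

End steady_state.

Definition queue_length (R : realType) (n : nat) (q : R) : R :=
  Num.max (q - n%:R) 0.

(* P(n^(-1/alpha) L > x), where L = (Q - n)^+ and Q has law mu *)
Definition scaled_tail (R : realType) (alpha : R) (n : nat)
    (mu : probability R R) (x : R) : \bar R :=
  mu [set q : R | x < n%:R `^ (- alpha^-1) * queue_length n q].

Definition upper_decay (R : realType) (tail : nat -> R -> \bar R) : \bar R :=
  limf_esup (fun x : R => ((x^-1)%:E * lne (limn_esup (tail ^~ x)))%E)
    (pinfty_nbhs R).

Definition lower_decay (R : realType) (tail : nat -> R -> \bar R) : \bar R :=
  limf_einf (fun x : R => ((x^-1)%:E * lne (limn_einf (tail ^~ x)))%E)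
    (pinfty_nbhs R).

Definition decay_rate (R : realType) (B C_A alpha : R) : R :=
  (B / (C_A * alpha * Gamma (- alpha))) `^ (alpha - 1)^-1.

Definition deterministic d (Omega : measurableType d) (R : realType)
    (P : probability Omega R) (X : {RV P >-> R}) : Prop :=
  exists r : R, P [set w | X w = r] = 1%E.

(* Main.v *)
(* Upper bound. The queue is dominated by the system in which no server is ever
   idle: a server finding no waiting job serves a virtual one, so that the starts
   of service form n independent renewal processes. Taken in equilibrium, these
   processes make at least (n - delta n^(1/alpha)) s starts, up to an error of order
   n^(1/alpha), in all windows of length s ending at time t, outside an event whose
   probability vanishes as n grows. A job waiting behind more than x n^(1/alpha)
   others forces, outside that event, the random walk of the interarrival times to
   exceed its drift by about x n^(1/alpha). With kappa = C_A alpha Gamma(-alpha),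
   E[exp(-sA)] = 1 - s + kappa s^alpha + o(s^alpha), so Lundberg's inequality bounds
   the probability of that by exp(-theta x) as soon as kappa theta^(alpha-1) < B.

   Lower bound. If S = 1, every server starts at most one job per unit of time, so
   that the queue is long at time t once there are too many arrivals in the last k
   units of time. For k proportional to x, an exponential tilting of the sum of
   about n k interarrival times shows that this has probability at least
   exp(-(theta + eta) x - c), where kappa theta^(alpha-1) = B.

   Times are rounded to a lattice, and expectations over i.i.d. variables become
   the iterated finite sums [Ex]. *)
Require Import Defs.
From HB Require Import structures.
From mathcomp Require Import all_boot all_order all_algebra.
From mathcomp Require Import all_classical all_reals all_analysis.
From mathcomp Require Import measurable_realfun.
From mathcomp Require Import ring lra zify.
Set Implicit Arguments.
Unset Strict Implicit.
Unset Printing Implicit Defensive.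
Import Order.TTheory GRing.Theory Num.Theory.
Import numFieldNormedType.Exports.

Local Open Scope ring_scope.

(** Steady state is reached from every initial condition, so each bound chooses its own: residual
    services drawn from the equilibrium law for the upper bound, an empty system for the lower one.
    From equilibrium the renewal measure of a server is uniform and only fluctuations of the starts
    matter. The Chernoff bounds over all windows carry a factor exp(- c d / sqrt n) with d of order
    n^(1/alpha); since alpha < 2, d / sqrt n is a power of n and beats the factor n lost in summing
    over windows. A moment of order 1 + eps of S keeps the error of the renewal function sublinear,
    and that error enters the exponent only at second order. The coupling reveals services in an
    order that depends on those already seen; with sums over words this is an induction on the draws
    left. For fixed n and time, arrival mesh and caps are refined first; then time and at last n go
    to infinity. The constant kappa reduces to the integral of (1 - exp(-x)) x^(-alpha). Its product
    with Gamma(alpha) is Euler's integral for pi / sin, which is identified through its tripling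
    equation. *)

(** * Expectations over independent lattice variables *)

Section finite_expectation.
Context {R : realType}.
Implicit Types (C K : nat) (p : nat -> R) (F G : seq nat -> R).

(** The weights [p] need not sum to one: the truncated residual law, a sub-probability, is
    integrated with the same operator. *)
Fixpoint Ex C p K F : R :=
  if K is K'.+1 then \sum_(v < C) p v * Ex C p K' (fun l => F (val v :: l))
  else F [::].

Lemma Ex_ext C p K F G :
  (forall l, size l = K -> F l = G l) -> Ex C p K F = Ex C p K G.
Proof.
elim: K F G => [|K IH] F G FG /=; first exact: FG.
by apply: eq_bigr => v _; congr (_ * _); apply: IH => l lK; apply: FG; rewrite /= lK.
Qed.

Lemma Ex_le C p K F G : (forall v, 0 <= p v) ->
  (forall l, size l = K -> F l <= G l) -> Ex C p K F <= Ex C p K G.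
Proof.
move=> p0; elim: K F G => [|K IH] F G FG /=; first exact: FG.
by apply: ler_sum => v _; apply: ler_wpM2l => //; apply: IH => l lK; apply: FG; rewrite /= lK.
Qed.

Lemma Ex_add C p K F G :
  Ex C p K (fun l => F l + G l) = Ex C p K F + Ex C p K G.
Proof.
elim: K F G => [//|K IH] F G /=; rewrite -big_split /=.
by apply: eq_bigr => v _; rewrite IH mulrDr.
Qed.

Lemma Ex_scale C p K (a : R) F :
  Ex C p K (fun l => a * F l) = a * Ex C p K F.
Proof.
elim: K F => [//|K IH] F /=; rewrite mulr_sumr.
by apply: eq_bigr => v _; rewrite IH mulrCA.
Qed.

Lemma Ex_const C p K (a : R) : \sum_(v < C) p v = 1 -> Ex C p K (fun=> a) = a.
Proof.
move=> p1; elim: K => [//|K IH] /=.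
by rewrite -mulr_suml p1 mul1r.
Qed.

Lemma Ex_sum C p K (I : Type) (r : seq I) (F : I -> seq nat -> R) :
  Ex C p K (fun l => \sum_(i <- r) F i l) = \sum_(i <- r) Ex C p K (F i).
Proof.
elim: r => [|i r IH].
  under Ex_ext do rewrite big_nil.
  rewrite big_nil -[X in Ex _ _ _ (fun=> X)](mul0r 0) Ex_scale mul0r //.
by under Ex_ext do rewrite big_cons; rewrite Ex_add IH big_cons.
Qed.

Lemma Ex_ge0 C p K F : (forall v, 0 <= p v) ->
  (forall l, size l = K -> 0 <= F l) -> 0 <= Ex C p K F.
Proof.
move=> p0 F0; have -> : 0 = Ex C p K (fun=> 0 * 0) by rewrite Ex_scale mul0r.
by apply: Ex_le => // l lK; rewrite mul0r F0.
Qed.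

Lemma Ex_cat C p M K F : Ex C p (M + K) F =
  Ex C p M (fun l1 => Ex C p K (fun l2 => F (l1 ++ l2))).
Proof.
elim: M F => [//|M IH] F /=.
by apply: eq_bigr => v _; rewrite IH.
Qed.

Lemma Ex_rcons C p K F :
  Ex C p K.+1 F = \sum_(v < C) p v * Ex C p K (fun l => F (rcons l v)).
Proof.
rewrite -addn1 Ex_cat /=.
under Ex_ext do under eq_bigr do rewrite cats1.
by rewrite Ex_sum; apply: eq_bigr => v _; rewrite Ex_scale.
Qed.

Lemma Ex_rev C p K F : Ex C p K F = Ex C p K (fun l => F (rev l)).
Proof.
elim: K F => [//|K IH] F; rewrite Ex_rcons /=.
apply: eq_bigr => v _; congr (_ * _); rewrite IH.
by apply: Ex_ext => l _; rewrite rev_cons.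
Qed.

Lemma Ex_prod C p K (f : nat -> R) :
  Ex C p K (fun l => \prod_(v <- l) f v) = (\sum_(v < C) p v * f v) ^+ K.
Proof.
elim: K => [|K IH] /=; first by rewrite big_nil expr0.
rewrite exprS -IH mulr_suml; apply: eq_bigr => v _.
under Ex_ext do rewrite big_cons.
by rewrite Ex_scale mulrA.
Qed.

Fixpoint ExA C p (Ks : seq nat) (F : seq (seq nat) -> R) : R :=
  if Ks is K :: Ks' then
    Ex C p K (fun row => ExA C p Ks' (fun rows => F (row :: rows)))
  else F [::].

Lemma ExA_le C p Ks (F G : seq (seq nat) -> R) : (forall v, 0 <= p v) ->
  (forall rows, shape rows = Ks -> F rows <= G rows) ->
  ExA C p Ks F <= ExA C p Ks G.
Proof.
move=> p0; elim: Ks F G => [|K Ks IH] F G FG /=; first exact: FG.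
apply: Ex_le => // l lK; apply: IH => rows rKs; apply: FG.
by rewrite /= lK rKs.
Qed.

Lemma ExA_ext C p Ks (F G : seq (seq nat) -> R) :
  (forall rows, shape rows = Ks -> F rows = G rows) ->
  ExA C p Ks F = ExA C p Ks G.
Proof.
elim: Ks F G => [|K Ks IH] F G FG /=; first exact: FG.
apply: Ex_ext => l lK; apply: IH => rows rKs; apply: FG.
by rewrite /= lK rKs.
Qed.

Lemma ExA_sum C p Ks (I : Type) (r : seq I) (F : I -> seq (seq nat) -> R) :
  ExA C p Ks (fun l => \sum_(i <- r) F i l) = \sum_(i <- r) ExA C p Ks (F i).
Proof.
elim: Ks F => [//|K Ks IH] F /=.
by under Ex_ext do rewrite IH; rewrite Ex_sum.
Qed.

Lemma ExA_scale C p Ks (a : R) (F : seq (seq nat) -> R) :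
  ExA C p Ks (fun l => a * F l) = a * ExA C p Ks F.
Proof.
elim: Ks F => [//|K Ks IH] F /=.
by under Ex_ext do rewrite IH; rewrite Ex_scale.
Qed.

Lemma ExA_add C p Ks (F G : seq (seq nat) -> R) :
  ExA C p Ks (fun l => F l + G l) = ExA C p Ks F + ExA C p Ks G.
Proof.
elim: Ks F G => [//|K Ks IH] F G /=.
by under Ex_ext do rewrite IH; rewrite Ex_add.
Qed.

Lemma ExA_ge0 C p Ks (F : seq (seq nat) -> R) : (forall v, 0 <= p v) ->
  (forall rows, shape rows = Ks -> 0 <= F rows) -> 0 <= ExA C p Ks F.
Proof.
move=> p0 F0; have -> : 0 = ExA C p Ks (fun=> 0 * 0) by rewrite ExA_scale mul0r.
by apply: ExA_le => // l lK; rewrite mul0r F0.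
Qed.

Lemma ExA_const C p Ks (a : R) : \sum_(v < C) p v = 1 ->
  ExA C p Ks (fun=> a) = a.
Proof.
move=> p1; elim: Ks => [//|K Ks IH] /=.
by under Ex_ext do rewrite IH; rewrite Ex_const.
Qed.

Fixpoint modnth (T : Type) (i : nat) (f : T -> T) (s : seq T) : seq T :=
  match s, i with
  | [::], _ => [::]
  | x :: s', 0%N => f x :: s'
  | x :: s', i'.+1 => x :: modnth i' f s'
  end.

Lemma size_modnth (T : Type) i (f : T -> T) s : size (modnth i f s) = size s.
Proof. by elim: s i => [|x s IH] [|i] //=; rewrite IH. Qed.

(** Finite sums commute, so the head of any nonempty row can be drawn first. Used repeatedly, this
    reveals services one at a time, on a server chosen from what is already known. *)
Lemma ExA_peel C p Ks i (F : seq (seq nat) -> R) : (0 < nth 0%N Ks i)%N ->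
  ExA C p Ks F = \sum_(v < C) p v *
    ExA C p (modnth i predn Ks) (fun rows => F (modnth i (cons (val v)) rows)).
Proof.
elim: Ks i F => [|K Ks IH] [|i] F //=.
  by case: K => [//|K] _ /=.
move=> Hi; under Ex_ext do rewrite (IH i) //.
by rewrite Ex_sum; apply: eq_bigr => v _; rewrite Ex_scale.
Qed.

(** Independence of the rows: it factors the exponential moment of the starts of all servers. *)
Lemma ExA_prod C p Ks (g : nat -> seq nat -> R) (rs : seq nat) :
  size rs = size Ks ->
  ExA C p Ks (fun rows => \prod_(x <- zip rs rows) g x.1 x.2) =
  \prod_(x <- zip rs Ks) Ex C p x.2 (g x.1).
Proof.
elim: Ks rs => [|K Ks IH] [|r rs] //=; first by rewrite !big_nil.
move=> [srs]; rewrite big_cons /= -IH //.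
under Ex_ext do under ExA_ext do rewrite big_cons /=.
under Ex_ext do rewrite ExA_scale mulrC.
by rewrite Ex_scale mulrC.
Qed.

End finite_expectation.

(** * Coupling with the system in which no server idles *)

Section always_busy.
Context {R : realType}.
Implicit Types (f g : seq R) (a y z w : R).

Definition step a (v : R) f : seq R :=
  sort <=%R (Num.max a (head 0 f) + v :: behead f).

(** For lists of equal length: the k-th smallest entry of [f] is at most the k-th smallest of [g].
    Counting up to every level avoids matching entries. *)
Definition dom f g : Prop :=
  forall z, (count (fun y => (y <= z)%R) g <= count (fun y => (y <= z)%R) f)%N.

(** [step] replaces the head by the new completion time. The removed head is added on the left to
    avoid subtraction in [nat]. *)
Lemma count_step (P : pred R) a v f : f != [::] ->
  (count P (step a v f) + P (head 0%R f) = P (Num.max a (head 0 f) + v)%R + count P f)%N.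
Proof.
case: f => [//|x f] _; rewrite /step.
have /permP -> := permEl (perm_sort <=%R (Num.max a (head 0 (x :: f)) + v :: behead (x :: f))).
by rewrite /= ; lia.
Qed.

Lemma sorted_head f x : sorted <=%R f -> x \in f -> head 0 f <= x.
Proof.
case: f => [//|y f] /= yf; rewrite inE => /predU1P[->//|xf].
by have /allP/(_ x xf) := order_path_min le_trans yf.
Qed.

Lemma sort_sorted_le f : sorted <=%R (sort <=%R f).
Proof. by apply: sort_sorted => ? ?; apply: le_total. Qed.

Lemma size_step a v f : f != [::] -> size (step a v f) = size f.
Proof. by case: f => [//|x f] _; rewrite size_sort. Qed.

Lemma sorted_step a v f : sorted <=%R (step a v f).
Proof. exact: sort_sorted_le. Qed.

Lemma step_neq0 a v f : step a v f != [::].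
Proof. by rewrite -size_eq0 size_sort. Qed.

Lemma dom_head f g x : f != [::] -> sorted <=%R f -> dom f g -> x \in g ->
  head 0 f <= x.
Proof.
move=> f0 sf /(_ x) fg xg.
have : (0 < count (fun y => (y <= x)%R) g)%N.
  by rewrite -has_count; apply/hasP; exists x.
move=> /leq_trans/(_ fg); rewrite -has_count => /hasP[y yf yx].
by rewrite (le_trans _ yx)// sorted_head.
Qed.

(** At a level [z >= x] both lists lose an entry, and the new one on the left enters whenever [y]
    does. Below [x] the right list has at most the entry [y], which the new entry on the left
    matches. *)
Lemma dom_step f g' x y a v : f != [::] -> sorted <=%R f ->
  dom f (x :: g') -> (forall e, e \in g' -> x <= e) ->
  Num.max a (head 0 f) + v <= y -> dom (step a v f) (y :: g').
Proof.
move=> f0 sf fg xg wy z.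
have := count_step (fun y => (y <= z)%R) a v f0.
have := fg z; rewrite /=.
have [xz|zx] := leP x z.
  rewrite (le_trans (dom_head f0 sf fg _) xz) ?mem_head//=.
  have [yz|_] := leP y z; last by lia.
  by rewrite (le_trans wy yz) /=; lia.
have -> : count (fun y => (y <= z)%R) g' = 0%N.
  apply/eqP; rewrite -leqn0 leqNgt -has_count; apply/hasPn => e /xg xe.
  by rewrite -ltNge (lt_le_trans zx).
have [yz|_] := leP y z; last by lia.
rewrite (le_trans wy yz) /=.
have : head 0 f <= z -> (0 < count (fun y => (y <= z)%R) f)%N.
  move=> hz; rewrite -has_count; apply/hasP; exists (head 0 f) => //.
  by case: (f) f0 => //= ? ? _; rewrite mem_head.
by case: (_ <= z) => /=; lia.
Qed.

Variables (C : nat) (p : nat -> R) (h : R) (tau : nat).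
Hypotheses (h0 : 0 < h) (p0 : forall v, 0 <= p v) (p1 : \sum_(v < C) p v = 1).

(* Probability that the last job of the arrival list starts after h * tau,
   when the servers become free at the times f. *)
Fixpoint late (arr : seq R) (f : seq R) : R :=
  if arr is a :: arr' then
    if arr' is [::] then (h * tau%:R < Num.max a (head 0 f))%R%:R
    else \sum_(v < C) p v * late arr' (step a (h * v%:R) f)
  else 0.

Definition epochs (b : nat) (row : seq nat) := b :: scanl addn b row.

Definition starts a (b : nat) row :=
  count (fun e => (a <= h * e%:R) && (e <= tau)%N) (epochs b row).

Definition total_starts a (bs : seq nat) rows :=
  (\sum_(x <- zip bs rows) starts a x.1 x.2)%N.

(** A finite row of services fails to reach beyond [tau]. Rows of [tau + 1] positive services
    exclude it. *)
Definition exhausted (bs : seq nat) rows :=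
  has (fun x : nat * seq nat => x.1 + sumn x.2 <= tau)%N (zip bs rows).

(** The reflection formula of the queue, unrolled: the last job is late only if, for some job of the
    list, the starts since its arrival number at most the jobs listed after it. *)
Fixpoint backlog (arr : seq R) (bs : seq nat) rows : bool :=
  if arr is a :: arr' then
    (total_starts a bs rows <= size arr')%N || backlog arr' bs rows
  else false.

Lemma late_cons a a' arr f : late [:: a, a' & arr] f =
  \sum_(v < C) p v * late (a' :: arr) (step a (h * v%:R) f).
Proof. by []. Qed.

Lemma late_le1 arr f : late arr f <= 1.
Proof.
elim: arr f => [|a [|a' arr] IH] f; first by rewrite /= ler01.
  by rewrite /= lern1; case: (_ < _).
rewrite late_cons.
by rewrite -p1; apply: ler_sum => v _; apply: ler_piMr => //; apply: IH.
Qed.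

Lemma modnth_perm (T : eqType) (x0 : T) i F (s : seq T) : (i < size s)%N ->
  exists s', perm_eq s (nth x0 s i :: s') /\
             perm_eq (modnth i F s) (F (nth x0 s i) :: s').
Proof.
elim: s i => [//|x s IH] [|i] /= Hi; first by exists s.
have [s' [H1 H2]] := IH i Hi; exists (x :: s'); split.
  by rewrite -(perm_cons x) in H1; apply: (perm_trans H1); apply/permPl/(perm_catCA [:: _] [:: _]).
by rewrite -(perm_cons x) in H2; apply: (perm_trans H2); apply/permPl/(perm_catCA [:: _] [:: _]).
Qed.

Lemma exists_min (bs : seq nat) : bs != [::] -> exists2 i, (i < size bs)%N &
  forall e, e \in bs -> (nth 0%N bs i <= e)%N.
Proof.
elim: bs => [//|b [|b' bs] IH] _; first by exists 0%N => // e; rewrite inE => /eqP ->.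
have [//|i Hi Hm] := IH; have [bi|ib] := leqP b (nth 0%N (b' :: bs) i).
  exists 0%N => // e; rewrite inE => /predU1P[->//|/Hm]; exact: leq_trans.
by exists i.+1 => // e; rewrite inE => /predU1P[->|/Hm//]; rewrite ltnW.
Qed.

(** Drawing [v] on server [i] uses up its epoch and leaves a server whose next epoch is [v]
    later. *)
Lemma total_starts_cons a bs rows i v : size rows = size bs -> (i < size bs)%N ->
  total_starts a bs (modnth i (cons v) rows) =
  (total_starts a (modnth i (addn^~ v) bs) rows +
   ((a <= h * (nth 0 bs i)%:R)%R && (nth 0 bs i <= tau)))%N.
Proof.
rewrite /total_starts; elim: bs rows i => [//|b bs IH] [|row rows] [|i] //= [Hs] Hi.
  rewrite !big_cons /= /starts /epochs /=.
  by rewrite -addnA addnC.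
by rewrite !big_cons /= IH // !addnA.
Qed.

Lemma exhausted_cons bs rows i v : size rows = size bs -> (i < size bs)%N ->
  exhausted bs (modnth i (cons v) rows) = exhausted (modnth i (addn^~ v) bs) rows.
Proof.
rewrite /exhausted; elim: bs rows i => [//|b bs IH] [|row rows] [|i] //= [Hs] Hi.
  by rewrite addnA.
by rewrite IH.
Qed.

Lemma epochs_ge b row : all (leq b) (epochs b row).
Proof.
rewrite /epochs /= leqnn /=; elim: row b => [//|v row IH] b /=.
rewrite leq_addr /=; apply: sub_all (IH (b + v)%N) => e.
by apply: leq_trans; apply: leq_addr.
Qed.

Lemma total_starts_early a a' (x : nat) bs rows :
  (forall e, e \in bs -> (x <= e)%N) -> a <= h * x%:R -> a' <= h * x%:R ->
  total_starts a bs rows = total_starts a' bs rows.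
Proof.
move=> xbs ax a'x; rewrite /total_starts.
elim: bs rows xbs => [|b bs IH] [|row rows] xbs //=; rewrite ?big_nil //.
rewrite !big_cons /= IH; last by move=> e eb; apply: xbs; rewrite inE eb orbT.
congr addn; rewrite /starts; apply: eq_in_count => e /(allP (epochs_ge b row)) be.
have xe : (x <= e)%N by apply: leq_trans be; apply: xbs; rewrite mem_head.
have xe' : h * x%:R <= h * e%:R by rewrite ler_pM2l // ler_nat.
by rewrite (le_trans ax xe') (le_trans a'x xe').
Qed.

Lemma starts_late a (b : nat) row : (tau < b)%N -> starts a b row = 0%N.
Proof.
move=> tb; apply/eqP; rewrite -leqn0 leqNgt -has_count; apply/hasPn => e.
by move=> /(allP (epochs_ge b row)) be; rewrite negb_and -ltnNge (leq_trans tb be) orbT.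
Qed.

Lemma total_starts_late a bs rows : (forall e, e \in bs -> (tau < e)%N) ->
  total_starts a bs rows = 0%N.
Proof.
rewrite /total_starts; elim: bs rows => [|b bs IH] [|row rows] H //=; rewrite ?big_nil//.
rewrite big_cons IH ?starts_late //= ?H ?mem_head //.
by move=> e eb; apply: H; rewrite inE eb orbT.
Qed.

Lemma backlog_virtual arr bs rows i v : size rows = size bs -> (i < size bs)%N ->
  (forall a, a \in arr -> h * (nth 0%N bs i)%:R < a) ->
  backlog arr bs (modnth i (cons v) rows) = backlog arr (modnth i (addn^~ v) bs) rows.
Proof.
move=> Hs Hi; elim: arr => [//|a arr IH] Ha /=.
rewrite IH; last by move=> a' ?; apply: Ha; rewrite inE orbC; apply/orP; left.
by rewrite total_starts_cons // leNgt Ha ?mem_head //= addn0.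
Qed.

(** Suppose the backlog starts at some arrival of [arr]. If that arrival is not after the epoch just
    used, counting from [a] adds this one start and at least one job. If it is after the epoch, its
    own count does not change. *)
Lemma backlog_real a arr bs rows i v : size rows = size bs -> (i < size bs)%N ->
  (forall e, e \in bs -> (nth 0 bs i <= e)%N) -> (nth 0 bs i <= tau)%N ->
  a <= h * (nth 0%N bs i)%:R ->
  backlog arr (modnth i (addn^~ v) bs) rows ->
  backlog (a :: arr) bs (modnth i (cons v) rows).
Proof.
move=> Hs Hi Hm Ht Ha; set x := nth 0%N bs i.
have Hn e : e \in modnth i (addn^~ v) bs -> (x <= e)%N.
  have [s' [H1 H2]] := modnth_perm 0%N (addn^~ v) Hi.
  rewrite (perm_mem H2) inE => /predU1P[->|es]; first exact: leq_addr.
  by apply: Hm; rewrite (perm_mem H1) inE es orbT.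
elim: arr => [//|a1 arr IH] /= /orP[H|/IH/= /orP[H|->]]; last by rewrite !orbT.
- have [a1x|a1x] := leP a1 (h * x%:R).
    rewrite total_starts_cons // Ht Ha /= addn1.
    by rewrite (total_starts_early rows Hn Ha a1x) ltnS H.
  have -> : total_starts a1 bs (modnth i (cons v) rows) =
      total_starts a1 (modnth i (addn^~ v) bs) rows.
    by rewrite total_starts_cons // -/x leNgt a1x /= addn0.
  by rewrite H orbT.
- by rewrite (leq_trans H) // ltnW.
Qed.

(* In the always-busy system a server finding no waiting job serves a virtual
   one, so that its starts form a renewal process; each service time is drawn
   when the service starts, by peeling the array of the services. *)
Theorem late_le_always_busy arr bs f Ks : sorted <=%R arr -> arr != [::] ->
  size bs = size Ks -> bs != [::] -> sorted <=%R f -> f != [::] ->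
  dom f (map (fun e => h * e%:R) bs) ->
  late arr f <= ExA C p Ks (fun rows =>
    (exhausted bs rows || backlog arr bs rows)%:R).
Proof.
(* Each step of the coupling uses one draw, real or virtual, so the induction is on the draws
   left. *)
have [N] := ubnP (sumn Ks); elim: N => // N IH in arr bs f Ks *.
rewrite ltnS => HN sa a0 sbs b0 sf f0 Hd.
have [i ib xmin] := exists_min b0; set x := nth 0%N bs i in xmin.
(* When the event on the right is certain, [late <= 1] is enough. *)
have one : forall (F : seq (seq nat) -> bool), (forall rows, shape rows = Ks -> F rows) ->
    late arr f <= ExA C p Ks (fun rows => (F rows)%:R).
  move=> F HF; apply: le_trans (late_le1 _ _) _.
  rewrite -[leLHS](ExA_const Ks 1 p1); apply: ExA_le => // rows Hr.
  by rewrite HF.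
(* If every next epoch lies beyond [tau], no start is counted and the last job alone makes a
   backlog. *)
have [xt|tx] := leqP x tau; last first.
  apply: (one (fun rows => exhausted bs rows || backlog arr bs rows)) => rows _; apply/orP; right.
  have z : forall a, total_starts a bs rows = 0%N.
    by move=> ?; apply: total_starts_late => e /xmin; apply: leq_trans.
  elim: (arr) a0 => [//|a [|a1 l] IHl] _; first by rewrite /= z.
  by apply/orP; right; apply: IHl.
case HK : (nth 0%N Ks i) => [|K].
  apply: (one (fun rows => exhausted bs rows || backlog arr bs rows)) => rows Hr; apply/orP; left; apply/hasP.
  have Hri : size (nth [::] rows i) = 0%N by rewrite -HK -Hr -nth_shape.
  have srb : size rows = size bs by rewrite sbs -Hr size_map.
  exists (nth (0%N, [::]) (zip bs rows) i).
    by apply: mem_nth; rewrite size_zip srb minnn.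
  by rewrite nth_zip //= (size0nil Hri) addn0.
have peelE : forall F : seq (seq nat) -> R, ExA C p Ks F = \sum_(v < C) p v *
    ExA C p (modnth i predn Ks) (fun rows => F (modnth i (cons (val v)) rows)).
  by move=> F; apply: ExA_peel; rewrite HK.
have HN' : (sumn (modnth i predn Ks) < N)%N.
  apply: leq_trans HN.
  elim: (Ks) (i) HK => [|K' Ks' IHK] [|i'] //=; first by move=> ->.
  by move=> /IHK; lia.
have srK rows : shape rows = modnth i predn Ks -> size rows = size bs.
  by move=> /(congr1 size); rewrite size_map size_modnth => ->.
have [s' [H1 H2]] := modnth_perm 0%N (addn^~ 0%N) ib.
have permN v : perm_eq (modnth i (addn^~ v) bs) ((x + v)%N :: s').
  have [s'' [H3 H4]] := modnth_perm 0%N (addn^~ v) ib.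
  apply: (perm_trans H4); rewrite perm_cons.
  by rewrite -(perm_cons x) -(permPr H1) perm_sym.
have Hd1 : dom f (h * x%:R :: map (fun e => h * e%:R) s').
  move=> z; apply: leq_trans (Hd z).
  have /permP -> := perm_map (fun e => h * e%:R) H1.
  by [].
have Hs' e : e \in map (fun e => h * e%:R) s' -> h * x%:R <= e.
  move=> /mapP[e' es ->]; rewrite ler_pM2l // ler_nat; apply: xmin.
  by rewrite (perm_mem H1) inE es orbT.
have domN v g : dom g (h * (x + v)%:R :: map (fun e => h * e%:R) s') ->
    dom g (map (fun e => h * e%:R) (modnth i (addn^~ v) bs)).
  move=> Hg z; apply: leq_trans (Hg z).
  by have /permP -> := perm_map (fun e => h * e%:R) (permN v).
have mb v : modnth i (addn^~ v) bs != [::] by rewrite -size_eq0 size_modnth size_eq0.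
case: arr a0 sa {one} => [//|a arr] _ sa.
have ale a' : a' \in arr -> a <= a'.
  by move=> aa; have /allP/(_ a' aa) := order_path_min le_trans sa.
rewrite peelE.
(* The server with the earliest epoch makes its start. If no job has arrived by then, the start is
   virtual and the true queue does not move; otherwise it is paired, with the same draw, with the
   job arriving at [a], whose true start is no later. *)
have [hxa|ahx] := ltP (h * x%:R) a.
  rewrite -[late _ _]mul1r -[X in X * late _ _]p1 mulr_suml; apply: ler_sum => v _.
  apply: ler_wpM2l => //.
  apply: (le_trans (IH _ (modnth i (addn^~ (val v)) bs) f _ HN' sa _ _ _ sf f0 _)) => //.
  - by rewrite !size_modnth.
  - apply: domN => z; apply: leq_trans (Hd1 z); rewrite /= leq_add2r.
    have [/= xvz|//] := leP (h * (x + v)%:R) z.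
    by rewrite (le_trans _ xvz) // ler_pM2l // ler_nat leq_addr.
  apply: ExA_le => // rows /srK Hr.
  rewrite exhausted_cons // backlog_virtual //.
  move=> a'; rewrite inE => /predU1P[->//|/ale]; exact: lt_le_trans.
have mx : Num.max a (head 0 f) <= h * x%:R.
  by rewrite ge_max ahx (dom_head f0 sf Hd1) ?mem_head.
case: arr sa ale => [|a1 arr] sa ale.
  have -> : late [:: a] f = 0.
    rewrite /= ltNge (le_trans mx) //.
    by rewrite ler_pM2l // ler_nat.
  apply: sumr_ge0 => v _; apply: mulr_ge0 => //.
  exact: ExA_ge0.
rewrite late_cons.
apply: ler_sum => v _; apply: ler_wpM2l => //.
apply: (le_trans (IH _ (modnth i (addn^~ (val v)) bs) _ _ HN' _ _ _ _ _ _ _)) => //.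
- by move: sa => /= /andP[].
- by rewrite !size_modnth.
- exact: sorted_step.
- exact: step_neq0.
- apply: domN; apply: (dom_step f0 sf Hd1 Hs').
  by rewrite natrD mulrDr lerD2r.
apply: ExA_le => // rows /srK Hr.
rewrite exhausted_cons //.
case: (exhausted _ _) => //; rewrite !orFb.
case B : (backlog _ (modnth i (addn^~ (val v)) bs) rows) => //.
by rewrite (backlog_real Hr ib xmin xt ahx B).
Qed.

End always_busy.

(** * Exponential moments of equilibrium renewal counts *)

Section renewal.
Context {R : realType}.
Variables (C : nat) (p : nat -> R) (tau : nat).
Hypotheses (p0 : forall v, 0 <= p v) (p1 : \sum_(v < C) p v = 1) (p00 : p 0%N = 0).

Definition survival (r : nat) : R := \sum_(v < C | (r < v)%N) p v.

Lemma sum_shift (f : nat -> R) n v : (forall u, (n <= u)%N -> f u = 0) ->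
  \sum_(0 <= r < n) f (r + v)%N = \sum_(0 <= u < n) (v <= u)%N%:R * f u.
Proof.
move=> f0; have -> : \sum_(0 <= r < n) f (r + v)%N = \sum_(v <= u < n + v) f u.
  by rewrite -{2}[v]add0n big_addn addnK.
have -> : \sum_(v <= u < n + v) f u = \sum_(0 <= u < n + v) (v <= u)%N%:R * f u.
  rewrite [RHS](@big_cat_nat _ _ _ v) //= ?leq_addl//.
  have -> : \sum_(0 <= u < v) (v <= u)%N%:R * f u = 0.
    by rewrite big_nat big1 // => u Hu; rewrite leqNgt (_ : (u < v)%N) ?mul0r //; lia.
  rewrite add0r.
  by rewrite big_nat [RHS]big_nat; apply: eq_bigr => u Hu; rewrite (_ : (v <= u)%N) ?mul1r //; lia.
rewrite (@big_cat_nat _ _ _ n) //= ?leq_addr//.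
have -> : \sum_(n <= u < n + v) (v <= u)%N%:R * f u = 0.
  by rewrite big_nat big1 // => u Hu; rewrite f0 ?mulr0 //; lia.
by rewrite addr0.
Qed.

Lemma survivalE r : survival r = 1 - \sum_(v < C) (v <= r)%N%:R * p v.
Proof.
apply/eqP; rewrite eq_sym subr_eq; apply/eqP.
rewrite -[LHS]p1 /survival (bigID (fun v : 'I_C => (r < v)%N)) /=; congr (_ + _).
rewrite big_mkcond /=; apply: eq_bigr => v _; rewrite -leqNgt.
by case: leqP; rewrite ?mul1r ?mul0r.
Qed.

(* The renewal measure of the delayed renewal process whose delay has density
   [survival] is the counting measure. *)
Lemma equilibrium_sum (f : nat -> R) : (forall u, (tau < u)%N -> f u = 0) ->
  \sum_(0 <= r < tau.+1) survival r * f r =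
  \sum_(0 <= r < tau.+1) (f r - \sum_(v < C) p v * f (r + v)%N).
Proof.
move=> f0; rewrite sumrB [X in _ = _ - X]exchange_big /=.
have -> : \sum_(v < C) \sum_(0 <= r < tau.+1) p v * f (r + v)%N =
    \sum_(v < C) \sum_(0 <= r < tau.+1) p v * ((v <= r)%N%:R * f r).
  apply: eq_bigr => v _; rewrite -!mulr_sumr; congr (_ * _).
  exact: sum_shift.
rewrite exchange_big -sumrB; apply: eq_bigr => r _.
rewrite survivalE mulrBl mul1r mulr_suml; congr (_ - _).
by apply: eq_bigr => v _; rewrite mulrA [_%:R * _]mulrC.
Qed.

Variables (W : pred nat) (theta : R).
Hypotheses (Wtau : forall e, W e -> (e <= tau)%N) (theta0 : 0 < theta).
Let q := expR (- theta).

Definition gen K r := Ex C p K (fun row => expR (- theta * (count W (epochs r row))%:R)).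

Lemma gen0 r : gen 0 r = expR (- theta * (W r)%:R).
Proof. by rewrite /gen /= addn0. Qed.

Lemma genS K r :
  gen K.+1 r = expR (- theta * (W r)%:R) * \sum_(v < C) p v * gen K (r + v)%N.
Proof.
rewrite /gen [LHS]/= mulr_sumr; apply: eq_bigr => v _.
rewrite mulrCA; congr (_ * _); rewrite -Ex_scale.
by apply: Ex_ext => l _; rewrite natrD mulrDr expRD.
Qed.

Lemma gen_late K r : (tau < r)%N -> gen K r = 1.
Proof.
have W0 r' : (tau < r')%N -> W r' = false.
  by move=> tr; apply/negP => /Wtau; rewrite leqNgt tr.
elim: K r => [|K IH] r tr; first by rewrite gen0 W0 // mulr0 expR0.
rewrite genS W0 // mulr0 expR0 mul1r -[RHS]p1.
by apply: eq_bigr => v _; rewrite IH ?mulr1// (leq_trans tr) ?leq_addr.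
Qed.

(** As [p 0 = 0], epochs increase by at least one, and the epoch after [K + 1] steps lies beyond
    [tau], outside [W]. *)
Lemma gen_stable K r : (tau <= r + K)%N -> gen K.+1 r = gen K r.
Proof.
have pS (f g : nat -> R) : (forall v, f v.+1 = g v.+1) ->
    \sum_(v < C) p v * f v = \sum_(v < C) p v * g v.
  move=> fg; apply: eq_bigr => -[[|v] vC] _ /=; first by rewrite p00 !mul0r.
  by rewrite fg.
elim: K r => [|K IH] r tr.
  rewrite genS gen0 (pS (fun v => gen 0 (r + v)%N) (fun=> 1)); last first.
    by move=> v; rewrite gen_late //; lia.
  by rewrite -mulr_suml p1 !mulr1.
rewrite genS [RHS]genS; congr (_ * _).
apply: (pS (fun v => gen K.+1 (r + v)%N) (fun v => gen K (r + v)%N)) => v.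
by apply: IH; lia.
Qed.

(** The identity [equilibrium_sum] applied to [1 - gen K]: by the first-step recursion its drift
    vanishes off [W], and on [W] it is [1 - q] times the continuation. *)
Lemma equilibrium_gen K : (tau <= K)%N ->
  \sum_(0 <= r < tau.+1) survival r * (1 - gen K r) =
  (1 - q) * \sum_(0 <= r < tau.+1) (W r)%:R * \sum_(v < C) p v * gen K (r + v)%N.
Proof.
move=> tK; rewrite equilibrium_sum; last first.
  by move=> u tu; rewrite gen_late // subrr.
rewrite mulr_sumr; apply: eq_bigr => r _.
under eq_bigr do rewrite mulrBr mulr1.
rewrite sumrB p1 -gen_stable ?(leq_trans tK) ?leq_addl// genS /q.
by case: (W r) => /=; rewrite ?mulr1 ?mulr0 ?expR0; ring.
Qed.

Fixpoint expected_starts K r : R :=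
  if (r <= tau)%N then
    1 + (if K is K'.+1 then \sum_(v < C) p v * expected_starts K' (r + v)%N else 0)
  else 0.

(** Wald's identity for increments capped at [L]: when the walk first passes [tau], the capped sum
    exceeds [tau - r] by at most [L]. *)
Lemma expected_starts_le K r L : (r <= tau)%N ->
  expected_starts K r * \sum_(v < C) p v * (minn v L)%:R <= (tau - r + L)%:R.
Proof.
set mu := \sum_(v < C) _; have mu0 : 0 <= mu by apply: sumr_ge0 => v _; rewrite mulr_ge0.
have muL : mu <= L%:R.
  rewrite -[leRHS]mul1r -[X in X * L%:R]p1 mulr_suml; apply: ler_sum => v _.
  by rewrite ler_wpM2l // ler_nat geq_minr.
elim: K r => [|K IH] r rt /=; rewrite rt.
  by rewrite addr0 mul1r (le_trans muL) // ler_nat leq_addl.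
rewrite mulrDl mul1r mulr_suml /mu -big_split /=.
rewrite -[leRHS]mul1r -[X in X * _]p1 mulr_suml; apply: ler_sum => v _.
rewrite -/mu -mulrA -mulrDr ler_wpM2l //.
have [vt|tv] := leqP (r + v) tau.
  apply: le_trans (lerD (lexx _) (IH _ vt)) _.
  by rewrite -natrD ler_nat; lia.
have -> : expected_starts K (r + v)%N = 0 by case: (K) => [|K'] /=; rewrite leqNgt tv.
by rewrite mul0r addr0 ler_nat; lia.
Qed.

Lemma jensen_expR (f : nat -> R) :
  expR (- theta * \sum_(v < C) p v * f v) <= \sum_(v < C) p v * expR (- theta * f v).
Proof.
set m := \sum_(v < C) _.
have -> : expR (- theta * m) = \sum_(v < C) p v * (expR (- theta * m) * (1 + (- theta * f v - - theta * m))).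
  under eq_bigr do rewrite mulrCA.
  rewrite -mulr_sumr -[LHS]mulr1; congr (_ * _).
  transitivity (\sum_(v < C) (p v + (- theta * (p v * f v) + theta * m * p v))).
    by rewrite !big_split /= p1 -!mulr_sumr p1 -/m; ring.
  by apply: eq_bigr => v _; ring.
apply: ler_sum => v _; rewrite ler_wpM2l //.
rewrite -[in leRHS](subrK (- theta * m) (- theta * f v)) expRD mulrC ler_wpM2r ?expR_ge0 //.
exact: expR_ge1Dx.
Qed.

(** Jensen's inequality, one step at a time. Starts outside [W] are counted on the left as well,
    which only weakens the bound. *)
Lemma gen_ge K r : expR (- theta * expected_starts K r) <= gen K r.
Proof.
elim: K r => [|K IH] r.
  rewrite gen0 ler_expR /=; case: (leqP r tau) => [_|tr].
    by rewrite addr0 !mulNr lerN2 ler_pM2l // lern1 leq_b1.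
  rewrite !mulNr lerN2 ler_pM2l //.
  by case: (boolP (W r)) => [/Wtau|//]; rewrite leqNgt tr.
have [rt|tr] := leqP r tau; last by rewrite gen_late //= leqNgt tr mulr0 expR0.
rewrite genS /= rt mulrDr mulr1 expRD; apply: ler_pM; rewrite ?expR_ge0 //.
  by rewrite ler_expR -[leLHS]mulr1 !mulNr lerN2 ler_pM2l // lern1 leq_b1.
apply: le_trans (jensen_expR (fun v => expected_starts K (r + v)%N)) _.
by apply: ler_sum => v _; rewrite ler_wpM2l // IH.
Qed.

Variables (s : nat) (m G : R).
Hypotheses (sW : forall r, (r <= tau)%N -> W r = (tau - r <= s)%N) (st : (s <= tau)%N).
Hypotheses (m0 : 0 < m) (G0 : 0 <= G).
Hypothesis startsG : forall K r, (r <= tau)%N -> (tau - r <= s)%N ->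
  \sum_(v < C) p v * expected_starts K (r + v)%N <= (tau - r)%:R / m + G.
Hypothesis mass : \sum_(0 <= r < tau.+1) survival r <= m.

Let sigma := s.+1%:R / m.

(** A left Riemann sum of a decreasing exponential dominates its integral; the proof telescopes. *)
Lemma sum_expR_ge (x : R) n : 0 < x ->
  1 - expR (- (n%:R * x)) <= x * \sum_(0 <= u < n) expR (- (u%:R * x)).
Proof.
move=> x0; elim: n => [|n IH].
  by rewrite big_nil mul0r oppr0 expR0 subrr mulr0.
rewrite big_nat_recr //= mulrDr.
have : expR (- (n%:R * x)) - expR (- (n.+1%:R * x)) <= x * expR (- (n%:R * x)).
  rewrite -natr1 mulrDl mul1r opprD expRD -[X in X - _]mulr1 -mulrBr mulrC.
  by rewrite ler_wpM2r ?expR_ge0 // lerBlDr -lerBlDl; have := expR_ge1Dx (- x).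
by lra.
Qed.

(** To first order the exponent is the mean number [sigma] of equilibrium starts in the window. The
    remainder is of second order in [theta] and linear in the renewal error [G]. *)
Lemma equilibrium_gen_le K N : (tau <= K)%N -> (N <= tau.+1)%N ->
  \sum_(0 <= r < N) (survival r / m) * gen K r <=
  expR (- theta * sigma + theta * (G + 1) * (expR (theta * sigma) - 1)).
Proof.
move=> tK Nt.
have S0 r : 0 <= survival r by apply: sumr_ge0.
have g0 r : 0 <= gen K r by apply: Ex_ge0 => // l _; exact: expR_ge0.
apply: (@le_trans _ _ (\sum_(0 <= r < tau.+1) (survival r / m) * gen K r)).
  rewrite [leRHS](@big_cat_nat _ _ _ N) //= lerDl.
  by apply: sumr_ge0 => r _; rewrite mulr_ge0 // divr_ge0 // ltW.
have E : \sum_(0 <= r < tau.+1) (survival r / m) * gen K r =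
   (\sum_(0 <= r < tau.+1) survival r -
   \sum_(0 <= r < tau.+1) survival r * (1 - gen K r)) / m.
  rewrite -sumrB mulr_suml; apply: eq_bigr => r _; field; exact: lt0r_neq0.
rewrite E equilibrium_gen //.
(* For a start at distance [u <= s] from [tau], Jensen and the renewal bound keep the continuation
   above [exp(- theta * (u / m + G))]. *)
have lo : expR (- theta * G) * \sum_(0 <= u < s.+1) expR (- (u%:R * (theta / m))) <=
    \sum_(0 <= r < tau.+1) (W r)%:R * \sum_(v < C) p v * gen K (r + v)%N.
  have -> : \sum_(0 <= r < tau.+1) (W r)%:R * \sum_(v < C) p v * gen K (r + v)%N =
      \sum_(0 <= u < tau.+1) (W (tau - u)%N)%:R * \sum_(v < C) p v * gen K (tau - u + v)%N.
    by rewrite big_nat_rev /=; apply: eq_big_nat => u _; rewrite add0n subSS.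
  rewrite [leRHS](@big_cat_nat _ _ _ s.+1) //=.
  rewrite ler_wpDr //.
    apply: sumr_ge0 => r _; rewrite mulr_ge0 //; apply: sumr_ge0 => v _.
    by rewrite mulr_ge0.
  rewrite mulr_sumr; apply: ler_sum_nat => u Hu.
  have ut : (u <= tau)%N by lia.
  rewrite sW ?leq_subr // subKn // (_ : (u <= s)%N) ?mul1r; last by lia.
  rewrite -expRD.
  apply: (@le_trans _ _ (expR (- theta * \sum_(v < C) p v * expected_starts K (tau - u + v)%N))).
    rewrite ler_expR.
    have := @startsG K (tau - u)%N (leq_subr _ _); rewrite subKn // => /(_ ltac:(lia)).
    rewrite -(ler_pM2l theta0) => HG.
    have -> : - theta * G + - (u%:R * (theta / m)) = - (theta * (u%:R / m + G)) by ring.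
    by rewrite mulNr lerN2.
  apply: le_trans (jensen_expR (fun v => expected_starts K (tau - u + v)%N)) _.
  apply: ler_sum => v _.
  by rewrite ler_wpM2l // gen_ge.
have tm0 : 0 < theta / m by rewrite divr_gt0.
have sg := sum_expR_ge s.+1 tm0.
set X := \sum_(0 <= u < s.+1) _ in lo sg.
set Y := \sum_(0 <= r < tau.+1) _ * \sum_(v < C) _ in lo *.
have es : s.+1%:R * (theta / m) = theta * sigma by rewrite /sigma; ring.
rewrite es in sg.
set e := expR (- (theta * sigma)) in sg.
have e1 : e <= 1 by rewrite -expR0 ler_expR oppr_le0 mulr_ge0 // ?divr_ge0 // ltW.
have e0 : 0 < e by apply: expR_gt0.
have X0 : 0 <= X by apply: sumr_ge0 => u _; exact: expR_ge0.
have q1 : theta * q <= 1 - q.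
  have := expR_ge1Dx theta; rewrite -(ler_pM2r (expR_gt0 (- theta))).
  by rewrite -expRD addrN expR0 /q; lra.
have qG : 1 - theta * (G + 1) <= q * expR (- theta * G).
  rewrite /q -expRD; apply: le_trans (expR_ge1Dx _); lra.
have Y1 : (1 - theta * (G + 1)) * (1 - e) <= (1 - q) * Y / m.
  apply: (@le_trans _ _ (q * expR (- theta * G) * (1 - e))).
    by rewrite ler_wpM2r // subr_ge0.
  apply: (@le_trans _ _ (q * expR (- theta * G) * (theta / m * X))).
    by rewrite ler_wpM2l // mulr_ge0 ?expR_ge0.
  rewrite (_ : _ * _ = (theta * q) * (expR (- theta * G) * X) / m); last by ring.
  rewrite ler_pM2r ?invr_gt0 //.
  apply: (@le_trans _ _ ((1 - q) * (expR (- theta * G) * X))).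
    by rewrite ler_wpM2r // mulr_ge0 ?expR_ge0.
  by rewrite ler_wpM2l // (le_trans _ q1) // mulr_ge0 ?expR_ge0 // ltW.
(* With [X = theta * (G + 1)], both [1 - (1 - X) * (1 - e)] and the middle term equal
   [e + X * (1 - e)], because [e * exp(theta * sigma) = 1]. *)
apply: (@le_trans _ _ (e * (1 + theta * (G + 1) * (expR (theta * sigma) - 1)))).
  have ee : e * expR (theta * sigma) = 1 by rewrite /e -expRD addNr expR0.
  rewrite mulrDr mulr1 mulrCA mulrBr ee mulr1 mulrBl.
  have : (\sum_(0 <= r < tau.+1) survival r) / m <= 1 by rewrite ler_pdivrMr // mul1r.
  by move: Y1; lra.
rewrite expRD mulNr -/e; apply: ler_wpM2l; first exact: ltW.
exact: expR_ge1Dx.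
Qed.

End renewal.

(** * Random walks: Lundberg's inequality, reversal, overshoot, tilting *)

Section random_walk.
Context {R : realType}.
Variables (C : nat) (p : nat -> R).
Hypotheses (p0 : forall v, 0 <= p v) (p1 : \sum_(v < C) p v = 1).

Section lundberg.
Variables (f : nat -> R) (theta : R).
Hypotheses (theta0 : 0 <= theta) (lundberg1 : \sum_(v < C) p v * expR (theta * f v) <= 1).

Fixpoint exceeds (y : R) (l : seq nat) : bool :=
  (y <= 0) || (if l is v :: l' then exceeds (y - f v) l' else false).

Lemma exceeds_take y M l : exceeds y (take M l) -> exceeds y l.
Proof.
elim: M l y => [|M IH] [|v l] y //=; first by rewrite orbF => ->.
by move=> /orP[->//|/IH->]; rewrite orbT.
Qed.

(** The exponential of [theta] times the walk is a supermartingale. Stopping at the first passage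
    becomes an induction that conditions on the first step. *)
Lemma lundberg K y : Ex C p K (fun l => (exceeds y l)%:R) <= expR (- theta * y).
Proof.
elim: K y => [|K IH] y.
  rewrite /= orbF; case: (leP y 0) => [y0|_]; last exact: expR_ge0.
  by rewrite -expR0 ler_expR mulNr -mulrN mulr_ge0 // oppr_ge0.
have [y0|y0] := leP y 0.
  apply: (@le_trans _ _ 1); last by rewrite -expR0 ler_expR mulNr -mulrN mulr_ge0 // oppr_ge0.
  rewrite -[leRHS](Ex_const K.+1 1 p1); apply: Ex_le => // l _.
  by rewrite lern1 leq_b1.
rewrite /= (_ : (y <= 0) = false) /=; last by rewrite leNgt y0.
apply: (@le_trans _ _ (\sum_(v < C) p v * (expR (- theta * y) * expR (theta * f v)))).
  apply: ler_sum => v _; rewrite ler_wpM2l //; apply: le_trans (IH _) _.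
  by rewrite -expRD ler_expR; lra.
under eq_bigr do rewrite mulrCA.
by rewrite -mulr_sumr ler_piMr // expR_ge0.
Qed.

Variable early : pred nat.
Hypothesis early_le : forall a b, (a <= b)%N -> early b -> early a.

(** For the arrival walk, with [early] meaning not after the time of observation, [M] is the index
    of the last job to have arrived. *)
Definition last_early M (l : seq nat) := early (sumn (take M l)) && ~~ early (sumn (take M.+1 l)).

Lemma sum_last_early m l : (\sum_(0 <= M < m) (last_early M l)%:R : R) <= 1.
Proof.
have H : (\sum_(0 <= M < m) (last_early M l)%:R : R) =
    (early (sumn (take 0 l)))%:R - (early (sumn (take m l)))%:R.
  elim: m => [|m IH]; first by rewrite big_nil subrr.
  rewrite big_nat_recr //= IH /last_early.
  have := @early_le (sumn (take m l)) (sumn (take m.+1 l)).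
  have -> : (sumn (take m l) <= sumn (take m.+1 l))%N.
    elim: (m) (l) => [|k IHk] [|v l'] //=.
    by rewrite leq_add2l IHk.
  move=> /(_ isT); do 2 case: (early (sumn (take _ _))) => //=; last 2 first.
  - by move=> _; ring.
  - by move=> _; ring.
  - by move=> _; ring.
  - by move/(_ isT).
rewrite H lerBlDr -[leLHS]addr0 lerD //; first by rewrite lern1 leq_b1.
Qed.

(* Reversing the increments before the last early epoch preserves the event
   that it is the last one. *)
Lemma reversed_lundberg m y :
  Ex C p m (fun l => (has (fun M => last_early M l && exceeds y (rev (take M l)))
     (iota 0 m))%:R) <= expR (- theta * y).
Proof.
apply: (@le_trans _ _ (\sum_(0 <= M < m)
    Ex C p m (fun l => (last_early M l && exceeds y (rev (take M l)))%:R))).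
  rewrite -Ex_sum; apply: Ex_le => // l _.
  case: hasP => [[M Mm HM]|_]; last by apply: sumr_ge0.
  rewrite mem_iota add0n /= in Mm.
  by rewrite big_mkord (bigD1 (Ordinal Mm)) //= HM lerDl sumr_ge0.
apply: (@le_trans _ _ (\sum_(0 <= M < m)
    Ex C p m (fun l => (last_early M l && exceeds y (take M l))%:R))).
  apply: ler_sum_nat => M /andP[_ Mm].
  rewrite -(subnKC (ltnW Mm)) !Ex_cat [leRHS]Ex_rev.
  apply: Ex_le => // l lM; apply: Ex_le => // l2 _.
  rewrite /last_early !take_cat lM ltnn subnn take0 cats0 size_rev lM ltnn subnn take0 cats0.
  rewrite ltnNge leqnSn /= subSn // subnn.
  by rewrite !sumn_cat sumn_rev.
(* The events [last_early M] are disjoint, so the union over [M] is free: crossing within the first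
   [M] steps is crossing. *)
apply: le_trans (lundberg m y).
rewrite -Ex_sum; apply: Ex_le => // l _.
case: (boolP (exceeds y l)) => [_|E].
  apply: le_trans (sum_last_early m l); apply: ler_sum => M _.
  by rewrite ler_nat; case: (last_early _ _) => //=; apply: leq_b1.
rewrite big1 // => M _; case: (boolP (exceeds y (take M l))) => [/exceeds_take EM|].
  by rewrite EM in E.
by rewrite andbF.
Qed.

End lundberg.

Section overshoot.
Hypothesis p00 : p 0%N = 0.
Variables (m w eta : nat).

(* The first partial sum above u is at most u + eta and the next m increments
   sum up to at most w. *)
Fixpoint quick (u : nat) (l : seq nat) : bool :=
  if l is v :: l' then
    if (v <= u)%N then quick (u - v) l' else (v - u <= eta)%N && (sumn (take m l') <= w)%N
  else false.

(** Running out of increments counts as an overshoot, so that the complement certifies a passage. *)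
Fixpoint overshoots (u : nat) (l : seq nat) : bool :=
  if l is v :: l' then
    if (v <= u)%N then overshoots (u - v) l' else (eta < v - u)%N
  else true.

(** The increments after the passage are independent of it: a strong Markov property, by induction
    along the walk. *)
Lemma quick_ge K u :
  Ex C p K (fun l => 1 - (overshoots u l)%:R) * Ex C p m (fun l => (sumn l <= w)%N%:R) <=
  Ex C p (K + m) (fun l => (quick u l)%:R).
Proof.
set P := Ex C p m _; elim: K u => [|K IH] u.
  by rewrite /= subrr mul0r; apply: Ex_ge0.
rewrite addSn /= mulr_suml; apply: ler_sum => v _; rewrite -mulrA ler_wpM2l //.
case: (leqP v u) => [_|uv]; first exact: IH.
have -> : P = Ex C p (K + m) (fun l => (sumn (take m l) <= w)%N%:R).
  rewrite addnC Ex_cat; apply: Ex_ext => l lm.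
  rewrite (Ex_ext _ _ (G := fun=> (sumn l <= w)%N%:R)); last by move=> l' _; rewrite take_size_cat.
  by rewrite Ex_const.
rewrite (Ex_ext _ _ (G := fun=> 1 - (eta < val v - u)%N%:R)) // Ex_const //.
case: (ltnP eta (v - u)) => _ /=; first by rewrite subrr mul0r; apply: Ex_ge0.
by rewrite subr0 mul1r.
Qed.

Lemma survival_le r r' : (r <= r')%N -> survival C p r' <= survival C p r.
Proof.
move=> rr; rewrite /survival [leLHS]big_mkcond [leRHS]big_mkcond; apply: ler_sum => v _.
have [rv|_] := ltnP r' v; first by rewrite (leq_ltn_trans rr rv).
by case: ifP.
Qed.

(** The right side is a potential in [u]: a step [v] lowers it by at least
    [minn v L * survival C p (u + eta)], and this survival is the chance that the present step
    overshoots. The margin [L] below [eta] pays for the last step. Steps are positive, so [K > u] of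
    them suffice to pass [u]. *)
Lemma overshoot_le K u L : (u < K)%N -> (L <= eta)%N ->
  Ex C p K (fun l => (overshoots u l)%:R) * \sum_(v < C) p v * (minn v L)%:R <=
  \sum_(eta - L <= k < u + eta) survival C p k.
Proof.
move=> uK Leta; elim: K u uK => [//|K IH] u; rewrite ltnS => uK.
have S0 k : 0 <= survival C p k by apply: sumr_ge0.
set mu := \sum_(v < C) _; rewrite -/mu in IH.
have -> : Ex C p K.+1 (fun l => (overshoots u l)%:R) =
   \sum_(v < C) p v * (if (v <= u)%N then Ex C p K (fun l => (overshoots (u - v) l)%:R) else 0)
   + survival C p (u + eta).
  rewrite /survival [X in _ + X]big_mkcond -big_split /=; apply: eq_bigr => v _.
  case: (leqP v u) => vu.
    by rewrite ltnNge (leq_trans vu) ?leq_addr //= addr0.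
  rewrite (Ex_ext _ _ (G := fun=> (eta < val v - u)%N%:R)) // Ex_const //.
  rewrite mulr0 add0r ltn_subRL; case: ltnP; by rewrite ?mulr1 ?mulr0.
rewrite mulrDl mulr_suml [X in _ + X]mulrC /mu mulr_suml -/mu -big_split /=.
rewrite -[leRHS]mul1r -[X in X * _]p1 mulr_suml; apply: ler_sum => -[[|v] vC] _ /=.
  by rewrite p00 !mul0r addr0.
rewrite -!mulrA -mulrDr ler_wpM2l //.
(* [survival] decreases, so each of the [j] terms below [u + eta] is at least its value there. *)
have drop j : (j <= u + eta)%N ->
    j%:R * survival C p (u + eta) <= \sum_(u + eta - j <= k < u + eta) survival C p k.
  move=> ju; apply: (@le_trans _ _ (\sum_(u + eta - j <= k < u + eta) survival C p (u + eta))).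
    by rewrite big_const_nat subKn // iter_addr_0 mulr_natl.
  by apply: ler_sum_nat => k /andP[_ ku]; apply: survival_le; apply: ltnW.
case: ifP => vu.
  apply: le_trans (lerD (IH _ _) (drop (minn v.+1 L) _)) _; [lia|lia|].
  rewrite [leRHS](@big_cat_nat _ _ _ (u - v.+1 + eta)) //=; [|lia|lia].
  rewrite lerD2l.
  rewrite [leRHS](@big_cat_nat _ _ _ (u + eta - minn v.+1 L)) //=; [|lia|lia].
  by rewrite lerDr; apply: sumr_ge0.
rewrite mul0r add0r; apply: le_trans (drop _ _) _; first lia.
rewrite [leRHS](@big_cat_nat _ _ _ (u + eta - minn v.+1 L)) //=; [|lia|lia].
by rewrite lerDr; apply: sumr_ge0.
Qed.

End overshoot.

(** Under the law tilted by [theta], the mass outside [[y0, y1]] is removed by Chernoff bounds at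
    [theta - g] and [theta + g]. Undoing the tilt on the interval costs at most the factor
    [exp(theta * y1)]. *)
Lemma tilting m (f : nat -> R) (y0 y1 theta g : R) : 0 <= theta -> 0 < g ->
  expR (- theta * y1) *
   ((\sum_(v < C) p v * expR (theta * f v)) ^+ m -
    expR (g * y0) * (\sum_(v < C) p v * expR ((theta - g) * f v)) ^+ m -
    expR (- g * y1) * (\sum_(v < C) p v * expR ((theta + g) * f v)) ^+ m) <=
  Ex C p m (fun l => (y0 <= \sum_(v <- l) f v)%R%:R).
Proof.
move=> th0 g0; have ProdE a := Ex_prod C p m (fun v => expR (a * f v)).
rewrite -!ProdE {ProdE}.
have E (a : R) l : \prod_(v <- l) expR (a * f v) = expR (a * \sum_(v <- l) f v).
  by rewrite mulr_sumr expR_sum.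
have Hx (K : nat) (a b : R) (F G : seq nat -> R) :
    a * Ex C p K F - b * Ex C p K G = Ex C p K (fun l => a * F l - b * G l).
  under [RHS]Ex_ext do rewrite -mulNr; by rewrite Ex_add !Ex_scale mulNr.
rewrite -[X in X - _ - _]mul1r Hx -[X in X - _]mul1r Hx -Ex_scale.
(* The bound holds pointwise: outside [[y0, y1]] one subtracted exponential already exceeds
   [exp(theta * Y)]. *)
apply: Ex_le => // l _; rewrite !E; set Y := \sum_(v <- l) _.
rewrite !mul1r -!expRD.
have [yY|Yy] := leP y0 Y; last first.
  apply: mulr_ge0_le0; first exact: expR_ge0.
  rewrite subr_le0; apply: le_trans (expR_ge0 _).
  by rewrite subr_le0 ler_expR; nra.
have [Yy|yY1] := leP Y y1.
  apply: (@le_trans _ _ (expR (- theta * y1) * expR (theta * Y))).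
    rewrite ler_wpM2l ?expR_ge0 // lerBlDr lerBlDr -addrA lerDl.
    by rewrite addr_ge0 // expR_ge0.
  by rewrite -expRD -expR0 ler_expR; nra.
apply: (@le_trans _ _ 0) => //; apply: mulr_ge0_le0; first exact: expR_ge0.
rewrite subr_le0; apply: (@le_trans _ _ (expR (theta * Y))).
  by rewrite lerBlDr lerDl expR_ge0.
by rewrite ler_expR; nra.
Qed.

End random_walk.

Lemma head_mem (R : realType) (f : seq R) : f != [::] -> head 0 f \in f.
Proof. by case: f => // x f _; rewrite mem_head. Qed.

(** * Sample paths of the queue *)

Section pathwise.
Context {R : realType}.
Variables (n : nat) (c : initial_condition R) (T V : nat -> R).
Hypotheses (n0 : (0 < n)%N) (cn : admissible n c).
Hypotheses (T0 : forall j, 0 <= T j) (V0 : forall j, 0 <= V j).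

Local Notation arr := (arrival c T).
Local Notation free := (free_times n c T V).
Local Notation sta := (start n c T V).
Local Notation dep := (departure n c T V).

Lemma free_timesS j : free j.+1 = step (arr j) (V j) (free j).
Proof. by []. Qed.

Lemma size_free_times j : size (free j) = n.
Proof.
elim: j => [|j IH].
  rewrite size_sort size_cat size_nseq subnKC //; by case/and4P: cn.
by rewrite free_timesS size_step // -size_eq0 IH -lt0n.
Qed.

Lemma free_times_neq0 j : free j != [::].
Proof. by rewrite -size_eq0 size_free_times -lt0n. Qed.

Lemma sorted_free_times j : sorted <=%R (free j).
Proof. by case: j => [|j]; exact: sort_sorted_le. Qed.

Lemma arrival_le i j : (i <= j)%N -> arr i <= arr j.
Proof.
move=> ij; rewrite /arrival.
have Hs a b : (a <= b)%N -> \sum_(0 <= i < a) T i <= \sum_(0 <= i < b) T i.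
  by move=> ab; rewrite [leRHS](@big_cat_nat _ _ _ a) //= lerDl sumr_ge0.
case: (ltnP i) => iw; case: (ltnP j) => jw //.
- by rewrite addr_ge0 ?sumr_ge0 //; case/and4P: cn.
- by move: (leq_ltn_trans iw (leq_ltn_trans ij jw)); rewrite ltnn.
- by rewrite lerD2l Hs // leq_sub2r.
Qed.

(** The new head is either the completion just scheduled or one of the remaining free times, none
    smaller than the old head. *)
Lemma start_leS j : sta j <= sta j.+1.
Proof.
rewrite /start free_timesS ge_max !le_max arrival_le //=.
apply/orP; right; set f := free j.
have : head 0 (step (arr j) (V j) f) \in step (arr j) (V j) f.
  by have := step_neq0 (arr j) (V j) f; case: (step _ _ _) => //= *; rewrite mem_head.
rewrite {2}/step mem_sort inE => /predU1P[->|].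
  by rewrite -[leLHS]addr0 lerD // le_max lexx orbT.
move=> /mem_behead; exact: sorted_head (sorted_free_times j).
Qed.

Lemma start_le i j : (i <= j)%N -> sta i <= sta j.
Proof.
move=> /subnK <-; elim: (j - i)%N => [//|k IH].
by rewrite addSn (le_trans IH) // start_leS.
Qed.

(** Each job in service at [t] holds a free time beyond [t], and there are [n] free times. *)
Lemma in_service_le t j : 0 <= t ->
  (count (fun r => (t < r)%R) (residuals c) +
   \sum_(0 <= i < j) ((sta i <= t) && (t < dep i))%R <= n)%N.
Proof.
move=> t0; suff H : (count (fun r => (t < r)%R) (residuals c) +
   \sum_(0 <= i < j) ((sta i <= t) && (t < dep i))%R <=
   count (fun r => (t < r)%R) (free j))%N.
  by rewrite (leq_trans H) // (leq_trans (count_size _ _)) // size_free_times.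
elim: j => [|j IH].
  rewrite big_nil addn0; have /permP -> := permEl (perm_sort <=%R (residuals c ++ nseq (n - size (residuals c)) 0)).
  by rewrite count_cat leq_addr.
have := count_step (fun r => (t < r)%R) (arr j) (V j) (free_times_neq0 j).
rewrite -free_timesS -/(sta j) -/(dep j).
rewrite big_nat_recr // addnA; move: (free j.+1) => F'; rewrite /= -/(sta j) -/(dep j).
have [st|ts] := leP (sta j) t; rewrite /=.
  have -> : (t < head 0 (free j))%R = false.
    by apply/negbTE; rewrite -leNgt (le_trans _ st) // le_max lexx orbT.
  move: IH; move: (nat_of_bool (t < dep j)%R) (count _ (free j)) (count _ F') => a1 a2 a3.
  by move: (count _ _) (\sum_(0 <= i < j) _)%N => a4 a5; rewrite addn0; lia.
have -> : (t < dep j)%R by rewrite (lt_le_trans ts) // lerDl.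
move: IH; case: (t < head 0 (free j))%R; move: (count _ (free j)) (count _ F') => a2 a3;
by move: (count _ _) (\sum_(0 <= i < j) _)%N => a4 a5 /=; lia.
Qed.

Lemma number_in_systemE t m : t < arr m ->
  number_in_system n c T V t =
  ((count (fun r => (t < r)%R) (residuals c) +
    \sum_(0 <= j < m) ((arr j <= t) && (t < dep j))%R)%N%:R)%:E.
Proof.
move=> tm; rewrite /number_in_system (nneseries_split 0 m); last first.
  by move=> k _; rewrite lee_fin ler0n.
rewrite [X in (_ + (_ + X))%E]eseries0 ?adde0; last first.
  move=> i mi _; rewrite (_ : (arr i <= t) = false) //.
  by apply/negbTE; rewrite -ltNge (lt_le_trans tm) // arrival_le.
rewrite add0n natrD EFinD; congr (_ + _)%E.
by rewrite sumEFin natr_sum.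
Qed.

(** If all arrived jobs but the last [z] had started, at most [n] jobs would be in service and [z]
    waiting. *)
Lemma long_wait t m (z : nat) : 0 <= t -> t < arr m ->
  ((n + z)%:R%:E < number_in_system n c T V t)%E ->
  exists2 j, ((z + j).+1 <= \sum_(0 <= i < m) (arr i <= t)%R)%N & t < sta j.
Proof.
move=> t0 tm; rewrite (number_in_systemE tm) lte_fin ltr_nat => H.
pose N := (\sum_(0 <= i < m) (arr i <= t)%R)%N.
have [/hasP[j]|] := boolP (has (fun j => (t < sta j)%R) (iota 0 (N - z))).
  by rewrite mem_iota add0n /= => jN ts; exists j => //; rewrite -/N; lia.
move=> /hasPn Hn; exfalso.
suff : (\sum_(0 <= j < m) ((arr j <= t) && (t < dep j))%R <=
    \sum_(0 <= i < m) ((sta i <= t) && (t < dep i))%R + z)%N.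
  move: H (in_service_le m t0).
  move: (count _ _) (\sum_(0 <= i < m) ((sta i <= t) && (t < dep i))%R)%N.
  by move: (\sum_(0 <= i < m) _)%N => a1 a2 a3; lia.
have HN i : (N - z <= i)%N -> (i < N)%N -> True by [].
have arrN i : (arr i <= t) -> (i < N)%N.
  move=> it; have im : (i < m)%N.
    by rewrite ltnNge; apply/negP => mi; have := lt_le_trans tm (arrival_le mi); rewrite ltNge it.
  apply: (@leq_trans (\sum_(0 <= k < i.+1) (arr k <= t)%R)%N); last first.
    by rewrite /N [leqRHS](@big_cat_nat _ _ _ i.+1) //= leq_addr.
  rewrite (eq_big_nat _ _ (F2 := fun=> 1%N)); last first.
    by move=> k /andP[_ ki]; rewrite (le_trans (arrival_le _) it).
  by rewrite sum_nat_const_nat muln1 subn0.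
apply: (@leq_trans (\sum_(0 <= i < m) (((sta i <= t) && (t < dep i))%R + (N - z <= i < N)))%N).
  rewrite big_nat [leqRHS]big_nat; apply: leq_sum => i /andP[_ im].
  have [it|//] := leP (arr i) t; rewrite /=.
  case: (t < dep i)%R => //; rewrite andbT.
  have iN := arrN i it; have [Ni|iNz] := leqP (N - z) i; first by rewrite iN addn1.
  by rewrite leNgt Hn // mem_iota.
rewrite big_split /= leq_add2l.
have : forall k, (\sum_(0 <= i < k) (N - z <= i < N) <= minn k N - (N - z))%N.
  elim=> [|k IH]; first by rewrite big_nil.
  by rewrite big_nat_recr //=; lia.
by move=> /(_ m); lia.
Qed.

Lemma number_in_system_ge t i k :
  (forall j, (i <= j < i + k)%N -> arr j <= t < dep j) ->
  (k%:R%:E <= number_in_system n c T V t)%E.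
Proof.
move=> H; rewrite /number_in_system -[leLHS]add0e leeD ?lee_fin //.
apply: le_trans (nneseries_lim_ge (i + k)%N _); last by move=> *; rewrite lee_fin.
rewrite (@big_cat_nat _ _ _ i) ?leq_addr //= -[leLHS]add0e leeD //.
  by apply: sume_ge0 => *; rewrite lee_fin.
rewrite sumEFin lee_fin big_nat.
rewrite (eq_bigr (fun=> 1)); last by move=> j /H ->.
by rewrite -big_nat sumr_const_nat addKn.
Qed.

End pathwise.

(** * Monotonicity in arrivals and services *)

Section comparison.
Context {R : realType}.
Variables (n : nat) (c : initial_condition R) (T V : nat -> R).
Hypotheses (n0 : (0 < n)%N) (cn : admissible n c).
Variables (h t : R) (a : nat -> R) (s : nat -> nat).
Hypotheses (h0 : 0 < h) (arra : forall j, arrival c T j <= a j)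
  (Vs : forall j, V j <= h * (s j)%:R).

(** The event behind [late], for prescribed services. A list of services that is too short counts as
    late. *)
Fixpoint is_late (ar : seq R) (vs : seq nat) (f : seq R) : bool :=
  if ar is x :: ar' then
    if ar' is [::] then t < Num.max x (head 0 f)
    else if vs is v :: vs' then is_late ar' vs' (step x (h * v%:R) f) else true
  else false.

(** Later arrivals and longer services preserve the domination of the free times, so a job that is
    late on the true path is late on the rounded one. *)
Lemma is_late_start j k f : f != [::] -> sorted <=%R f ->
  dom (free_times n c T V j) f -> t < start n c T V (j + k) ->
  is_late (map a (iota j k.+1)) (map s (iota j k)) f.
Proof.
elim: k j f => [|k IH] j f f0 sf fd.
  rewrite addn0 /=; move/lt_le_trans; apply; rewrite /start ge_max !le_max arra /=.
  apply/orP; right; apply: (dom_head (free_times_neq0 T V n0 cn j) _ fd); last exact: head_mem.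
  exact: sorted_free_times.
rewrite addnS -addSn => ts.
change (is_late (map a (iota j.+1 k.+1)) (map s (iota j.+1 k)) (step (a j) (h * (s j)%:R) f)).
apply: IH => //; [exact: step_neq0|exact: sorted_step|].
rewrite free_timesS.
have F0 := free_times_neq0 T V n0 cn j.
have sF := sorted_free_times n c T V j.
case: f f0 sf fd => [//|x g] _ sf fd.
move=> z; have /permP -> := permEl (perm_sort <=%R (Num.max (a j) x + h * (s j)%:R :: g)).
apply: (dom_step F0 sF fd).
  by move=> e eg; apply: (sorted_head sf); rewrite inE eg orbT.
rewrite lerD // ge_max !le_max arra /=.
by apply/orP; right; apply: (dom_head F0 sF fd); rewrite mem_head.
Qed.

End comparison.

(** * Unit service times *)

Section deterministic_services.
Context {R : realType}.
Variables (n : nat) (c : initial_condition R) (T V : nat -> R).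
Hypotheses (n0 : (0 < n)%N) (cn : admissible n c) (T0 : forall j, 0 <= T j).
Hypothesis V1 : forall j, V j = 1.

Local Notation sta := (start n c T V).

(** Jobs [j, ..., j + n - 1] all complete at [start j + 1] or later. As long as a free time before
    that moment remains, each of them uses one up; after [n] jobs none is left. *)
Lemma start_addn j : sta j + 1 <= sta (j + n).
Proof.
have V0 i : 0 <= V i by rewrite V1.
pose f := free_times n c T V.
have Hc k : (count (fun x => (x < sta j + 1)%R) (f (j + k)) <= n - k)%N.
  elim: k => [|k IH].
    by rewrite addn0 subn0 (leq_trans (count_size _ _)) // size_free_times.
  rewrite addnS /f free_timesS.
  have := count_step (fun x => (x < sta j + 1)%R) (arrival c T (j + k)) (V (j + k)) (free_times_neq0 T V n0 cn (j + k)).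
  rewrite -/(sta (j + k)) [X in (_ = X + _)%N -> _](_ : _ = 0%N); last first.
    by rewrite V1 ltrD2r ltNge start_le // leq_addr.
  move: IH; rewrite /f; set F := free_times _ _ _ _ _; set cs := count _ (step _ _ _).
  move: (@sorted_head _ F); move: (sorted_free_times n c T V (j + k)); rewrite -/F => sF /(_ _ sF) hF.
  have [->|] := posnP (count (fun x => (x < sta j + 1)%R) F).
    by move=> _; move: (nat_of_bool _) => b; rewrite addn0; lia.
  rewrite -has_count => /hasP[x xF xs].
  have -> : (head 0 F < sta j + 1)%R by apply: le_lt_trans xs; apply: hF.
  by move: (count _ F) cs => a b; rewrite addn1 add0n; lia.
rewrite [leRHS]/start le_max; apply/orP; right.
have := Hc n; rewrite subnn leqn0 => /eqP Hn.
rewrite leNgt; apply/negP => Hh.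
have : (0 < count (fun x => (x < sta j + 1)%R) (f (j + n)))%N.
  rewrite -has_count; apply/hasP; exists (head 0 (f (j + n))) => //.
  by apply: head_mem; apply: free_times_neq0.
by rewrite Hn.
Qed.

Lemma start_addn_mul j k : sta j + k%:R <= sta (j + n * k).
Proof.
elim: k => [|k IH]; first by rewrite addr0 muln0 addn0.
rewrite mulnS addnCA addnC -natr1 addrA.
by apply: le_trans (start_addn _); rewrite lerD2r.
Qed.

(** Job [j + n * k] starts at least [k] after job [j], hence leaves after [t], and so do the [m]
    jobs behind it, all of which have arrived. *)
Lemma crowded t j k (m : nat) : t - k.+1%:R < arrival c T j ->
  arrival c T (j + n * k + m) <= t ->
  (m.+1%:R%:E <= number_in_system n c T V t)%E.
Proof.
move=> tj jt; apply: (@number_in_system_ge _ _ _ _ _ _ (j + n * k)%N) => i Hi.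
have V0 i' : 0 <= V i' by rewrite V1.
rewrite (le_trans _ jt) /=; last by apply: arrival_le => //; lia.
rewrite /departure V1.
have : sta (j + n * k) <= sta i by apply: start_le => //; lia.
have := start_addn_mul j k.
have : arrival c T j <= sta j by rewrite /start le_max lexx.
by move: tj; rewrite -natr1; lra.
Qed.

End deterministic_services.

(** * The cosecant and its tripling equation *)

Section cosecant.
Context {R : realType}.
Implicit Types (s x : R).

Lemma ge0_derive1_ge0 (f f' : R -> R) : f 0 = 0 ->
  (forall x, is_derive x 1 f (f' x)) -> (forall x, 0 <= x -> 0 <= f' x) ->
  forall x, 0 <= x -> 0 <= f x.
Proof.
move=> f0 df f'0 x x0.
have [->|xn0] := eqVneq x 0; first by rewrite f0.
have xgt : 0 < x by rewrite lt_def xn0.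
have [|z /andP[z0 zx]] := @MVT R f f' 0 x xgt (fun y _ => df y).
  by apply: derivable_within_continuous => y _; exact: (@ex_derive _ _ _ _ _ _ _ (df y)).
by rewrite f0 !subr0 => ->; rewrite mulr_ge0 // f'0 // ltW.
Qed.

Lemma sin_le_id x : 0 <= x -> sin x <= x.
Proof.
move=> x0; rewrite -subr_ge0.
have df (y : R) : is_derive y 1 (fun x => x - sin x) (1 - cos y) by apply: is_derive_eq.
apply: (ge0_derive1_ge0 _ df) => //; first by rewrite sin0 subr0.
Qed.

Lemma cos_ge_quadratic x : 0 <= x -> 1 - x ^+ 2 / 2 <= cos x.
Proof.
move=> x0; rewrite -subr_ge0.
have df (y : R) : is_derive y 1 (fun x => cos x - (1 - x ^+ 2 / 2)) (y - sin y).
  by apply: is_derive_eq; rewrite /GRing.scale /=; field.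
apply: (ge0_derive1_ge0 _ df) => //; first by rewrite cos0 expr0n /= mul0r subr0 subrr.
by move=> y y0; rewrite subr_ge0 sin_le_id.
Qed.

Lemma sin_ge_cubic x : 0 <= x -> x - x ^+ 3 / 6 <= sin x.
Proof.
move=> x0; rewrite -subr_ge0.
have df (y : R) : is_derive y 1 (fun x => sin x - (x - x ^+ 3 / 6)) (cos y - (1 - y ^+ 2 / 2)).
  by apply: is_derive_eq; rewrite /GRing.scale /=; field.
apply: (ge0_derive1_ge0 _ df) => //; first by rewrite sin0 expr0n /= mul0r subr0 subrr.
by move=> y y0; rewrite subr_ge0 cos_ge_quadratic.
Qed.

Definition csc s : R := pi / sin (pi * s).

Lemma pi_mul_itv s : 0 < s < 1 -> 0 < pi * s < pi.
Proof. by move=> /andP[s0 s1]; rewrite mulr_gt0 ?pi_gt0 //= gtr_pMr // pi_gt0. Qed.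

Lemma csc_ge s : 0 < s < 1 -> s^-1 <= csc s.
Proof.
move=> s01; have /andP[s0 s1] := s01; have ps := pi_mul_itv s01.
rewrite /csc ler_pdivlMr ?sin_gt0_pi // mulrC ler_pdivrMr //.
by apply: sin_le_id; rewrite mulr_ge0 ?pi_ge0 // ltW.
Qed.

Lemma cscB s : csc (1 - s) = csc s.
Proof. by rewrite /csc mulrBr mulr1 sinB sinpi cospi mul0r mulN1r sub0r opprK. Qed.

(** The error relative to [s^-1] must vanish at 0: a merely bounded difference would not yield the
    contradiction in [csc_unique]. *)
Lemma csc_le s : 0 < s -> pi * s <= 1 -> csc s <= s^-1 + pi ^+ 2 * s.
Proof.
move=> s0 ps1; set x := pi * s.
have x0 : 0 < x by rewrite mulr_gt0 // pi_gt0.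
have sx := sin_ge_cubic (ltW x0).
have x21 : x ^+ 2 <= 1 by rewrite expr_le1 // ltW.
have sin0 : 0 < sin x.
  apply: lt_le_trans sx; have -> : x - x ^+ 3 / 6 = x * (1 - x ^+ 2 / 6) by field.
  by apply: mulr_gt0 => //; lra.
rewrite /csc -/x ler_pdivrMr //.
have -> : s^-1 + pi ^+ 2 * s = pi * (x^-1 + x).
  by rewrite /x; move: (pi : R) (@pi_gt0 R) => p /lt0r_neq0 pn; field; rewrite pn gt_eqF.
rewrite -[leLHS]mulr1 -mulrA ler_pM2l ?pi_gt0 //.
apply: (@le_trans _ _ ((x^-1 + x) * (x - x ^+ 3 / 6))); last first.
  by rewrite ler_pM2l // addr_gt0 // invr_gt0.
have -> : (x^-1 + x) * (x - x ^+ 3 / 6) = 1 + x ^+ 2 - x ^+ 2 / 6 - x ^+ 4 / 6.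
  by field; rewrite gt_eqF.
have : x ^+ 4 <= x ^+ 2 by rewrite ler_wiXn2l // ltW.
by move=> x4; have x2 := sqr_ge0 x; lra.
Qed.

Lemma csc_bounded s : 0 < s <= 2^-1 -> csc s <= s^-1 + pi ^+ 2.
Proof.
move=> /andP[s0 s1].
have [ps|ps] := leP (pi * s) 1.
  apply: le_trans (csc_le s0 ps) _; rewrite lerD2l ler_piMr ?sqr_ge0 //.
  by apply: le_trans s1 _; rewrite invf_le1 // ler1n.
apply: (@le_trans _ _ (pi ^+ 2)); last by rewrite lerDr invr_ge0 ltW.
have p2 := @pi_ge2 R.
have s1' : sin 1 <= sin (pi * s).
  have sq : pi * s <= pi / 2 by rewrite ler_pM2l // pi_gt0.
  rewrite leNgt; apply/negP; rewrite ltr_sin ?in_itv /=; first by rewrite ltNge (ltW ps).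
    by apply/andP; split; lra.
  by apply/andP; split; lra.
have s5 : 5 / 6 <= sin 1 :> R.
  by have := @sin_ge_cubic 1 ler01; rewrite expr1n; lra.
rewrite /csc ler_pdivrMr; last by lra.
nra.
Qed.

(** Partial fractions for sin(3a) = 4 sin(a) sin(pi/3 - a) sin(pi/3 + a). Euler's integral inherits
    the same relation from the substitution of [3 x] for [x]. *)
Lemma csc_triple s : 0 < s < 1 ->
  3 * csc s = csc (s / 3) - csc ((s + 1) / 3) + csc ((s + 2) / 3).
Proof.
move=> s01; have /andP[s0 s1] := s01.
set a := pi * (s / 3); set b : R := pi / 3.
have Ha : pi * s = a + (a + a) by rewrite /a; move: (pi : R) => p; field.
have Hb : pi = b + (b + b) :> R by rewrite /b; move: (pi : R) => p; field.
have -> : csc ((s + 1) / 3) = pi / sin (a + b) by rewrite /csc /a /b; congr (_ / sin _); move: (pi : R) => p; field.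
have -> : csc ((s + 2) / 3) = pi / sin (b - a).
  by rewrite -cscB /csc /a /b; congr (_ / sin _); move: (pi : R) => p; field.
rewrite {1 2}/csc -/a.
have pa : 0 < sin a.
  by apply: sin_gt0_pi; apply: pi_mul_itv; apply/andP; split; lra.
have pab : 0 < sin (a + b).
  have -> : a + b = pi * ((s + 1) / 3) by rewrite /a /b; move: (pi : R) => p; field.
  by apply: sin_gt0_pi; apply: pi_mul_itv; apply/andP; split; lra.
have pba : 0 < sin (b - a).
  have -> : b - a = pi * ((1 - s) / 3) by rewrite /a /b; move: (pi : R) => p; field.
  by apply: sin_gt0_pi; apply: pi_mul_itv; apply/andP; split; lra.
have pb : 0 < sin b.
  have -> : b = pi * 3^-1 by [].
  by apply: sin_gt0_pi; apply: pi_mul_itv; apply/andP; split; lra.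
have pcb : 0 < cos b.
  apply: cos_gt0_pihalf; have := @pi_gt0 R; rewrite /b => ?; apply/andP; split; lra.
have ps : 0 < sin (pi * s) by apply/sin_gt0_pi/pi_mul_itv.
have e1 := cos2Dsin2 a; have e2 := cos2Dsin2 b.
have e3 : sin (b + (b + b)) = 0 by rewrite -Hb sinpi.
rewrite !sinD !cosD in e3.
(* The triple angle formula at [pi / 3], where sin(3b) = 0, determines the sine and cosine of
   [b]. *)
have H : sin b * (3 * cos b ^+ 2 - sin b ^+ 2) = 0 by rewrite -e3; ring.
move/eqP: H; rewrite mulf_eq0 (gt_eqF pb) orFb => /eqP H.
have sb2 : sin b ^+ 2 = 3 / 4 by lra.
have cb : cos b = 2^-1.
  have cb2 : (cos b - 2^-1) * (cos b + 2^-1) = 0.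
    by transitivity (cos b ^+ 2 - 4^-1); [field|lra].
  by move/eqP: cb2; rewrite mulf_eq0 => /orP[|] /eqP; lra.
rewrite Ha !sinD !cosD.
move: pa pab pba ps; rewrite Ha !sinD !cosD sinN cosN cb.
set S := sin a in e1 *; set C := cos a in e1 *; set r := sin b in sb2 pb *.
move=> pa pab pba ps.
have E : S * (C * C - S * S) + C * (S * C + C * S) = 4 * S * (r * C - 2^-1 * S) * (r * C + 2^-1 * S).
  have r2 : r * r = 3 / 4 by rewrite -expr2.
  transitivity (S * (4 * (r * r) * (C * C) - S * S)); last by field.
  by rewrite r2; field.
have pba' : 0 < r * C - 2^-1 * S by lra.
have pab' : 0 < r * C + 2^-1 * S by lra.
rewrite E.
have -> : S * 2^-1 + C * r = r * C + 2^-1 * S by ring.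
have -> : r * C + 2^-1 * - S = r * C - 2^-1 * S by ring.
have r2 : r ^+ 2 = 3 / 4 := sb2.
have C2 : C ^+ 2 = 1 - S ^+ 2 by lra.
apply/eqP; rewrite -subr_eq0; apply/eqP.
move: (pi : R) => p.
transitivity (p / (S * (r * C - 2^-1 * S) * (r * C + 2^-1 * S)) *
  (3 / 4 - ((r ^+ 2 * C ^+ 2 - S ^+ 2 / 4) - S * (r * C - 2^-1 * S) + S * (r * C + 2^-1 * S)))).
  by field; apply/and3P; split; rewrite gt_eqF //; lra.
by rewrite [X in _ * X](_ : _ = 0) ?mulr0 // r2 C2; field.
Qed.

(* The bounds make J - csc bounded; by the symmetry it suffices to bound it on
   (0, 1/2], and the tripling equation then improves the bound by a constant factor. *)
Lemma csc_unique (J : R -> R) :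
  (forall s, 0 < s < 1 -> 3 * J s = J (s / 3) - J ((s + 1) / 3) + J ((s + 2) / 3)) ->
  (forall s, 0 < s < 1 -> J (1 - s) = J s) ->
  (forall s, 0 < s < 1 -> s^-1 <= J s <= s^-1 + (1 - s)^-1 - (1 + s)^-1) ->
  forall s, 0 < s < 1 -> J s = csc s.
Proof.
move=> J3 JB Jb.
pose h s := `|J s - csc s|.
have hB s : 0 < s < 1 -> h (1 - s) = h s by move=> ?; rewrite /h JB // cscB.
have h3 s : 0 < s < 1 -> 3 * h s <= h (s / 3) + h ((s + 1) / 3) + h ((s + 2) / 3).
  move=> s01; rewrite /h; have -> : 3 * `|J s - csc s| = `|3 * (J s - csc s)| by rewrite normrM gtr0_norm.
  rewrite mulrBr J3 // csc_triple //.
  set x1 := J _; set x2 := J _; set x3 := J _; set y1 := csc _; set y2 := csc _; set y3 := csc _.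
  have -> : x1 - x2 + x3 - (y1 - y2 + y3) = (x1 - y1) - (x2 - y2) + (x3 - y3) by ring.
  by apply: le_trans (ler_normD _ _) _; rewrite lerD2r ler_normB.
have Jle s : 0 < s <= 2^-1 -> J s <= s^-1 + 4 * s.
  move=> /andP[s0 s1]; have /Jb/andP[_ H] : 0 < s < 1 by rewrite s0 /=; lra.
  apply: le_trans H _; rewrite -addrA lerD2l.
  have -> : (1 - s)^-1 - (1 + s)^-1 = 2 * s / (1 - s ^+ 2).
    by field; apply/and3P; split; rewrite gt_eqF //; nra.
  rewrite ler_pdivrMr; nra.
(* On the half interval [4 * s <= 2] bounds [J] above [s^-1], and [pi ^+ 2] does so for [csc]. *)
pose K : R := 2 + pi ^+ 2.
have K0 : 0 < K by rewrite /K ltr_pwDl // sqr_ge0.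
have hsmall s : 0 < s <= 2^-1 -> pi * s <= 1 -> h s <= K * 2 * s.
  move=> s02 ps; have /andP[s0 s1] := s02.
  have s01 : 0 < s < 1 by rewrite s0 /=; lra.
  have /andP[j1 _] := Jb _ s01; have j2 := Jle _ s02.
  have c1 := csc_ge s01; have c2 := csc_le s0 ps.
  have := sqr_ge0 (pi : R) => p2.
  by rewrite /h ler_norml /K; apply/andP; split; nra.
have hbound s : 0 < s < 1 -> h s <= K.
  suff H : forall s, 0 < s <= 2^-1 -> h s <= K.
    move=> s01; have [s2|s2] := leP s 2^-1; first by apply: H; case/andP: s01 => ->.
    by rewrite -hB //; apply: H; case/andP: s01 => ? ?; apply/andP; split; lra.
  move=> {}s s02; have /andP[s0 s1] := s02.
  have s01 : 0 < s < 1 by rewrite s0 /=; lra.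
  have /andP[j1 _] := Jb _ s01; have j2 := Jle _ s02.
  have c1 := csc_ge s01; have c2 := csc_bounded s02.
  have := sqr_ge0 (pi : R) => p2.
  by rewrite /h ler_norml /K; apply/andP; split; lra.
pose H := [set x | exists2 s, 0 < s < 1 & x = h s]%classic.
have supH : has_sup H.
  split; first by exists (h 2^-1), 2^-1 => //; apply/andP; split; lra.
  by exists K => x [s s01 ->]; exact: hbound.
pose M := sup H.
have hM s : 0 < s < 1 -> h s <= M by move=> s01; apply: ub_le_sup; [exact: supH.2|exists s].
suff M0 : M <= 0.
  move=> s s01; apply/eqP; rewrite -subr_eq0 -normr_le0; exact: le_trans (hM _ s01) M0.
rewrite leNgt; apply/negP => M0.
(* A maximum principle: the right side of [h3] has three terms, none above [M], so a value within
   [eta] of the supremum at [s] forces one within [3 * eta] at [s / 3]. Iterating leads near 0,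
   where [h] is small. *)
have step k eta s : 0 < s < 1 -> M - eta <= h s -> M - 3 ^+ k * eta <= h (s / 3 ^+ k).
  elim: k eta s => [|k IH] eta s s01 Hs; first by rewrite expr0 mul1r divr1.
  have /andP[s0 s1] := s01.
  rewrite exprS.
  have -> : s / (3 * 3 ^+ k) = (s / 3) / 3 ^+ k.
    by field; rewrite expf_neq0 // pnatr_eq0.
  have -> : 3 * 3 ^+ k * eta = 3 ^+ k * (3 * eta) by ring.
  apply: IH; first by apply/andP; split; lra.
  have := h3 _ s01; have : h ((s + 1) / 3) <= M by apply: hM; apply/andP; split; lra.
  have : h ((s + 2) / 3) <= M by apply: hM; apply/andP; split; lra.
  by lra.
pose x0 := Num.min (4^-1) (M / (8 * K)).
have x00 : 0 < x0 by rewrite lt_min invr_gt0 ltr0n /= divr_gt0 // mulr_gt0.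
have [k Hk] : exists k, 3 ^- k <= x0 :> R.
  exists (Num.truncn x0^-1).+1.
  rewrite -[leRHS]invrK lef_pV2 ?posrE ?invr_gt0 ?exprn_gt0 //.
  apply: (@le_trans _ _ (Num.truncn x0^-1).+1%:R).
    by apply: ltW; have := @truncnS_gt R x0^-1.
  rewrite -natrX ler_nat; apply: ltnW; exact: ltn_expl.
pose eta := M / (4 * 3 ^+ k).
have k0 : 0 < 3 ^+ k :> R by rewrite exprn_gt0.
have eta0 : 0 < eta by rewrite divr_gt0 // mulr_gt0.
have [x [s s01 ->] Hx] := sup_adherent eta0 supH.
have := step k eta s s01 (ltW Hx).
have /andP[s0 s1] := s01.
have sk : s / 3 ^+ k <= x0.
  by apply: le_trans Hk; rewrite ler_piMl ?ltW // invr_gt0.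
have sk0 : 0 < s / 3 ^+ k by rewrite divr_gt0.
have := hsmall (s / 3 ^+ k).
have : x0 <= 4^-1 by rewrite ge_min lexx.
have : x0 <= M / (8 * K) by rewrite ge_min lexx orbT.
rewrite ler_pdivlMr; last by rewrite mulr_gt0.
move=> xK x4 Hs.
have pi4 : (pi : R) < 4 by have := @pihalf_lt2 R; lra.
have p0 := @pi_gt0 R.
have {}Hs : h (s / 3 ^+ k) <= K * 2 * (s / 3 ^+ k) by apply: Hs; [apply/andP; split; lra|nra].
have -> : 3 ^+ k * eta = M / 4 by rewrite /eta; field; rewrite gt_eqF.
nra.
Qed.

End cosecant.

(** * Restriction to words with positive letters *)

Section support.
Context {R : realType}.
Variables (C : nat) (p : nat -> R).
Hypotheses (p0 : forall v, 0 <= p v) (p00 : p 0%N = 0).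

Lemma Ex_le_support K F G :
  (forall l, size l = K -> 0%N \notin l -> F l <= G l) -> Ex C p K F <= Ex C p K G.
Proof.
elim: K F G => [|K IH] F G FG /=; first exact: FG.
apply: ler_sum => -[[|v] vC] _ /=; first by rewrite p00 !mul0r.
rewrite ler_wpM2l //; apply: IH => l lK l0; apply: FG; first by rewrite /= lK.
by rewrite inE negb_or l0.
Qed.

Lemma ExA_le_support Ks (F G : seq (seq nat) -> R) :
  (forall rows, shape rows = Ks -> all (fun row => 0%N \notin row) rows ->
    F rows <= G rows) -> ExA C p Ks F <= ExA C p Ks G.
Proof.
elim: Ks F G => [|K Ks IH] F G FG /=; first exact: FG.
apply: Ex_le_support => l lK l0; apply: IH => rows rK r0.
by apply: FG; rewrite /= ?lK ?rK ?l0.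
Qed.

Lemma Ex_is_late (h : R) tau K ar f : \sum_(v < C) p v = 1 -> (size ar <= K.+1)%N ->
  Ex C p K (fun vs => (is_late h (h * tau%:R) ar vs f)%:R) = late C p h tau ar f.
Proof.
move=> p1; elim: ar K f => [|x [|y ar] IH] K f.
- by move=> _; rewrite Ex_const.
- by move=> _; rewrite Ex_const.
case: K => // K arK; rewrite late_cons.
by apply: eq_bigr => v _; congr (_ * _); exact: IH.
Qed.

End support.

Lemma exceeds_sum (R : realType) (f : nat -> R) y l k :
  y <= \sum_(v <- take k l) f v -> exceeds f y l.
Proof.
elim: l k y => [|v l IH] k y; first by rewrite big_nil /= orbF.
case: k => [|k]; first by rewrite take0 big_nil /= => ->.
by rewrite /= big_cons => H; apply/orP; right; apply: (IH k); rewrite lerBlDl.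
Qed.

Lemma sumn_sum (R : realType) (l : seq nat) : \sum_(v <- l) (v%:R : R) = (sumn l)%:R.
Proof. by rewrite sumnE natr_sum. Qed.

Lemma sumn_take_le (l : seq nat) i j : (i <= j)%N -> (sumn (take i l) <= sumn (take j l))%N.
Proof.
move=> ij; rewrite -[in X in (_ <= X)%N](subnKC ij) takeD sumn_cat; exact: leq_addr.
Qed.

(** * The lattice queue at a fixed time *)

Section lattice_upper_bound.
Context {R : realType}.
Variables (C CA N n tau m : nat) (p pA pi : nat -> R) (h hA eta : R).
Hypotheses (n0 : (0 < n)%N) (h0 : 0 < h) (hA0 : 0 <= hA) (eta0 : 0 <= eta).
Hypotheses (p0 : forall v, 0 <= p v) (p1 : \sum_(v < C) p v = 1) (p00 : p 0%N = 0).
Hypotheses (pA0 : forall v, 0 <= pA v) (pA1 : \sum_(v < CA) pA v = 1).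
Hypotheses (pi0 : forall v, 0 <= pi v) (pi1 : \sum_(v < N) pi v <= 1).
Variables (nn y0 GF : R) (z : nat).
Hypotheses (nn0 : 0 <= nn) (y00 : 0 < y0).

Let t := h * tau%:R.
Let g (s : nat) : R := nn * (h * s.+1%:R) - y0.
Let D rs rows s := total_starts h tau (h * (tau - s)%:R) rs rows.

(** Some window ending at [tau] has too few starts for the rate [nn]. The additional unit [s.+1] in
    [g] absorbs rounding the left end of a window to the lattice. *)
Definition starved (rs : seq nat) rows : bool :=
  has (fun s => (D rs rows s)%:R <= g s) (iota 0 tau.+1).

Lemma backlogP arr rs rows : backlog h tau arr rs rows ->
  exists2 i, (i < size arr)%N &
    (total_starts h tau (nth 0%R arr i) rs rows <= size arr - i.+1)%N.
Proof.
elim: arr => [//|a arr IH] /= /orP[H|/IH[i iarr H]]; first by exists 0%N; rewrite //= subSS subn0.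
by exists i.+1 => //=; rewrite subSS.
Qed.

Lemma total_starts_anti a a' rs rows : a <= a' ->
  (total_starts h tau a' rs rows <= total_starts h tau a rs rows)%N.
Proof.
move=> aa'; apply: leq_sum => -[b row] _; apply: sub_count => e /= /andP[ae ->].
by rewrite (le_trans aa' ae).
Qed.

Lemma starts_large rs rows a : ~~ starved rs rows -> 0 <= a ->
  nn * (t - a) - y0 < (total_starts h tau a rs rows)%:R.
Proof.
move=> ns a0; have [ta|ta] := ltP t a.
  apply: (@lt_le_trans _ _ 0); last exact: ler0n.
  by rewrite subr_lt0 (le_lt_trans _ y00) // mulr_ge0_le0 // subr_le0 ltW.
pose s := Num.truncn ((t - a) / h).
have ta0 : 0 <= (t - a) / h by rewrite divr_ge0 ?subr_ge0 // ltW.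
have /andP[s1 s2] : s%:R <= (t - a) / h < s.+1%:R by rewrite truncn_itv.
rewrite ler_pdivlMr // in s1; rewrite ltr_pdivrMr // in s2.
have stau : (s <= tau)%N.
  rewrite -(ler_nat R) -(ler_pM2r h0) (le_trans s1) // /t; lra.
have : g s < (D rs rows s)%:R.
  rewrite ltNge; apply/negP => H; case/negP: ns; apply/hasP; exists s => //.
  by rewrite mem_iota add0n ltnS.
have : (D rs rows s <= total_starts h tau a rs rows)%N.
  apply: total_starts_anti; rewrite natrB // mulrBr; move: s1; rewrite /t; lra.
rewrite -(ler_nat R) => H1 H2; apply: (@le_lt_trans _ _ (g s)); last exact: lt_le_trans H2 H1.
by rewrite /g lerD2r ler_wpM2l // mulrC ltW.
Qed.

Definition early k : bool := hA * k%:R <= t.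

(** The increments are interarrival times rounded down; [eta] is to cover the accumulated rounding,
    so that these times bound the true arrivals from above. *)
Definition late_arrivals (l : seq nat) J : seq R :=
  map (fun i => hA * (sumn (take i l))%:R + eta) (iota 0 J.+1).

Definition residual_times (rs : seq nat) : seq R := sort <=%R (map (fun r => h * r%:R) rs).

(** [M] is the last job to have arrived, and job [M - z], with [z] jobs behind it, has not
    started. *)
Definition lattice_wait rs l vs : bool :=
  has (fun M => [&& last_early early M l, (z <= M)%N &
    is_late h t (late_arrivals l (M - z)) vs (residual_times rs)]) (iota 0 m).

Let y := z%:R - y0 - nn * eta.
Let f (v : nat) : R := 1 - nn * hA * v%:R.

(** Since arrival [i] there were more than [nn] times the elapsed time minus [y0] starts, yet at
    most [M - z - i]. Read backwards from [M], the walk with steps [1 - nn * hA * v] has therefore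
    climbed to [y]. *)
Lemma backlog_exceeds l M rs rows : last_early early M l -> (z <= M)%N -> size l = m -> (M < m)%N ->
  backlog h tau (late_arrivals l (M - z)) rs rows -> ~~ starved rs rows ->
  exceeds f y (rev (take M l)).
Proof.
move=> /andP[eM _] zM lm Mm /backlogP[i]; rewrite size_map size_iota ltnS => iJ.
rewrite (nth_map 0%N) ?size_iota ?ltnS // nth_iota ?ltnS // add0n subSS => H ns.
have iM : (i <= M)%N by lia.
have Ml : size (take M l) = M by rewrite size_take lm Mm.
apply: (@exceeds_sum _ _ _ _ (M - i)).
have -> : \sum_(v <- take (M - i) (rev (take M l))) f v =
    (M - i)%:R - nn * hA * ((sumn (take M l))%:R - (sumn (take i l))%:R).
  rewrite take_rev Ml subKn // (perm_big (drop i (take M l))) ?perm_rev //=.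
  have {1}-> : take i l = take i (take M l) by rewrite take_takel.
  rewrite -[in RHS](cat_take_drop i (take M l)) take_size_cat; last first.
    by rewrite size_take Ml; case: ltnP => //; lia.
  rewrite sumn_cat natrD addrAC subrr add0r big_split /= sumrN -mulr_sumr sumn_sum.
  by rewrite big_const_seq count_predT size_drop Ml iter_addr_0.
move: eM; rewrite /early => eM; have aM := sumn_take_le l iM; rewrite -(ler_nat R) in aM.
have ai : 0 <= hA * (sumn (take i l))%:R + eta by rewrite addr_ge0 // mulr_ge0.
have := starts_large ns ai; move: H; rewrite -(ler_nat R) => H1 H2.
have : (M - z - i)%N = (M - i - z)%N by lia.
move=> E; rewrite E in H1; rewrite natrB in H1; last by lia.
have H3 := lt_le_trans H2 H1.
have H4 := ler_wpM2l nn0 eM; move: H3 H4; rewrite /y.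
move: (sumn _)%:R (sumn _)%:R (M - i)%:R => sM si Mi; move: (t) => tt; lra.
Qed.
Lemma Ex_const_le (q : nat -> R) K c : (forall v, 0 <= q v) -> \sum_(v < N) q v <= 1 ->
  0 <= c -> Ex N q K (fun=> c) <= c.
Proof.
move=> q0 q1 c0; elim: K => [//|K IH] /=; rewrite -mulr_suml.
apply: (@le_trans _ _ (1 * c)); last by rewrite mul1r.
by apply: ler_pM => //; [exact: sumr_ge0 | exact: Ex_ge0].
Qed.

Lemma has_le_sum (T : Type) (P : pred T) s : ((has P s)%:R : R) <= \sum_(i <- s) (P i)%:R.
Proof.
elim: s => [|i s IH]; first by rewrite big_nil.
by rewrite big_cons /=; apply: le_trans (lerD (lexx _) IH); rewrite -natrD ler_nat; case: (P i) => //=.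
Qed.

Hypothesis GFstarved :
  Ex N pi n (fun rs => ExA C p (nseq n tau.+1) (fun rows => (starved rs rows)%:R)) <= GF.
Variable theta : R.
Hypotheses (theta0 : 0 <= theta) (lundberg1 : \sum_(v < CA) pA v * expR (theta * f v) <= 1).

Let over l := has (fun M => last_early early M l && exceeds f y (rev (take M l))) (iota 0 m).

Lemma early_le a b : (a <= b)%N -> early b -> early a.
Proof. by move=> ab; rewrite /early; apply: le_trans; rewrite ler_wpM2l // ler_nat. Qed.

Lemma late_le l M rs : size rs = n -> size l = m -> (M < m)%N ->
  last_early early M l -> (z <= M)%N ->
  late C p h tau (late_arrivals l (M - z)) (residual_times rs) <=
  ExA C p (nseq n tau.+1) (fun rows => (starved rs rows)%:R) + (over l)%:R.
Proof.
move=> rsn lm Mm eM zM.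
apply: (@le_trans _ _ (ExA C p (nseq n tau.+1) (fun rows =>
    (exhausted tau rs rows || backlog h tau (late_arrivals l (M - z)) rs rows)%:R))).
  apply: late_le_always_busy => //.
  - rewrite /late_arrivals sorted_map; apply: (@sub_sorted _ leq) (iota_sorted _ _).
    by move=> i j ij /=; rewrite lerD2r ler_wpM2l // ler_nat sumn_take_le.
  - by rewrite rsn size_nseq.
  - by rewrite -size_eq0 rsn -lt0n.
  - exact: sort_sorted_le.
  - by rewrite -size_eq0 size_sort size_map rsn -lt0n.
  - move=> x; apply/eq_leq/permP; rewrite perm_sym; apply/permPl; exact: perm_sort.
rewrite -[X in _ + X](@ExA_const _ C p (nseq n tau.+1) _ p1) -ExA_add.
apply: ExA_le_support => // rows rowsK rows0; rewrite -natrD ler_nat.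
(* [tau + 1] services of at least one unit each outlast [tau]. *)
have -> : exhausted tau rs rows = false.
  apply/negbTE/hasPn => -[b row] /= brow; rewrite -ltnNge.
  have srows : size rs = size rows by rewrite -(size_map size rows) -/(shape rows) rowsK size_nseq.
  have rowin : row \in rows.
    by rewrite -(unzip2_zip (eq_leq (esym srows))); apply: (map_f snd brow).
  have rsz : size row = tau.+1.
    have : size row \in shape rows by exact: map_f.
    by rewrite rowsK mem_nseq => /andP[_ /eqP].
  have : 0%N \notin row by apply: (allP rows0).
  rewrite -rsz => r0; apply: leq_trans (leq_addl _ _).
  elim: (row) r0 => [//|v r IH] /=; rewrite inE negb_or => /andP[v0 /IH].
  by move: v0; case: v => // v _ H; rewrite addSn ltnS (leq_trans H) ?leq_addl.
case: (boolP (starved _ _)) => [_|ns]; first by case: orb => //; rewrite leq_addr.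
rewrite orFb add0n; case B: (backlog _ _ _ _ _) => //.
have -> // : over l.
apply/hasP; exists M; first by rewrite mem_iota.
by rewrite eM; exact: (@backlog_exceeds l M rs rows eM zM lm Mm B ns).
Qed.

Theorem lattice_wait_le :
  Ex N pi n (fun rs => Ex CA pA m (fun l => Ex C p m (fun vs => (lattice_wait rs l vs)%:R)))
  <= expR (- theta * y) + GF.
Proof.
apply: (@le_trans _ _ (Ex N pi n (fun rs =>
    expR (- theta * y) + ExA C p (nseq n tau.+1) (fun rows => (starved rs rows)%:R)))); last first.
  by rewrite Ex_add lerD // Ex_const_le // expR_ge0.
apply: Ex_le => // rs rsn.
apply: (@le_trans _ _ (Ex CA pA m (fun l => (over l)%:R +
     ExA C p (nseq n tau.+1) (fun rows => (starved rs rows)%:R)))); last first.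
  rewrite Ex_add Ex_const // lerD2r; apply: reversed_lundberg => //; exact: early_le.
apply: Ex_le => // l lm.
set X := _ + _.
have X0 : 0 <= X by rewrite addr_ge0 // ExA_ge0.
(* The index [M] depends on the arrivals alone and at most one is selected, so the sum over [M]
   costs nothing. *)
apply: (@le_trans _ _ (Ex C p m (fun vs => \sum_(M <- iota 0 m)
    (last_early early M l && (z <= M)%N)%:R *
    (is_late h t (late_arrivals l (M - z)) vs (residual_times rs))%:R))).
  apply: Ex_le => // vs _; apply: le_trans (has_le_sum _ _) _.
  by apply: ler_sum => M _; rewrite andbA -natrM mulnb.
rewrite Ex_sum.
apply: (@le_trans _ _ (\sum_(M <- iota 0 m) (last_early early M l)%:R * X)).
  rewrite big_seq [leRHS]big_seq; apply: ler_sum => M; rewrite mem_iota add0n => /andP[_ Mm].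
  rewrite Ex_scale /t Ex_is_late //; last by rewrite size_map size_iota; lia.
  case: (boolP (last_early _ _ _)) => eM; last by rewrite andFb !mul0r.
  case: (leqP z M) => zM; last by rewrite andTb mul0r mul1r.
  by rewrite !mul1r /X addrC late_le.
rewrite -mulr_suml; apply: (@le_trans _ _ (1 * X)); last by rewrite mul1r.
rewrite ler_wpM2r // -[X in iota _ X]subn0; apply: (@sum_last_early R early); exact: early_le.
Qed.

End lattice_upper_bound.

(** * Equilibrium starts in all windows at once *)

Section starvation.
Context {R : realType}.
Variables (n C N tau : nat) (p : nat -> R) (h mean c0 c1 eps d : R).
Hypotheses (n0 : (0 < n)%N) (h0 : 0 < h) (p0 : forall v, 0 <= p v)
  (p1 : \sum_(v < C) p v = 1) (p00 : p 0%N = 0).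
Hypotheses (mean_ge1 : 1 <= mean) (c00 : 0 <= c0) (eps0 : 0 < eps) (eps1 : eps <= 1).
Hypothesis min_ge : forall l : R, 2 <= l -> ((Num.truncn (l * mean)).+1 < C)%N ->
  mean * (1 - c0 * l `^ (- eps)) <= \sum_(v < C) p v * (minn v (Num.truncn (l * mean)).+1)%:R.
Hypotheses (c12 : 2 <= c1) (c1c0 : c0 * c1 `^ (- eps) <= 2^-1).
Hypothesis mass : \sum_(0 <= r < tau.+1) survival C p r <= mean.
Let beta := eps / 2.

Let sigma s : R := s.+1%:R / mean.
Let q s : R := 1 + sigma s.
Let w s : R := q s `^ (- beta).
Let G s : R := (2 * c1 + 3) * (q s * w s).

Lemma mean_gt0 : 0 < mean. Proof. exact: lt_le_trans mean_ge1. Qed.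

Lemma sigma_ge0 s : 0 <= sigma s.
Proof. by rewrite divr_ge0 // ltW // mean_gt0. Qed.

Lemma q_ge1 s : 1 <= q s. Proof. by rewrite lerDl sigma_ge0. Qed.

Lemma qw_ge s : q s `^ 2^-1 <= q s * w s.
Proof.
have q0 : 0 < q s := lt_le_trans ltr01 (q_ge1 s).
have -> : q s * w s = q s `^ (1 - beta).
  by rewrite powRD ?powRr1 ?ltW //; apply/implyP => _; rewrite gt_eqF.
by apply: ler_powR; rewrite ?q_ge1 // /beta; have := eps1; lra.
Qed.

Lemma qw_ge1 s : 1 <= q s * w s.
Proof. by apply: le_trans (qw_ge s); rewrite -[leLHS](powRr0 (q s)) ler_powR ?q_ge1. Qed.

Hypothesis Clarge : forall s, (s <= tau)%N ->
  ((Num.truncn (c1 * q s `^ 2^-1 * mean)).+1 < C)%N.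

(** Wald's bound with increments capped near [l * mean]. The level [l = c1 * sqrt q] balances the
    overshoot, of order [sqrt q], against the relative loss [x <= w / 2] in the mean, which costs
    about [q * w] over the window. Since [eps <= 1], [q * w] dominates both and is sublinear in
    [q]. *)
Lemma startsG s : (s <= tau)%N -> forall K r, (r <= tau)%N -> (tau - r <= s)%N ->
  \sum_(v < C) p v * expected_starts C p tau K (r + v)%N <= (tau - r)%:R / mean + G s.
Proof.
move=> stau K r rtau rs.
have m0 := mean_gt0.
pose l := c1 * q s `^ 2^-1.
have q0 : 0 < q s := lt_le_trans ltr01 (q_ge1 s).
have sq1 : 1 <= q s `^ 2^-1.
  by rewrite -[leLHS](powRr0 (q s)) ler_powR ?q_ge1.
have l2 : 2 <= l by rewrite /l; have := c12; nra.
pose L := (Num.truncn (l * mean)).+1.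
have LC : (L < C)%N by exact: Clarge.
have Hmin := min_ge l2 LC.
pose x := c0 * l `^ (- eps).
have xE : x = c0 * c1 `^ (- eps) * w s.
  rewrite /x /l powRM ?powR_ge0 //; last by rewrite (le_trans _ c12).
  by rewrite -powRrM mulrA /w /beta; congr (_ * _ `^ _); field.
have w1 : w s <= 1.
  by rewrite /w -[leRHS](powRr0 (q s)) ler_powR ?q_ge1 // oppr_le0 /beta divr_ge0 // ltW.
have w0 : 0 < w s by rewrite powR_gt0.
have x2 : x <= 2^-1 * w s by rewrite xE ler_wpM2r // ltW.
have x0 : 0 <= x by rewrite mulr_ge0 ?powR_ge0.
set mu := \sum_(v < C) _ in Hmin.
have mu0 : 0 < mu by apply: lt_le_trans Hmin; rewrite mulr_gt0 // -/x; lra.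
have Lle : L%:R <= (l + 1) * mean.
  have : (Num.truncn (l * mean))%:R <= l * mean.
    by rewrite Num.Theory.truncn_le // mulr_ge0 // ltW // (lt_le_trans _ l2).
  by rewrite /L -natr1; have := mean_ge1; lra.
pose u := (tau - r)%N.
have us : u%:R / mean <= sigma s.
  by rewrite ler_wpM2r ?invr_ge0 ?(ltW m0) // ler_nat leqW.
have u0 : 0 <= u%:R / mean by rewrite divr_ge0 // ltW.
have Hs : \sum_(v < C) p v * expected_starts C p tau K (r + v)%N <= (u%:R + L%:R) / mu.
  rewrite -[leRHS]mul1r -[X in X * _]p1 mulr_suml; apply: ler_sum => v _.
  rewrite ler_wpM2l //; have [rv|rv] := leqP (r + v) tau; last first.
    have -> : expected_starts C p tau K (r + v)%N = 0 by case: (K) => [|K'] /=; rewrite leqNgt rv.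
    by rewrite divr_ge0 // ?addr_ge0 // ltW.
  rewrite ler_pdivlMr //; apply: le_trans (expected_starts_le p0 p1 ltr01 K L rv) _.
  by rewrite -natrD ler_nat leq_add2r leq_sub2l // leq_addr.
apply: le_trans Hs _; rewrite -/u.
have Hmu : (mean * (1 - x)) <= mu := Hmin.
rewrite ler_pdivrMr //.
have qw1 := qw_ge1 s; have qwr := qw_ge s; have qs : q s = 1 + sigma s by [].
have H1 : u%:R = u%:R / mean * mean by rewrite divfK // gt_eqF.
rewrite [X in X + L%:R]H1; move: (u%:R / mean) u0 us => U U0 Us.
have key : U + (l + 1) <= (U + G s) * (1 - x).
  rewrite /G /l; have := c12; move: (q s `^ 2^-1) sq1 qwr => Q Q1 QW.
  have : U * x <= q s * w s / 2.
    apply: (@le_trans _ _ (q s * x)); first by rewrite ler_wpM2r // qs; lra.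
    have : 0 < q s by []. nra.
  move: (q s * w s) qw1 QW => QW' H2 H3 H4 H5.
  have : 0 <= (2 * c1 + 3) * QW' * (2^-1 - x) .
    by apply: mulr_ge0; [nra|have := w1; lra].
  nra.
have GU : 0 <= U + G s by rewrite addr_ge0 // /G; have := c12; nra.
apply: (@le_trans _ _ ((U + (l + 1)) * mean)); first by rewrite mulrDl lerD2l.
apply: (@le_trans _ _ ((U + G s) * (mean * (1 - x)))); last by rewrite ler_wpM2l.
by rewrite mulrCA mulrC ler_wpM2l // ltW.
Qed.

Hypothesis Ntau : (N <= tau.+1)%N.
Let pi r := survival C p r / mean.

Section chernoff.
Variables (theta : R) (s : nat).
Hypotheses (theta0 : 0 < theta) (stau : (s <= tau)%N).
Let W e := (h * (tau - s)%:R <= h * e%:R) && (e <= tau)%N.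

Lemma expR_starts rs K : size rs = n ->
  ExA C p (nseq n K) (fun rows =>
    expR (- theta * (total_starts h tau (h * (tau - s)%:R) rs rows)%:R)) =
  \prod_(r <- rs) gen C p W theta K r.
Proof.
move=> rsn.
pose k r row := expR (- theta * (count W (epochs r row))%:R) : R.
transitivity (ExA C p (nseq n K) (fun rows => \prod_(x <- zip rs rows) k x.1 x.2)).
  apply: ExA_ext => rows _.
  rewrite /total_starts natr_sum mulr_sumr; elim: (zip rs rows) => [|x xs IH].
    by rewrite !big_nil expR0.
  by rewrite !big_cons expRD IH.
rewrite ExA_prod ?size_nseq // -rsn; elim: (rs) => [|r rs' IH]; first by rewrite !big_nil.
by rewrite /= !big_cons IH.
Qed.

(** Chernoff's bound for one window: the servers are independent, and each contributes the moment of
    [equilibrium_gen_le]. *)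
Lemma starved_at_le (g : R) :
  Ex N pi n (fun rs => ExA C p (nseq n tau.+1) (fun rows =>
    ((total_starts h tau (h * (tau - s)%:R) rs rows)%:R <= g)%R%:R)) <=
  expR (theta * g + n%:R * (- theta * sigma s +
    theta * (G s + 1) * (expR (theta * sigma s) - 1))).
Proof.
have m0 := mean_gt0.
have pi0 v : 0 <= pi v by rewrite divr_ge0 // ?(ltW m0) // sumr_ge0.
apply: (@le_trans _ _ (Ex N pi n (fun rs => expR (theta * g) *
    \prod_(r <- rs) gen C p W theta tau.+1 r))).
  apply: Ex_le => // rs rsn; rewrite -expR_starts // -ExA_scale.
  apply: ExA_le => // rows _; rewrite -expRD.
  case: (leP _%:R g) => H; last exact: expR_ge0.
  by rewrite -[leLHS]expR0 ler_expR mulNr -mulrBr mulr_ge0 ?subr_ge0 // ltW.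
rewrite Ex_scale Ex_prod expRD ler_wpM2l ?expR_ge0 //.
rewrite expRM_natl; apply: lerXn2r; rewrite ?nnegrE ?expR_ge0 //.
  by apply: sumr_ge0 => r _; rewrite mulr_ge0 // Ex_ge0 // => l _; exact: expR_ge0.
rewrite -(big_mkord xpredT (fun r => pi r * gen C p W theta tau.+1 r)).
have G0 : 0 <= G s.
  rewrite /G mulr_ge0 ?(le_trans _ (qw_ge1 s)) //; have := c12; lra.
apply: (@equilibrium_gen_le _ C p tau p0 p1 p00 W theta _ theta0 s mean (G s) _ stau m0 G0 _ mass tau.+1 N _ Ntau) => //.
- by move=> e /andP[].
- by move=> r rtau; rewrite /W rtau andbT ler_pM2l // ler_nat; lia.
- exact: startsG.
Qed.

End chernoff.

Let b := beta / 2.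
Let rt : R := Num.sqrt n%:R.
Definition starvation_const : R := (2 * c1 + 4) * (8 / b ^+ 2).

Lemma sqr_expRN (x : R) : 0 <= x -> x ^+ 2 * expR (- (b * x)) <= 4 / b ^+ 2.
Proof.
have b0 : 0 < b by rewrite /b /beta; have := eps0; lra.
move=> x0; rewrite expRN ler_pdivrMr ?expR_gt0 //.
have -> : b * x = b * x / 2 + b * x / 2 by field.
have bx : 0 <= b * x / 2 by rewrite divr_ge0 // mulr_ge0 // ltW.
rewrite expRD; have := expR_ge1Dx (b * x / 2).
move: (expR _) => E H; rewrite -ler_pdivrMl ?divr_gt0 ?exprn_gt0 //.
have -> : (4 / b ^+ 2)^-1 * x ^+ 2 = (b * x / 2) ^+ 2 by field; rewrite gt_eqF.
by rewrite expr2 ler_pM //; lra.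
Qed.

Hypotheses (d0 : 0 < d) (rtb : rt^-1 <= b) (P2 : 2 <= d / rt).

(** This [theta] turns the main term into [- d / sqrt n * L]. The second-order term is of order
    [L ^ 2 * w * exp(theta * sigma)]: [rtb] lets the exponential use up only half of the decay of
    [w], and the other half beats [L ^ 2]. The reserve [2 * L] makes the windows summable. *)
Lemma exponent_le s L theta : L = ln (1 + q s) -> theta = L / (rt * q s) ->
  theta * ((n%:R - d) * sigma s - d) + n%:R * (- theta * sigma s +
    theta * (G s + 1) * (expR (theta * sigma s) - 1)) <=
  starvation_const - (d / rt - 2) * ln 2 - 2 * L.
Proof.
move=> LE thE.
have rt0 : 0 < rt by rewrite sqrtr_gt0 ltr0n.
have rt2 : rt ^+ 2 = n%:R by rewrite sqr_sqrtr.
have q1 := q_ge1 s; have q0 : 0 < q s := lt_le_trans ltr01 q1.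
have L2 : ln 2 <= L by rewrite LE ler_ln ?posrE //; lra.
have L0 : 0 < L by apply: lt_le_trans L2; rewrite ln_gt0 //; lra.
have th0 : 0 < theta by rewrite thE divr_gt0 // mulr_gt0.
have sq : sigma s <= q s by rewrite /q; lra.
have s0 := sigma_ge0 s.
have dq : theta * d * q s = d / rt * L.
  by rewrite thE; field; rewrite ?gt_eqF.
have sqs : sigma s = q s - 1 by rewrite /q; ring.
have x0 : 0 <= theta * sigma s by rewrite mulr_ge0 // ltW.
have nx : n%:R * theta * (theta * sigma s) * q s <= L ^+ 2.
  have -> : n%:R * theta * (theta * sigma s) * q s = L ^+ 2 * (sigma s / q s).
    by rewrite -rt2 thE; field; rewrite ?gt_eqF.
  by rewrite ler_piMr ?sqr_ge0 // ler_pdivrMr // mul1r.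
have xb : theta * sigma s <= b * L.
  apply: (@le_trans _ _ (rt^-1 * L)); last by rewrite ler_wpM2r // ltW.
  have -> : theta * sigma s = rt^-1 * L * (sigma s / q s).
    by rewrite thE; field; rewrite ?gt_eqF.
  apply: ler_piMr; first by rewrite mulr_ge0 ?invr_ge0 // ltW.
  by rewrite ler_pdivrMr // mul1r.
have we : w s * expR (theta * sigma s) <= 2 * expR (- (b * L)).
  have Lq : L <= ln 2 + ln (q s).
    by rewrite LE -lnM ?posrE // ler_ln ?posrE //; lra.
  have be0 : 0 < beta by rewrite /beta; have := eps0; lra.
  have be1 : beta <= 1 by rewrite /beta; have := eps1; lra.
  have -> : w s = expR (- beta * ln (q s)) by rewrite /w /powR gt_eqF.
  rewrite -expRD -[X in X * expR _](@lnK _ 2) ?posrE // -expRD ler_expR.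
  have ln20 : 0 < ln 2 :> R by rewrite ln_gt0 //; lra.
  have bb : beta = b + b by rewrite /b; field.
  by rewrite bb in be0 be1 *; nra.
have H : n%:R * (theta * (G s + 1) * (expR (theta * sigma s) - 1)) <= starvation_const.
  have H1 : expR (theta * sigma s) - 1 <= theta * sigma s * expR (theta * sigma s).
    have := expR_ge1Dx (- (theta * sigma s)); rewrite expRN.
    rewrite -(ler_pM2r (expR_gt0 (theta * sigma s))) mulVf ?gt_eqF ?expR_gt0 //.
    by move: (expR _) => E; lra.
  have qw0 : 0 <= q s * w s by rewrite (le_trans _ (qw_ge1 s)).
  have GK : G s + 1 <= (2 * c1 + 4) * (q s * w s) by rewrite /G; have := qw_ge1 s; lra.
  have G0 : 0 <= G s by rewrite /G; have := c12; nra.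
  have K0 : 0 <= 2 * c1 + 4 by have := c12; lra.
  have nt : 0 <= n%:R * theta by rewrite mulr_ge0 // ltW.
  apply: (@le_trans _ _ (n%:R * theta * ((2 * c1 + 4) * (q s * w s)) * (theta * sigma s * expR (theta * sigma s)))).
    have H2 : 0 <= expR (theta * sigma s) - 1 by rewrite subr_ge0 -[leLHS]expR0 ler_expR.
    have -> : n%:R * (theta * (G s + 1) * (expR (theta * sigma s) - 1)) =
      n%:R * theta * ((G s + 1) * (expR (theta * sigma s) - 1)) by ring.
    by rewrite -[leRHS]mulrA ler_wpM2l // ler_pM // addr_ge0.
  apply: (@le_trans _ _ ((2 * c1 + 4) * (L ^+ 2 * (w s * expR (theta * sigma s))))).
    have -> : n%:R * theta * ((2 * c1 + 4) * (q s * w s)) *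
        (theta * sigma s * expR (theta * sigma s)) =
      (2 * c1 + 4) * (n%:R * theta * (theta * sigma s) * q s * (w s * expR (theta * sigma s))) by ring.
    by rewrite ler_wpM2l // ler_wpM2r // mulr_ge0 ?expR_ge0 // powR_ge0.
  rewrite /starvation_const ler_wpM2l //.
  apply: (@le_trans _ _ (L ^+ 2 * (2 * expR (- (b * L))))); first by rewrite ler_wpM2l ?sqr_ge0.
  have := sqr_expRN (ltW L0); move: (expR _) (b ^+ 2)^-1 => E B; lra.
have P2L : (d / rt - 2) * ln 2 <= (d / rt - 2) * L by rewrite ler_wpM2l // subr_ge0.
have -> : theta * ((n%:R - d) * sigma s - d) + n%:R * (- theta * sigma s +
    theta * (G s + 1) * (expR (theta * sigma s) - 1)) =
    - (theta * d * q s) + n%:R * (theta * (G s + 1) * (expR (theta * sigma s) - 1)).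
  by rewrite sqs; ring.
by rewrite dq; move: H P2L; lra.
Qed.

(** Telescoping against [mean * (1 - 1 / (1 + k / mean))]. The union over windows thus costs a
    single factor [mean]. *)
Lemma sum_inverse_squares k : \sum_(0 <= s < k) (1 + q s) ^- 2 <= mean.
Proof.
have m0 := mean_gt0.
apply: (@le_trans _ _ (mean * (1 - (1 + k%:R / mean)^-1))); last first.
  by rewrite ler_piMr ?(ltW m0) // gerBl invr_ge0 addr_ge0 // divr_ge0 // ltW.
elim: k => [|k IH]; first by rewrite big_nil mul0r addr0 invr1 subrr mulr0.
rewrite big_nat_recr //=; apply: le_trans (lerD IH (lexx _)) _.
rewrite /q /sigma -natr1.
have k0 : 0 <= k%:R / mean by rewrite divr_ge0 // ltW.
have -> : (k%:R + 1) / mean = k%:R / mean + mean^-1 by rewrite mulrDl mul1r.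
have mi : 0 < mean^-1 by rewrite invr_gt0.
have mE : mean = (mean^-1)^-1 by rewrite invrK.
move: (k%:R / mean) k0 => x x0; move: (mean^-1) mi mE => u u0 ->.
rewrite -subr_ge0.
have -> : u^-1 * (1 - (1 + (x + u))^-1) - (u^-1 * (1 - (1 + x)^-1) + (1 + (1 + (x + u))) ^- 2) =
  ((1 + (1 + (x + u))) ^+ 2 - (1 + x) * (1 + (x + u))) / ((1 + (1 + (x + u))) ^+ 2 * ((1 + x) * (1 + (x + u)))).
  by field; rewrite ?gt_eqF //; lra.
apply: divr_ge0; first by nra.
by rewrite mulr_ge0 ?sqr_ge0 // mulr_ge0; lra.
Qed.

Lemma starved_le :
  Ex N pi n (fun rs => ExA C p (nseq n tau.+1) (fun rows =>
    (starved tau h ((n%:R - d) / (h * mean)) d rs rows)%:R)) <=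
  expR (starvation_const - (d / rt - 2) * ln 2) * mean.
Proof.
have m0 := mean_gt0.
have pi0 v : 0 <= pi v by rewrite divr_ge0 // ?(ltW m0) // sumr_ge0.
apply: (@le_trans _ _ (Ex N pi n (fun rs => \sum_(s <- iota 0 tau.+1)
    ExA C p (nseq n tau.+1) (fun rows =>
    ((total_starts h tau (h * (tau - s)%:R) rs rows)%:R <= (n%:R - d) * sigma s - d)%R%:R)))).
  apply: Ex_le => // rs _; rewrite -ExA_sum; apply: ExA_le => // rows _.
  apply: le_trans (has_le_sum _ _) _; apply: ler_sum => s _.
  have -> // : (n%:R - d) / (h * mean) * (h * s.+1%:R) - d = (n%:R - d) * sigma s - d.
  by rewrite /sigma; field; rewrite ?gt_eqF.
rewrite Ex_sum; apply: (@le_trans _ _ (\sum_(s <- iota 0 tau.+1)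
    expR (starvation_const - (d / rt - 2) * ln 2) * (1 + q s) ^- 2)).
  rewrite big_seq [leRHS]big_seq; apply: ler_sum => s; rewrite mem_iota add0n ltnS => stau.
  have q0 : 0 < 1 + q s by have := q_ge1 s; lra.
  have rt0 : 0 < rt by rewrite sqrtr_gt0 ltr0n.
  have th0 : 0 < ln (1 + q s) / (rt * q s).
    have := q_ge1 s => q1; rewrite divr_gt0 ?mulr_gt0 ?ln_gt0 //; lra.
  apply: le_trans (starved_at_le th0 stau _) _.
  have -> : (1 + q s) ^- 2 = expR (- (2 * ln (1 + q s))).
    by rewrite expRN expRM_natl lnK.
  by rewrite -expRD ler_expR; exact: exponent_le (erefl _) (erefl _).
rewrite -mulr_sumr ler_wpM2l ?expR_ge0 //.
by have := sum_inverse_squares tau.+1; rewrite /index_iota subn0.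
Qed.

End starvation.

Local Open Scope classical_set_scope.

(** * From independent random variables to iterated sums *)

Section independence_link.
Context d (Omega : measurableType d) (R : realType) (P : probability Omega R).
Variables (I : choiceType) (X : I -> {RV P >-> R}).
Hypothesis indep : mutually_independent X.
Variables (D : I -> R -> nat) (C : I -> nat).
Hypotheses (mD : forall i v, measurable (D i @^-1` [set v])).
Hypotheses (DC : forall i x, (D i x < C i)%N).

Definition atom_prob (i : I) (v : nat) : R :=
  fine (P (X i @^-1` (D i @^-1` [set v]))).

Fixpoint ExI (s : seq I) (F : seq nat -> R) : R :=
  if s is i :: s' then
    \sum_(v < C i) atom_prob i v * ExI s' (fun l => F (val v :: l))
  else F [::].

Let Y i w := D i (X i w).

Lemma measurable_Y i v : measurable (Y i @^-1` [set v]).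
Proof.
have := @measurable_funPT _ _ _ _ (X i); move=> /(_ measurableT (D i @^-1` [set v])).
by rewrite setTI; apply.
Qed.

Lemma atom_probE i v : P (Y i @^-1` [set v]) = (atom_prob i v)%:E.
Proof. by rewrite fineK // fin_num_measure //; apply: measurable_Y. Qed.

Lemma measurable_discrete s (F : seq nat -> bool) :
  measurable [set w | F (map (fun i => Y i w) s)].
Proof.
elim: s F => [|i s IH] F /=.
  by case: (F [::]); rewrite (set_true, set_false).
pose G v := Y i @^-1` [set v] `&` [set w | F (v :: map (fun i => Y i w) s)].
rewrite (_ : [set w | _] = \big[setU/set0]_(v < C i) G v).
  by apply: bigsetU_measurable => v _; apply: measurableI; [exact: measurable_Y|exact: (IH (fun l => F (val v :: l)))].
rewrite -(bigcup_mkord _ G); apply/seteqP; split => w /=.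
  by move=> Fw; exists (Y i w) => //; exact: DC.
by move=> [v _ [/= Yv]]; rewrite Yv.
Qed.

Lemma measure_partition (Z : Omega -> nat) k (E : set Omega) : measurable E ->
  (forall v, measurable (Z @^-1` [set v])) -> (forall w, (Z w < k)%N) ->
  P E = (\sum_(v < k) P (E `&` Z @^-1` [set val v]))%E.
Proof.
move=> mE mZ Zk.
have mEZ v : measurable (E `&` Z @^-1` [set v]) by apply: measurableI.
transitivity (P (\big[setU/set0]_(v < k) (E `&` Z @^-1` [set val v]))).
  congr (P _); rewrite -(bigcup_mkord _ (fun v => E `&` Z @^-1` [set v])).
  apply/seteqP; split => w; last by move=> [v _ []].
  by move=> Ew; exists (Z w) => //=.
rewrite measure_bigsetU_ord //.
apply/trivIsetP => i j _ _ /eqP ij; apply/seteqP; split => // w [[_ /= Zi] [_ /= Zj]].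
by apply: ij; apply: val_inj; rewrite /= -Zi -Zj.
Qed.

(** The coordinates in [pre] have fixed values. Moving coordinates from [s] to [pre] one by one,
    independence is needed only at the end, for a finite intersection of level sets. *)
Lemma independence_link_prefix pre s (g : I -> nat) (F : seq nat -> bool) :
  uniq (pre ++ s) ->
  P (\bigcap_(i in [set` pre]) (Y i @^-1` [set g i]) `&`
     [set w | F (map (fun i => Y i w) s)]) =
  (\prod_(i <- pre) atom_prob i (g i) * ExI s (fun l => (F l)%:R))%:E.
Proof.
have mpre (q : seq I) : measurable (\bigcap_(i in [set` q]) (Y i @^-1` [set g i])).
  apply: fin_bigcap_measurable => [|i _]; [exact: finite_seq|exact: measurable_Y].
elim: s pre g F mpre => [|i s IH] pre g F mpre.
  rewrite cats0 => upre; case E : (F [::]); last first.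
    rewrite (_ : _ `&` _ = set0) ?measure0 /= ?E ?mulr0 //.
    by apply/seteqP; split => // w [_] /=; rewrite ?E.
  rewrite (_ : _ `&` _ = \bigcap_(i in [set` pre]) (Y i @^-1` [set g i])); last first.
    by apply/seteqP; split => [w []//|w]; split => //=; rewrite ?E.
  rewrite /= ?E mulr1 (indep (E := fun i => D i @^-1` [set g i]) upre) //.
  rewrite (eq_bigr (fun i => (atom_prob i (g i))%:E)); last by move=> j _; exact: atom_probE.
  by elim: (pre) => [|j q IHq]; rewrite ?big_nil // !big_cons IHq EFinM.
move=> ups; have [upre ips us] : [/\ uniq pre, i \notin pre & uniq (rcons pre i ++ s)].
  move: ups; rewrite cat_rcons => H; split => //; move: H; rewrite cat_uniq => /and3P[] //.
  by move=> _ /hasPn/(_ i); rewrite mem_head => /(_ isT).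
rewrite (@measure_partition (Y i) (C i)); last first.
- by move=> w; exact: DC.
- exact: measurable_Y.
- by apply: measurableI => //; exact: (measurable_discrete (i :: s)).
rewrite /= mulr_sumr -sumEFin; apply: eq_bigr => v _.
pose g' j := if j == i then val v else g j.
have gg' j : j \in pre -> g' j = g j.
  by rewrite /g'; case: eqP => // -> ipre; rewrite ipre in ips.
have := IH (rcons pre i) g' (fun l => F (val v :: l)) _ us.
have g'i : g' i = val v by rewrite /g' eqxx.
rewrite -cats1 big_cat big_seq1 /= g'i -mulrA.
rewrite (eq_big_seq (fun j => atom_prob j (g j))); last by move=> j /gg' ->.
move=> <-; last first.
  by move=> q; apply: fin_bigcap_measurable => [|j _]; [exact: finite_seq|exact: measurable_Y].
congr (P _); apply/seteqP; split => w /=.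
  move=> [[Hp HF] Yv]; split; last by rewrite -Yv.
  move=> j /=; rewrite mem_cat mem_seq1 => /orP[jp|/eqP->]; last by rewrite /g' eqxx.
  by rewrite gg' //; apply: Hp.
move=> [Hp HF]; have Yv : Y i w = v.
  by have := Hp i; rewrite /= mem_cat mem_seq1 eqxx orbT /g' eqxx; apply.
split => //; split; last by rewrite Yv.
by move=> j /= jp; rewrite -gg' //; apply: Hp; rewrite /= mem_cat jp.
Qed.

Lemma independence_link s (F : seq nat -> bool) : uniq s ->
  P [set w | F (map (fun i => Y i w) s)] = (ExI s (fun l => (F l)%:R))%:E.
Proof.
move=> us; have := @independence_link_prefix [::] s (fun=> 0%N) F us.
rewrite big_nil mul1r => <-; congr (P _).
by rewrite (_ : [set` [::]] = set0) ?bigcap_set0 ?setTI //; apply/seteqP; split.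
Qed.

End independence_link.

Lemma ExI_Ex d (Omega : measurableType d) (R : realType) (P : probability Omega R)
    (A S : nat -> {RV P >-> R}) (DA DS : R -> nat) (CA CS : nat) (pA pS : nat -> R) :
  let X i := match i with inl j => A j | inr j => S j end in
  let D i := match i with inl _ => DA | inr _ => DS end in
  let C i := match i with inl _ => CA | inr _ => CS end in
  (forall j v, atom_prob X D (inl j) v = pA v) ->
  (forall j v, atom_prob X D (inr j) v = pS v) ->
  forall m l F,
  ExI X D C (map inl (iota 0 m) ++ map inr (iota 0 l)) F =
  Ex CA pA m (fun a => Ex CS pS l (fun s => F (a ++ s))).
Proof.
move=> X D C HA HS m l F.
have HSl k G : ExI X D C (map inr (iota k l)) G = Ex CS pS l G.
  elim: l k G => [//|l IH] k G /=.
  by apply: eq_bigr => v _; rewrite HS (IH k.+1 (fun l => G (val v :: l))).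
have HAm k G : ExI X D C (map inl (iota k m) ++ map inr (iota 0 l)) G =
    Ex CA pA m (fun a => ExI X D C (map inr (iota 0 l)) (fun s => G (a ++ s))).
  elim: m k G => [//|m IH] k G /=.
  by apply: eq_bigr => v _; rewrite HA (IH k.+1 (fun l => G (val v :: l))).
by rewrite HAm; apply: Ex_ext => a _; rewrite HSl.
Qed.

(** * Measurability of the sample path *)

Section measurability.
Context {d} {Omega : measurableType d} {R : realType}.
Variables (n : nat) (c : initial_condition R) (T V : Omega -> nat -> R).
Hypotheses (n0 : (0 < n)%N) (cn : admissible n c).
Hypotheses (mT : forall j, measurable_fun setT (T ^~ j)) (mV : forall j, measurable_fun setT (V ^~ j)).

Lemma measurable_arrival j : measurable_fun setT (fun w => arrival c (T w) j).
Proof.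
rewrite /arrival; case: (j < waiting c)%N; first exact: measurable_cst.
apply: measurable_funD => //.
exact: (measurable_sum (index_iota 0 (j - waiting c)) (h := fun j w => T w j)).
Qed.

(** The sorted list is followed through its counts up to each level, which evolve by [count_step];
    the head is at most [y] exactly when the count at [y] is positive. *)
Let fc y j w := count (fun x => (x <= y)%R) (free_times n c (T w) (V w) j).

Lemma measurable_from_le (f : Omega -> R) :
  (forall y, measurable [set w | (f w <= y)%R]) -> measurable_fun setT f.
Proof.
move=> H; apply: (measurability _ (RGenOInfty.measurableE R)) => _ [_ [y ->] <-].
rewrite setTI (_ : _ @^-1` _ = ~` [set w | (f w <= y)%R]); first exact: measurableC.
by apply/seteqP; split => w /=; rewrite in_itv /= andbT ltNge => /negP.
Qed.

Lemma measurable_head j : (forall y, measurable_fun setT (fc y j)) ->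
  measurable_fun setT (fun w => head 0 (free_times n c (T w) (V w) j)).
Proof.
move=> H; apply: measurable_from_le => y.
rewrite (_ : mkset _ = fc y j @^-1` ~` [set 0%N]).
  by rewrite -[X in measurable X]setTI; exact: H.
apply/seteqP; split => w /=; rewrite /fc.
  move=> hy; apply/eqP; rewrite -lt0n -has_count; apply/hasP.
  exists (head 0 (free_times n c (T w) (V w) j)) => //.
  by apply/head_mem/free_times_neq0.
move=> /eqP; rewrite -lt0n -has_count => /hasP[x xf xy].
by apply: le_trans xy; apply: sorted_head => //; exact: sorted_free_times.
Qed.

Lemma measurable_nat_of_bool (b : Omega -> bool) : measurable_fun setT b ->
  measurable_fun setT (fun w => nat_of_bool (b w)).
Proof. by move=> mb; apply: (measurableT_comp (f := nat_of_bool)). Qed.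

Lemma measurable_start_fc j :
  (forall y, measurable_fun setT (fc y j)) ->
  measurable_fun setT (fun w => start n c (T w) (V w) j).
Proof.
by move=> H; apply: measurable_maxr; [exact: measurable_arrival|exact: measurable_head].
Qed.

Lemma measurable_fc y j : measurable_fun setT (fc y j).
Proof.
elim: j y => [|j IH] y; first exact: measurable_cst.
rewrite (_ : fc y j.+1 = (fun w => (start n c (T w) (V w) j + V w j <= y)%R + fc y j w
   - (head 0 (free_times n c (T w) (V w) j) <= y)%R)%N); last first.
  apply/funext => w; rewrite /fc free_timesS.
  have := count_step (fun x => (x <= y)%R) (arrival c (T w) j) (V w j)
    (free_times_neq0 (T w) (V w) n0 cn j).
  by rewrite /start => <-; rewrite addnK.
apply: measurable_fun_subn.
  apply: measurable_fun_addn => //; apply: measurable_nat_of_bool.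
  by apply: measurable_fun_ler => //; apply: measurable_funD => //; exact: measurable_start_fc.
by apply: measurable_nat_of_bool; apply: measurable_fun_ler => //; exact: measurable_head.
Qed.

Lemma measurable_start j : measurable_fun setT (fun w => start n c (T w) (V w) j).
Proof. by apply: measurable_start_fc => y; exact: measurable_fc. Qed.

Lemma measurable_number_in_system t :
  measurable_fun setT (fun w => number_in_system n c (T w) (V w) t).
Proof.
apply: emeasurable_funD; first exact: measurable_cst.
apply: (ge0_emeasurable_sum _ (P := xpredT)) => [k w _ _|k _].
  by rewrite lee_fin.
apply/measurable_EFinP; apply: (measurableT_comp (f := fun b : bool => b%:R : R)) => //.
apply: measurable_and.
  by apply: measurable_fun_ler => //; exact: measurable_arrival.
apply: measurable_fun_ltr => //; apply: measurable_funD => //; exact: measurable_start.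
Qed.

End measurability.

(** * Changes of variables on unbounded intervals *)

Section exponential_substitution.
Context {R : realType}.
Notation mu := (@lebesgue_measure R).

Lemma derive1_expR : (@expR R)^`() = expR.
Proof. by apply/funext => x; rewrite derive1E; have [_ ->] := is_derive_expR x. Qed.

Lemma continuous_gt0_within (G : R -> R) (a b : R) : 0 < a ->
  (forall x, 0 < x -> {for x, continuous G}) -> {within `[a, b], continuous G}.
Proof.
move=> a0 cG; apply/subspace_continuousP => x /=; rewrite in_itv /= => /andP[ax _].
apply: cvg_within_filter; apply: cG.
exact: lt_le_trans ax.
Qed.

(** Substitution on the compact intervals [[-i, i]], then monotone convergence on both sides. *)
Lemma exp_substitution (G : R -> R) : (forall x, 0 < x -> {for x, continuous G}) ->
  (forall x, 0 < x -> 0 <= G x) ->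
  (\int[mu]_(x in `]0%R, +oo[) (G x)%:E = \int[mu]_x (G (expR x) * expR x)%:E)%E.
Proof.
move=> cG G0.
pose A (i : nat) := `[expR (- i%:R : R), expR i%:R]%classic.
pose B (i : nat) := `[- i%:R : R, i%:R]%classic.
have UA : \bigcup_i A i = `]0, +oo[.
  apply/seteqP; split => x /=.
    by move=> [i _ /=]; rewrite /A /= !in_itv /= andbT => /andP[/(lt_le_trans (expR_gt0 _))].
  rewrite in_itv /= andbT => x0; exists (Num.truncn `|ln x|).+1 => //=.
  rewrite /A /= in_itv /= -[x](@lnK R) ?posrE // !ler_expR lnK ?posrE // -ler_norml.
  by rewrite ltW // truncnS_gt.
have UB : \bigcup_i B i = setT.
  apply/seteqP; split => // x _; exists (Num.truncn `|x|).+1 => //=.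
  by rewrite /B /= in_itv /= -ler_norml ltW // truncnS_gt.
have ndA : nondecreasing_seq A.
  move=> i j ij; apply/subsetPset => x; rewrite /A /= !in_itv /= => /andP[xi ix].
  by rewrite (le_trans _ xi) ?(le_trans ix) // ler_expR ?lerN2 ler_nat.
have ndB : nondecreasing_seq B.
  move=> i j ij; apply/subsetPset => x; rewrite /B /= !in_itv /= => /andP[xi ix].
  by rewrite (le_trans _ xi) ?(le_trans ix) // ?lerN2 ler_nat.
have cGE : continuous (fun x : R => G (expR x) * expR x).
  move=> x; apply: cvgM; last exact: continuous_expR.
  apply: continuous_comp; first exact: continuous_expR.
  by apply: cG; exact: expR_gt0.
have cA : ((\int[mu]_(x in A i) (G x)%:E)%E @[i --> \oo] --> (\int[mu]_(x in `]0%R, +oo[) (G x)%:E)%E).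
  rewrite -UA; apply: ge0_nondecreasing_set_cvg_integral => // [i|i|i x].
  - exact: measurable_itv.
  - apply/measurable_EFinP; apply: subspace_continuous_measurable_fun.
      exact: measurable_itv.
    exact: (continuous_gt0_within (expR_gt0 _) cG).
  - rewrite /A /= in_itv /= lee_fin => /andP[/(lt_le_trans (expR_gt0 _)) x0 _]; exact: G0.
have cB : ((\int[mu]_(x in B i) (G (expR x) * expR x)%:E)%E @[i --> \oo] --> (\int[mu]_x (G (expR x) * expR x)%:E)%E).
  rewrite -UB; apply: ge0_nondecreasing_set_cvg_integral => // [i|i|i x _].
  - exact: measurable_itv.
  - apply/measurable_EFinP; apply: measurable_funTS; exact: continuous_measurable_fun.
  - by rewrite lee_fin mulr_ge0 ?expR_ge0 // G0 // expR_gt0.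
suff eqAB : (fun i => (\int[mu]_(x in A i) (G x)%:E)%E) =
    (fun i => (\int[mu]_(x in B i) (G (expR x) * expR x)%:E)%E).
  by rewrite eqAB in cA; exact: (cvg_unique _ cA cB).
apply/funext => i; rewrite /A /B (@integration_by_substitution_increasing _ expR G (- i%:R) i%:R) //.
- by apply: eq_integral => x _ /=; rewrite derive1_expR.
- by rewrite (@le_trans _ _ 0) // lerNl oppr0.
- by move=> x y _ _; rewrite ltr_expR.
- by move=> x _; rewrite derive1_expR; exact: continuous_expR.
- by rewrite derive1_expR; apply/cvg_ex; exists (expR (- i%:R)); apply: cvg_at_right_filter; exact: continuous_expR.
- by rewrite derive1_expR; apply/cvg_ex; exists (expR (i%:R)); apply: cvg_at_left_filter; exact: continuous_expR.
- split; first by move=> x _.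
    by apply: cvg_at_right_filter; exact: continuous_expR.
  by apply: cvg_at_left_filter; exact: continuous_expR.
- exact: (continuous_gt0_within (expR_gt0 _) cG).
Qed.

Lemma derive1_affine (a b : R) : (fun x : R => a * x + b)^`() = cst a.
Proof.
apply/funext => x; rewrite derive1E.
have H : is_derive x 1 (fun x : R => a * x + b) a.
  by apply: is_derive_eq; rewrite addr0 /GRing.scale /= mulr1.
by have [_ ->] := H.
Qed.

Lemma affine_substitution (G : R -> R) (a b : R) : 0 < a -> continuous G ->
  (forall x, 0 <= G x) ->
  (\int[mu]_x (G x)%:E = \int[mu]_x (G (a * x + b) * a)%:E)%E.
Proof.
move=> a0 cG G0.
have cF : continuous (fun x : R => a * x + b).
  by move=> x; apply: cvgD; [apply: cvgMr; exact: cvg_id|exact: cvg_cst].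
rewrite (@increasing_ge0_integration_by_substitutionT _ (fun x => a * x + b) G) //.
- by apply: eq_integral => x _ /=; rewrite derive1_affine.
- by move=> x y xy; rewrite ltrD2r ltr_pM2l.
- by rewrite derive1_affine; move=> x; exact: cvg_cst.
- by rewrite derive1_affine; exact: is_cvg_cst.
- by rewrite derive1_affine; exact: is_cvg_cst.
- apply/cvgrNyPle => y; near=> x.
  have : x <= (y - b) / a by near: x; apply: nbhs_ninfty_le; exact: num_real.
  by rewrite ler_pdivlMr // => H; lra.
- apply/cvgryPge => y; near=> x.
  have : (y - b) / a <= x by near: x; apply: nbhs_pinfty_ge; exact: num_real.
  by rewrite ler_pdivrMr // => H; lra.
Unshelve. all: by end_near. Qed.

Lemma fold_integral (f : R -> R) : continuous f -> (forall x, 0 <= f x) ->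
  (\int[mu]_x (f x)%:E = \int[mu]_(x in `[0%R, +oo[) (f x + f (- x))%:E)%E.
Proof.
move=> cf f0.
have mf : measurable_fun [set: R] f by exact: continuous_measurable_fun.
have cfN : continuous (f \o -%R).
  by move=> x; apply: continuous_comp; [exact: continuousN|exact: cf].
have mfN : measurable_fun [set: R] (f \o -%R) by exact: continuous_measurable_fun.
have -> : [set: R] = `]-oo, 0%R] `|` `]0%R, +oo[.
  apply/seteqP; split => // x _ /=; rewrite !in_itv /= andbT.
  by case: (leP x 0) => H; [left|right].
rewrite ge0_integral_setU //=; last 3 first.
- by apply/measurable_EFinP; exact: measurable_funTS.
- by move=> x _; rewrite lee_fin.
- apply/disj_setPS => x /= []; rewrite !in_itv /= andbT => x0 x1.
  by move: (lt_le_trans x1 x0); rewrite ltxx.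
rewrite integral_itv_obnd_cbnd; last by apply/measurable_EFinP; exact: measurable_funTS.
have := @ge0_integration_by_substitutionNy R f 0; rewrite oppr0 => ->; last 2 first.
- by apply: continuous_subspaceT.
- by move=> x _.
rewrite addeC -ge0_integralD //=.
- by move=> x _; rewrite lee_fin.
- by apply/measurable_EFinP; exact: measurable_funTS.
- by move=> x _; rewrite lee_fin.
- by apply/measurable_EFinP; exact: measurable_funTS.
Qed.

Lemma integral_expRN (a : R) : 0 < a ->
  (\int[mu]_(x in `[0%R, +oo[) (expR (- (a * x)))%:E = (a^-1)%:E)%E.
Proof.
move=> a0.
have H (x : R) : is_derive x 1 (fun x => - a^-1 * expR (- (a * x))) (expR (- (a * x))).
  apply: is_derive_eq; rewrite /GRing.scale /=; field; exact: lt0r_neq0.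
have cE : continuous (fun x : R => expR (- (a * x))).
  move=> x; apply: continuous_comp; last exact: continuous_expR.
  by apply: cvgN; apply: cvgMr; exact: cvg_id.
rewrite (@ge0_continuous_FTC2y _ _ (fun x => - a^-1 * expR (- (a * x))) 0 0).
- by rewrite mulr0 oppr0 expR0 mulr1 sub0e EFinN oppeK.
- by move=> x _; exact: expR_ge0.
- exact: continuous_subspaceT.
- rewrite -[X in _ --> X](mulr0 (- a^-1)); apply: cvgMr.
  apply: (cvg_comp (fun x : R => a * x) (fun y => expR (- y))); last exact: cvgr_expR.
  apply/cvgryPge => y; near=> x.
  have : y / a <= x by near: x; apply: nbhs_pinfty_ge; exact: num_real.
  by rewrite ler_pdivrMr // mulrC.
- by move=> x _.
- have : {for (0 : R), continuous (fun x : R => - a^-1 * expR (- (a * x)))}.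
    apply: differentiable_continuous; apply/derivable1_diffP.
    exact: (@ex_derive _ _ _ _ _ _ _ (H 0)).
  exact: cvg_at_right_filter.
- by move=> x _; rewrite derive1E; have [_ ->] := H x.
Unshelve. all: by end_near. Qed.

End exponential_substitution.

(** * Euler's integral for the cosecant *)

Section mellin.
Context {R : realType}.
Notation mu := (@lebesgue_measure R).

(** The integrand of Euler's integral of [u ^ (s - 1) / (1 + u)] over the half-line, after
    [u = exp y]. *)
Definition mellin (s y : R) : R := expR (s * y) / (1 + expR y).

Lemma mellin_ge0 s y : 0 <= mellin s y.
Proof. by rewrite divr_ge0 ?expR_ge0 // addr_ge0 ?expR_ge0. Qed.

Lemma continuous_expRM (s : R) : continuous (fun y : R => expR (s * y)).
Proof.
move=> y; apply: continuous_comp; last exact: continuous_expR.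
by apply: cvgMr; exact: cvg_id.
Qed.

Lemma continuous_expRMN (s : R) : continuous (fun y : R => expR (- (s * y))).
Proof.
have -> : (fun y : R => expR (- (s * y))) = (fun y => expR (- s * y)).
  by apply/funext => y; rewrite mulNr.
exact: continuous_expRM.
Qed.

Lemma continuous_mellin s : continuous (mellin s).
Proof.
move=> y; apply: cvgM; first exact: continuous_expRM.
apply: cvgV; first by rewrite gt_eqF // addr_gt0 ?expR_gt0.
by apply: cvgD; [exact: cvg_cst|exact: continuous_expR].
Qed.

Lemma mellinN s y : mellin s (- y) = mellin (1 - s) y.
Proof.
rewrite /mellin mulrBl mul1r expRB mulrN !expRN.
have := expR_gt0 y; have := expR_gt0 (s * y); set a := expR y; set b := expR (s * y).
by move=> b0 a0; field; rewrite !gt_eqF // ?addr_gt0.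
Qed.

Definition mellin_int s : \bar R := (\int[mu]_y (mellin s y)%:E)%E.

Lemma mellin_fold s : mellin_int s =
  (\int[mu]_(x in `[0%R, +oo[) (mellin s x + mellin (1 - s) x)%:E)%E.
Proof.
rewrite /mellin_int fold_integral; last first.
- exact: mellin_ge0.
- exact: continuous_mellin.
by apply: eq_integral => x _; rewrite mellinN.
Qed.

Lemma mellin_intB s : mellin_int (1 - s) = mellin_int s.
Proof. by rewrite !mellin_fold; apply: eq_integral => x _; rewrite subKr addrC. Qed.

Lemma measurable_mellin s (D : set R) : measurable_fun D (EFin \o mellin s).
Proof.
apply/measurable_EFinP; apply: measurable_funTS; apply: continuous_measurable_fun.
exact: continuous_mellin.
Qed.

Lemma measurable_mellinD s t (D : set R) : measurable_fun D (fun x => (mellin s x + mellin t x)%:E).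
Proof.
apply/measurable_EFinP; apply: measurable_funTS; apply: continuous_measurable_fun => x.
by apply: cvgD; exact: continuous_mellin.
Qed.

Lemma measurable_expRM s (D : set R) : measurable_fun D (fun x : R => (expR (- (s * x)))%:E).
Proof.
apply/measurable_EFinP; apply: measurable_funTS; apply: continuous_measurable_fun.
exact: continuous_expRMN.
Qed.

Lemma mellin_pair s x : mellin s x + mellin (1 - s) x =
  (expR (- (s * x)) + expR (- ((1 - s) * x))) / (1 + expR (- x)).
Proof.
have E t : mellin t x = expR (- ((1 - t) * x)) / (1 + expR (- x)).
  by rewrite -[x in LHS]opprK mellinN /mellin mulrN.
by rewrite !E subKr -mulrDl addrC.
Qed.

Lemma mellin_int_ge s : 0 < s < 1 -> ((s^-1)%:E <= mellin_int s)%E.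
Proof.
move=> /andP[s0 s1]; rewrite mellin_fold -integral_expRN //.
apply: ge0_le_integral; [exact: measurable_itv|by move=> x _; rewrite lee_fin expR_ge0|
  exact: measurable_expRM|exact: measurable_mellinD|].
move=> x; rewrite /= in_itv /= andbT => x0; rewrite lee_fin mellin_pair.
rewrite ler_pdivlMr ?addr_gt0 ?expR_gt0 // mulrDr mulr1 lerD2l -expRD ler_expR.
nra.
Qed.

(** With [a = exp(- s x)], [b = exp(- (1 - s) x)] and [E = exp(- x)], the folded integrand
    [(a + b) / (1 + E)] is at most [a + b - a * E], because [a * E <= b]. The subtracted term stands
    on the left so that only nonnegative integrals are added. *)
Lemma mellin_int_le s : 0 < s < 1 ->
  (mellin_int s + ((1 + s)^-1)%:E <= (s^-1)%:E + ((1 - s)^-1)%:E)%E.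
Proof.
move=> /andP[s0 s1]; rewrite mellin_fold -!integral_expRN //; [|lra|lra].
have mE t x : (0%R <= (expR (- (t * x)) : R)%:E)%E by rewrite lee_fin expR_ge0.
have mM x : (0%R <= (mellin s x + mellin (1 - s) x)%:E)%E by rewrite lee_fin addr_ge0 // mellin_ge0.
rewrite -ge0_integralD; [|exact: measurable_itv|by move=> x _|exact: measurable_mellinD|
  by move=> x _|exact: measurable_expRM].
rewrite -ge0_integralD; [|exact: measurable_itv|by move=> x _|exact: measurable_expRM|
  by move=> x _|exact: measurable_expRM].
apply: ge0_le_integral; [exact: measurable_itv|by move=> x _; rewrite adde_ge0| | |].
- by apply: emeasurable_funD; [exact: measurable_mellinD|exact: measurable_expRM].
- by apply: emeasurable_funD; exact: measurable_expRM.
move=> x; rewrite /= in_itv /= andbT => x0; rewrite lee_fin mellin_pair.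
have E0 : 0 < 1 + expR (- x) by rewrite addr_gt0 ?expR_gt0.
have -> : expR (- ((1 + s) * x)) = expR (- (s * x)) * expR (- x).
  by rewrite -expRD; congr expR; ring.
have H : expR (- (s * x)) * expR (- x) <= expR (- ((1 - s) * x)).
  rewrite -expRD ler_expR; nra.
move: (expR_gt0 (- x)) H E0; move: (expR (- (s * x))) (expR (- x)) (expR (- ((1 - s) * x))) => a E b E0 H E1.
rewrite -lerBrDr ler_pdivrMr // -subr_ge0.
have -> : (a + b - a * E) * (1 + E) - (a + b) = E * (b - a * E) by ring.
by apply: mulr_ge0; [exact: ltW|rewrite subr_ge0].
Qed.

Lemma mellin_int_fin s : 0 < s < 1 -> mellin_int s \is a fin_num.
Proof.
move=> s01; rewrite ge0_fin_numE; last by apply: integral_ge0 => x _; rewrite lee_fin mellin_ge0.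
have := mellin_int_le s01; case: mellin_int => [r _|+|//]; first exact: ltry.
by rewrite -EFinD addye // leye_eq.
Qed.

Lemma mellin_scale u : mellin_int (u / 3) =
  (\int[mu]_x (3 * expR (u * x) / (1 + expR x ^+ 3))%:E)%E.
Proof.
rewrite /mellin_int (@affine_substitution _ (mellin (u / 3)) 3 0) //; last first.
- exact: mellin_ge0.
- exact: continuous_mellin.
apply: eq_integral => x _; rewrite /mellin addr0 -expRM_natr mulrC [x * 3]mulrC.
by rewrite mulrA divfK ?pnatr_eq0 // mulrA.
Qed.

(** Once the terms at thirds are rescaled by 3, this is [1 + a ^ 3 = (1 + a) * (1 - a + a ^ 2)] with
    [a = exp x]. *)
Lemma mellin_triple s : 0 < s < 1 ->
  (3%:E * mellin_int s + mellin_int ((s + 1) / 3) =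
   mellin_int (s / 3) + mellin_int ((s + 2) / 3))%E.
Proof.
move=> s01; rewrite !mellin_scale /mellin_int.
have cK u : measurable_fun [set: R] (fun x : R => (3 * expR (u * x) / (1 + expR x ^+ 3))%:E).
  apply/measurable_EFinP; apply: continuous_measurable_fun => x.
  apply: cvgM; first by apply: cvgMr; exact: continuous_expRM.
  apply: cvgV; first by rewrite gt_eqF // addr_gt0 ?exprn_gt0 ?expR_gt0.
  apply: cvgD; first exact: cvg_cst.
  have e3 : (fun x : R => expR x ^+ 3) = (fun x => expR (3 * x)).
    by apply/funext => y; rewrite mulrC expRM_natr.
  have c3 : continuous (fun x : R => expR x ^+ 3) by rewrite e3; exact: continuous_expRM.
  exact: c3.
have K0 u x : (0%R <= (3 * expR (u * x) / (1 + expR x ^+ 3))%:E)%E.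
  by rewrite lee_fin divr_ge0 ?mulr_ge0 ?addr_ge0 ?exprn_ge0 ?expR_ge0.
have M0 x : (0%R <= (mellin s x)%:E)%E by rewrite lee_fin mellin_ge0.
rewrite -ge0_integralZl; [|by []|exact: measurable_mellin|by move=> x _|by []].
rewrite -ge0_integralD; [|by []|by move=> x _; rewrite mule_ge0|
  by apply: measurable_funeM; exact: measurable_mellin|by move=> x _|exact: cK].
rewrite -ge0_integralD; [|by []|by move=> x _|exact: cK|by move=> x _|exact: cK].
apply: eq_integral => x _; rewrite -!EFinM -!EFinD; congr EFin.
have e2 : expR (2 * x) = expR x ^+ 2 by rewrite mulrC expRM_natr.
have -> : expR ((s + 2) * x) = expR (s * x) * expR x ^+ 2 by rewrite mulrDl expRD e2.
have -> : expR ((s + 1) * x) = expR (s * x) * expR x by rewrite mulrDl expRD mul1r.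
rewrite /mellin.
have := expR_gt0 x; set a := expR x; set b := expR (s * x) => a0.
field; rewrite ?gt_eqF // ?addr_gt0 ?exprn_gt0 //.
Qed.

Lemma fine_triple (x1 x2 x3 x4 : \bar R) :
  x1 \is a fin_num -> x2 \is a fin_num -> x3 \is a fin_num -> x4 \is a fin_num ->
  (3%:E * x1 + x3 = x2 + x4)%E -> 3 * fine x1 = fine x2 - fine x3 + fine x4.
Proof.
case: x1 => // y1; case: x2 => // y2; case: x3 => // y3; case: x4 => // y4 _ _ _ _.
by rewrite -EFinM -!EFinD => -[] /=; lra.
Qed.

Theorem mellin_intE s : 0 < s < 1 -> mellin_int s = (csc s)%:E.
Proof.
move=> s01; rewrite -[LHS]fineK ?mellin_int_fin //; congr EFin.
apply: (@csc_unique _ (fun s => fine (mellin_int s))) s01 => {}s s01.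
- have /andP[s0 s1] := s01.
  apply: fine_triple (mellin_triple s01); apply: mellin_int_fin => //;
  by apply/andP; split; lra.
- by rewrite mellin_intB.
- have H1 := mellin_int_ge s01; have H2 := mellin_int_le s01.
  rewrite -[mellin_int s]fineK ?mellin_int_fin // in H1 H2.
  by move: H1 H2; rewrite -!EFinD !lee_fin /= => H1 H2; apply/andP; split; lra.
Qed.

End mellin.

(** * The integral of [(1 - exp(-x)) x^(-alpha)] in terms of [Gamma] *)

Section laplace_constant.
Context {R : realType}.
Notation mu := (@lebesgue_measure R).
Variable alpha : R.
Hypotheses (a1 : 1 < alpha) (a2 : alpha < 2).

Lemma powR_expR (y r : R) : expR y `^ r = expR (r * y).
Proof. by rewrite mulrC expRM. Qed.

Lemma continuous_powR (r x : R) : 0 < x -> {for x, continuous (fun x : R => x `^ r)}.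
Proof.
move=> x0; apply: differentiable_continuous; apply/derivable1_diffP.
by apply: derivable_powR; rewrite in_itv /= andbT.
Qed.

Lemma continuous_expRN : continuous (fun x : R => expR (- x)).
Proof. by move=> x; apply: continuous_comp; [exact: continuousN|exact: continuous_expR]. Qed.

Let c (y : R) := (1 - expR (- expR y)) * expR ((1 - alpha) * y).
Let g (z : R) := expR (alpha * z - expR z).

Definition laplace_int : \bar R :=
  (\int[mu]_(x in `]0%R, +oo[) ((1 - expR (- x)) * x `^ (- alpha))%:E)%E.

Lemma laplace_intE : laplace_int = (\int[mu]_y (c y)%:E)%E.
Proof.
rewrite /laplace_int (exp_substitution (G := fun x => (1 - expR (- x)) * x `^ (- alpha))).
- apply: eq_integral => y _; rewrite powR_expR /c -mulrA -expRD; congr (_ * expR _)%:E.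
  ring.
- move=> x x0; apply: cvgM; last exact: continuous_powR.
  by apply: cvgB; [exact: cvg_cst|exact: continuous_expRN].
- move=> x x0; rewrite mulr_ge0 ?powR_ge0 // subr_ge0 -expR0 ler_expR oppr_le0; exact: ltW.
Qed.

Lemma euler_gamma_int : euler_gamma alpha = fine (\int[mu]_z (g z)%:E)%E.
Proof.
rewrite /euler_gamma /Rintegral; congr fine.
rewrite (exp_substitution (G := fun x => x `^ (alpha - 1) * expR (- x))).
- apply: eq_integral => y _; rewrite powR_expR /g -!expRD; congr (expR _)%:E; ring.
- move=> x x0; apply: cvgM; [exact: continuous_powR|exact: continuous_expRN].
- by move=> x x0; rewrite mulr_ge0 ?powR_ge0 ?expR_ge0.
Qed.

Lemma c_ge0 y : 0 <= c y.
Proof. by rewrite mulr_ge0 ?expR_ge0 // subr_ge0 -expR0 ler_expR oppr_le0 expR_ge0. Qed.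

Lemma measurable_c : measurable_fun setT c.
Proof.
apply: continuous_measurable_fun => y; apply: cvgM; last exact: continuous_expRM.
apply: cvgB; first exact: cvg_cst.
by apply: (@continuous_comp _ _ _ expR (fun x => expR (- x)) y); [exact: continuous_expR|exact: continuous_expRN].
Qed.

Lemma continuous_g : continuous g.
Proof.
move=> z; apply: (@continuous_comp _ _ _ (fun z => alpha * z - expR z) expR z); last exact: continuous_expR.
by apply: cvgB; [apply: cvgMr; exact: cvg_id|exact: continuous_expR].
Qed.

Lemma inner_integral (v : R) : 0 < v ->
  (\int[mu]_(u in `]0%R, +oo[) ((1 - expR (- u)) * expR (- (v * u)))%:E = (v^-1 - (1 + v)^-1)%:E)%E.
Proof.
move=> v0; have v10 : 0 < 1 + v by lra.
have H : (\int[mu]_(u in `]0%R, +oo[) ((1 - expR (- u)) * expR (- (v * u)))%:E + ((1 + v)^-1)%:E = (v^-1)%:E)%E.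
  rewrite -!integral_expRN // -!(integral_itv_obnd_cbnd (r := 0)); last 2 first.
  - exact: measurable_expRM.
  - exact: measurable_expRM.
  rewrite -ge0_integralD; [|exact: measurable_itv| | |by move=> u _; rewrite lee_fin expR_ge0|exact: measurable_expRM].
  - apply: eq_integral => u _; rewrite -EFinD mulrBl mul1r -expRD; congr EFin.
    by rewrite (_ : - u + - (v * u) = - ((1 + v) * u)); [rewrite subrK|ring].
  - move=> u; rewrite /= in_itv /= andbT => u0; rewrite lee_fin mulr_ge0 ?expR_ge0 //.
    by rewrite subr_ge0 -expR0 ler_expR oppr_le0 ltW.
  - apply/measurable_EFinP; apply: measurable_funTS; apply: continuous_measurable_fun => u.
    apply: cvgM; first by apply: cvgB; [exact: cvg_cst|exact: continuous_expRN].
    exact: continuous_expRMN.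
by rewrite EFinB -H addeK.
Qed.

Lemma c_g (y z : R) : expR (alpha * z) *
    ((1 - expR (- expR y)) * expR (- (expR z * expR y)) * expR y) = c y * g (y + z).
Proof.
rewrite /c /g.
have -> : expR (alpha * (y + z) - expR (y + z)) =
        expR (alpha * y) * (expR (alpha * z) * expR (- (expR z * expR y))).
  rewrite [expR (y + z)]expRD -[in RHS]expRD -[RHS]expRD; congr expR; ring.
have -> : expR ((1 - alpha) * y) = expR y / expR (alpha * y).
  by rewrite -expRB; congr expR; ring.
by field; rewrite gt_eqF // expR_gt0.
Qed.

(** In exponential coordinates the product is a double integral in which [z] may be shifted by [y].
    Tonelli leaves an elementary integral in [u = exp y] and then, in [z], Euler's integral at
    [alpha - 1]. *)
Lemma laplace_gamma : (laplace_int * (\int[mu]_z (g z)%:E) = (csc (alpha - 1))%:E)%E.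
Proof.
rewrite -mellin_intE; last by rewrite subr_gt0 a1 ltrBlDr.
have g0 z : 0 <= g z by apply: expR_ge0.
have mg : measurable_fun setT g by apply: continuous_measurable_fun; exact: continuous_g.
have mf : measurable_fun setT (fun q : R * R => (c q.1 * g (q.1 + q.2))%:E).
  apply/measurable_EFinP; apply: measurable_funM.
    by apply: measurableT_comp => //; exact: measurable_c.
  by apply: measurableT_comp => //; apply: measurable_funD.
have f0 (q : R * R) : (0%R <= (c q.1 * g (q.1 + q.2))%:E)%E by rewrite lee_fin mulr_ge0 // c_ge0.
transitivity (\int[mu]_y \int[mu]_z (c y * g (y + z))%:E)%E.
  rewrite laplace_intE -ge0_integralZr; [|by []| |by move=> y _; rewrite lee_fin c_ge0|
    by apply: integral_ge0 => z _; rewrite lee_fin]; last first.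
    by apply/measurable_EFinP; exact: measurable_c.
  apply: eq_integral => y _.
  rewrite (@affine_substitution _ g 1 y) //; last exact: continuous_g.
  rewrite -ge0_integralZl; [|by []| |by move=> z _; rewrite lee_fin mulr_ge0|by rewrite lee_fin c_ge0]; last first.
    apply/measurable_EFinP; apply: measurable_funM => //.
    by apply: (measurableT_comp mg); apply: measurable_funD => //; apply: measurable_funM.
  by apply: eq_integral => z _; rewrite mul1r mulr1 -EFinM addrC.
rewrite (@fubini_tonelli _ _ _ _ _ mu mu (fun q : R * R => (c q.1 * g (q.1 + q.2))%:E)) //.
apply: eq_integral => z _ /=.
have v0 := expR_gt0 z; set v := expR z in v0.
transitivity ((expR (alpha * z))%:E * \int[mu]_y ((1 - expR (- expR y)) * expR (- (v * expR y)) * expR y)%:E)%E.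
  rewrite -ge0_integralZl //.
  - by apply: eq_integral => y _; rewrite -EFinM; congr EFin; exact: (esym (c_g y z)).
  - apply/measurable_EFinP; apply: continuous_measurable_fun => y.
    apply: cvgM; last exact: continuous_expR.
    apply: cvgM.
      apply: cvgB; first exact: cvg_cst.
      by apply: (@continuous_comp _ _ _ expR (fun x => expR (- x)) y); [exact: continuous_expR|exact: continuous_expRN].
    apply: (@continuous_comp _ _ _ (fun y => v * expR y) (fun x => expR (- x)) y); last exact: continuous_expRN.
    by apply: cvgMr; exact: continuous_expR.
rewrite -(exp_substitution (G := fun u => (1 - expR (- u)) * expR (- (v * u)))); last 2 first.
- move=> u _; apply: cvgM; first by apply: cvgB; [exact: cvg_cst|exact: continuous_expRN].
  exact: continuous_expRMN.
- by move=> u u0; rewrite mulr_ge0 ?expR_ge0 // subr_ge0 -expR0 ler_expR oppr_le0 ltW.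
rewrite inner_integral // -EFinM /mellin mulrBl mul1r expRB -/v; congr EFin.
by field; rewrite !gt_eqF // addr_gt0.
Qed.

Theorem laplace_int_Gamma : laplace_int = (alpha * Gamma (- alpha))%:E /\ 0 < alpha * Gamma (- alpha).
Proof.
have H := laplace_gamma.
have csc0 : 0 < csc (alpha - 1).
  have s01 : 0 < alpha - 1 < 1 by rewrite subr_gt0 a1 ltrBlDr.
  by apply: lt_le_trans (csc_ge s01); rewrite invr_gt0; case/andP: s01.
have L0 : (0%R <= laplace_int)%E by rewrite laplace_intE; apply: integral_ge0 => y _; rewrite lee_fin c_ge0.
have G0 : (0%R <= \int[mu]_z (g z)%:E)%E by apply: integral_ge0 => z _; rewrite lee_fin expR_ge0.
have al0 : 0 < alpha by apply: lt_trans a1.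
rewrite /Gamma oppr_gt0 ltNge (ltW al0) /=.
rewrite opprK euler_gamma_int.
have sE : sin (pi * alpha) = - sin (pi * (alpha - 1)).
  by rewrite mulrBr mulr1 sinB cospi sinpi mulrN1 mulr0 subr0 opprK.
have s0 : 0 < sin (pi * (alpha - 1)).
  by apply/sin_gt0_pi/pi_mul_itv; rewrite subr_gt0 a1 ltrBlDr.
move: H L0 G0; rewrite /csc in csc0 *.
set L := laplace_int; set G := (\int[mu]_z _)%E; rewrite sE.
move: (sin _) s0 csc0 => s s0; move: (pi : R) => q csc0.
(* The product is finite and positive, which excludes zero and infinite factors. *)
case: L => [l| |] //; case: G => [e| |] //.
- rewrite -EFinM !lee_fin => -[H] l0 e0 /=.
  have e1 : 0 < e.
    by rewrite lt_def e0 andbT; apply: contraPneq H => ->; rewrite mulr0 => H; rewrite -H ltxx in csc0.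
  have qe : q = l * e * s by rewrite H divfK // gt_eqF.
  have -> : alpha * (q / (- alpha * e * - s)) = l.
    by rewrite qe; field; rewrite !gt_eqF //; lra.
  split => //; rewrite lt_def l0 andbT; apply: contraPneq H => ->; rewrite mul0r => H.
  by rewrite -H ltxx in csc0.
- move=> + l0 _; rewrite mulry; have [l1|l1|l1] := sgrP l; rewrite ?mul1e // ?mul0e ?mulN1e //.
  by move=> -[H]; rewrite -H ltxx in csc0.
- move=> + _ e0; rewrite mulyr; have [l1|l1|l1] := sgrP e; rewrite ?mul1e // ?mul0e ?mulN1e //.
  by move=> -[H]; rewrite -H ltxx in csc0.
Qed.

End laplace_constant.

(** * The Laplace transform of an interarrival time near 0 *)

Section laplace_asymptotics.
Context {R : realType} d (Omega : measurableType d) (P : probability Omega R).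
Variables (A : {RV P >-> R}) (alpha C_A : R).
Hypotheses (A0 : forall w, 0 <= A w) (EA : ('E_P[A] = 1)%E).
Hypotheses (a1 : 1 < alpha) (a2 : alpha < 2) (CA0 : 0 < C_A).
Hypothesis tailA : ((x `^ alpha)%:E * P [set w | (x < A w)%R])%E @[x --> +oo] --> C_A%:E.
Notation mu := (@lebesgue_measure R).

Let h (s x : R) := s * (1 - expR (- (s * x))).
Let Fb x := P [set w | (x < A w)%R].

Lemma measurable_tail x : measurable [set w | (x < A w)%R].
Proof.
rewrite -[X in measurable X]setTI (_ : mkset _ = A @^-1` `]x, +oo[).
  by apply: measurable_funPT => //; exact: measurable_itv.
by apply/seteqP; split => w /=; rewrite in_itv /= andbT.
Qed.

Lemma h_ge0 s x : 0 <= s -> 0 <= x -> 0 <= h s x.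
Proof.
by move=> s0 x0; rewrite mulr_ge0 // subr_ge0 -expR0 ler_expR oppr_le0 mulr_ge0.
Qed.

Lemma continuous_h s : continuous (h s).
Proof.
move=> x; apply: cvgMr; apply: cvgB; first exact: cvg_cst.
apply: (@continuous_comp _ _ _ (fun x => s * x) (fun x => expR (- x)) x); last exact: continuous_expRN.
by apply: cvgMr; exact: cvg_id.
Qed.

Let gs (s x : R) : R := expR (- (s * x)) - 1 + s * x.

Lemma integral_h s a : 0 <= s -> 0 <= a ->
  (\int[mu]_(x in `]0%R, a[) (h s x)%:E = (gs s a)%:E)%E.
Proof.
move=> s0; rewrite le_eqVlt => /predU1P[<-|a0].
  by rewrite set_itv_ge ?bnd_simp // integral_set0 /gs mulr0 oppr0 expR0 subrr addr0.
have H (x : R) : is_derive x 1 (gs s) (h s x).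
  by apply: is_derive_eq; rewrite /GRing.scale /= /h; ring.
have cg : continuous (gs s).
  move=> x; apply: differentiable_continuous; apply/derivable1_diffP.
  exact: (@ex_derive _ _ _ _ _ _ _ (H x)).
have -> : (\int[mu]_(x in `]0%R, a[) (h s x)%:E = \int[mu]_(x in `[0%R, a]) (h s x)%:E)%E.
  rewrite integral_itv_bndo_bndc ?integral_itv_obnd_cbnd //;
  by apply/measurable_EFinP; apply: measurable_funTS; apply: continuous_measurable_fun; exact: continuous_h.
rewrite (continuous_FTC2 (F := gs s)) //.
- by rewrite /gs mulr0 oppr0 expR0 subrr addr0 sube0.
- by apply: continuous_subspaceT; exact: continuous_h.
- split; first by move=> x _; exact: (@ex_derive _ _ _ _ _ _ _ (H x)).
    exact/cvg_at_right_filter/cg.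
  exact/cvg_at_left_filter/cg.
- by move=> x _; rewrite derive1E; have [_ ->] := H x.
Qed.

(** [h s] is the derivative of [gs s], which vanishes at 0; Tonelli exchanges levels and
    expectation. *)
Lemma layer_cake s : 0 <= s ->
  (\int[P]_w (gs s (A w))%:E = \int[mu]_(x in `]0%R, +oo[) ((h s x)%:E * Fb x))%E.
Proof.
move=> s0.
pose b (q : Omega * R) := ((0 < q.2) && (q.2 < A q.1))%R.
have mb : measurable_fun setT b.
  apply: measurable_and; first by apply: measurable_fun_ltr.
  apply: measurable_fun_ltr => //.
  by apply: (measurableT_comp (f := A)).
pose f (q : Omega * R) := (h s q.2 * (b q)%:R)%:E.
have mf : measurable_fun setT f.
  apply/measurable_EFinP; apply: measurable_funM.
    apply: (measurableT_comp (f := h s)) => //; apply: continuous_measurable_fun; exact: continuous_h.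
  by apply: (measurableT_comp (f := fun c : bool => c%:R : R)).
have f0 q : (0%R <= f q)%E.
  rewrite lee_fin /b; case: (ltP 0 q.2) => q0 /=; last by rewrite mulr0.
  by rewrite mulr_ge0 // h_ge0 // ltW.
transitivity (\int[P]_w \int[mu]_x f (w, x))%E.
  apply: eq_integral => w _ /=.
  rewrite -integral_h // [LHS]integral_mkcond; apply: eq_integral => x _.
  rewrite patchE /f /b /= mem_setE in_itv /=.
  by case: ifP => _; rewrite ?mulr1 ?mulr0.
rewrite (@fubini_tonelli _ _ _ _ _ P mu f) // [RHS]integral_mkcond.
apply: eq_integral => x _; rewrite patchE /f /b /= mem_setE in_itv /= andbT.
case: (ltP 0 x) => x0 /=; last by under eq_integral do rewrite mulr0; rewrite integral0.
rewrite /Fb (_ : P [set w | (x < A w)%R] = \int[P]_w (\1_[set w | (x < A w)%R] w)%:E)%E; last first.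
  by rewrite integral_indic ?setIT //; exact: measurable_tail.
rewrite -ge0_integralZl //.
- by apply: eq_integral => w _; rewrite indicE -EFinM mem_setE.
- by apply/measurable_EFinP/measurable_indic; exact: measurable_tail.
- by rewrite lee_fin h_ge0 // ltW.
Qed.

Lemma scaled_eq (s y : R) : 0 < s ->
  s * (1 - expR (- (s * expR y))) * expR (- alpha * y) * expR y =
  s `^ alpha * ((1 - expR (- expR (y + ln s))) * expR ((1 - alpha) * (y + ln s))).
Proof.
move=> s0; have e1 : expR (y + ln s) = s * expR y by rewrite expRD lnK ?posrE // mulrC.
have e2 : s `^ alpha = expR (alpha * ln s) by rewrite /powR gt_eqF.
have e3 : expR (alpha * ln s) * expR ((1 - alpha) * (y + ln s)) = expR (- alpha * y) * expR y * s.
  rewrite -[in RHS](@lnK _ s) ?posrE // -!expRD; congr expR; ring.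
by rewrite e1 e2 mulrCA e3; ring.
Qed.

Lemma scaled_laplace_int s : 0 < s ->
  (\int[mu]_(x in `]0%R, +oo[) (h s x * x `^ (- alpha))%:E = (s `^ alpha)%:E * laplace_int alpha)%E.
Proof.
move=> s0; rewrite (exp_substitution (G := fun x => h s x * x `^ (- alpha))); last 2 first.
- by move=> x x0; apply: cvgM; [exact: continuous_h|exact: continuous_powR].
- by move=> x x0; rewrite mulr_ge0 ?powR_ge0 // h_ge0 // ltW.
pose c (y : R) := (1 - expR (- expR y)) * expR ((1 - alpha) * y).
have c0 y : 0 <= c y by rewrite mulr_ge0 ?expR_ge0 // subr_ge0 -expR0 ler_expR oppr_le0 expR_ge0.
have cc : continuous c.
  move=> y; apply: cvgM; last exact: continuous_expRM.
  apply: cvgB; first exact: cvg_cst.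
  by apply: (@continuous_comp _ _ _ expR (fun x => expR (- x)) y); [exact: continuous_expR|exact: continuous_expRN].
rewrite laplace_intE // -/c (@affine_substitution _ c 1 (ln s)) //.
rewrite -ge0_integralZl //.
- apply: eq_integral => y _; rewrite -EFinM mul1r mulr1 /c /h powR_expR; congr EFin.
  exact: scaled_eq.
- apply/measurable_EFinP; apply: measurable_funM => //.
  apply: (measurableT_comp (f := c)); first exact: continuous_measurable_fun.
  by apply: measurable_funD => //; apply: measurable_funM.
- by move=> y _; rewrite lee_fin mulr_ge0.
- by rewrite lee_fin powR_ge0.
Qed.

Definition laplace (s : R) : R := fine (\int[P]_w (expR (- (s * A w)))%:E)%E.

Let mA : measurable_fun setT A. Proof. exact: measurable_funPT. Qed.

Lemma gs_ge0 s x : 0 <= gs s x.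
Proof. by have := expR_ge1Dx (- (s * x)); rewrite /gs; lra. Qed.

Lemma measurable_expRA s : measurable_fun setT (fun w => (expR (- (s * A w)))%:E).
Proof.
apply/measurable_EFinP; apply: (measurableT_comp (f := expR)) => //.
by apply: measurable_funN; apply: measurable_funM.
Qed.

Lemma laplace_int_le1 s : 0 <= s -> (\int[P]_w (expR (- (s * A w)))%:E <= 1)%E.
Proof.
move=> s0; apply: (@le_trans _ _ (\int[P]_w (cst 1 w))%E); last first.
  by rewrite integral_cst // mul1e probability_le1.
apply: ge0_le_integral => //; first exact: measurable_expRA.
by move=> w _; rewrite /cst /= lee_fin -expR0 ler_expR oppr_le0 mulr_ge0.
Qed.

Lemma laplaceE s : 0 <= s -> (\int[P]_w (expR (- (s * A w)))%:E)%E = (laplace s)%:E.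
Proof.
move=> s0; rewrite fineK // ge0_fin_numE; first exact: le_lt_trans (laplace_int_le1 s0) (ltry _).
by apply: integral_ge0 => w _; rewrite lee_fin expR_ge0.
Qed.

Lemma integral_gs s : 0 <= s -> (\int[P]_w (gs s (A w))%:E = (laplace s - 1 + s)%:E)%E.
Proof.
move=> s0.
have mgs : measurable_fun setT (fun w => (gs s (A w))%:E).
  apply/measurable_EFinP; apply: measurable_funD; last by apply: measurable_funM.
  apply: measurable_funB => //.
  exact/measurable_EFinP/measurable_expRA.
have H : (\int[P]_w (gs s (A w))%:E + 1 = (laplace s + s)%:E)%E.
  have -> : (1 = \int[P]_w (cst 1%E w))%E.
    by rewrite integral_cst // mul1e; exact/esym/probability_setT.
  rewrite -ge0_integralD //; last by move=> w _; rewrite lee_fin gs_ge0.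
  transitivity (\int[P]_w ((expR (- (s * A w)))%:E + s%:E * (A w)%:E))%E.
    by apply: eq_integral => w _; rewrite -EFinM -!EFinD /gs; congr EFin; rewrite /cst; lra.
  rewrite ge0_integralD //; last 3 first.
  - exact: measurable_expRA.
  - by move=> w _; rewrite -EFinM lee_fin mulr_ge0.
  - by apply: measurable_funeM; apply/measurable_EFinP.
  rewrite ge0_integralZl //; last 2 first.
  - exact/measurable_EFinP.
  - by move=> w _; rewrite lee_fin.
  by rewrite -expectation_def EA mule1 laplaceE.
have := congr1 (fun z => (z - 1)%E) H; rewrite addeK // => ->.
by rewrite -EFinB; congr EFin; lra.
Qed.

Let fb x := fine (Fb x).

Lemma FbE x : Fb x = (fb x)%:E.
Proof. by rewrite fineK // fin_num_measure //; exact: measurable_tail. Qed.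

Lemma fb_ge0 x : 0 <= fb x. Proof. by rewrite fine_ge0. Qed.

Lemma fb_le1 x : fb x <= 1.
Proof. by rewrite -lee_fin -FbE probability_le1 //; exact: measurable_tail. Qed.

Lemma tail_bounds (e : R) : 0 < e -> exists2 x0, 0 < x0 & forall x, x0 <= x ->
  (C_A - e) * x `^ (- alpha) <= fb x <= (C_A + e) * x `^ (- alpha).
Proof.
move=> e0.
have H : x `^ alpha * fb x @[x --> +oo] --> C_A.
  move/fine_cvgP : tailA => [_]; apply: cvg_trans; apply: near_eq_cvg; near=> x.
  by rewrite /= -/(Fb x) FbE.
have := @cvgr_dist_lt _ _ _ _ _ _ _ H e e0 => -[M [Mreal HM]].
exists (Num.max (M + 1) 1); first by rewrite lt_max ltr01 orbT.
move=> x; rewrite ge_max => /andP[Mx x1].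
have x0 : 0 < x by lra.
have p0 : 0 < x `^ alpha by rewrite powR_gt0.
have : `|C_A - x `^ alpha * fb x| < e by apply: HM; lra.
rewrite ltr_norml powRN => /andP[H1 H2].
rewrite ler_pdivrMr // ler_pdivlMr //; apply/andP; split; lra.
Unshelve. all: by end_near. Qed.

Let k0 := alpha * Gamma (- alpha).
Let k00 : 0 < k0. Proof. exact: (laplace_int_Gamma a1 a2).2. Qed.
Let hx s x := h s x * x `^ (- alpha).

Lemma integral_hx s : 0 < s -> (\int[mu]_(x in `]0%R, +oo[) (hx s x)%:E = (s `^ alpha * k0)%:E)%E.
Proof. by move=> s0; rewrite scaled_laplace_int // (laplace_int_Gamma a1 a2).1 -EFinM. Qed.

Lemma measurable_hx (s : R) : measurable_fun (`]0%R, +oo[%classic : set R) (fun x => (hx s x)%:E).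
Proof.
apply/measurable_EFinP; apply: measurable_funM.
  by apply: measurable_funTS; apply: continuous_measurable_fun; exact: continuous_h.
by apply: measurable_funTS; exact: measurable_powR.
Qed.

Lemma measurable_hFb (s : R) : measurable_fun (`]0%R, +oo[%classic : set R) (fun x => ((h s x)%:E * Fb x)%E).
Proof.
apply: emeasurable_funM.
  by apply/measurable_EFinP; apply: measurable_funTS; apply: continuous_measurable_fun; exact: continuous_h.
have E : Fb = ccdf A.
  apply/funext => x; rewrite /ccdf /distribution /pushforward /Fb; congr (P _).
  by apply/seteqP; split => w /=; rewrite in_itv /= andbT.
have H : measurable_fun setT (ccdf A) by exact: ccdf_measurable.
by rewrite -E in H; exact: measurable_funTS.
Qed.

(** The comparison is with [h 1], not with a constant, so that the error from small levels is again
    an integral against [x ^ (- alpha)] over the whole half-line. *)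
Lemma small_h s x x0 : 0 < s -> 0 < x -> x <= x0 -> h s x <= s ^+ 2 * (1 + x0) * h 1 x.
Proof.
move=> s0 x_0 xx; rewrite /h !mul1r.
have H1 : 1 - expR (- (s * x)) <= s * x by have := expR_ge1Dx (- (s * x)); lra.
have H2 : x <= (1 + x0) * (1 - expR (- x)).
  have : (1 + x) * expR (- x) <= 1.
    by rewrite expRN ler_pdivrMr ?expR_gt0 // mul1r expR_ge1Dx.
  have := expR_gt0 (- x); have : expR (- x) <= 1 by rewrite -expR0 ler_expR; lra.
  move: (expR (- x)) => E E1 E0; nra.
rewrite expr2 -!mulrA ler_pM2l // (le_trans H1) // ler_pM2l //.
Qed.

(** An Abelian argument. Beyond [x0] the tail is close to [C_A * x ^ (- alpha)], and scaling [x] by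
    [s] produces [s ^ alpha]. Levels below [x0] contribute [O(s ^ 2)], negligible because
    [alpha < 2]. *)
Theorem laplace_asymptotics (eps : R) : 0 < eps -> exists2 s0, 0 < s0 &
  forall s, 0 < s -> s < s0 ->
  (C_A * k0 - eps) * s `^ alpha <= laplace s - 1 + s <= (C_A * k0 + eps) * s `^ alpha.
Proof.
have [K kE] : exists K, K = k0 by exists k0.
have kk : 0 < K by rewrite kE; exact: k00.
rewrite -kE => eps0; pose e := eps / (2 * K).
have e0 : 0 < e by rewrite divr_gt0 // mulr_gt0 //.
have [x0 x00 Hx0] := tail_bounds e0.
(* On [(0, x0]] the summand [C_A] dominates the power law put in place of the tail, and [x0 ^ alpha]
   dominates the true tail, which is at most 1. *)
pose D := (1 + x0) * (x0 `^ alpha + C_A).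
have D0 : 0 < D by rewrite mulr_gt0 ?addr_gt0 // powR_gt0.
have two0 : 0 < 2 - alpha by rewrite subr_gt0.
pose s0 := (eps / (2 * D * K)) `^ (2 - alpha)^-1.
have q0 : 0 < eps / (2 * D * K) by rewrite divr_gt0 // mulr_gt0  // mulr_gt0.
exists s0 => [|s s_0 ss0]; first by rewrite powR_gt0.
have sa0 : 0 < s `^ alpha by rewrite powR_gt0.
have Hs2 : D * K * s ^+ 2 <= eps / 2 * s `^ alpha.
  have -> : s ^+ 2 = s `^ alpha * s `^ (2 - alpha).
    rewrite -powRD; last by apply/implyP => _; rewrite gt_eqF.
    by rewrite addrC subrK powR_mulrn // ltW.
  have : s `^ (2 - alpha) <= eps / (2 * D * K).
    have -> : eps / (2 * D * K) = s0 `^ (2 - alpha).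
      by rewrite /s0 -powRrM mulVf ?gt_eqF // powRr1 // ltW.
    by rewrite ge0_ler_powR ?nnegrE ?ltW // powR_gt0.
  rewrite ler_pdivlMr; last by rewrite mulr_gt0  // mulr_gt0.
  by nra.
have fb0 := fb_ge0; have fb1 := fb_le1; have _ := I.
have h0' x : 0 < x -> 0 <= h s x by move=> ?; rewrite h_ge0 // ltW.
have h1' x : 0 < x -> 0 <= h 1 x by move=> ?; rewrite h_ge0 // ltW.
have x_a x : 0 < x -> 0 < x `^ (- alpha) by move=> ?; rewrite powR_gt0.
have xpow x : 0 < x -> x <= x0 -> 1 <= x0 `^ alpha * x `^ (- alpha).
  move=> x_0 xx; rewrite powRN ler_pdivlMr ?powR_gt0 // mul1r.
  by apply: ge0_ler_powR => //; rewrite ?nnegrE ltW // (lt_trans _ a1).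
have hx0 x : 0 < x -> 0 <= hx s x by move=> ?; rewrite mulr_ge0 ?h0' // ltW // x_a.
have hx1 x : 0 < x -> 0 <= hx 1 x by move=> ?; rewrite mulr_ge0 ?h1' // ltW // x_a.
have CA1 := CA0.
have D2 : 0 <= D * s ^+ 2 by rewrite mulr_ge0 ?sqr_ge0 // ltW.
have ID : (\int[mu]_(x in `]0%R, +oo[) ((D * s ^+ 2)%:E * (hx 1 x)%:E) = (D * s ^+ 2 * K)%:E)%E.
  rewrite ge0_integralZl //.
  - by rewrite integral_hx // -kE powR1 mul1r.
  - exact: measurable_hx.
  - by move=> x; rewrite /= in_itv /= andbT => x_0; rewrite lee_fin hx1.
have Dlow x : 0 < x -> x <= x0 -> C_A * hx s x <= D * s ^+ 2 * hx 1 x.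
  move=> x_0 xx; have := small_h s_0 x_0 xx; have := x_a _ x_0; have := h1' _ x_0.
  have := powR_gt0 alpha x00; rewrite /hx /D.
  move: (h s x) (h 1 x) (x `^ _) (x0 `^ _) => a b c q q0' b0 c0 ab.
  apply: (@le_trans _ _ (C_A * (s ^+ 2 * (1 + x0) * b * c))).
    by rewrite ler_pM2l // ler_pM2r.
  rewrite -subr_ge0.
  have -> : (1 + x0) * (q + C_A) * s ^+ 2 * (b * c) - C_A * (s ^+ 2 * (1 + x0) * b * c) =
    (1 + x0) * q * s ^+ 2 * (b * c) by ring.
  by do !apply: mulr_ge0; rewrite ?sqr_ge0 //; lra.
have Dup x : 0 < x -> x <= x0 -> h s x <= D * s ^+ 2 * hx 1 x.
  move=> x_0 xx; have := small_h s_0 x_0 xx; have := xpow _ x_0 xx; have := x_a _ x_0; have := h1' _ x_0.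
  have := powR_gt0 alpha x00; rewrite /hx /D.
  move: (h s x) (h 1 x) (x `^ _) (x0 `^ _) => a b c q q0' b0 c0 qc ab.
  apply: (le_trans ab); rewrite -subr_ge0.
  have -> : (1 + x0) * (q + C_A) * s ^+ 2 * (b * c) - s ^+ 2 * (1 + x0) * b =
    s ^+ 2 * (1 + x0) * b * (q * c - 1) + (1 + x0) * C_A * s ^+ 2 * (b * c) by ring.
  by apply: addr_ge0; do !apply: mulr_ge0; rewrite ?sqr_ge0 //; lra.
have mD : measurable_fun (`]0%R, +oo[%classic : set R) (fun x => ((D * s ^+ 2)%:E * (hx 1 x)%:E)%E).
  by apply: measurable_funeM; exact: measurable_hx.
have E := integral_gs (ltW s_0); rewrite layer_cake ?(ltW s_0) // in E.
have CE : 0 <= C_A + e by rewrite addr_ge0 // ltW.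
have hE : e * K = eps / 2 by rewrite /e; field; rewrite gt_eqF.
apply/andP; split.
- rewrite -lee_fin.
  (* If the lower constant is not positive the claim is trivial; otherwise [C_A - e >= 0], as the
     nonnegative integrals require. *)
  have [Ce|Ce] := leP (C_A * K) eps.
    apply: (@le_trans _ _ 0%E); first by rewrite lee_fin mulr_le0_ge0 ?subr_le0 // ltW.
    rewrite -integral_gs; last exact: ltW.
    by apply: integral_ge0 => w _; rewrite lee_fin gs_ge0.
  have Ce' : 0 <= C_A - e.
    rewrite subr_ge0 /e ler_pdivrMr ?mulr_gt0 //; nra.
  have : (\int[mu]_(x in `]0%R, +oo[) ((C_A - e)%:E * (hx s x)%:E) <=
          (laplace s - 1 + s)%:E + (D * s ^+ 2 * K)%:E)%E.
    rewrite -E -ID -ge0_integralD; [|exact: measurable_itv| |exact: measurable_hFb| |exact: mD]; last 2 first.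
    - by move=> x; rewrite /= in_itv /= andbT => x_0; rewrite FbE -EFinM lee_fin mulr_ge0 // h0'.
    - by move=> x; rewrite /= in_itv /= andbT => x_0; rewrite -EFinM lee_fin mulr_ge0 // hx1.
    apply: ge0_le_integral; [exact: measurable_itv| | | |].
    - by move=> x; rewrite /= in_itv /= andbT => x_0; rewrite -EFinM lee_fin mulr_ge0 // hx0.
    - by apply: measurable_funeM; exact: measurable_hx.
    - by apply: emeasurable_funD => //; exact: measurable_hFb.
    move=> x; rewrite /= in_itv /= andbT => x_0; rewrite FbE -!EFinM -EFinD lee_fin.
    have [xx|xx] := leP x x0.
      apply: (@le_trans _ _ (C_A * hx s x)); first by rewrite ler_wpM2r ?hx0 // gerBl ltW.
      by apply: le_trans (Dlow _ x_0 xx) _; rewrite lerDr mulr_ge0 // h0'.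
    have /andP[H _] := Hx0 _ (ltW xx).
    apply: (@le_trans _ _ (h s x * fb x)); last by rewrite lerDl mulr_ge0 // hx1.
    by rewrite /hx mulrCA ler_wpM2l // h0'.
  rewrite ge0_integralZl //; last 2 first.
  - exact: measurable_hx.
  - by move=> x; rewrite /= in_itv /= andbT => x_0; rewrite lee_fin hx0.
  rewrite integral_hx // -kE -EFinM -EFinD !lee_fin; nra.
- have : ((laplace s - 1 + s)%:E <=
    \int[mu]_(x in `]0%R, +oo[) ((C_A + e)%:E * (hx s x)%:E) + (D * s ^+ 2 * K)%:E)%E.
    rewrite -E -ID -ge0_integralD; [|exact: measurable_itv| | | |exact: mD]; last 3 first.
    - by move=> x; rewrite /= in_itv /= andbT => x_0; rewrite -EFinM lee_fin mulr_ge0 ?hx0.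
    - by apply: measurable_funeM; exact: measurable_hx.
    - by move=> x; rewrite /= in_itv /= andbT => x_0; rewrite -EFinM lee_fin mulr_ge0 // hx1.
    apply: ge0_le_integral; [exact: measurable_itv| | | |].
    - by move=> x; rewrite /= in_itv /= andbT => x_0; rewrite FbE -EFinM lee_fin mulr_ge0 // h0'.
    - exact: measurable_hFb.
    - apply: emeasurable_funD => //.
      by apply: measurable_funeM; exact: measurable_hx.
    move=> x; rewrite /= in_itv /= andbT => x_0; rewrite FbE -!EFinM -EFinD lee_fin.
    have [xx|xx] := leP x x0.
      apply: (@le_trans _ _ (h s x)); first by rewrite ler_piMr // h0'.
      by apply: le_trans (Dup _ x_0 xx) _; rewrite lerDr mulr_ge0 ?hx0.
    have /andP[_ H] := Hx0 _ (ltW xx).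
    apply: (@le_trans _ _ ((C_A + e) * hx s x)); last by rewrite lerDl mulr_ge0 // hx1.
    by rewrite /hx mulrCA ler_wpM2l // h0'.
  rewrite ge0_integralZl; [|exact: measurable_itv|exact: measurable_hx| |by rewrite lee_fin]; last first.
    by move=> x; rewrite /= in_itv /= andbT => x_0; rewrite lee_fin hx0.
  rewrite integral_hx // -kE -EFinM -EFinD !lee_fin; nra.
Qed.

End laplace_asymptotics.

Lemma integral_one d (Omega : measurableType d) (R : realType) (P : probability Omega R) :
  (\int[P]_w 1%:E = 1%:E)%E.
Proof. by rewrite integral_cst // mul1e; exact: probability_setT. Qed.

(** * Laws of monotonically rounded variables *)

Section discrete_law.
Context d (Omega : measurableType d) (R : realType) (P : probability Omega R).
Variables (X : {RV P >-> R}) (D : R -> nat) (C : nat).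
Hypotheses (Dmono : forall x y, x <= y -> (D x <= D y)%N) (DC : forall x, (D x < C)%N).

Lemma measurable_level v : measurable (D @^-1` [set v]).
Proof.
apply: is_interval_measurable => x y /= Dx Dy z /andP[xz zy].
by apply/eqP; rewrite eqn_leq -{1}Dy -Dx !Dmono.
Qed.

Definition discrete_law (v : nat) : R := fine (P (X @^-1` (D @^-1` [set v]))).

Lemma measurable_event v : measurable (X @^-1` (D @^-1` [set v])).
Proof.
by rewrite -[X in measurable X]setTI; apply: measurable_funPT => //; exact: measurable_level.
Qed.

Lemma discrete_law_ge0 v : 0 <= discrete_law v.
Proof. by rewrite fine_ge0. Qed.

Lemma sum_discrete_law (f : nat -> R) : (forall v, 0 <= f v) ->
  (\int[P]_w (f (D (X w)))%:E = (\sum_(v < C) discrete_law v * f v)%:E)%E.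
Proof.
move=> f0.
have E w : ((f (D (X w)))%:E =
    \sum_(v <- index_enum 'I_C) (f v * \1_(X @^-1` (D @^-1` [set val v])) w)%:E)%E.
  rewrite sumEFin; congr _%:E; rewrite (bigD1 (Ordinal (DC (X w)))) //= indicE mem_set //= mulr1.
  rewrite big1 ?addr0 // => v vD; rewrite indicE memNset ?mulr0 //= => H.
  by move: vD; rewrite -val_eqE /= H eqxx.
under eq_integral do rewrite E.
rewrite ge0_integral_sum //=; last 2 first.
- move=> v; apply/measurable_EFinP; apply: measurable_funM => //.
  by apply: measurable_indic; exact: measurable_event.
- by move=> v w _; rewrite lee_fin mulr_ge0.
rewrite -sumEFin; apply: eq_bigr => v _.
under eq_integral do rewrite EFinM.
rewrite ge0_integralZl //; last 2 first.
- by apply/measurable_EFinP; apply: measurable_indic; exact: measurable_event.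
- by rewrite lee_fin.
rewrite integral_indic //; last exact: measurable_event.
by rewrite setIT /discrete_law mulrC EFinM fineK // fin_num_measure //; exact: measurable_event.
Qed.

Lemma discrete_law1 : \sum_(v < C) discrete_law v = 1.
Proof.
have := @sum_discrete_law (fun=> 1) (fun=> ler01).
rewrite integral_one => -[->].
by under eq_bigr do rewrite mulr1.
Qed.

Lemma sum_discrete_law_le (f : nat -> R) (g : Omega -> R) : (forall v, 0 <= f v) ->
  measurable_fun setT g -> (forall w, f (D (X w)) <= g w) ->
  ((\sum_(v < C) discrete_law v * f v)%:E <= \int[P]_w (g w)%:E)%E.
Proof.
move=> f0 mg fg; rewrite -sum_discrete_law //; apply: ge0_le_integral => //.
- by move=> w _; rewrite lee_fin.
- apply: (eq_measurable_fun (fun w => (\sum_(v < C) f v * \1_(X @^-1` (D @^-1` [set val v])) w)%:E)).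
    move=> w _; congr _%:E; rewrite (bigD1 (Ordinal (DC (X w)))) //= indicE mem_set //= mulr1.
    rewrite big1 ?addr0 // => v vD; rewrite indicE memNset ?mulr0 //= => H.
    by move: vD; rewrite -val_eqE /= H eqxx.
  apply/measurable_EFinP; apply: measurable_sum => v; apply: measurable_funM => //.
  by apply: measurable_indic; exact: measurable_event.
- exact/measurable_EFinP.
- by move=> w _; rewrite lee_fin.
Qed.

End discrete_law.

Lemma sum_survival (R : realType) (p : nat -> R) C L :
  \sum_(0 <= r < L) survival C p r = \sum_(v < C) p v * (minn v L)%:R.
Proof.
rewrite /survival.
under eq_bigr do rewrite big_mkcond /=.
rewrite exchange_big /=; apply: eq_bigr => v _.
elim: L => [|L IH]; first by rewrite big_geq // minn0 mulr0.
rewrite big_nat_recr //= IH; case: ltnP => vL.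
  by rewrite (minn_idPr vL) -natr1 mulrDr mulr1.
by rewrite addr0 (minn_idPl (leqW vL)).
Qed.

(** * Services rounded up to multiples of [1 / n] *)

Section service_discretization.
Context d (Omega : measurableType d) (R : realType) (P : probability Omega R).
Variables (S : {RV P >-> R}) (n C : nat) (eps mom : R).
Hypotheses (S0 : forall w, 0 <= S w) (ES : ('E_P[S] = 1)%E) (n0 : (0 < n)%N).
Hypotheses (eps0 : 0 < eps) (eps1 : eps <= 1).
Hypothesis moment : (\int[P]_w (S w `^ (1 + eps))%:E = mom%:E)%E.

(** The mesh [1 / n] raises the mean service by at most [1 / n], so the total rate of [n] servers
    drops by at most one, negligible against [n ^ (1 / alpha)]. The cap [C] makes the law finite. *)
Definition round_up C (x : R) : nat := minn (Num.truncn (n%:R * x)).+1 C.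

Let st w : R := (Num.truncn (n%:R * S w)).+1%:R.

Lemma round_up_mono x y : x <= y -> (round_up C x <= round_up C y)%N.
Proof. by move=> xy; rewrite /round_up leq_min geq_minr andbT (leq_trans (geq_minl _ _)) // ltnS le_truncn // ler_wpM2l. Qed.

Lemma round_up_lt x : (round_up C x < C.+1)%N.
Proof. by rewrite ltnS geq_minr. Qed.

Definition service_law := discrete_law S (round_up C).

Lemma measurable_st : measurable_fun setT st.
Proof.
rewrite (_ : st = (fun x : R => (Num.truncn (n%:R * x)).+1%:R) \o S) //.
apply: measurableT_comp; last exact: measurable_funPT.
apply: nondecreasing_measurable => // x y xy.
by rewrite ler_nat ltnS le_truncn // ler_wpM2l.
Qed.

Lemma st_itv w : n%:R * S w <= st w <= n%:R * S w + 1.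
Proof.
have nS : 0 <= n%:R * S w by rewrite mulr_ge0.
have /andP[H1 H2] := truncn_itv nS.
by rewrite ltW //= /st -natr1 lerD2r.
Qed.

Lemma integral_nS : (\int[P]_w (n%:R * S w)%:E = n%:R%:E)%E.
Proof.
under eq_integral do rewrite EFinM.
rewrite ge0_integralZl //.
- by move: ES; rewrite expectation_def => ->; rewrite mule1.
- by apply/measurable_EFinP; exact: measurable_funPT.
- by move=> w _; rewrite lee_fin.
Qed.

(** The mean without the cap: normalizing by it keeps the equilibrium law independent of [C]. *)
Definition mean_service : R := fine (\int[P]_w (st w)%:E)%E.

Lemma mean_service_bounds :
  (n%:R%:E <= \int[P]_w (st w)%:E)%E /\ (\int[P]_w (st w)%:E <= (n%:R + 1)%:E)%E.
Proof.
have mnS : measurable_fun setT (fun w => (n%:R * S w)%:E).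
  by apply/measurable_EFinP; apply: measurable_funM => //; exact: measurable_funPT.
have mst : measurable_fun setT (fun w => (st w)%:E) by apply/measurable_EFinP; exact: measurable_st.
split.
  rewrite -integral_nS; apply: ge0_le_integral => //.
  - by move=> w _; rewrite lee_fin mulr_ge0.
  - by move=> w _; rewrite lee_fin; case/andP: (st_itv w).
apply: (@le_trans _ _ (\int[P]_w ((n%:R * S w)%:E + 1%:E))%E).
  apply: ge0_le_integral; [exact: measurableT| |exact: mst| |].
  - by move=> w _; rewrite lee_fin.
  - by apply: emeasurable_funD; [exact: mnS|exact: measurable_cst].
  - by move=> w _; rewrite -EFinD lee_fin; case/andP: (st_itv w).
rewrite ge0_integralD //; last by move=> w _; rewrite lee_fin mulr_ge0.
by rewrite integral_nS integral_one EFinD.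
Qed.

Lemma mean_serviceE : (\int[P]_w (st w)%:E = mean_service%:E)%E.
Proof.
have [H1 H2] := mean_service_bounds; rewrite fineK // fin_numE.
by rewrite -ltNye (lt_le_trans _ H1) ?ltNyr // -ltey (le_lt_trans H2) ?ltry.
Qed.

Lemma mean_service_ge : n%:R <= mean_service.
Proof. by rewrite -lee_fin -mean_serviceE; case: mean_service_bounds. Qed.

Lemma mean_service_le : mean_service <= n%:R + 1.
Proof. by rewrite -lee_fin -mean_serviceE; case: mean_service_bounds. Qed.

Lemma service_law0 : (0 < C)%N -> service_law 0 = 0.
Proof.
move=> C0; rewrite /service_law /discrete_law (_ : _ @^-1` _ = set0) ?measure0 //.
by rewrite -subset0 => w /=; rewrite /round_up; case: (C) C0 => // C' _; rewrite minnSS.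
Qed.

Lemma mean_service_mass L : \sum_(0 <= r < L) survival C.+1 service_law r <= mean_service.
Proof.
rewrite sum_survival -lee_fin -mean_serviceE.
apply: (@sum_discrete_law_le _ _ _ P S _ _ round_up_mono round_up_lt (fun v => (minn v L)%:R) st) => //.
- exact: measurable_st.
- by move=> w; rewrite ler_nat (leq_trans (geq_minl _ _)) // geq_minl.
Qed.

Lemma survival_service r : (r < C)%N ->
  survival C.+1 service_law r = fine (P [set w | (r < (Num.truncn (n%:R * S w)).+1)%N]).
Proof.
move=> rC; rewrite /survival big_mkcond /=.
transitivity (\sum_(v < C.+1) service_law v * (r < v)%N%:R).
  by apply: eq_bigr => v _; case: ifP => _; rewrite ?mulr1 ?mulr0.
have mE : measurable [set w | (r < (Num.truncn (n%:R * S w)).+1)%N].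
  rewrite (_ : mkset _ = [set w | r%:R < st w]); last first.
    by apply/seteqP; split => w /=; rewrite ltr_nat.
  rewrite -[X in measurable X]setTI (_ : mkset _ = st @^-1` `]r%:R, +oo[).
    by apply: measurable_st => //; exact: measurable_itv.
  by apply/seteqP; split => w /=; rewrite in_itv /= andbT.
apply: EFin_inj.
rewrite -(@sum_discrete_law _ _ _ P S _ _ round_up_mono round_up_lt (fun v => (r < v)%N%:R)); last by [].
rewrite fineK ?fin_num_measure // -[X in P X]setIT -integral_indic //.
apply: eq_integral => w _; congr _%:E; rewrite indicE /round_up leq_min rC andbT.
by congr (nat_of_bool _)%:R; apply/idP/idP => [H|/set_mem //]; exact: mem_set.
Qed.

(** What lies beyond [L] is dominated pointwise by [k * S ^ (1 + eps)]: there [S >= a], hence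
    [a ^ (- eps) * S ^ eps >= 1], and [a >= l / 2]. *)
Lemma min_service_ge (l : R) : 2 <= l -> ((Num.truncn (l * mean_service)).+1 <= C)%N ->
  mean_service * (1 - 2 * mom * l `^ (- eps)) <=
  \sum_(v < C.+1) service_law v * (minn v (Num.truncn (l * mean_service)).+1)%:R.
Proof.
move=> l2 LC; set L := (Num.truncn _).+1 in LC *.
have M1 := mean_service_ge; have n1 : 1 <= n%:R :> R by rewrite ler1n.
have m0 : 0 < mean_service by apply: lt_le_trans M1; rewrite ltr0n.
have l0 : 0 < l by lra.
have lm : 0 <= l * mean_service by rewrite mulr_ge0 // ltW.
pose a : R := (L%:R - 1) / n%:R.
have aL : l / 2 <= a.
  rewrite /a ler_pdivlMr ?ltr0n //.
  have := truncnS_gt (l * mean_service); rewrite -/L; have := M1; nra.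
have a0 : 0 < a by apply: lt_le_trans aL; lra.
have n_0 : 0 < n%:R :> R by rewrite ltr0n.
pose k := n%:R * a `^ (- eps).
have k0 : 0 <= k by rewrite mulr_ge0 // powR_ge0.
have pt w : st w <= (minn (round_up C (S w)) L)%:R + k * S w `^ (1 + eps).
  have p0 : 0 <= k * S w `^ (1 + eps) by rewrite mulr_ge0 // powR_ge0.
  have [sL|sL] := leqP (Num.truncn (n%:R * S w)).+1 L.
    by rewrite /round_up (minn_idPl (leq_trans sL LC)) (minn_idPl sL) lerDl.
  have -> : minn (round_up C (S w)) L = L.
    by apply/minn_idPr; rewrite /round_up leq_min LC (ltnW sL).
  have Sa : a <= S w.
    rewrite /a ler_pdivrMr //; have /andP[_ H] := st_itv w.
    have : L%:R <= st w by rewrite ler_nat ltnW.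
    lra.
  apply: (@le_trans _ _ (L%:R + n%:R * S w)).
    have /andP[_ H] := st_itv w; have : 1 <= L%:R :> R by rewrite ler1n.
    lra.
  rewrite lerD2l /k -mulrA ler_wpM2l //.
  rewrite powRD ?powRr1 ?S0 //; last by apply/implyP => _; rewrite gt_eqF // (lt_le_trans a0).
  rewrite mulrCA ler_peMr ?S0 // powRN mulrC ler_pdivlMr ?powR_gt0 // mul1r.
  by rewrite ge0_ler_powR ?nnegrE // ltW.
have mP : measurable_fun setT (fun w => S w `^ (1 + eps)).
  by apply: (measurableT_comp (measurable_powR _)); exact: measurable_funPT.
have main : (mean_service%:E <= (\sum_(v < C.+1) service_law v * (minn v L)%:R)%:E + (k * mom)%:E)%E.
  have mst : measurable_fun setT (fun w => (st w)%:E) by apply/measurable_EFinP; exact: measurable_st.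
  have mrd : measurable_fun setT (fun w => (minn (round_up C (S w)) L)%:R%:E : \bar R).
    apply/measurable_EFinP; rewrite (_ : (fun w => _) = (fun x => (minn (round_up C x) L)%:R) \o S) //.
    apply: measurableT_comp; last exact: measurable_funPT.
    apply: nondecreasing_measurable => // x y xy.
    by rewrite ler_nat leq_min geq_minr andbT (leq_trans (geq_minl _ _)) // round_up_mono.
  have kP w : 0 <= k * S w `^ (1 + eps) by rewrite mulr_ge0 // powR_ge0.
  have mkP : measurable_fun setT (fun w => (k * S w `^ (1 + eps))%:E).
    by apply/measurable_EFinP; exact: measurable_funM.
  rewrite -mean_serviceE -(@sum_discrete_law _ _ _ P S _ _ round_up_mono round_up_lt (fun v => (minn v L)%:R)); last by [].
  rewrite EFinM -moment -ge0_integralZl; [|exact: measurableT|exact/measurable_EFinP| |by rewrite lee_fin]; last first.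
    by move=> w _; rewrite lee_fin powR_ge0.
  rewrite -ge0_integralD; [|exact: measurableT| |exact: mrd| | ]; last 3 first.
  - by move=> w _; rewrite lee_fin.
  - by move=> w _; rewrite -EFinM lee_fin.
  - exact: mkP.
  apply: ge0_le_integral; [exact: measurableT| |exact: mst| |].
  - by move=> w _; rewrite lee_fin.
  - by apply: emeasurable_funD; [exact: mrd|exact: mkP].
  - by move=> w _; rewrite -EFinM -EFinD lee_fin.
have mom0 : 0 <= mom by rewrite -lee_fin -moment; apply: integral_ge0 => w _; rewrite lee_fin powR_ge0.
rewrite -EFinD lee_fin in main.
have ak : a `^ (- eps) <= 2 * l `^ (- eps).
  apply: (@le_trans _ _ ((l / 2) `^ (- eps))).
    have l20 : 0 < l / 2 by rewrite divr_gt0.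
    rewrite !powRN lef_pV2 ?posrE ?powR_gt0 //.
    by apply: ge0_ler_powR => //; rewrite ?nnegrE ltW.
  rewrite powRM ?(ltW l0) // mulrC; apply: ler_wpM2r; first exact: powR_ge0.
  rewrite -powR_inv1 // -powRrM mulN1r opprK.
  by rewrite -[leRHS](powRr1 (ler0n _ 2)) ler_powR // ler1n.
have : k * mom <= mean_service * (2 * mom * l `^ (- eps)).
  apply: (@le_trans _ _ (n%:R * (2 * l `^ (- eps)) * mom)).
    by rewrite ler_wpM2r // ler_wpM2l.
  have -> : n%:R * (2 * l `^ (- eps)) * mom = n%:R * (2 * mom * l `^ (- eps)) by ring.
  by rewrite ler_wpM2r // !mulr_ge0 // powR_ge0.
by move: main; rewrite mulrBr mulr1; lra.
Qed.

End service_discretization.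

Lemma is_late_cat (R : realType) (h t : R) ar vs vs' f : (size ar <= (size vs).+1)%N ->
  is_late h t ar vs f -> is_late h t ar (vs ++ vs') f.
Proof.
elim: ar vs f => [|x [|y ar] IH] [|v vs] f //= sz.
by apply: IH.
Qed.

(** * From a sample path to the lattice queue *)

Section pathwise_lattice.
Context {R : realType}.
Variables (n m z tau : nat) (rs : seq nat) (h hA eta : R) (T V : nat -> R) (DT DV : nat -> nat).
Let c := InitialCondition 0 (map (fun r => h * r%:R) rs) 0%N.
Hypotheses (n0 : (0 < n)%N) (h0 : 0 < h) (hA0 : 0 <= hA) (rsn : size rs = n).
Hypotheses (T0 : forall j, 0 <= T j) (V0 : forall j, 0 <= V j).
Hypotheses (lo : forall i, (i < m)%N -> hA * (DT i)%:R <= T i)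
  (hi : forall i, (i < m)%N -> T i <= hA * (DT i)%:R + hA)
  (up : forall i, (i < m)%N -> V i <= h * (DV i)%:R) (slack : hA * m%:R <= eta).
Let l := map DT (iota 0 m).
Let vs := map DV (iota 0 m).
Let t := h * tau%:R.

Lemma admissible_lattice : admissible n c.
Proof.
rewrite /admissible /= lexx size_map rsn leqnn /= andbT.
by apply/allP => x /mapP[r _ ->]; rewrite mulr_ge0 // ltW.
Qed.

Lemma sumn_take_map k : (k <= m)%N -> sumn (take k l) = (\sum_(0 <= i < k) DT i)%N.
Proof.
by move=> km; rewrite /l -map_take take_iota (minn_idPl km) sumnE big_map /index_iota subn0.
Qed.

Lemma arrival_lattice k : arrival c T k = \sum_(0 <= i < k) T i.
Proof. by rewrite /arrival /= subn0 add0r. Qed.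

Lemma arrival_lo k : (k <= m)%N -> hA * (sumn (take k l))%:R <= arrival c T k.
Proof.
move=> km; rewrite sumn_take_map // arrival_lattice natr_sum mulr_sumr !big_nat.
by apply: ler_sum => i /andP[_ ik]; rewrite lo // (leq_trans ik).
Qed.

Lemma arrival_hi k : (k <= m)%N -> arrival c T k <= hA * (sumn (take k l))%:R + eta.
Proof.
move=> km; rewrite sumn_take_map // arrival_lattice natr_sum mulr_sumr.
apply: (@le_trans _ _ (\sum_(0 <= i < k) (hA * (DT i)%:R + hA))).
  by rewrite !big_nat; apply: ler_sum => i /andP[_ ik]; rewrite hi // (leq_trans ik).
rewrite big_split /= lerD2l sumr_const_nat subn0 -mulr_natr.
by apply: le_trans slack; rewrite ler_wpM2l // ler_nat.
Qed.

Hypothesis arrived : ~~ early tau h hA (sumn l).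

Lemma exists_last_early : exists2 M, (M < m)%N & last_early (early tau h hA) M l.
Proof.
have ex : exists M, ~~ early tau h hA (sumn (take M.+1 l)).
  by exists m; rewrite take_oversize // size_map size_iota.
have e0 : early tau h hA (sumn (take 0 l)).
  by rewrite /early take0 /= mulr0 mulr_ge0 // ltW.
have m0 : (0 < m)%N.
  rewrite lt0n; apply/eqP => m0; have l0 : l = [::] by rewrite /l m0.
  by move: e0 arrived; rewrite take0 l0 => ->.
case: (ex_minnP ex) => M eM minM; exists M; last first.
  rewrite /last_early eM andbT; case: (M) minM => [//|M'] minM.
  by apply: contraT => /minM; rewrite ltnn.
rewrite -(prednK m0) ltnS; apply: minM; rewrite prednK // take_oversize //.
by rewrite size_map size_iota.
Qed.

(** Arrivals rounded down give an index [M] at least that of the last true arrival. Delaying them by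
    [eta] and rounding services up only postpones starts, and starts are ordered, so job [M - z]
    waits if an earlier one does. *)
Lemma long_wait_lattice :
  ((n + z)%:R%:E < number_in_system n c T V t)%E -> lattice_wait tau m h hA eta z rs l vs.
Proof.
have cn := admissible_lattice; have [M Mm lM] := exists_last_early.
have eta0 : 0 <= eta by apply: le_trans slack; rewrite mulr_ge0.
have t0 : 0 <= t by rewrite mulr_ge0 // ltW.
have tm : t < arrival c T m.
  apply: lt_le_trans (arrival_lo (leqnn m)); rewrite take_oversize ?size_map ?size_iota //.
  by rewrite ltNge.
move=> /(long_wait n0 cn T0 V0 t0 tm)[j jM tj].
have le_M i : (i < m)%N -> arrival c T i <= t -> (i <= M)%N.
  move=> im it; rewrite leqNgt; apply/negP => Mi; case/andP: lM => _ /negP; apply.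
  rewrite /early; apply: le_trans it; apply: le_trans (arrival_lo (ltnW im)).
  by rewrite ler_wpM2l // ler_nat sumn_take_le.
have zjM : (z + j <= M)%N.
  rewrite -ltnS; apply: leq_trans jM _.
  apply: (@leq_trans (\sum_(0 <= i < m) (i <= M))%N).
    by rewrite !big_nat; apply: leq_sum => i /andP[_ im]; case: leP => // /(le_M _ im) ->.
  rewrite (big_cat_nat (n := M.+1)) //=.
  have -> : (\sum_(M.+1 <= i < m) (i <= M) = 0)%N.
    by rewrite big_nat big1 // => i /andP[Mi _]; rewrite leqNgt Mi.
  rewrite addn0.
  apply: (@leq_trans (\sum_(0 <= i < M.+1) 1)%N); first by apply: leq_sum => i _; exact: leq_b1.
  by rewrite sum_nat_const_nat subn0 muln1.
apply/hasP; exists M; first by rewrite mem_iota.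
rewrite lM (leq_trans (leq_addr _ _) zjM) !andTb.
pose a i := if (i < m)%N then hA * (sumn (take i l))%:R + eta else arrival c T i.
pose s i := if (i < m)%N then DV i else (Num.truncn (V i / h)).+1.
have arra i : arrival c T i <= a i by rewrite /a; case: ltnP => // im; exact: arrival_hi (ltnW im).
have Vs i : V i <= h * (s i)%:R.
  rewrite /s; case: ltnP => [im|_]; first exact: up.
  by rewrite mulrC -ler_pdivrMr // ltW // truncnS_gt.
have free0 : free_times n c T V 0 = residual_times h rs.
  by rewrite /= size_map rsn subnn cats0.
have st : t < start n c T V (0 + (M - z)).
  apply: lt_le_trans tj _; apply: start_le => //; clear -zjM; lia.
have := @is_late_start _ n c T V n0 cn h t a s arra Vs 0%N (M - z)%N (residual_times h rs).
have f0 : residual_times h rs != [::] by rewrite -size_eq0 size_sort size_map rsn -lt0n.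
rewrite free0 => /(_ f0 (sort_sorted_le _) (fun z => leqnn _) st) H.
have E1 : map a (iota 0 (M - z).+1) = late_arrivals hA eta l (M - z).
  apply/eq_in_map => i; rewrite mem_iota add0n ltnS => /andP[_ iM].
  by rewrite /a ifT //; clear -iM Mm; lia.
have E2 : map s (iota 0 (M - z)) = take (M - z) vs.
  rewrite /vs -map_take take_iota (minn_idPl _); last by clear -Mm; lia.
  by apply/eq_in_map => i; rewrite mem_iota add0n => /andP[_ iM]; rewrite /s ifT //; clear -iM Mm; lia.
rewrite E1 E2 in H.
rewrite -(cat_take_drop (M - z) vs); apply: is_late_cat H.
have -> : size (take (M - z) vs) = (M - z)%N.
  by rewrite size_takel // size_map size_iota; clear -Mm; lia.
by rewrite size_map size_iota.
Qed.

End pathwise_lattice.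

Lemma Ex_ext_law (R : realType) C (p q : nat -> R) K F :
  (forall v, (v < C)%N -> p v = q v) -> Ex C p K F = Ex C q K F.
Proof.
move=> pq; elim: K F => [//|K IH] F /=.
by apply: eq_bigr => v _; rewrite pq // IH.
Qed.

(** * Queue tail at a fixed time, from equilibrium residuals *)

Section queue_tail.
Context d0 d (Omega0 : measurableType d0) (Omega : measurableType d) (R : realType).
Variables (P0 : probability Omega0 R) (P : probability Omega R).
Variables (A0 S0 : {RV P0 >-> R}) (A S : nat -> {RV P >-> R}).
Hypotheses (hA0 : forall w, 0 <= A0 w) (hS0 : forall w, 0 <= S0 w)
  (hAS : GI_primitives A0 S0 A S) (hEA : ('E_P0[A0] = 1)%E) (hES : ('E_P0[S0] = 1)%E).

Definition nonneg_event : set Omega := [set w | forall j, 0 <= A j w /\ 0 <= S j w].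

Lemma same_law_probability (X0 : {RV P0 >-> R}) (X : {RV P >-> R}) E :
  same_law X X0 -> measurable E -> P (X @^-1` E) = P0 (X0 @^-1` E).
Proof. by move=> XX mE; exact: XX. Qed.

Lemma measurable_ge (Y : {RV P >-> R}) x : measurable [set w | x <= Y w].
Proof.
rewrite -[X in measurable X]setTI (_ : mkset _ = Y @^-1` `[x, +oo[).
  by apply: measurable_funPT => //; exact: measurable_itv.
by apply/seteqP; split => w /=; rewrite in_itv /= andbT.
Qed.

(** The copies have the laws of [A0] and [S0] but need not share their pointwise properties;
    countably many null sets are discarded. *)
Lemma le_ae_event (EA ES : set R) E F : measurable EA -> measurable ES ->
  P0 (A0 @^-1` ~` EA) = 0%E -> P0 (S0 @^-1` ~` ES) = 0%E -> measurable E -> measurable F ->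
  E `&` [set w | forall j, EA (A j w) /\ ES (S j w)] `<=` F -> (P E <= P F)%E.
Proof.
case: hAS => lawA lawS _ mEA mES nullA nullS mE mF EF.
have mN (X : {RV P >-> R}) D : measurable D -> measurable (X @^-1` (~` D)).
  by move=> mD; rewrite -[X in measurable X]setTI; apply: measurable_funPT => //; exact: measurableC.
pose N j := A j @^-1` (~` EA) `|` S j @^-1` (~` ES).
have mNj j : measurable (N j) by apply: measurableU; exact: mN.
have N0 j : P (N j) = 0%E.
  rewrite /N measureU0; [ |exact: mN|exact: mN| ].
    by apply: etrans (same_law_probability (lawA j) (measurableC mEA)) _.
  by apply: etrans (same_law_probability (lawS j) (measurableC mES)) _.
have mU : measurable (\bigcup_j N j) by exact: bigcupT_measurable.
have U0 : P (\bigcup_j N j) = 0%E.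
  apply/eqP; rewrite eq_le measure_ge0 andbT.
  apply: le_trans (measure_sigma_subadditive _ _ _ (fun x H => H)) _ => //.
  by rewrite eseries0 // => i _ _; exact: N0.
apply: (@le_trans _ _ (P (F `|` \bigcup_j N j))).
  apply: le_measure; rewrite ?inE //; first exact: measurableU.
  move=> w Ew; have [H|H] := pselect (forall j, EA (A j w) /\ ES (S j w)).
    by left; apply: EF.
  right; apply: contrapT => K; apply: H => j; split; apply: contrapT => L; apply: K; exists j => //.
    by left.
  by right.
by rewrite measureU0.
Qed.

Lemma le_nonneg_event E F : measurable E -> measurable F -> E `&` nonneg_event `<=` F ->
  (P E <= P F)%E.
Proof.
move=> mE mF EF.
have null (X0 : {RV P0 >-> R}) : (forall w, 0 <= X0 w) -> P0 (X0 @^-1` ~` `[0%R, +oo[) = 0%E.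
  move=> X00; rewrite (_ : _ @^-1` _ = set0) ?measure0 // -subset0 => w /=.
  by rewrite in_itv /= andbT; apply; exact: X00.
apply: (@le_ae_event `[0%R, +oo[ `[0%R, +oo[) => //; try exact: null.
move=> w [Ew H]; apply: EF; split => // j.
by have [] := H j; rewrite /= !in_itv /= !andbT.
Qed.

Lemma markov_RV (X0 : {RV P0 >-> R}) (X : {RV P >-> R}) k : (forall w, 0 <= X0 w) ->
  ('E_P0[X0] = 1)%E -> same_law X X0 -> 0 < k -> (P [set w | (k <= X w)%R] <= (k^-1)%:E)%E.
Proof.
move=> X00 EX XX k0.
rewrite (_ : [set w | _] = X @^-1` `[k, +oo[); last first.
  by apply/seteqP; split => w /=; rewrite in_itv /= andbT.
rewrite (same_law_probability XX); last exact: measurable_itv.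
have mX : measurable_fun setT X0 by exact: measurable_funPT.
have mE : measurable (X0 @^-1` `[k, +oo[).
  by rewrite -[X in measurable X]setTI; apply: mX => //; exact: measurable_itv.
rewrite -[X in P0 X]setIT -integral_indic //.
have -> : (k^-1)%:E = (\int[P0]_w ((k^-1)%:E * (X0 w)%:E))%E.
  rewrite ge0_integralZl //; [| exact/measurable_EFinP| |].
  - by move: EX; rewrite expectation_def => ->; rewrite mule1.
  - by move=> w _; rewrite lee_fin.
  - by rewrite lee_fin invr_ge0 ltW.
apply: ge0_le_integral; [exact: measurableT| | | | ].
- by move=> w _; rewrite lee_fin.
- by apply/measurable_EFinP; exact: measurable_indic.
- by apply: measurable_funeM; exact/measurable_EFinP.
move=> w _; rewrite -EFinM lee_fin indicE.
case: (boolP (w \in _)) => [/set_mem /=|_]; last by rewrite mulr_ge0 // invr_ge0 ltW.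
by rewrite in_itv /= andbT => kX; rewrite mulrC ler_pdivlMr // mul1r.
Qed.


Lemma measure_bigsetU_le m (F : nat -> set Omega) (b : R) : (forall j, measurable (F j)) ->
  (forall j, (P (F j) <= b%:E)%E) ->
  (P (\big[setU/set0]_(j < m) F j) <= (m%:R * b)%:E)%E.
Proof.
move=> mF Fb; elim: m => [|m IH]; first by rewrite big_ord0 measure0 mul0r.
rewrite big_ord_recr /=; apply: le_trans (measureU2 _ _ _) _ => //.
  by apply: bigsetU_measurable.
by rewrite -natr1 mulrDl mul1r EFinD; apply: leeD; [exact: IH|exact: Fb].
Qed.

Variables (n N tau z : nat) (lam del theta eps mom c1 : R).
Hypotheses (n0 : (0 < n)%N) (lam0 : 0 < lam).
Let h : R := n%:R^-1.

(** A residual time for each server, nobody waiting, an arrival at once. The residuals are averaged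
    later over the equilibrium law. *)
Definition lattice_condition (rs : seq nat) : initial_condition R :=
  InitialCondition 0 (map (fun r => h * r%:R) rs) 0%N.

Definition queue_exceeds rs : set Omega :=
  [set w | ((n + z)%:R%:E < number_in_system n (lattice_condition rs)
     (fun j => A j w / lam)%R (fun j => S j w) (h * tau%:R)%R)%E].

Let h0 : 0 < h. Proof. by rewrite invr_gt0 ltr0n. Qed.

Definition round_down hA C (x : R) : nat := minn (Num.truncn (x / (lam * hA))) C.

Section discretized.
Variables (m C : nat) (hA : R).
Hypotheses (hA0' : 0 < hA) (C0 : (0 < C)%N) (hAm : hA * m%:R <= h).
Let pS := service_law S0 n C.
Let pA := discrete_law A0 (round_down hA C).

Lemma round_down_mono x y : x <= y -> (round_down hA C x <= round_down hA C y)%N.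
Proof.
move=> xy; rewrite /round_down leq_min geq_minr andbT (leq_trans (geq_minl _ _)) //.
by rewrite le_truncn // ler_wpM2r // invr_ge0 mulr_ge0 // ltW.
Qed.

Lemma round_down_lt x : (round_down hA C x < C.+1)%N.
Proof. by rewrite ltnS geq_minr. Qed.

Lemma measurable_queue_exceeds rs : size rs = n -> measurable (queue_exceeds rs).
Proof.
move=> rsn; rewrite /queue_exceeds -[X in measurable X]setTI; apply: emeasurable_fun_o_infty => //.
apply: measurable_number_in_system => //.
- exact: admissible_lattice.
by move=> j; apply: measurable_funM => //; exact: measurable_funPT.
Qed.

Let bad : set Omega :=
  \big[setU/set0]_(j < m) [set w | C%:R / n%:R <= S j w] `|`
  \big[setU/set0]_(j < m) [set w | C%:R * (lam * hA) <= A j w].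
Let DA w j := round_down hA C (A j w).
Let DS w j := round_up n C (S j w).
Let F rs (s : seq nat) := early tau h hA (sumn (take m s)) ||
  lattice_wait tau m h hA h z rs (take m s) (drop m s).

Lemma queue_exceeds_sub rs : size rs = n -> queue_exceeds rs `&` nonneg_event `<=`
  [set w | F rs (map (DA w) (iota 0 m) ++ map (DS w) (iota 0 m))] `|` bad.
Proof.
move=> rsn w [Q N0]; have [B|nB] := pselect (bad w); [by right|left].
rewrite /= /F take_size_cat ?size_map ?size_iota // drop_size_cat ?size_map ?size_iota //.
case: (boolP (early _ _ _ _)) => // notearly; rewrite orFb.
have lh : 0 < lam * hA by rewrite mulr_gt0.
apply: (@long_wait_lattice R n m z tau rs h hA h (fun j => A j w / lam) (fun j => S j w) (DA w) (DS w)) => //.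
- exact: ltW.
- by move=> j; rewrite divr_ge0 ?(N0 j).1 // ltW.
- by move=> j; rewrite (N0 j).2.
- move=> i im; apply: (@le_trans _ _ (hA * (A i w / (lam * hA)))).
    rewrite ler_wpM2l ?(ltW hA0') // (@le_trans _ _ (Num.truncn (A i w / (lam * hA)))%:R) //.
      by rewrite ler_nat geq_minl.
    by rewrite truncn_le divr_ge0 ?(N0 i).1 // ltW.
  by rewrite le_eqVlt; apply/orP; left; apply/eqP; field; rewrite ?gt_eqF.
- move=> i im; have Ai : A i w / (lam * hA) < C%:R.
    rewrite ltr_pdivrMr // ltNge; apply/negP => K; apply: nB; right.
    by rewrite -(bigcup_mkord m (fun j => [set w | C%:R * (lam * hA) <= A j w])); exists i.
  rewrite /DA /round_down (minn_idPl _); last by rewrite truncn_le_nat (lt_trans Ai) // ltr_nat.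
  have := truncnS_gt (A i w / (lam * hA)); rewrite ltr_pdivrMr // -natr1 => H.
  by rewrite ler_pdivrMr //; move: H; lra.
- move=> i im; have Si : n%:R * S i w < C%:R.
    rewrite mulrC -ltr_pdivlMr ?ltr0n // ltNge; apply/negP => K; apply: nB; left.
    by rewrite -(bigcup_mkord m (fun j => [set w | C%:R / n%:R <= S j w])); exists i.
  rewrite /DS /round_up (minn_idPl _); last by rewrite truncn_lt_nat // mulr_ge0 ?(N0 i).2.
  by rewrite /h mulrC ler_pdivlMr ?ltr0n // mulrC ltW // truncnS_gt.
Qed.

(** Besides the lattice event, the bound pays for [m] interarrival times not reaching past the time
    of observation and, by Markov's inequality, for values beyond the caps. *)
Lemma discretized_tail rs : size rs = n ->
  fine (P (queue_exceeds rs)) <=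
  Ex C.+1 pA m (fun l => Ex C.+1 pS m (fun vs => (lattice_wait tau m h hA h z rs l vs)%:R)) +
  Ex C.+1 pA m (fun l => (early tau h hA (sumn l))%:R) +
  m%:R * (n%:R / C%:R + (C%:R * (lam * hA))^-1).
Proof.
move=> rsn; case: (hAS) => lawA lawS indep.
have CR : 0 < C%:R :> R by rewrite ltr0n.
have lh : 0 < lam * hA by rewrite mulr_gt0.
pose X (i : nat + nat) := match i with inl j => A j | inr j => S j end.
pose D (i : nat + nat) := match i with inl _ => round_down hA C | inr _ => round_up n C end.
pose CC (i : nat + nat) := match i with inl _ => C.+1 | inr _ => C.+1 end.
pose s : seq (nat + nat) := map inl (iota 0 m) ++ map inr (iota 0 m).
have mD i v : measurable (D i @^-1` [set v]).
  by case: i => j; apply: measurable_level; [exact: round_down_mono|exact: round_up_mono].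
have DC i x : (D i x < CC i)%N by case: i => j; [exact: round_down_lt|exact: round_up_lt].
have us : uniq s.
  rewrite cat_uniq !map_inj_uniq ?iota_uniq //=; try by move=> ? ? [].
  by rewrite andbT; apply/hasPn => _ /mapP[j _ ->]; apply/mapP => -[].
have E1 w : map (DA w) (iota 0 m) ++ map (DS w) (iota 0 m) = map (fun i => D i (X i w)) s.
  by rewrite map_cat -!map_comp.
have sub := queue_exceeds_sub rsn.
rewrite (_ : [set w | _] = [set w | F rs (map (fun i => D i (X i w)) s)]) in sub; last first.
  by apply/funext => w /=; rewrite E1.
have mF : measurable [set w | F rs (map (fun i => D i (X i w)) s)] by exact: measurable_discrete.
have mS j : measurable [set w | C%:R / n%:R <= S j w] by exact: measurable_ge.
have mA j : measurable [set w | C%:R * (lam * hA) <= A j w] by exact: measurable_ge.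
have mbS : measurable (\big[setU/set0]_(j < m) [set w | C%:R / n%:R <= S j w]) by exact: bigsetU_measurable.
have mbA : measurable (\big[setU/set0]_(j < m) [set w | C%:R * (lam * hA) <= A j w]) by exact: bigsetU_measurable.
have mbad : measurable bad by exact: measurableU.
have mQ := measurable_queue_exceeds rsn.
rewrite -lee_fin fineK ?fin_num_measure //.
apply: le_trans (le_nonneg_event mQ _ sub) _; first exact: measurableU.
apply: le_trans (measureU2 _ mF mbad) _.
rewrite EFinD; apply: leeD; last first.
  apply: le_trans (measureU2 _ mbS mbA) _.
  rewrite mulrDr EFinD; apply: leeD.
    apply: (@measure_bigsetU_le m (fun j => [set w | C%:R / n%:R <= S j w]) _ mS) => j.
    by rewrite -[n%:R / _]invf_div; apply: (markov_RV hS0 hES (lawS j)); rewrite divr_gt0 // ltr0n.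
  apply: (@measure_bigsetU_le m (fun j => [set w | C%:R * (lam * hA) <= A j w]) _ mA) => j.
  by apply: (markov_RV hA0 hEA (lawA j)); rewrite mulr_gt0.
have link : P [set w | F rs (map (fun i => D i (X i w)) s)] =
    (ExI X D CC s (fun l => (F rs l)%:R))%:E := independence_link indep mD DC (F rs) us.
apply: (@le_trans _ _ (ExI X D CC s (fun l => (F rs l)%:R))%:E).
  by rewrite le_eqVlt; apply/orP; left; apply/eqP; exact: link.
rewrite lee_fin.
rewrite (@ExI_Ex _ _ _ P A S (round_down hA C) (round_up n C) C.+1 C.+1 pA pS); last 2 first.
- move=> j v; rewrite /atom_prob /pA /discrete_law; congr fine.
  by apply: same_law_probability => //; apply: measurable_level; exact: round_down_mono.
- move=> j v; rewrite /atom_prob /pS /service_law /discrete_law; congr fine.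
  by apply: same_law_probability => //; apply: measurable_level; exact: round_up_mono.
have pA0 v : 0 <= pA v by exact: discrete_law_ge0.
have pS0 v : 0 <= pS v by exact: discrete_law_ge0.
have pS1 : \sum_(v < C.+1) pS v = 1.
  exact: (discrete_law1 _ (@round_up_mono R n C) (@round_up_lt R n C)).
rewrite -Ex_add; apply: Ex_le => // l lm.
rewrite -[X in _ + X](@Ex_const _ C.+1 pS m _ pS1) -Ex_add; apply: Ex_le => // vs _.
rewrite /F take_size_cat // drop_size_cat // -natrD ler_nat addnC.
by case: (early _ _ _ _) => //=; exact: leq_addr.
Qed.


Lemma pA_ge0 v : 0 <= pA v. Proof. exact: discrete_law_ge0. Qed.

(** Rounding down costs one mesh in the exponent. Beyond the cap the exponential is at most
    [exp th], and Markov's inequality gives the last term. *)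
Lemma lundberg_discrete th nn : 0 <= th -> 0 <= nn ->
  \sum_(v < C.+1) pA v * expR (th * (1 - nn * hA * v%:R)) <=
  expR (th * (1 + nn * hA)) * laplace A0 (th * nn / lam) + expR th / (C%:R * (lam * hA)).
Proof.
move=> th0 nn0.
have lh : 0 < lam * hA by rewrite mulr_gt0.
have Clh : 0 < C%:R * (lam * hA) by rewrite mulr_gt0 // ltr0n.
pose s := th * nn / lam.
have s0 : 0 <= s by rewrite divr_ge0 // ?mulr_ge0 // ltW.
pose g1 w := expR (th * (1 + nn * hA)) * expR (- (s * A0 w)).
pose g2 w := expR th / (C%:R * (lam * hA)) * A0 w.
have g20 w : 0 <= g2 w by rewrite mulr_ge0 // divr_ge0 ?expR_ge0 // ltW.
have mA0 : measurable_fun setT A0 by exact: measurable_funPT.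
have mg1 : measurable_fun setT g1.
  by apply: measurable_funM => //; apply/measurable_EFinP; exact: measurable_expRA.
have mg2 : measurable_fun setT g2 by exact: measurable_funM.
have I : (\int[P0]_w (g1 w + g2 w)%:E = (expR (th * (1 + nn * hA)) * laplace A0 s +
    expR th / (C%:R * (lam * hA)))%:E)%E.
  under eq_integral do rewrite EFinD.
  rewrite ge0_integralD //; [|by move=> w _; rewrite lee_fin mulr_ge0 // expR_ge0|exact/measurable_EFinP|by move=> w _; rewrite lee_fin|exact/measurable_EFinP].
  rewrite EFinD; congr (_ + _)%E.
    rewrite /g1; under eq_integral do rewrite EFinM.
    rewrite ge0_integralZl; [|exact: measurableT|exact: measurable_expRA|by move=> w _; rewrite lee_fin expR_ge0|by rewrite lee_fin expR_ge0].
    by rewrite laplaceE.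
  rewrite /g2; under eq_integral do rewrite EFinM.
  rewrite ge0_integralZl; [|exact: measurableT|exact/measurable_EFinP|by move=> w _; rewrite lee_fin|by rewrite lee_fin divr_ge0 ?expR_ge0 // ltW].
  by move: hEA; rewrite expectation_def => ->; rewrite mule1.
rewrite -lee_fin -I.
apply: (@sum_discrete_law_le _ _ _ P0 A0 _ _ round_down_mono round_down_lt
  (fun v => expR (th * (1 - nn * hA * v%:R))) (fun w => g1 w + g2 w)) => [v||w].
- exact: expR_ge0.
- exact: measurable_funD.
have [tC|Ct] := leqP (Num.truncn (A0 w / (lam * hA))) C.
  apply: (@le_trans _ _ (g1 w)); last by rewrite lerDl.
  rewrite /round_down (minn_idPl tC) /g1 -expRD ler_expR -subr_ge0.
  have := truncnS_gt (A0 w / (lam * hA)); rewrite ltr_pdivrMr // -natr1.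
  move: (Num.truncn _)%:R => D AD.
  have -> : th * (1 + nn * hA) + - (s * A0 w) - th * (1 - nn * hA * D) =
    th * nn * ((D + 1) * (lam * hA) - A0 w) / lam by rewrite /s; field; rewrite gt_eqF.
  by rewrite divr_ge0 ?(ltW lam0) // !mulr_ge0 // subr_ge0 ltW.
apply: (@le_trans _ _ (g2 w)); last by rewrite lerDr mulr_ge0 // expR_ge0.
apply: (@le_trans _ _ (expR th)).
  by rewrite ler_expR ler_piMr // gerBl !mulr_ge0 // ltW.
rewrite /g2 -mulrA ler_peMr ?expR_ge0 // mulrC ler_pdivlMr // mul1r.
rewrite truncn_gt_nat ler_pdivlMr // in Ct; apply: le_trans Ct.
by rewrite ler_wpM2r ?(ltW lh) // ler_nat.
Qed.

Lemma early_le_expR th nn : 0 <= th -> 0 <= nn ->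
  \sum_(v < C.+1) pA v * expR (th * (1 - nn * hA * v%:R)) <= 1 ->
  Ex C.+1 pA m (fun l => (early tau h hA (sumn l))%:R) <= expR (th * nn * (h * tau%:R) - th * m%:R).
Proof.
move=> th0 nn0 H.
apply: (@le_trans _ _ (Ex C.+1 pA m (fun l => expR (th * nn * (h * tau%:R) - th * m%:R) *
   \prod_(v <- l) expR (th * (1 - nn * hA * v%:R))))).
  apply: Ex_le => [v|l lm]; first exact: pA_ge0.
  have -> : \prod_(v <- l) expR (th * (1 - nn * hA * v%:R)) =
      expR (th * (m%:R - nn * hA * (sumn l)%:R)).
    rewrite -lm; elim: (l) => [|v l' IH]; first by rewrite big_nil /= mulr0 subrr mulr0 expR0.
    by rewrite big_cons IH -expRD /= natrD -natr1; congr expR; ring.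
  rewrite -expRD; case: (boolP (early _ _ _ _)) => [e|_]; last exact: expR_ge0.
  rewrite -[leLHS]expR0 ler_expR.
  have -> : th * nn * (h * tau%:R) - th * m%:R + th * (m%:R - nn * hA * (sumn l)%:R) =
    th * nn * (h * tau%:R - hA * (sumn l)%:R) by ring.
  by rewrite !mulr_ge0 // subr_ge0.
rewrite Ex_scale Ex_prod ler_piMr ?expR_ge0 // -[leRHS](expr1n _ m).
by apply: lerXn2r; rewrite ?nnegrE // sumr_ge0 // => v _; rewrite mulr_ge0 ?expR_ge0 ?pA_ge0.
Qed.

End discretized.


Let M1 := mean_service S0 n.
(** The equilibrium delay of the renewal process with rounded, uncapped services. *)
Definition residual_law (r : nat) : R :=
  fine (P0 [set w | (r < (Num.truncn (n%:R * S0 w)).+1)%N]) / M1.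
Definition start_rate : R := (n%:R - del) / (h * M1).

Hypotheses (eps0 : 0 < eps) (eps1 : eps <= 1)
  (moment : (\int[P0]_w (S0 w `^ (1 + eps))%:E = mom%:E)%E) (theta0 : 0 < theta)
  (c12 : 2 <= c1) (c1c0 : 2 * mom * c1 `^ (- eps) <= 2^-1) (del0 : 0 < del) (deln : del <= n%:R)
  (rtb : (Num.sqrt n%:R)^-1 <= eps / 2 / 2) (P2 : 2 <= del / Num.sqrt n%:R)
  (lund : expR theta * laplace A0 (theta * start_rate / lam) < 1) (Ntau : (N <= tau.+1)%N).

(** The bound is uniform in [tau] and [N], as the passage to steady state requires. Arrival mesh,
    number of arrivals and caps are chosen for the given [tau] and disappear with [e]. *)
Theorem queue_exceeds_le :
  Ex N residual_law n (fun rs => fine (P (queue_exceeds rs))) <=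
  expR (- theta * (z%:R - del - start_rate * h)) +
  expR (starvation_const c1 eps - (del / Num.sqrt n%:R - 2) * ln 2) * M1.
Proof.
have n1 : 1 <= n%:R :> R by rewrite ler1n.
have M1n : n%:R <= M1 := mean_service_ge n hS0 hES.
have M10 : 0 < M1 by lra.
have nn0 : 0 <= start_rate by rewrite divr_ge0 ?subr_ge0 // mulr_ge0 // ltW.
have mom0 : 0 <= mom by rewrite -lee_fin -moment; apply: integral_ge0 => w _; rewrite lee_fin powR_ge0.
set GF := expR (starvation_const c1 eps - _) * M1.
apply/ler_addgt0Pr => e e0.
have [x xE] : exists x, x = expR theta * laplace A0 (theta * start_rate / lam) by eexists.
have x1 : x < 1 by rewrite xE.
(* The strict inequality [lund] leaves room for two errors of size [r]: the factor [1 + r] from the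
   mesh and the term [r] from the cap. *)
pose r := (1 - x) / 2.
have r0 : 0 < r by rewrite divr_gt0 // subr_gt0.
have lap0 : 0 <= laplace A0 (theta * start_rate / lam).
  by apply: fine_ge0; apply: integral_ge0 => w _; rewrite lee_fin expR_ge0.
have x0 : 0 <= x by rewrite xE mulr_ge0 ?expR_ge0.
have r10 : 0 < 1 + r by rewrite addr_gt0.
have lr0 : 0 < ln (1 + r) by rewrite ln_gt0 // ltrDl.
(* [m > X1] makes [m] arrivals before the time of observation unlikely; [m > X2] keeps the mesh
   factor below [1 + r]. *)
pose X1 := start_rate * (h * tau%:R) - ln (e / 3) / theta.
pose X2 := theta * start_rate * h / ln (1 + r).
pose m := ((Num.truncn X1).+1 + (Num.truncn X2).+1)%N.
have m0 : 0 < m%:R :> R by rewrite ltr0n.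
have X1m : X1 < m%:R by apply: lt_le_trans (truncnS_gt _) _; rewrite ler_nat leq_addr.
have X2m : X2 < m%:R by apply: lt_le_trans (truncnS_gt _) _; rewrite ler_nat leq_addl.
pose hA := h / m%:R.
have hA_0 : 0 < hA by rewrite divr_gt0.
have hAm : hA * m%:R <= h by rewrite divfK // gt_eqF.
have lh : 0 < lam * hA by rewrite mulr_gt0.
(* Caps: [Y1] for the moment, [Y2] and [Y3] for Markov's bounds on services and interarrivals, [CL]
   for the truncation levels of [startsG]. *)
pose Y1 := expR theta / (r * (lam * hA)).
pose Y2 := 3 * m%:R * n%:R / e.
pose Y3 := 3 * m%:R / (e * (lam * hA)).
pose CL s := (Num.truncn (c1 * (1 + s.+1%:R / M1) `^ 2^-1 * M1)).+1.
pose C := (N + ((Num.truncn Y1).+1 + ((Num.truncn Y2).+1 + ((Num.truncn Y3).+1 + \sum_(0 <= s < tau.+1) CL s))))%N.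
have NC : (N <= C)%N by rewrite leq_addr.
have C0 : (0 < C)%N by rewrite /C addnS.
have CR : 0 < C%:R :> R by rewrite ltr0n.
have Y1C : Y1 < C%:R.
  by apply: lt_le_trans (truncnS_gt _) _; rewrite ler_nat /C;
  move: (Num.truncn Y1) (Num.truncn Y2) (Num.truncn Y3) (\sum_(0 <= s < tau.+1) CL s)%N => a1 a2 a3 a4; clear; lia.
have Y2C : Y2 < C%:R.
  by apply: lt_le_trans (truncnS_gt _) _; rewrite ler_nat /C;
  move: (Num.truncn Y1) (Num.truncn Y2) (Num.truncn Y3) (\sum_(0 <= s < tau.+1) CL s)%N => a1 a2 a3 a4; clear; lia.
have Y3C : Y3 < C%:R.
  by apply: lt_le_trans (truncnS_gt _) _; rewrite ler_nat /C;
  move: (Num.truncn Y1) (Num.truncn Y2) (Num.truncn Y3) (\sum_(0 <= s < tau.+1) CL s)%N => a1 a2 a3 a4; clear; lia.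
have CLC s : (s <= tau)%N -> (CL s <= C)%N.
  move=> st; apply: (@leq_trans (\sum_(0 <= s < tau.+1) CL s)%N); last by rewrite /C; clear; lia.
  by rewrite big_mkord (bigD1 (Ordinal (st : (s < tau.+1)%N))) //= leq_addr.
have DA1 := @round_down_mono C hA hA_0; have DA2 := @round_down_lt C hA.
pose pA := discrete_law A0 (round_down hA C).
pose pS := service_law S0 n C.
have pA0 v : 0 <= pA v by exact: discrete_law_ge0.
have pS0 v : 0 <= pS v by exact: discrete_law_ge0.
have pA1 : \sum_(v < C.+1) pA v = 1 by exact: (discrete_law1 _ DA1 DA2).
have pS1 : \sum_(v < C.+1) pS v = 1.
  exact: (discrete_law1 _ (@round_up_mono R n C) (@round_up_lt R n C)).
have pS00 : pS 0%N = 0 by exact: service_law0.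
have mass L : \sum_(0 <= r < L) survival C.+1 pS r <= M1 by exact: mean_service_mass.
have lundA : \sum_(v < C.+1) pA v * expR (theta * (1 - start_rate * hA * v%:R)) <= 1.
  apply: le_trans (lundberg_discrete hA_0 C0 (ltW theta0) nn0) _.
  have H1 : expR theta / (C%:R * (lam * hA)) <= r.
    rewrite ler_pdivrMr; last by rewrite mulr_gt0.
    move: Y1C; rewrite /Y1 (ltr_pdivrMr _ _ (mulr_gt0 r0 lh)).
    by move: (lam * hA) (expR theta) => L E H; lra.
  have H2 : expR (theta * (1 + start_rate * hA)) * laplace A0 (theta * start_rate / lam) <= (1 + r) * x.
    rewrite mulrDr mulr1 expRD xE -mulrA [X in _ <= X]mulrCA ler_wpM2l ?expR_ge0 //.
    rewrite ler_wpM2r //.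
    rewrite -[leRHS]lnK ?posrE // ler_expR /hA.
    have -> : theta * (start_rate * (h / m%:R)) = theta * start_rate * h / m%:R by ring.
    move: X2m; rewrite /X2 ltr_pdivrMr // => H.
    by rewrite ler_pdivrMr // [leRHS]mulrC ltW.
  have : (1 + r) * x + r <= 1 by rewrite /r; nra.
  lra.
pose pi v := survival C.+1 pS v / M1.
have pi0 v : 0 <= pi v by rewrite divr_ge0 ?(ltW M10) // sumr_ge0.
have pi1 : \sum_(v < N) pi v <= 1.
  by rewrite -mulr_suml ler_pdivrMr // mul1r -(big_mkord xpredT (survival C.+1 pS)).
have piE v : (v < N)%N -> residual_law v = pi v.
  by move=> vN; rewrite /residual_law /pi survival_service // (leq_trans vN).
rewrite (Ex_ext_law _ _ piE).
have star : Ex N pi n (fun rs => ExA C.+1 pS (nseq n tau.+1) (fun rows =>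
    (starved tau h start_rate del rs rows)%:R)) <= GF.
  apply: (@starved_le R n C.+1 N tau pS h M1 (2 * mom) c1 eps del) => //; try lra.
  by move=> l l2 lC; apply: min_service_ge.
have lat := @lattice_wait_le R C.+1 C.+1 N n tau m pS pA pi h hA h n0 h0 (ltW hA_0) (ltW h0)
  pS0 pS1 pS00 pA0 pA1 pi0 pi1 start_rate del GF z nn0 del0 star theta (ltW theta0) lundA.
have earl : Ex C.+1 pA m (fun l => (early tau h hA (sumn l))%:R) <=
    expR (theta * start_rate * (h * tau%:R) - theta * m%:R).
  by apply: early_le_expR => //; exact: ltW.
pose bad := m%:R * (n%:R / C%:R + (C%:R * (lam * hA))^-1).
have bad0 : 0 <= bad by rewrite mulr_ge0 // addr_ge0 ?divr_ge0 // invr_ge0 mulr_ge0 // ltW.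
apply: (@le_trans _ _ (Ex N pi n (fun rs =>
   Ex C.+1 pA m (fun l => Ex C.+1 pS m (fun vs => (lattice_wait tau m h hA h z rs l vs)%:R)) +
   (expR (theta * start_rate * (h * tau%:R) - theta * m%:R) + bad)))).
  apply: Ex_le => // rs rsn; apply: le_trans (discretized_tail hA_0 C0 hAm rsn) _.
  by rewrite -addrA lerD2l lerD2r.
rewrite Ex_add; apply: lerD; first exact: lat.
apply: le_trans (Ex_const_le _ pi0 pi1 _) _; first by rewrite addr_ge0 ?expR_ge0.
have H1 : expR (theta * start_rate * (h * tau%:R) - theta * m%:R) <= e / 3.
  rewrite -[leRHS]lnK ?posrE ?divr_gt0 // ler_expR.
  move: X1m; rewrite /X1 ltrBlDr -ltrBlDl ltr_pdivlMr // => H.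
  by move: (ln _) (h * tau%:R) H => lx ht H; nra.
have H2 : m%:R * (n%:R / C%:R) <= e / 3.
  move: Y2C; rewrite /Y2 ltr_pdivrMr // mulrA => H; rewrite ler_pdivrMr //; lra.
have H3 : m%:R * (C%:R * (lam * hA))^-1 <= e / 3.
  move: Y3C; rewrite /Y3 (ltr_pdivrMr _ _ (mulr_gt0 e0 lh)) => H.
  rewrite (ler_pdivrMr _ _ (mulr_gt0 CR lh)).
  by move: (lam * hA) H => L H; lra.
by rewrite /bad mulrDr; lra.
Qed.

End queue_tail.

(** * Passage to the steady state, upper bound *)

Definition real_id {R : realType} (x : R) : R := x.
HB.instance Definition _ (R : realType) :=
  isMeasurableFun.Build _ _ R R (@real_id R) (@measurable_id _ R setT).

(** Convergence in distribution speaks only of points without mass. Atoms are countable, so an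
    interval of positive length contains such a point. *)
Lemma exists_nonatom (R : realType) (mu : probability R R) (a b : R) : a < b ->
  exists2 y, a <= y <= b & mu [set y] = 0%E.
Proof.
move=> ab; apply: contrapT => H.
pose X : {RV mu >-> R} := real_id.
have sub : `[a, b]%classic `<=` [set r | 0 < pmf X r].
  move=> r /=; rewrite in_itv /= => rab; rewrite lt_neqAle pmf_ge0 andbT eq_sym.
  apply/negP => /eqP r0; apply: H; exists r => //.
  move: r0; rewrite /pmf (_ : X @^-1` [set r] = [set r]) // => r0.
  by rewrite -[LHS]fineK ?fin_num_measure // r0.
have := countable_lebesgue_measure0 (sub_countable (subset_card_le sub) (pmf_gt0_countable X)).
rewrite lebesgue_measure_itv /= lte_fin ab -EFinB => -[] /eqP.
by rewrite subr_eq0 gt_eqF.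
Qed.

(** Only finitely many words occur, so one threshold serves them all. *)
Lemma Ex_eventually (R : realType) C (p : nat -> R) K F (G : nat -> seq nat -> R) :
  (forall v, 0 <= p v) ->
  (forall l, size l = K -> exists t0, forall t, (t0 <= t)%N -> F l <= G t l) ->
  exists t0, forall t, (t0 <= t)%N -> Ex C p K F <= Ex C p K (G t).
Proof.
move=> p0; elim: K F G => [|K IH] F G FG /=; first exact: FG.
have /choice[f Hf] (v : 'I_C) : exists t0, forall t, (t0 <= t)%N ->
    Ex C p K (fun l => F (val v :: l)) <= Ex C p K (fun l => G t (val v :: l)).
  by apply: (IH _ (fun t l => G t (val v :: l))) => l lK; apply: FG; rewrite /= lK.
exists (\max_v f v)%N => t ft; apply: ler_sum => v _; rewrite ler_wpM2l // Hf //.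
exact: leq_trans (leq_bigmax v) ft.
Qed.

Lemma Ex_const_mass (R : realType) C (p : nat -> R) K a :
  Ex C p K (fun=> a) = a * (\sum_(v < C) p v) ^+ K.
Proof.
elim: K => [|K IH] /=; first by rewrite expr0 mulr1.
by rewrite -mulr_suml IH exprS mulrCA.
Qed.

Lemma bernoulli_le (R : realType) (eta : R) n : 0 <= eta -> eta <= 1 -> 1 - n%:R * eta <= (1 - eta) ^+ n.
Proof.
move=> e0 e1; elim: n => [|n IH]; first by rewrite mul0r subr0 expr0.
rewrite exprS -natr1; apply: (@le_trans _ _ ((1 - eta) * (1 - n%:R * eta))); last first.
  by rewrite ler_wpM2l // subr_ge0.
have : 0 <= n%:R * eta * eta by rewrite !mulr_ge0.
lra.
Qed.

Section stationary_upper_bound.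
Context d0 d (Omega0 : measurableType d0) (Omega : measurableType d) (R : realType).
Variables (P0 : probability Omega0 R) (P : probability Omega R).
Variables (A0 S0 : {RV P0 >-> R}) (A S : nat -> {RV P >-> R}).
Hypotheses (hA0 : forall w, 0 <= A0 w) (hS0 : forall w, 0 <= S0 w)
  (hAS : GI_primitives A0 S0 A S) (hEA : ('E_P0[A0] = 1)%E) (hES : ('E_P0[S0] = 1)%E).

Variables (B alpha : R) (n : nat) (mu : probability R R).
Hypotheses (n0 : (0 < n)%N) (stat : steady_state_Q A S B alpha n mu).
Let lam := arrival_rate B alpha n.

Let h : R := n%:R^-1.
Let h0 : 0 < h. Proof. by rewrite invr_gt0 ltr0n. Qed.

Lemma large_times (f : R -> R) l u : f t @[t --> +oo] --> l -> l < u ->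
  exists t0, forall tau, (t0 <= tau)%N -> f (h * tau%:R) < u.
Proof.
move=> fl lu; have [M [_ HM]] : \forall t \near +oo, f t < u by apply: (cvgr_lt l).
exists (Num.truncn (M / h)).+1 => tau t0; apply: HM.
rewrite mulrC -ltr_pdivrMr // (lt_le_trans (truncnS_gt _)) // ler_nat.
exact: t0.
Qed.

Lemma queue_exceeds_limit rs z y e : size rs = n -> (n + z)%:R <= y -> mu [set y] = 0%E -> 0 < e ->
  exists t0, forall tau, (t0 <= tau)%N ->
    fine (mu `]y, +oo[) - e <= fine (P (queue_exceeds A S n tau z lam rs)).
Proof.
move=> rsn zy y0 e0.
have cn : admissible n (lattice_condition R n rs) by apply: (@admissible_lattice R n rs n%:R^-1 h0 rsn).
have := stat cn y0.
have mI : measurable (`]-oo, y]%classic : set R) by exact: measurable_itv.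
rewrite -[X in _ --> X]fineK ?fin_num_measure // => /fine_cvg /(@large_times _ _ (fine (mu `]-oo, y]) + e)).
case=> [|t0 H]; first by rewrite ltrDl.
exists t0 => tau /H {}H.
have mQ : measurable [set w | (number_in_system n (lattice_condition R n rs)
     (interarrival A B alpha n w) (processing S w) (h * tau%:R) <= y%:E)%E].
  rewrite -[X in measurable X]setTI; apply: emeasurable_fun_infty_c => //.
  apply: measurable_number_in_system => //.
  by move=> j; apply: measurable_funM => //; exact: measurable_funPT.
have -> : `]y, +oo[%classic = ~` `]-oo, y]%classic :> set R.
  by apply/seteqP; split => q /=; rewrite !in_itv /= andbT ltNge => /negP.
have -> : fine (mu (~` `]-oo, y]%classic)) = 1 - fine (mu `]-oo, y]).
  by rewrite probability_setC // fineB ?fin_num_measure.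
have mE := measurable_queue_exceeds A S tau z lam n0 rsn.
apply: (@le_trans _ _ (1 - fine (P [set w | (number_in_system n (lattice_condition R n rs)
     (interarrival A B alpha n w) (processing S w) (h * tau%:R) <= y%:E)%E]))).
  by move: H; rewrite /=; lra.
rewrite -lee_fin EFinB !fineK ?fin_num_measure // -probability_setC //.
apply: le_measure; rewrite ?inE //; first exact: measurableC.
move=> w /= /negP; rewrite -ltNge => yQ; apply: le_lt_trans yQ.
by rewrite lee_fin.
Qed.

Variables (eps mom : R).
Hypotheses (eps0 : 0 < eps) (eps1 : eps <= 1)
  (moment : (\int[P0]_w (S0 w `^ (1 + eps))%:E = mom%:E)%E).

Lemma residual_mass eta : 0 < eta -> exists N, 1 - eta <= \sum_(v < N) residual_law S0 n v <= 1.
Proof.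
move=> eta0.
have mom0 : 0 <= mom by rewrite -lee_fin -moment; apply: integral_ge0 => w _; rewrite lee_fin powR_ge0.
have M1n := mean_service_ge n hS0 hES; set M1 := mean_service S0 n in M1n.
have n1 : 1 <= n%:R :> R by rewrite ler1n.
have M10 : 0 < M1 by lra.
pose l : R := 2 + ((2 * mom) / eta) `^ eps^-1.
have l2 : 2 <= l by rewrite lerDl powR_ge0.
have l0 : 0 < l by lra.
have lE : 2 * mom * l `^ (- eps) <= eta.
  rewrite powRN ler_pdivrMr ?powR_gt0 // [leRHS]mulrC -ler_pdivrMr //.
  apply: (@le_trans _ _ ((((2 * mom) / eta) `^ eps^-1) `^ eps)).
    by rewrite -powRrM mulVf ?gt_eqF // powRr1 // divr_ge0 ?mulr_ge0 // ltW.
  by apply: ge0_ler_powR; rewrite ?nnegrE ?powR_ge0 ?(ltW eps0) ?(ltW l0) // lerDr.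
pose N := (Num.truncn (l * M1)).+1; exists N.
have E : \sum_(v < N) residual_law S0 n v =
    (\sum_(0 <= r < N) survival N.+1 (service_law S0 n N) r) / M1.
  rewrite mulr_suml big_mkord; apply: eq_bigr => v _.
  by rewrite /residual_law survival_service.
rewrite E; apply/andP; split.
  rewrite ler_pdivlMr // sum_survival.
  apply: le_trans (min_service_ge hS0 hES n0 eps0 eps1 moment l2 (leqnn _)).
  rewrite mulrC ler_wpM2l ?(ltW M10) //; lra.
by rewrite ler_pdivrMr // mul1r; exact: mean_service_mass.
Qed.

Variables (z : nat) (y b : R).
Hypothesis bound : forall N tau, (N <= tau.+1)%N ->
  Ex N (residual_law S0 n) n (fun rs => fine (P (queue_exceeds A S n tau z lam rs))) <= b.

(** All initial conditions share the limit, so the average over truncated residuals tends to the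
    steady-state tail times the total mass, and at most [n * eta] of the mass is missing. *)
Lemma stationary_tail_le : (n + z)%:R <= y -> mu [set y] = 0%E -> fine (mu `]y, +oo[) <= b.
Proof.
move=> zy y0; apply/ler_addgt0Pr => e e0.
set a := fine (mu _).
have a1 : a <= 1 by rewrite -lee_fin fineK ?fin_num_measure // probability_le1.
have a0 : 0 <= a by rewrite fine_ge0.
have n_0 : 0 < n%:R :> R by rewrite ltr0n.
pose eta := Num.min 1 (e / 2 / n%:R).
have eta0 : 0 < eta by rewrite lt_min ltr01 !divr_gt0.
have eta1 : eta <= 1 by rewrite ge_min lexx.
have etan : n%:R * eta <= e / 2.
  by rewrite mulrC -ler_pdivlMr // ge_min lexx orbT.
have [N /andP[N1 N2]] := residual_mass eta0.
have pi0 v : 0 <= residual_law S0 n v.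
  apply: divr_ge0; first exact: fine_ge0.
  by apply: le_trans (mean_service_ge n hS0 hES); exact: ler0n.
have [t0 Ht0] := @Ex_eventually R N (residual_law S0 n) n (fun=> a - e / 2)
  (fun tau rs => fine (P (queue_exceeds A S n tau z lam rs))) pi0
  (fun rs rsn => queue_exceeds_limit rsn zy y0 (divr_gt0 e0 (ltr0Sn _ 1))).
have := Ht0 (maxn t0 N) (leq_maxl _ _).
have := bound (leqW (leq_maxr t0 N)).
set E := Ex _ _ _ _ => Eb.
rewrite Ex_const_mass.
set s := (\sum_(v < N) _) ^+ n => Hs.
have s1 : s <= 1 by rewrite exprn_ile1 // (le_trans _ N1) // subr_ge0.
have s2 : 1 - n%:R * eta <= s.
  apply: le_trans (bernoulli_le n (ltW eta0) eta1) _.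
  by apply: lerXn2r; rewrite ?nnegrE ?subr_ge0 // (le_trans _ N1) // subr_ge0.
have s0 : 0 <= s by rewrite exprn_ge0 // (le_trans _ N1) // subr_ge0.
have : a * (1 - s) <= 1 - s by rewrite ler_piMl // subr_ge0.
have : e / 2 * s <= e / 2 by rewrite ler_piMr // divr_ge0 // ltW.
lra.
Qed.

End stationary_upper_bound.

Lemma near_powR (R : realType) (r M : R) : 0 < r -> \forall n \near \oo, M <= n%:R `^ r.
Proof.
move=> r0; exists (Num.truncn (`|M| `^ r^-1)).+1 => // n /= Mn.
apply: (le_trans (ler_norm M)); have -> : `|M| = (`|M| `^ r^-1) `^ r.
  by rewrite -powRrM mulVf ?gt_eqF // powRr1.
apply: ge0_ler_powR; rewrite ?nnegrE ?powR_ge0 ?(ltW r0) //.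
by apply/ltW/(lt_le_trans (truncnS_gt _)); rewrite ler_nat.
Qed.

(** * Orders of magnitude as n grows *)

Section upper_asymptotics.
Context {R : realType}.
Variables (alpha B : R).
Hypotheses (a1 : 1 < alpha) (a2 : alpha < 2) (B0 : 0 < B).

Let nu (n : nat) : R := n%:R `^ alpha^-1.

Lemma near_nu M : \forall n \near \oo, M <= nu n.
Proof. by apply: near_powR; rewrite invr_gt0 (lt_trans ltr01). Qed.

Lemma near_nu_small M : \forall n \near \oo, M * nu n <= n%:R.
Proof.
have ai : alpha^-1 < 1 by rewrite invf_lt1 // (lt_trans ltr01).
have r0 : 0 < 1 - alpha^-1 by rewrite subr_gt0.
near=> n.
have n0 : 0 < n%:R :> R by rewrite ltr0n; near: n; exists 1%N.
have -> : n%:R = n%:R `^ (1 - alpha^-1) * nu n.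
  by rewrite /nu -powRD ?subrK ?powRr1 ?ltW //; apply/implyP => _; rewrite gt_eqF.
rewrite ler_wpM2r ?powR_ge0 //; near: n; exact: near_powR.
Unshelve. all: by end_near. Qed.

Lemma near_nu_sqrt M : \forall n \near \oo, M <= nu n / Num.sqrt n%:R.
Proof.
have r0 : 0 < alpha^-1 - 2^-1.
  by rewrite subr_gt0 ltf_pV2 ?posrE // (lt_trans ltr01).
near=> n.
have n0 : 0 < n%:R :> R by rewrite ltr0n; near: n; exists 1%N.
have -> : nu n / Num.sqrt n%:R = n%:R `^ (alpha^-1 - 2^-1).
  by rewrite -powR12_sqrt ?ltW // -powRN -powRD //; apply/implyP => _; rewrite gt_eqF.
near: n; exact: near_powR.
Unshelve. all: by end_near. Qed.

Lemma near_sqrt_inv (b : R) : 0 < b -> \forall n \near \oo, (Num.sqrt (n%:R : R))^-1 <= b.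
Proof.
move=> b0; near=> n.
have n0 : 0 < n%:R :> R by rewrite ltr0n; near: n; exists 1%N.
rewrite -[leRHS]invrK lef_pV2 ?posrE ?sqrtr_gt0 ?invr_gt0 //.
rewrite -powR12_sqrt ?(ltW n0) //; near: n; by apply: near_powR; rewrite invr_gt0.
Unshelve. all: by end_near. Qed.

(** [n ^ (1 / alpha) / sqrt n] is a positive power of [n]; its square root already dominates [ln n],
    so the product of two such roots beats it. *)
Lemma near_starvation_small (c0 c e : R) : 0 < c -> 0 < e -> \forall n \near \oo,
  expR (c0 - (c * nu n / Num.sqrt n%:R - 2) * ln 2) * (n%:R + 1) <= e.
Proof.
move=> c_0 e0; pose b := alpha^-1 - 2^-1.
have b0 : 0 < b by rewrite subr_gt0 ltf_pV2 ?posrE // (lt_trans ltr01).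
have l2 : 0 < ln 2 :> R by rewrite ln_gt0 //; lra.
pose K := `|c0 + 2 * ln 2 + ln 2 - ln e| + 2 / b.
near=> n.
have n1 : 1 <= n%:R :> R by rewrite ler1n; near: n; exists 1%N.
have n0 : 0 < n%:R :> R by lra.
have Y1 : 1 <= n%:R `^ (b / 2) by near: n; apply: near_powR; rewrite divr_gt0.
have YK : K / (c * ln 2) <= n%:R `^ (b / 2) by near: n; apply: near_powR; rewrite divr_gt0.
have YE : nu n / Num.sqrt n%:R = n%:R `^ (b / 2) * n%:R `^ (b / 2).
  rewrite -powRD; last by apply/implyP => _; rewrite gt_eqF.
  rewrite -powR12_sqrt ?ltW // -powRN -powRD; last by apply/implyP => _; rewrite gt_eqF.
  have -> : b / 2 + b / 2 = b by field.
  by [].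
have lnn : ln n%:R <= 2 / b * n%:R `^ (b / 2).
  have -> : ln n%:R = 2 / b * ln (n%:R `^ (b / 2)).
    by rewrite ln_powR mulrA (_ : 2 / b * (b / 2) = 1) ?mul1r //; field; rewrite gt_eqF.
  by rewrite ler_wpM2l ?divr_ge0 ?(ltW b0) // ltW // ln_sublinear // powR_gt0.
have n10 : 0 < n%:R + 1 :> R by rewrite addr_gt0.
rewrite -[X in _ * X](@lnK _ (n%:R + 1)) ?posrE //.
rewrite -expRD -[leRHS]lnK ?posrE // ler_expR -mulrA YE.
have l2n : ln (n%:R + 1) <= ln 2 + ln n%:R :> R.
  by rewrite -lnM ?posrE // ler_ln ?posrE ?addr_gt0 ?mulr_gt0 //; lra.
have := ler_norm (c0 + 2 * ln 2 + ln 2 - ln e).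
move: YK lnn; rewrite /K ler_pdivrMr ?mulr_gt0 //.
move: (n%:R `^ (b / 2)) Y1 (ln (n%:R + 1)) l2n (2 / b) (divr_gt0 (ltr0Sn R 1) b0) => Y Y1 L Ln q q0 H1 H2 H3.
have : `|c0 + 2 * ln 2 + ln 2 - ln e| <= `|c0 + 2 * ln 2 + ln 2 - ln e| * Y by rewrite ler_peMr.
have := ler_wpM2r (le_trans ler01 Y1) H1.
move: `|_| H3 => a H3; lra.
Unshelve. all: by end_near. Qed.

(* The load condition behind the Lundberg exponent: with s = theta' * rate / lam,
   theta' - s + K s^alpha < 0 as soon as K theta^(alpha-1) < B - 2 delta. *)
Lemma near_load (theta delta K : R) : 0 < theta -> 0 < delta -> 0 < K ->
  K * theta `^ (alpha - 1) + 2 * delta < B ->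
  \forall n \near \oo, forall M lam th s, n%:R <= M -> M <= n%:R + 1 ->
  lam = n%:R - B * nu n -> th = theta / nu n ->
  s = th * ((n%:R - delta * nu n) / (n%:R^-1 * M)) / lam ->
  [/\ 0 < lam, 0 < s, s <= 2 * th & th - s + K * s `^ alpha < 0].
Proof.
move=> th0 d0 K0 load; pose Q := K * theta `^ (alpha - 1).
have Q0 : 0 < Q by rewrite mulr_gt0 // powR_gt0.
pose r := (B - 2 * delta) / Q.
have r1 : 1 < r by rewrite ltr_pdivlMr // mul1r; move: load; rewrite -/Q; lra.
(* Chosen so that [rho < q] yields [rho ^ alpha < r]. *)
pose q := r `^ alpha^-1.
have ai0 : 0 < alpha^-1 by rewrite invr_gt0 (lt_trans ltr01).
have q1 : 1 < q.
  by rewrite /q /powR gt_eqF ?(lt_trans ltr01) // expR_gt1 mulr_gt0 // ln_gt0.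
near=> n.
have n_0 : (0 < n)%N by near: n; exists 1%N.
have n0 : 0 < n%:R :> R by rewrite ltr0n.
have nu0 : 0 < nu n by rewrite powR_gt0.
have c1 : 2 * B * nu n <= n%:R by near: n; exact: near_nu_small.
have c2 : 2 * delta * nu n <= n%:R by near: n; exact: near_nu_small.
have c3 : delta^-1 <= nu n by near: n; exact: near_nu.
have c3' : B^-1 <= nu n by near: n; exact: near_nu.
have c4 : 2 * q * B / (q - 1) * nu n <= n%:R by near: n; exact: near_nu_small.
move=> M lam th s nM Mn lamE thE sE'.
have lam0 : 0 < lam by rewrite lamE; nra.
have lamn : n%:R <= 2 * lam by rewrite lamE; nra.
have th_0 : 0 < th by rewrite thE divr_gt0.
have M0 : 0 < M by lra.
pose rho := (n%:R - delta * nu n) * n%:R / (M * lam).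
have sE : s = th * rho by rewrite sE' /rho; field; rewrite !gt_eqF.
have Ml : 0 < M * lam by rewrite mulr_gt0.
have nd : 0 < n%:R - delta * nu n by nra.
have rho0 : 0 < rho by rewrite divr_gt0 // mulr_gt0.
have rholam : rho <= n%:R / lam.
  rewrite /rho invfM mulrA ler_wpM2r ?invr_ge0 ?(ltW lam0) // ler_pdivrMr //.
  apply: (@le_trans _ _ (n%:R * n%:R)); last by rewrite ler_wpM2l // ltW.
  by rewrite ler_wpM2r ?(ltW n0) // gerBl mulr_ge0 // ltW.
have rho2 : rho <= 2 by apply: le_trans rholam _; rewrite ler_pdivrMr.
have rhoq : rho < q.
  apply: le_lt_trans rholam _; rewrite ltr_pdivrMr // lamE.
  have q10 : 0 < q - 1 by rewrite subr_gt0.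
  have : 2 * (q * B * nu n) <= (q - 1) * n%:R.
    have -> : 2 * (q * B * nu n) = (q - 1) * (2 * q * B / (q - 1) * nu n) by field; rewrite gt_eqF.
    by rewrite ler_wpM2l // ltW.
  have : 0 < q * B * nu n by rewrite !mulr_gt0 // (lt_trans ltr01).
  by lra.
have dn : 1 <= delta * nu n by rewrite -ler_pdivrMl // mulr1.
have Bn : 1 <= B * nu n by rewrite -ler_pdivrMl // mulr1.
have B2 : 0 < B - 2 * delta by move: load Q0; rewrite -/Q; lra.
(* The arrival slack [B * nu] minus the deficiency [delta * nu] of the starts; the second
   [delta * nu] pays for [M] being up to one more than [n]. *)
have rho1 : (B - 2 * delta) * (nu n / n%:R) <= rho - 1.
  rewrite lerBrDr /rho ler_pdivlMr //.
  have H1 : M * lam <= n%:R * n%:R - (B * nu n - 1) * n%:R.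
    apply: (@le_trans _ _ ((n%:R + 1) * lam)); first by rewrite ler_wpM2r // ltW.
    by rewrite lamE; nra.
  have H2 : M * lam <= n%:R * n%:R by nra.
  have H3 : (B - 2 * delta) * (nu n / n%:R) * (M * lam) <= (B - 2 * delta) * nu n * n%:R.
    have -> : (B - 2 * delta) * (nu n / n%:R) * (M * lam) = (B - 2 * delta) * nu n * (M * lam / n%:R) by ring.
    rewrite ler_wpM2l ?mulr_ge0 ?(ltW B2) ?(ltW nu0) // ler_pdivrMr //.
  rewrite mulrDl mul1r.
  have H4 : n%:R <= delta * nu n * n%:R by rewrite ler_peMl // ltW.
  by move: H1 H3 H4; move: (M * lam) ((B - 2 * delta) * (nu n / n%:R) * (M * lam)) => x y; nra.
split => //.
- by rewrite sE mulr_gt0.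
- by rewrite sE mulrC ler_wpM2r // ltW.
have nuE : nu n `^ (alpha - 1) = n%:R / nu n.
  have nuA : nu n `^ alpha = n%:R.
    by rewrite /nu -powRrM mulVf ?powRr1 ?(ltW n0) // gt_eqF // (lt_trans ltr01).
  by rewrite powRB ?gt_eqF ?implybT // nuA powRr1 // ltW.
have sa : K * s `^ alpha = th * (Q * (nu n / n%:R)) * rho `^ alpha.
  rewrite sE powRM ?(ltW th_0) ?(ltW rho0) // !mulrA; congr (_ * _).
  have -> : th `^ alpha = th * th `^ (alpha - 1).
    rewrite -{2}(powRr1 (ltW th_0)) -powRD; first by rewrite addrC subrK.
    by apply/implyP => _; rewrite gt_eqF.
  have -> : th `^ (alpha - 1) = theta `^ (alpha - 1) * (nu n / n%:R).
    rewrite thE powRM ?(ltW th0) ?invr_ge0 ?(ltW nu0) //; congr (_ * _).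
    rewrite -powR_inv1 ?(ltW nu0) // -powRrM mulrC powRrM nuE powR_inv1 ?invf_div //.
    by rewrite divr_ge0 // ltW.
  by rewrite /Q; ring.
have ra : rho `^ alpha < r.
  have -> : r = q `^ alpha.
    by rewrite /q -powRrM mulVf ?powRr1 // ?gt_eqF // ?(lt_trans ltr01) // ltW // (lt_trans ltr01).
  apply: gt0_ltr_powR; rewrite ?nnegrE ?(ltW rho0) ?(lt_trans ltr01) // ltW // (lt_trans ltr01) //.
rewrite sa sE.
have -> : th - th * rho + th * (Q * (nu n / n%:R)) * rho `^ alpha =
  - (th * (rho - 1 - Q * (nu n / n%:R) * rho `^ alpha)) by ring.
rewrite oppr_lt0 mulr_gt0 // subr_gt0; apply: lt_le_trans rho1.
have -> : B - 2 * delta = Q * r by rewrite /r [RHS]mulrC divfK // gt_eqF.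
have -> : Q * r * (nu n / n%:R) = Q * (nu n / n%:R) * r by ring.
by rewrite ltr_pM2l // mulr_gt0 // divr_gt0.
Unshelve. all: by end_near. Qed.

End upper_asymptotics.

Lemma scaled_tailE (R : realType) (alpha x : R) n (mu : probability R R) : (0 < n)%N -> 0 <= x ->
  scaled_tail alpha n mu x = mu `]n%:R + x * n%:R `^ alpha^-1, +oo[%classic.
Proof.
move=> n0 x0; rewrite /scaled_tail; congr (mu _); apply/seteqP.
have nu0 : 0 < n%:R `^ alpha^-1 :> R by rewrite powR_gt0 // ltr0n.
have E q : (x < n%:R `^ (- alpha^-1) * queue_length n q) = (x * n%:R `^ alpha^-1 < queue_length n q).
  by rewrite powRN [in LHS]mulrC ltr_pdivlMr.
split => q /=; rewrite in_itv /= andbT E /queue_length.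
  by rewrite lt_max => /orP[|H]; [lra | have := mulr_ge0 x0 (ltW nu0); lra].
by rewrite lt_max => H; apply/orP; left; lra.
Qed.

(** * Asymptotic upper bound for the scaled tail *)

Section upper_tail.
Context d0 d (Omega0 : measurableType d0) (Omega : measurableType d) (R : realType).
Variables (P0 : probability Omega0 R) (P : probability Omega R).
Variables (A0 S0 : {RV P0 >-> R}) (A S : nat -> {RV P >-> R}).
Hypotheses (hA0 : forall w, 0 <= A0 w) (hS0 : forall w, 0 <= S0 w)
  (hAS : GI_primitives A0 S0 A S) (hEA : ('E_P0[A0] = 1)%E) (hES : ('E_P0[S0] = 1)%E).
Variables (alpha C_A B eps mom : R) (Q : nat -> probability R R).
Hypotheses (a1 : 1 < alpha) (a2 : alpha < 2) (CA0 : 0 < C_A) (B0 : 0 < B).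
Hypothesis tailA : ((x `^ alpha)%:E * P0 [set w | (x < A0 w)%R])%E @[x --> +oo] --> C_A%:E.
Hypotheses (eps0 : 0 < eps) (eps1 : eps <= 1)
  (moment : (\int[P0]_w (S0 w `^ (1 + eps))%:E = mom%:E)%E).
Hypothesis stat : \forall n \near \oo, steady_state_Q A S B alpha n (Q n).
Let kappa := C_A * (alpha * Gamma (- alpha)).

Theorem upper_tail (theta : R) : 0 < theta -> kappa * theta `^ (alpha - 1) < B ->
  exists c : R, forall x e, 0 < x -> 0 < e -> \forall n \near \oo,
    (scaled_tail alpha n (Q n) x <= (expR (- theta * (x - c)) + e)%:E)%E.
Proof.
move=> th0 load.
have k0 : 0 < kappa by rewrite mulr_gt0 //; exact: (laplace_int_Gamma a1 a2).2.
(* A quarter of the gap: one share for the Laplace error [e1], two for [near_load], and one to keep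
   the inequality strict. *)
pose delta := (B - kappa * theta `^ (alpha - 1)) / 4.
have d_0 : 0 < delta by rewrite divr_gt0 // subr_gt0.
have tp0 : 0 < theta `^ (alpha - 1) by rewrite powR_gt0.
pose e1 := delta / theta `^ (alpha - 1).
have e10 : 0 < e1 by rewrite divr_gt0.
pose K := kappa + e1.
have K0 : 0 < K by rewrite addr_gt0.
have KB : K * theta `^ (alpha - 1) + 2 * delta < B.
  have d4 : delta * 4 = B - kappa * theta `^ (alpha - 1) by rewrite divfK.
  by rewrite /K mulrDl /e1 divfK ?gt_eqF //; lra.
have [s0 s00 Hs0] := laplace_asymptotics hA0 hEA a1 a2 CA0 tailA e10.
have mom0 : 0 <= mom by rewrite -lee_fin -moment; apply: integral_ge0 => w _; rewrite lee_fin powR_ge0.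
pose c1 : R := 2 + (4 * mom) `^ eps^-1.
have c12 : 2 <= c1 by rewrite lerDl powR_ge0.
have c10 : 0 < c1 by lra.
have c1c0 : 2 * mom * c1 `^ (- eps) <= 2^-1.
  rewrite powRN ler_pdivrMr ?powR_gt0 // -ler_pdivrMl ?invr_gt0 // invrK mulrA.
  have -> : 2 * 2 * mom = ((4 * mom) `^ eps^-1) `^ eps.
    by rewrite -powRrM mulVf ?gt_eqF // powRr1 ?mulr_ge0 //; ring.
  by apply: ge0_ler_powR; rewrite ?nnegrE ?powR_ge0 ?(ltW eps0) ?(ltW c10) // lerDr.
exists (2 * delta) => x e x0 e0.
pose nu (m : nat) : R := m%:R `^ alpha^-1.
near=> n.
have n_0 : (0 < n)%N by near: n; exists 1%N.
have n0 : 0 < n%:R :> R by rewrite ltr0n.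
have st : steady_state_Q A S B alpha n (Q n) by near: n; exact: stat.
have nu0 : 0 < nu n by rewrite powR_gt0.
have Hload : forall M lam th s, n%:R <= M -> M <= n%:R + 1 ->
  lam = n%:R - B * nu n -> th = theta / nu n ->
  s = th * ((n%:R - delta * nu n) / (n%:R^-1 * M)) / lam ->
  [/\ 0 < lam, 0 < s, s <= 2 * th & th - s + K * s `^ alpha < 0].
  by near: n; exact: near_load.
have deln : delta * nu n <= n%:R by near: n; exact: near_nu_small.
have rtb : (Num.sqrt (n%:R : R))^-1 <= eps / 2 / 2 by near: n; apply: near_sqrt_inv; rewrite !divr_gt0.
have P2 : 2 / delta <= nu n / Num.sqrt n%:R by near: n; exact: near_nu_sqrt.
have GFe : expR (starvation_const c1 eps - (delta * nu n / Num.sqrt n%:R - 2) * ln 2) * (n%:R + 1) <= e.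
  by near: n; exact: near_starvation_small.
have nus : 2 * theta / s0 + 1 <= nu n by near: n; exact: near_nu.
have nux : 2 / x <= nu n by near: n; exact: near_nu.
have nud : 3 / delta <= nu n by near: n; exact: near_nu.
pose M1 := mean_service S0 n.
have M1n : n%:R <= M1 := mean_service_ge n hS0 hES.
have M1n1 : M1 <= n%:R + 1 := mean_service_le n hS0 hES.
have M10 : 0 < M1 by lra.
pose lam := arrival_rate B alpha n; pose th := theta / nu n.
have th_0 : 0 < th by rewrite divr_gt0.
pose s := th * start_rate S0 n (delta * nu n) / lam.
have [lam0 s_0 sth sK] := Hload M1 lam th s M1n M1n1 erefl erefl erefl.
have ss0 : s < s0.
  have : 2 * theta / s0 < nu n by lra.
  rewrite ltr_pdivrMr // => H; apply: le_lt_trans sth _.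
  have -> : 2 * th = 2 * theta / nu n by rewrite /th mulrA.
  by rewrite ltr_pdivrMr // [ltRHS]mulrC.
have lund : expR th * laplace A0 s < 1.
  have /andP[_ H] := Hs0 _ s_0 ss0.
  apply: (@le_lt_trans _ _ (expR th * expR (- s + K * s `^ alpha))).
    rewrite ler_wpM2l ?expR_ge0 //; apply: le_trans (expR_ge1Dx _).
    by move: H; rewrite -/kappa -/K; lra.
  by rewrite -expRD -[ltRHS]expR0 ltr_expR; lra.
have dn0 : 0 < delta * nu n by rewrite mulr_gt0.
have P2' : 2 <= delta * nu n / Num.sqrt n%:R.
  by move: P2; rewrite ler_pdivrMr // mulrC mulrA.
have xnu : 2 <= x * nu n by move: nux; rewrite ler_pdivrMr // mulrC.
(* One below the integer part, which leaves a unit interval under [n + x * nu] in which to find a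
   point without mass. *)
pose z := (Num.truncn (x * nu n)).-1.
have /andP[t1 t2] : (Num.truncn (x * nu n))%:R <= x * nu n < (Num.truncn (x * nu n)).+1%:R.
  by rewrite truncn_itv //; lra.
have zE : (Num.truncn (x * nu n)) = z.+1.
  by rewrite /z prednK // truncn_gt0; lra.
rewrite zE in t1 t2.
have nz : (n + z)%:R < (n + z)%:R + 1 :> R by lra.
have [y /andP[y1 y2] y0] := exists_nonatom (Q n) nz.
have bound N tau : (N <= tau.+1)%N -> Ex N (residual_law S0 n) n
    (fun rs => fine (P (queue_exceeds A S n tau z lam rs))) <=
    expR (- th * (z%:R - delta * nu n - start_rate S0 n (delta * nu n) * n%:R^-1)) +
    expR (starvation_const c1 eps - (delta * nu n / Num.sqrt n%:R - 2) * ln 2) * M1.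
  move=> Nt; exact: (@queue_exceeds_le _ _ _ _ _ P0 P A0 S0 A S hA0 hS0 hAS hEA hES n N tau z lam
    (delta * nu n) th eps mom c1).
have := stationary_tail_le hS0 hES n_0 st eps0 eps1 moment bound y1 y0.
set b := _ + _ => muy.
rewrite scaled_tailE ?(ltW x0) //.
apply: (@le_trans _ _ (Q n `]y, +oo[%classic)).
  apply: le_measure; rewrite ?inE; [exact: measurable_itv|exact: measurable_itv|].
  move=> q /=; rewrite !in_itv /= !andbT; apply: le_lt_trans.
  by apply: le_trans y2 _; rewrite natrD -addrA lerD2l -/(nu n) natr1.
rewrite -[leLHS]fineK ?fin_num_measure ?lee_fin; last exact: measurable_itv.
apply: le_trans muy _; rewrite /b; apply: lerD; last first.
  by apply: le_trans GFe; rewrite ler_wpM2l ?expR_ge0.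
rewrite ler_expR !mulNr lerN2.
have sr1 : start_rate S0 n (delta * nu n) * n%:R^-1 <= 1.
  have -> : start_rate S0 n (delta * nu n) * n%:R^-1 = (n%:R - delta * nu n) / M1.
    by rewrite /start_rate -/M1; field; rewrite !gt_eqF.
  by rewrite ler_pdivrMr // mul1r; lra.
have -> : theta * (x - 2 * delta) = th * (x * nu n - 2 * delta * nu n).
  by rewrite /th; field; rewrite gt_eqF.
rewrite ler_wpM2l ?(ltW th_0) //.
(* Up to two units are lost in [z] and one in the start rate. *)
have : 3 <= delta * nu n by move: nud; rewrite ler_pdivrMr // mulrC.
move: t2; rewrite -!natr1; lra.
Unshelve. all: by end_near. Qed.

End upper_tail.

(** * Crowding of an empty system by quick arrivals *)

Lemma quickP m w eta u l : quick m w eta u l -> exists j, [/\ (j < size l)%N,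
  (sumn (take j l) <= u)%N, (u < sumn (take j.+1 l) <= u + eta)%N &
  (sumn (take m (drop j.+1 l)) <= w)%N].
Proof.
elim: l u => [//|v l IH] u /=; case: (leqP v u) => vu.
  move=> /IH[j [jl H1 /andP[H2 H3] H4]]; exists j.+1; split => //=; [lia|].
  by move: H2 H3; rewrite /=; lia.
move=> /andP[H1 H2]; exists 0%N; split => //=; last by rewrite drop0.
by rewrite take0 /=; lia.
Qed.

Lemma chernoff_sumn (R : realType) C (p : nat -> R) J u c : (forall v, 0 <= p v) -> 0 <= c ->
  Ex C p J (fun l => (sumn l <= u)%N%:R) <=
  expR (c * u%:R) * (\sum_(v < C) p v * expR (- (c * v%:R))) ^+ J.
Proof.
move=> p0 c0; rewrite -(@Ex_prod _ C p J (fun v => expR (- (c * v%:R)))) -Ex_scale.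
apply: Ex_le => // l _.
have -> : \prod_(v <- l) expR (- (c * v%:R)) = expR (- (c * (sumn l)%:R)).
  elim: l => [|v l IH]; first by rewrite big_nil /= mulr0 oppr0 expR0.
  by rewrite big_cons IH -expRD /= natrD; congr expR; ring.
rewrite -expRD; case: (leqP (sumn l) u) => [lu|_]; last exact: expR_ge0.
by rewrite -[leLHS]expR0 ler_expR subr_ge0 ler_wpM2l // ler_nat.
Qed.

Lemma exprD_le (R : realType) (a x : R) m : 0 <= a -> 0 <= x -> x <= 1 ->
  (a + x) ^+ m <= a ^+ m + x * (m%:R * (a + 1) ^+ m).
Proof.
move=> a0 x0 x1; elim: m => [|m IH]; first by rewrite !expr0 mul0r mulr0 addr0.
rewrite !exprS; apply: (@le_trans _ _ ((a + x) * (a ^+ m + x * (m%:R * (a + 1) ^+ m)))).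
  by rewrite ler_wpM2l // addr_ge0.
have H1 : a ^+ m <= (a + 1) ^+ m by apply: lerXn2r; rewrite ?nnegrE ?addr_ge0 //; lra.
have H0 : 0 <= a ^+ m by rewrite exprn_ge0.
have H2 : (a + 1) ^+ m <= (a + 1) * (a + 1) ^+ m by rewrite ler_peMl ?exprn_ge0 ?addr_ge0 //; lra.
rewrite -natr1; move: (a ^+ m) ((a + 1) ^+ m) H0 H1 H2 => A E A0 AE EE.
have m0 : 0 <= m%:R :> R by [].
have K1 : x * A <= x * ((a + 1) * E) by rewrite ler_wpM2l // (le_trans AE).
have K2 : (a + x) * (x * (m%:R * E)) <= (a + 1) * (x * (m%:R * E)).
  by rewrite ler_wpM2r ?lerD2l // !mulr_ge0 // (le_trans A0).
lra.
Qed.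

Section pathwise_crowd.
Context {R : realType}.
Variables (n k z J u eta w N : nat) (hA t : R) (T V : nat -> R) (DT : nat -> nat).
Let c : initial_condition R := InitialCondition 0 [::] 0%N.
Let m := (n * k + (n + z))%N.
Let l := map DT (iota 0 N).
Hypotheses (n0 : (0 < n)%N) (hA0 : 0 < hA) (T0 : forall j, 0 <= T j) (V1 : forall j, V j = 1).
Hypotheses (lo : forall i, hA * (DT i)%:R <= T i + hA)
  (hi : forall i, (i < J + m)%N -> T i <= hA * (DT i)%:R) (JN : (J + m <= N)%N).

(** The first arrival past [u] falls within the last [k + 1] units of time, and the next [m]
    arrivals are in by [t]. The condition on [J] bounds the index of that arrival, hence the
    rounding accumulated before it. *)
Lemma crowd_lattice : quick m w eta u l -> (u < sumn (take J l))%N ->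
  t - k.+1%:R < hA * (u.+1%:R - J%:R) -> hA * (u + eta + w)%:R <= t ->
  ((n + z).+1%:R%:E <= number_in_system n c T V t)%E.
Proof.
move=> /quickP[j [jl H1 /andP[H2 H3] H4]] uJ tk tle.
have cn : admissible n c by rewrite /admissible /= lexx.
have jJ : (j.+1 <= J)%N.
  rewrite leqNgt; apply/negP => Jj; have := sumn_take_le l (Jj : (J <= j)%N).
  by clear -uJ H1; lia.
have arrE i : arrival c T i = \sum_(0 <= i < i) T i by rewrite /arrival /= subn0 add0r.
have takeE i : (i <= N)%N -> (sumn (take i l))%:R = \sum_(0 <= i < i) (DT i)%:R :> R.
  by move=> iN; rewrite /l -map_take take_iota (minn_idPl iN) -natr_sum sumnE big_map /index_iota subn0.
apply: (@crowded R n c T V n0 cn T0 V1 t j.+1 k (n + z)).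
  apply: lt_le_trans tk _; rewrite arrE.
  apply: (@le_trans _ _ (\sum_(0 <= i < j.+1) (hA * (DT i)%:R - hA))); last first.
    by apply: ler_sum => i _; rewrite lerBlDr.
  rewrite big_split /= -mulr_sumr -takeE; last by clear -jJ JN; lia.
  rewrite sumrN sumr_const_nat subn0 -[hA *+ _]mulr_natr -mulrBr ler_wpM2l ?(ltW hA0) //.
  by apply: lerB; rewrite ler_nat.
apply: le_trans tle; rewrite arrE.
have -> : (j.+1 + n * k + (n + z) = j.+1 + m)%N by rewrite /m !addnA.
apply: (@le_trans _ _ (\sum_(0 <= i < j.+1 + m) hA * (DT i)%:R)).
  rewrite !big_nat; apply: ler_sum => i /andP[_ im]; apply: hi.
  by clear -im jJ; lia.
rewrite -mulr_sumr -takeE; last by clear -jJ JN; lia.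
rewrite ler_wpM2l ?(ltW hA0) // ler_nat takeD sumn_cat.
exact: leq_add.
Qed.

End pathwise_crowd.

(** * Interarrival times rounded up *)

Section lattice_up.
Context d0 (Omega0 : measurableType d0) (R : realType) (P0 : probability Omega0 R).
Variable A0 : {RV P0 >-> R}.
Hypotheses (hA0 : forall w, 0 <= A0 w) (hEA : ('E_P0[A0] = 1)%E).
Variables (r : R) (C : nat).
Hypotheses (r0 : 0 < r) (C0 : (0 < C)%N).

(** Opposite to [round_down]: a lower bound on the queue must not place arrivals too early. *)
Definition ceil_lattice (x : R) : nat := minn (Num.truncn (x / r)).+1 C.
Let D := ceil_lattice.

Lemma ceil_lattice_mono x y : x <= y -> (D x <= D y)%N.
Proof.
move=> xy; rewrite /D /ceil_lattice leq_min geq_minr andbT (leq_trans (geq_minl _ _)) // ltnS.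
by rewrite le_truncn // ler_wpM2r // invr_ge0 ltW.
Qed.

Lemma ceil_lattice_lt x : (D x < C.+1)%N.
Proof. by rewrite ltnS geq_minr. Qed.

Let p := discrete_law A0 D.

Lemma ceil_lattice_hi x : 0 <= x -> r * (D x)%:R <= x + r.
Proof.
move=> x0; have xr : 0 <= x / r by rewrite divr_ge0 // ltW.
apply: (@le_trans _ _ (r * (Num.truncn (x / r)).+1%:R)).
  by rewrite ler_wpM2l ?(ltW r0) // ler_nat geq_minl.
have /andP[H _] := truncn_itv xr; rewrite ler_pdivlMr // in H.
by rewrite -natr1; lra.
Qed.

Lemma ceil_lattice_lo x : x < r * C%:R -> x <= r * (D x)%:R.
Proof.
move=> xC; rewrite /D /ceil_lattice (minn_idPl _).
  by have := truncnS_gt (x / r); rewrite ltr_pdivrMr // => /ltW; rewrite mulrC.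
rewrite -[C](prednK C0) ltnS truncn_le_nat prednK // ltr_pdivrMr // mulrC //.
Qed.

Lemma ceil_law0 : p 0%N = 0.
Proof.
rewrite /p /discrete_law (_ : _ @^-1` _ = set0) ?measure0 //.
by rewrite -subset0 => w /=; rewrite /D /ceil_lattice; case: (C) C0 => // C' _; rewrite minnSS.
Qed.

Lemma ceil_laplace_ge s : 0 <= s -> expR (- (s * r)) * laplace A0 s <=
  \sum_(v < C.+1) p v * expR (- (s * r * v%:R)).
Proof.
move=> s0; rewrite -lee_fin EFinM -laplaceE //.
have mE := measurable_expRA A0 s.
rewrite -ge0_integralZl; [|exact: measurableT|exact: mE|by move=> w _; rewrite lee_fin expR_ge0|by rewrite lee_fin expR_ge0].
rewrite -(@sum_discrete_law _ _ _ P0 A0 _ _ ceil_lattice_mono ceil_lattice_lt (fun v => expR (- (s * r * v%:R)))); last first.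
  by move=> v; exact: expR_ge0.
apply: ge0_le_integral; [exact: measurableT| | | | ].
- by move=> w _; rewrite -EFinM lee_fin mulr_ge0 ?expR_ge0.
- by apply: measurable_funeM; exact: mE.
- apply/measurable_EFinP; apply: (measurableT_comp (f := fun x : R => expR (- (s * r * x)))).
    by apply: continuous_measurable_fun; exact: continuous_expRMN.
  rewrite (_ : (fun w => _) = (fun x => (D x)%:R) \o A0) //.
  apply: measurableT_comp; last exact: measurable_funPT.
  by apply: nondecreasing_measurable => // x y xy; rewrite ler_nat ceil_lattice_mono.
move=> w _; rewrite -EFinM lee_fin -expRD ler_expR.
have := ceil_lattice_hi (hA0 w); rewrite -/D; move: (D (A0 w))%:R => v H.
have := ler_wpM2l s0 H; lra.
Qed.

Lemma ceil_laplace_le s : 0 <= s ->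
  \sum_(v < C.+1) p v * expR (- (s * r * v%:R)) <= laplace A0 s + (C%:R * r)^-1.
Proof.
move=> s0; have Cr : 0 < C%:R * r by rewrite mulr_gt0 // ltr0n.
have mA0 : measurable_fun setT A0 by exact: measurable_funPT.
have mE := measurable_expRA A0 s.
have mg2 : measurable_fun setT (fun w => (C%:R * r)^-1 * A0 w) by exact: measurable_funM.
have g20 w : 0 <= (C%:R * r)^-1 * A0 w by rewrite mulr_ge0 // invr_ge0 ltW.
have I : (\int[P0]_w (expR (- (s * A0 w)) + (C%:R * r)^-1 * A0 w)%:E = (laplace A0 s + (C%:R * r)^-1)%:E)%E.
  under eq_integral do rewrite EFinD.
  rewrite ge0_integralD; [|exact: measurableT|by move=> w _; rewrite lee_fin expR_ge0|exact: mE|by move=> w _; rewrite lee_fin|exact/measurable_EFinP].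
  rewrite EFinD laplaceE //; congr (_ + _)%E.
  under eq_integral do rewrite EFinM.
  rewrite ge0_integralZl; [|exact: measurableT|exact/measurable_EFinP|by move=> w _; rewrite lee_fin|by rewrite lee_fin invr_ge0 ltW].
  by move: hEA; rewrite expectation_def => ->; rewrite mule1.
rewrite -lee_fin -I.
apply: (@sum_discrete_law_le _ _ _ P0 A0 _ _ ceil_lattice_mono ceil_lattice_lt
  (fun v => expR (- (s * r * v%:R))) (fun w => expR (- (s * A0 w)) + (C%:R * r)^-1 * A0 w)) => [v||w].
- exact: expR_ge0.
- by apply: measurable_funD => //; apply/measurable_EFinP.
have [AC|AC] := ltP (A0 w) (r * C%:R).
  apply: (@le_trans _ _ (expR (- (s * A0 w)))); last by rewrite lerDl.
  by rewrite ler_expR lerN2 -mulrA ler_wpM2l // ceil_lattice_lo.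
apply: (@le_trans _ _ 1); last first.
  apply: (@le_trans _ _ ((C%:R * r)^-1 * A0 w)); last by rewrite lerDr expR_ge0.
  by rewrite mulrC ler_pdivlMr // mul1r mulrC.
by rewrite -[leRHS]expR0 ler_expR oppr_le0 !mulr_ge0 // ltW.
Qed.

Variables (l0 : R) (a : nat).
Hypotheses (l00 : 0 <= l0) (al : l0 <= r * (a%:R - 1)) (aC : (a <= C)%N).
Hypothesis excess : (\int[P0]_w (Num.max (A0 w - l0) 0)%:E <= (8^-1)%:E)%E.

Lemma ceil_min_ge : 7 / 8 <= r * \sum_(v < C.+1) p v * (minn v a)%:R.
Proof.
have mA0 : measurable_fun setT A0 by exact: measurable_funPT.
have mD : measurable_fun setT (fun w => (minn (D (A0 w)) a)%:R%:E : \bar R).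
  apply/measurable_EFinP; rewrite (_ : (fun w => _) = (fun x => (minn (D x) a)%:R) \o A0) //.
  apply: measurableT_comp => //.
  apply: nondecreasing_measurable => // x y xy.
  by rewrite ler_nat leq_min geq_minr andbT (leq_trans (geq_minl _ _)) // ceil_lattice_mono.
have mM : measurable_fun setT (fun w => (Num.max (A0 w - l0) 0)%:E : \bar R).
  by apply/measurable_EFinP; apply: measurable_maxr => //; apply: measurable_funB.
have M0 w : 0 <= Num.max (A0 w - l0) 0 by rewrite le_max lexx orbT.
have : (1 <= r%:E * (\sum_(v < C.+1) p v * (minn v a)%:R)%:E + (8^-1)%:E)%E.
  apply: (@le_trans _ _ (r%:E * (\sum_(v < C.+1) p v * (minn v a)%:R)%:E + \int[P0]_w (Num.max (A0 w - l0) 0)%:E)%E); last by rewrite leeD2l.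
  rewrite -(@sum_discrete_law _ _ _ P0 A0 _ _ ceil_lattice_mono ceil_lattice_lt (fun v => (minn v a)%:R)); last by [].
  rewrite -ge0_integralZl; [|exact: measurableT|exact: mD|by move=> w _; rewrite lee_fin|by rewrite lee_fin ltW].
  rewrite -ge0_integralD; [|exact: measurableT| | |by move=> w _; rewrite lee_fin|exact: mM]; last 2 first.
  - by move=> w _; rewrite -EFinM lee_fin mulr_ge0 // ltW.
  - by apply: measurable_funeM.
  move: hEA; rewrite expectation_def => <-.
  apply: ge0_le_integral; [exact: measurableT|by move=> w _; rewrite lee_fin|exact/measurable_EFinP| | ].
    by apply: emeasurable_funD => //; apply: measurable_funeM.
  move=> w _; rewrite -EFinM -EFinD lee_fin.
  have m1 : A0 w - l0 <= Num.max (A0 w - l0) 0 by rewrite le_max lexx.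
  have ral : l0 <= r * a%:R by have := r0; move: al; lra.
  have [Da|Da] := leqP (D (A0 w)) a; last by move: m1 ral; lra.
  have [AC|AC] := ltP (A0 w) (r * C%:R).
    by apply: le_trans (ceil_lattice_lo AC) _; rewrite lerDl.
  have : (C <= D (A0 w))%N.
    rewrite /D /ceil_lattice leq_min leqnn andbT leqW // truncn_ge_nat ?divr_ge0 ?(ltW r0) //.
    by rewrite ler_pdivlMr // mulrC.
  move=> /(leq_trans aC) aD.
  have : r * a%:R <= r * (D (A0 w))%:R by rewrite ler_wpM2l ?(ltW r0) // ler_nat.
  by move: m1 ral; lra.
rewrite -EFinM -EFinD lee_fin; lra.
Qed.

(** The sum is the mean of the part of the rounded variable between [a] and [b], dominated by the
    excess over [l0]. With [ceil_min_ge] it makes the overshoot probability at most [1 / 7]. *)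
Lemma ceil_survival_le b : r * \sum_(a <= i < b) survival C.+1 p i <= 8^-1.
Proof.
have [ba|ab] := leqP b a; first by rewrite big_geq // mulr0 invr_ge0.
have E : \sum_(a <= i < b) survival C.+1 p i = \sum_(v < C.+1) p v * (minn v b - minn v a)%:R.
  have := sum_survival p C.+1 b; rewrite (big_cat_nat (n := a)) ?(ltnW ab) //=.
  rewrite sum_survival => H.
  transitivity (\sum_(v < C.+1) p v * (minn v b)%:R - \sum_(v < C.+1) p v * (minn v a)%:R).
    by rewrite -H; ring.
  rewrite -sumrB; apply: eq_bigr => v _; rewrite -mulrBr natrB //.
  by rewrite leq_min geq_minl (leq_trans (geq_minr _ _)) // ltnW.
rewrite E mulr_sumr -lee_fin; apply: le_trans excess.
under eq_bigr do rewrite mulrCA.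
apply: (@sum_discrete_law_le _ _ _ P0 A0 _ _ ceil_lattice_mono ceil_lattice_lt
  (fun v => r * (minn v b - minn v a)%:R) (fun w => Num.max (A0 w - l0) 0)) => [v||w].
- by rewrite mulr_ge0 // ltW.
- by apply: measurable_maxr => //; apply: measurable_funB => //; exact: measurable_funPT.
have [Da|Da] := leqP (D (A0 w)) a.
  by rewrite (minn_idPl (leq_trans Da (ltnW ab))) subnn mulr0 le_max lexx orbT.
rewrite le_max; apply/orP; left.
apply: (@le_trans _ _ (r * ((D (A0 w))%:R - a%:R))).
  by rewrite ler_wpM2l ?(ltW r0) // -natrB ?(ltnW Da) // ler_nat leq_sub2r // geq_minl.
have := ceil_lattice_hi (hA0 w); rewrite -/D; move: al; lra.
Qed.

End lattice_up.

(** * Unit services from the empty system *)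

Section deterministic_queue.
Context d0 d (Omega0 : measurableType d0) (Omega : measurableType d) (R : realType).
Variables (P0 : probability Omega0 R) (P : probability Omega R).
Variables (A0 S0 : {RV P0 >-> R}) (A S : nat -> {RV P >-> R}).
Hypotheses (hA0 : forall w, 0 <= A0 w)
  (hAS : GI_primitives A0 S0 A S) (hEA : ('E_P0[A0] = 1)%E) (S1 : P0 [set w | S0 w = 1] = 1%E).

Lemma le_unit_event E F : measurable E -> measurable F ->
  E `&` [set w | forall j, 0 <= A j w /\ S j w = 1] `<=` F -> (P E <= P F)%E.
Proof.
move=> mE mF EF.
apply: (@le_ae_event _ _ _ _ _ P0 P A0 S0 A S hAS `[0%R, +oo[ [set 1%R]) => //.
- rewrite (_ : _ @^-1` _ = set0) ?measure0 // -subset0 => w /=.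
  by rewrite in_itv /= andbT; apply; exact: hA0.
- have mS1 : measurable [set w | S0 w = 1].
    rewrite -[X in measurable X]setTI (_ : [set w | _] = S0 @^-1` [set 1%R]) //.
    by apply: measurable_funPT => //; exact: measurable_set1.
  by have := probability_setC P0 mS1; rewrite S1 subee.
move=> w [Ew H]; apply: EF; split => // j.
by have [] := H j; rewrite /= in_itv /= andbT.
Qed.

Variables (n k z : nat) (lam t hA : R) (J C u eta w K : nat).
Hypotheses (n0 : (0 < n)%N) (lam0 : 0 < lam) (hA_0 : 0 < hA) (C0 : (0 < C)%N).
Let m := (n * k + (n + z))%N.
Let c : initial_condition R := InitialCondition 0 [::] 0%N.
Hypotheses (JK : (J <= K)%N) (tk : t - k.+1%:R < hA * (u.+1%:R - J%:R))
  (tle : hA * (u + eta + w)%:R <= t).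

Definition empty_start_reaches : set Omega :=
  [set w | ((n + z).+1%:R%:E <= number_in_system n c (fun j => A j w / lam)%R (fun j => S j w) t)%E].

Lemma measurable_empty_start : measurable empty_start_reaches.
Proof.
rewrite /empty_start_reaches -[X in measurable X]setTI; apply: emeasurable_fun_c_infty => //.
apply: measurable_number_in_system => //.
  by rewrite /admissible /= lexx.
by move=> j; apply: measurable_funM => //; exact: measurable_funPT.
Qed.

Let D := ceil_lattice (lam * hA) C.
Let p := discrete_law A0 D.

(** Subtracted are the chance that [J] increments do not pass [u] and Markov's bound for
    interarrivals beyond the cap, above which rounding no longer goes up. *)
Lemma empty_start_ge :
  Ex C.+1 p (K + m) (fun l => (quick m w eta u l)%:R) -
  Ex C.+1 p J (fun l => (sumn l <= u)%N%:R) - (J + m)%:R * (C%:R * (lam * hA))^-1 <=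
  fine (P empty_start_reaches).
Proof.
case: (hAS) => lawA lawS indep.
have CR : 0 < C%:R :> R by rewrite ltr0n.
have lh : 0 < lam * hA by rewrite mulr_gt0.
pose X (i : nat + nat) := match i with inl j => A j | inr j => S j end.
pose DD (i : nat + nat) := match i with inl _ => D | inr _ => D end.
pose CC (i : nat + nat) := match i with inl _ => C.+1 | inr _ => C.+1 end.
pose s : seq (nat + nat) := map inl (iota 0 (K + m)).
have mD i v : measurable (DD i @^-1` [set v]).
  by case: i => j; apply: measurable_level; exact: ceil_lattice_mono.
have DC i x : (DD i x < CC i)%N by case: i => j; exact: ceil_lattice_lt.
have us : uniq s by rewrite map_inj_uniq ?iota_uniq // => ? ? [].
pose F l := quick m w eta u l && (u < sumn (take J l))%N.
have E1 w0 : map (fun j => D (A j w0)) (iota 0 (K + m)) = map (fun i => DD i (X i w0)) s.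
  by rewrite -map_comp.
pose bad := \big[setU/set0]_(j < J + m) [set w0 | C%:R * (lam * hA) <= A j w0].
have mA j : measurable [set w0 | C%:R * (lam * hA) <= A j w0] by exact: measurable_ge.
have mbad : measurable bad by exact: bigsetU_measurable.
have mF : measurable [set w0 | F (map (fun i => DD i (X i w0)) s)] by exact: measurable_discrete.
have mE := measurable_empty_start.
have sub : [set w0 | F (map (fun i => DD i (X i w0)) s)] `&` [set w0 | forall j, 0 <= A j w0 /\ S j w0 = 1]
    `<=` empty_start_reaches `|` bad.
  move=> w0 [/=]; rewrite -E1 => /andP[q uJ] N0; have [B|nB] := pselect (bad w0); [by right|left].
  apply: (@crowd_lattice R n k z J u eta w (K + m) hA t (fun j => A j w0 / lam) (fun j => S j w0)
    (fun j => D (A j w0))) => //.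
  - by move=> j; rewrite divr_ge0 ?(N0 j).1 // ltW.
  - by move=> j; rewrite (N0 j).2.
  - move=> i; have := ceil_lattice_hi C lh (N0 i).1.
    have -> : A i w0 / lam + hA = (A i w0 + lam * hA) / lam by field; rewrite gt_eqF.
    by rewrite ler_pdivlMr // => H; apply: le_trans H; rewrite le_eqVlt; apply/orP; left; apply/eqP; rewrite /D; ring.
  - move=> i im; rewrite ler_pdivrMr //.
    have AC : A i w0 < lam * hA * C%:R.
      rewrite ltNge; apply/negP => H; apply: nB.
      rewrite /bad -(bigcup_mkord (J + m) (fun j => [set w0 | C%:R * (lam * hA) <= A j w0])); exists i => //=.
      by rewrite mulrC.
    have := ceil_lattice_lo lh C0 AC; rewrite -/D => H; apply: le_trans H _.
    by rewrite le_eqVlt; apply/orP; left; apply/eqP; ring.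
  - by rewrite leq_add2r.
have link : P [set w0 | F (map (fun i => DD i (X i w0)) s)] =
    (ExI X DD CC s (fun l => (F l)%:R))%:E := independence_link indep mD DC F us.
have := le_unit_event mF (measurableU _ _ mE mbad) sub.
have := measureU2 P mE mbad.
have bb : (P bad <= ((J + m)%:R * (C%:R * (lam * hA))^-1)%:E)%E.
  apply: (@measure_bigsetU_le _ _ _ P (J + m) (fun j => [set w0 | C%:R * (lam * hA) <= A j w0]) _ mA) => j.
  by apply: (markov_RV hA0 hEA (lawA j)); rewrite mulr_gt0.
rewrite link => U2 U1.
pose pS := discrete_law S0 D.
have ExE : ExI X DD CC s (fun l => (F l)%:R) = Ex C.+1 p (K + m) (fun l => (F l)%:R).
  have := @ExI_Ex _ _ _ P A S D D C.+1 C.+1 p pS _ _ (K + m) 0 (fun l => (F l)%:R).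
  rewrite /= cats0 => ->.
  - by apply: Ex_ext => l _; rewrite cats0.
  - move=> j v; rewrite /atom_prob /p /discrete_law; congr fine.
    by apply: same_law_probability => //; apply: measurable_level; exact: ceil_lattice_mono.
  - move=> j v; rewrite /atom_prob /pS /discrete_law; congr fine.
    by apply: same_law_probability => //; apply: measurable_level; exact: ceil_lattice_mono.
have p0 v : 0 <= p v by exact: discrete_law_ge0.
have p1 : \sum_(v < C.+1) p v = 1.
  exact: (discrete_law1 A0 (@ceil_lattice_mono R _ C lh) (@ceil_lattice_lt R _ C)).
have early : Ex C.+1 p (K + m) (fun l => (sumn (take J l) <= u)%N%:R) =
    Ex C.+1 p J (fun l => (sumn l <= u)%N%:R).
  have -> : (K + m = J + (K + m - J))%N by rewrite subnKC // (leq_trans JK) // leq_addr.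
  rewrite Ex_cat; apply: Ex_ext => l lJ; rewrite -[RHS](@Ex_const _ C.+1 p (K + m - J) _ p1).
  by apply: Ex_ext => l' _; rewrite take_size_cat.
have FE : Ex C.+1 p (K + m) (fun l => (quick m w eta u l)%:R) <=
    Ex C.+1 p (K + m) (fun l => (F l)%:R) + Ex C.+1 p J (fun l => (sumn l <= u)%N%:R).
  rewrite -early -Ex_add; apply: Ex_le => // l _; rewrite /F -natrD ler_nat.
  by case: (quick _ _ _ _ _) => //=; case: (ltnP u (sumn (take J l))).
have : ((ExI X DD CC s (fun l => (F l)%:R))%:E <= (fine (P empty_start_reaches))%:E +
    ((J + m)%:R * (C%:R * (lam * hA))^-1)%:E)%E.
  apply: le_trans U1 _; apply: le_trans U2 _; rewrite fineK ?fin_num_measure //.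
  by rewrite leeD2l.
rewrite -EFinD lee_fin ExE; lra.
Qed.

End deterministic_queue.

(** * Steady-state lower bound at fixed n *)

Section stationary_lower_bound.
Context d0 d (Omega0 : measurableType d0) (Omega : measurableType d) (R : realType).
Variables (P0 : probability Omega0 R) (P : probability Omega R).
Variables (A0 S0 : {RV P0 >-> R}) (A S : nat -> {RV P >-> R}).
Hypotheses (hA0 : forall w, 0 <= A0 w)
  (hAS : GI_primitives A0 S0 A S) (hEA : ('E_P0[A0] = 1)%E) (S1 : P0 [set w | S0 w = 1] = 1%E).
Variables (B alpha : R) (n : nat) (mu : probability R R).
Hypotheses (n0 : (0 < n)%N) (stat : steady_state_Q A S B alpha n mu).
Let lam := arrival_rate B alpha n.
Hypothesis lam0 : 0 < lam.
Variables (l0 s0 : R).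
Hypotheses (l00 : 0 <= l0) (excess : (\int[P0]_w (Num.max (A0 w - l0) 0)%:E <= (8^-1)%:E)%E).
Hypotheses (s0_ge0 : 0 <= s0) (laplace_lt1 : laplace A0 s0 < 1).

(** The moment [E[exp(s * (1 - A))]] of one increment of the arrival walk. *)
Definition moment_factor (s : R) : R := expR s * laplace A0 s.
Let Phi := moment_factor.

Lemma laplace_ge0 s : 0 <= laplace A0 s.
Proof. by apply: fine_ge0; apply: integral_ge0 => w _; rewrite lee_fin expR_ge0. Qed.

Lemma moment_factor_ge0 s : 0 <= Phi s.
Proof. by rewrite mulr_ge0 ?expR_ge0 ?laplace_ge0. Qed.

Section lattice_moments.
Variables (r nu : R) (C m : nat).
Hypotheses (r0 : 0 < r) (C0 : (0 < C)%N) (nu0 : 0 < nu).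
Let p := discrete_law A0 (ceil_lattice r C).
Let f (v : nat) : R := (1 - r * v%:R) / nu.

Lemma lattice_momentE th : \sum_(v < C.+1) p v * expR (th * f v) =
  expR (th / nu) * \sum_(v < C.+1) p v * expR (- (th / nu * r * v%:R)).
Proof.
rewrite mulr_sumr; apply: eq_bigr => v _; rewrite [RHS]mulrCA -expRD; congr (_ * expR _).
by rewrite /f; field; rewrite gt_eqF.
Qed.

(** For fixed [m], a fine mesh, and in [lattice_moment_le] a high cap, changes the [m]-th power by
    at most [e]. *)
Lemma lattice_moment_ge th e : 0 <= th -> th / nu * r * (m%:R * Phi (th / nu) ^+ m) <= e ->
  Phi (th / nu) ^+ m - e <= (\sum_(v < C.+1) p v * expR (th * f v)) ^+ m.
Proof.
move=> th0 He; have s_0 : 0 <= th / nu by rewrite divr_ge0 // ltW.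
rewrite lattice_momentE; set s := th / nu in s_0 He *.
apply: (@le_trans _ _ ((expR (- (s * r)) * Phi s) ^+ m)); last first.
  apply: lerXn2r.
  - by rewrite nnegrE mulr_ge0 ?expR_ge0 // moment_factor_ge0.
  - rewrite nnegrE mulr_ge0 ?expR_ge0 //; apply: sumr_ge0 => v _.
    by rewrite mulr_ge0 ?expR_ge0 // discrete_law_ge0.
  by rewrite /Phi /moment_factor mulrCA ler_wpM2l ?expR_ge0 // ceil_laplace_ge.
move: (Phi s) (moment_factor_ge0 s) He => F F0 He.
have Pm : 0 <= F ^+ m by rewrite exprn_ge0.
rewrite exprMn -expRM_natl.
apply: (@le_trans _ _ ((1 + m%:R * (- (s * r))) * F ^+ m)); last by rewrite ler_wpM2r // expR_ge1Dx.
by move: He; move: (F ^+ m) (m%:R) => G M; lra.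
Qed.

Lemma lattice_moment_le th e : 0 <= th -> 0 < e ->
  expR (th / nu) * (1 + m%:R * (Phi (th / nu) + 1) ^+ m / e) <= C%:R * r ->
  (\sum_(v < C.+1) p v * expR (th * f v)) ^+ m <= Phi (th / nu) ^+ m + e.
Proof.
move=> th0 e0; have s_0 : 0 <= th / nu by rewrite divr_ge0 // ltW.
rewrite lattice_momentE; set s := th / nu in s_0 *; move=> He.
have Cr : 0 < C%:R * r by rewrite mulr_gt0 // ltr0n.
pose x := expR s * (C%:R * r)^-1.
have x0 : 0 <= x by rewrite mulr_ge0 ?expR_ge0 // invr_ge0 ltW.
have E0 := expR_gt0 s; have Pm : 0 <= (Phi s + 1) ^+ m by rewrite exprn_ge0 // addr_ge0 ?moment_factor_ge0.
have q0 : 0 <= m%:R * (Phi s + 1) ^+ m / e by rewrite divr_ge0 ?mulr_ge0 // ltW.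
have x1 : x <= 1 by rewrite ler_pdivrMr // mul1r; move: He; nra.
have xe : x * (m%:R * (Phi s + 1) ^+ m) <= e.
  rewrite /x mulrAC ler_pdivrMr //.
  have -> : expR s * (m%:R * (Phi s + 1) ^+ m) = e * (expR s * (m%:R * (Phi s + 1) ^+ m / e)).
    by field; rewrite gt_eqF.
  rewrite ler_wpM2l ?(ltW e0) //; move: He q0; nra.
apply: (@le_trans _ _ ((Phi s + x) ^+ m)).
  apply: lerXn2r; rewrite ?nnegrE ?mulr_ge0 ?addr_ge0 ?expR_ge0 ?moment_factor_ge0 //.
    by apply: sumr_ge0 => v _; rewrite mulr_ge0 ?expR_ge0 ?discrete_law_ge0.
  by rewrite /Phi /moment_factor /x -mulrDr ler_wpM2l ?expR_ge0 // ceil_laplace_le.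
by apply: le_trans (exprD_le m (moment_factor_ge0 s) x0 x1) _; rewrite lerD2l.
Qed.

End lattice_moments.

Variables (k z : nat) (nu theta g y y0 y1 : R).
Let m := (n * k + (n + z))%N.
Hypotheses (nu0 : 0 < nu) (g0 : 0 < g) (gtheta : g <= theta).
Hypotheses (yz : y < (n + z).+1%:R) (y_atom : mu [set y] = 0%E).
Hypotheses (lamk : 2 * l0 + 2 <= lam * k.+1%:R)
  (y0_ge : m%:R - lam * k.+1%:R + 2 * l0 + 1 <= nu * y0).

Ltac slim := clear - hA0 hAS hEA S1 n0 stat lam0 l00 excess s0_ge0 laplace_lt1 Phi m
  nu0 g0 gtheta yz y_atom lamk y0_ge y1.

(** Passing [u] without overshoot has probability at least one half, hence the factor 2. The next
    [m] arrivals must then fit into the last [k + 1] units of time, which [tilting] estimates. *)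
Theorem stationary_lower :
  expR (- theta * y1) * (Phi (theta / nu) ^+ m - expR (g * y0) * Phi ((theta - g) / nu) ^+ m
    - expR (- g * y1) * Phi ((theta + g) / nu) ^+ m) <= 2 * fine (mu `]y, +oo[%classic).
Proof.
apply/ler_addgt0Pr => e e_0.
have th0 : 0 < theta by apply: lt_le_trans gtheta.
pose c : initial_condition R := InitialCondition 0 [::] 0%N.
have cn : admissible n c by rewrite /admissible /= lexx.
have mI : measurable (`]-oo, y]%classic : set R) by exact: measurable_itv.
(* Three errors [e2], doubled, make [e / 2]; the moment error [E0 * e1] is the other half. *)
pose e2 := e / 12.
have e20 : 0 < e2 by rewrite divr_gt0.
have [t0 Ht0] : exists t0, forall t, t0 < t -> fine (mu `]-oo, y]) - e2 <
    fine (P [set w | (number_in_system n c (interarrival A B alpha n w) (processing S w) t <= y%:E)%E]).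
  have := stat cn y_atom; rewrite -[X in _ --> X]fineK ?fin_num_measure // => /fine_cvg fl.
  have [M [_ HM]] : \forall t \near +oo, fine (mu `]-oo, y]) - e2 < (fine \o (fun t => P [set w |
     (number_in_system n c (interarrival A B alpha n w) (processing S w) t <= y%:E)%E])) t.
    by apply: (cvgr_gt (fine (mu `]-oo, y]))) => //; rewrite gtrBl.
  by exists M => t; exact: HM.
pose t := Num.max (t0 + 1) k.+1%:R.
have tt0 : t0 < t by rewrite lt_max ltrDl ltr01.
have tk0 : 0 <= t - k.+1%:R by rewrite subr_ge0 le_max lexx orbT.
have t_ge0 : 0 <= t by move: tk0; have : 0 <= k.+1%:R :> R by []; lra.
pose eta0 := (1 - laplace A0 s0) / 2.
have eta00 : 0 < eta0 by rewrite divr_gt0 // subr_gt0.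
have lap0 := laplace_ge0 s0.
(* Enough arrivals to pass time [t + 1] up to probability [e2], by Chernoff's bound at [s0]. *)
pose J := (Num.truncn ((s0 * lam * (t + 1) - ln e2) / eta0)).+1.
have HJ : s0 * lam * (t + 1) - eta0 * J%:R <= ln e2.
  have := truncnS_gt ((s0 * lam * (t + 1) - ln e2) / eta0).
  by rewrite -/J ltr_pdivrMr // mulrC; lra.
pose E0 := expR (- theta * y1) * (1 + expR (g * y0) + expR (- g * y1)).
have E00 : 0 < E0 by rewrite mulr_gt0 ?expR_gt0 // !addr_gt0 ?expR_gt0.
pose e1 := e / (2 * E0).
have e10 : 0 < e1 by rewrite divr_gt0 // mulr_gt0.
pose q1 := theta / nu * (m%:R * Phi (theta / nu) ^+ m) / e1.
have q10 : 0 <= q1.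
  by rewrite divr_ge0 ?(ltW e10) // !mulr_ge0 ?exprn_ge0 ?moment_factor_ge0 ?invr_ge0 // ltW.
pose q2 := J%:R / lam.
have q20 : 0 <= q2 by rewrite divr_ge0 // ltW.
(* The summands control, in order, the rounding over [J] steps and in [eta], the rounding over [J]
   steps in units of time, and the loss in the moment at [theta]. *)
pose r := (J%:R + 4 + q2 + q1)^-1.
have J0 : 0 <= J%:R :> R by [].
have den0 : 0 < J%:R + 4 + q2 + q1 by lra.
have r0 : 0 < r by rewrite invr_gt0.
have rden : r * (J%:R + 4 + q2 + q1) = 1 by rewrite mulVf // gt_eqF.
have rJ : r * (J%:R + 4) <= 1 by rewrite -[leRHS]rden ler_wpM2l ?(ltW r0) //; lra.
have rq1 : r * q1 <= 1 by rewrite -[leRHS]rden ler_wpM2l ?(ltW r0) //; lra.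
have rq2 : r * q2 <= 1 by rewrite -[leRHS]rden ler_wpM2l ?(ltW r0) //; lra.
pose hA := r / lam.
have hA_0 : 0 < hA by rewrite divr_gt0.
have rE : lam * hA = r by rewrite /hA mulrC divfK // gt_eqF.
have hAJ : hA * J%:R <= 1 by move: rq2; rewrite /q2 /hA; lra.
pose a := (Num.truncn (l0 / r)).+2.
have l0r : 0 <= l0 / r by rewrite divr_ge0 // ltW.
have /andP[a1 a2] := truncn_itv l0r.
have aE : a%:R = (Num.truncn (l0 / r))%:R + 2 :> R by rewrite /a -natr1 -natr1; ring.
rewrite ler_pdivlMr // in a1; rewrite ltr_pdivrMr // -natr1 in a2.
have al : l0 <= r * (a%:R - 1) by rewrite aE; move: a2; lra.
have ra : r * a%:R <= l0 + 2 * r by rewrite aE; move: a1; lra.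
pose eta := (a + a)%N.
pose u := (Num.truncn ((t - k.+1%:R) / hA) + J)%N.
pose w := (Num.truncn (k.+1%:R / hA) - J - eta)%N.
have tkh : 0 <= (t - k.+1%:R) / hA by rewrite divr_ge0 // ltW.
have kh : 0 <= k.+1%:R / hA by rewrite divr_ge0 // ltW.
have /andP[u1 u2] := truncn_itv tkh; have /andP[w1 w2] := truncn_itv kh.
rewrite ler_pdivlMr // in u1; rewrite ltr_pdivrMr // in u2.
rewrite ler_pdivlMr // in w1; rewrite ltr_pdivrMr // in w2.
have etaR : eta%:R = a%:R + a%:R :> R by rewrite natrD.
have JE : (J + eta <= Num.truncn (k.+1%:R / hA))%N.
  rewrite truncn_ge_nat // ler_pdivlMr // /hA mulrA ler_pdivrMr // natrD etaR mulrC.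
  by rewrite [leRHS]mulrC; move: ra rJ lamk; lra.
have wE : w%:R = (Num.truncn (k.+1%:R / hA))%:R - J%:R - eta%:R :> R.
  by rewrite /w -subnDA natrB // natrD; ring.
have uE : u%:R = (Num.truncn ((t - k.+1%:R) / hA))%:R + J%:R :> R by rewrite /u natrD.
have tk : t - k.+1%:R < hA * (u.+1%:R - J%:R).
  rewrite -[u.+1%:R]natr1 uE; move: u2; rewrite -[(Num.truncn _).+1%:R]natr1; lra.
have tle : hA * (u + eta + w)%:R <= t.
  rewrite natrD natrD uE wE; move: u1 w1; lra.
have uh : hA * u%:R <= t + 1.
  by rewrite uE; move: u1 hAJ; have : 0 <= k.+1%:R :> R by []; lra.
pose Q th := expR (th / nu) * (1 + m%:R * (Phi (th / nu) + 1) ^+ m / e1).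
have Q0 th : 0 <= Q th.
  by rewrite mulr_ge0 ?expR_ge0 // addr_ge0 // divr_ge0 ?(ltW e10) // mulr_ge0 // exprn_ge0 // addr_ge0 ?moment_factor_ge0.
pose q3 := (J + m)%:R / e2.
have q30 : 0 <= q3 by rewrite divr_ge0 // ltW.
have ei0 : 0 <= eta0^-1 by rewrite invr_ge0 ltW.
pose Dt := Q (theta - g) + Q (theta + g) + q3 + eta0^-1.
pose C := (a + (Num.truncn (Dt / r)).+1)%N.
have C0 : (0 < C)%N by rewrite /C addnS.
have aC : (a <= C)%N by rewrite leq_addr.
have DC : Dt <= C%:R * r.
  rewrite -ler_pdivrMr // ltW // (lt_le_trans (truncnS_gt _)) // ler_nat leq_addl.
  by [].
have Cr : 0 < C%:R * r by rewrite mulr_gt0 // ltr0n.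
have Qm : Q (theta - g) <= C%:R * r by move: DC (Q0 (theta + g)) q30 ei0; rewrite /Dt; move: (Q (theta + g)) (Q (theta - g)) (q3) (eta0^-1) (C%:R * r) => ? ? ? ? ?; slim; lra.
have Qp : Q (theta + g) <= C%:R * r by move: DC (Q0 (theta - g)) q30 ei0; rewrite /Dt; move: (Q (theta + g)) (Q (theta - g)) (q3) (eta0^-1) (C%:R * r) => ? ? ? ? ?; slim; lra.
have Cq3 : (J + m)%:R * (C%:R * r)^-1 <= e2.
  rewrite ler_pdivrMr // mulrC -ler_pdivrMr //; move: DC (Q0 (theta - g)) (Q0 (theta + g)) ei0; rewrite /Dt -/q3; move: (Q (theta + g)) (Q (theta - g)) (q3) (eta0^-1) (C%:R * r) => ? ? ? ? ?; slim; lra.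
have Ceta : (C%:R * r)^-1 <= eta0.
  rewrite -[leRHS]invrK lef_pV2 ?posrE ?invr_gt0 //.
  by move: DC (Q0 (theta - g)) (Q0 (theta + g)) q30; rewrite /Dt; move: (Q (theta + g)) (Q (theta - g)) (q3) (eta0^-1) (C%:R * r) => ? ? ? ? ?; slim; lra.
pose p := discrete_law A0 (ceil_lattice r C).
have p0 v : 0 <= p v by exact: discrete_law_ge0.
have p1 : \sum_(v < C.+1) p v = 1.
  exact: (discrete_law1 A0 (@ceil_lattice_mono R _ C r0) (@ceil_lattice_lt R _ C)).
have p00 : p 0%N = 0 by exact: ceil_law0.
have main := @empty_start_ge _ _ _ _ _ P0 P A0 S0 A S hA0 hAS hEA S1 n k z lam t hA J C u eta w u.+1
  n0 lam0 hA_0 C0 (leqW (leq_addl _ _)) tk tle.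
rewrite rE -/p -/m in main.
have earlyJ : Ex C.+1 p J (fun l => (sumn l <= u)%N%:R) <= e2.
  have c0 : 0 <= s0 * r by rewrite mulr_ge0 // ltW.
  apply: le_trans (chernoff_sumn C.+1 J u p0 c0) _.
  apply: (@le_trans _ _ (expR (s0 * lam * (t + 1)) * expR (- eta0) ^+ J)).
    apply: ler_pM; rewrite ?expR_ge0 ?exprn_ge0 //.
    - by apply: sumr_ge0 => v _; rewrite mulr_ge0 ?expR_ge0.
    - have ruE : s0 * r * u%:R = s0 * lam * (hA * u%:R) by rewrite -rE; ring.
      by rewrite ler_expR ruE ler_wpM2l // mulr_ge0 // ltW.
    apply: lerXn2r; rewrite ?nnegrE ?expR_ge0 //.
      by apply: sumr_ge0 => v _; rewrite mulr_ge0 ?expR_ge0.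
    apply: le_trans (ceil_laplace_le hA0 hEA r0 C0 s0_ge0) _.
    apply: le_trans (expR_ge1Dx _); move: Ceta; rewrite /eta0; slim; lra.
  rewrite -expRM_natl -expRD -[leRHS]lnK ?posrE // ler_expR.
  by rewrite mulrN mulrC [J%:R * _]mulrC in HJ *; move: HJ; slim; lra.
have over : Ex C.+1 p u.+1 (fun l => (overshoots eta u l)%:R) <= 2^-1.
  have H1 := overshoot_le p0 p1 p00 (ltnSn u) (leq_addr a a : (a <= eta)%N).
  have H2 := ceil_min_ge hA0 hEA r0 C0 al aC excess.
  have H3 := ceil_survival_le hA0 C r0 al excess (u + eta).
  rewrite addnK -/p in H1 H3; rewrite -/p in H2.
  have O0 : 0 <= Ex C.+1 p u.+1 (fun l => (overshoots eta u l)%:R) by exact: Ex_ge0.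
  have := ler_wpM2l (ltW r0) H1; move: (Ex _ _ _ _) O0 => O O0.
  move: (\sum_(v < _) _) H2 => mn H2 H4.
  have : O * (7 / 8) <= O * (r * mn) by rewrite ler_wpM2l.
  by move: H3 H4; slim; lra.
have Pi0 : 0 <= Ex C.+1 p m (fun l => (sumn l <= w)%N%:R) by exact: Ex_ge0.
have quickge : 2^-1 * Ex C.+1 p m (fun l => (sumn l <= w)%N%:R) <=
    Ex C.+1 p (u.+1 + m) (fun l => (quick m w eta u l)%:R).
  apply: le_trans (quick_ge p0 p1 m w eta u.+1 u); rewrite ler_wpM2r //.
  have -> : Ex C.+1 p u.+1 (fun l => 1 - (overshoots eta u l)%:R) =
     1 - Ex C.+1 p u.+1 (fun l => (overshoots eta u l)%:R).
    rewrite -[X in X - _](@Ex_const _ C.+1 p u.+1 1 p1) -[in RHS]mulN1r -Ex_scale -Ex_add.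
    by apply: Ex_ext => l _; rewrite mulN1r.
  by move: over; slim; lra.
pose f (v : nat) : R := (1 - r * v%:R) / nu.
have tilt := tilting C.+1 p0 m f y0 y1 (ltW th0) g0.
have sumle : Ex C.+1 p m (fun l => (y0 <= \sum_(v <- l) f v)%R%:R) <=
    Ex C.+1 p m (fun l => (sumn l <= w)%N%:R).
  apply: Ex_le => // l lm; rewrite ler_nat.
  have -> : \sum_(v <- l) f v = (m%:R - r * (sumn l)%:R) / nu.
    rewrite -lm; elim: (l) => [|v l' IH]; first by rewrite big_nil /= mulr0 subrr mul0r.
    by rewrite big_cons IH /f /= natrD -natr1; ring.
  case: (boolP (_ <= _ / _)) => // H; rewrite ler_pdivlMr // in H.
  have : (sumn l + (J + eta) <= Num.truncn (k.+1%:R / hA))%N.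
    rewrite truncn_ge_nat // ler_pdivlMr // /hA mulrA ler_pdivrMr // natrD natrD etaR [leLHS]mulrC [leRHS]mulrC.
    by move: H y0_ge ra rJ; slim; lra.
  by rewrite /w; clear; move: (Num.truncn _) => T; lia.
have tmg : 0 <= theta - g by rewrite subr_ge0.
have tpg : 0 <= theta + g by rewrite addr_ge0 // ltW.
have M1 : Phi (theta / nu) ^+ m - e1 <= (\sum_(v < C.+1) p v * expR (theta * f v)) ^+ m.
  apply: lattice_moment_ge => //; first exact: ltW.
  have -> : theta / nu * r * (m%:R * Phi (theta / nu) ^+ m) = r * q1 * e1.
    by rewrite /q1; field; rewrite !gt_eqF.
  by rewrite ler_piMl // ltW.
have M2 := lattice_moment_le r0 C0 nu0 tmg e10 Qm.
have M3 := lattice_moment_le r0 C0 nu0 tpg e10 Qp.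
rewrite -/p -/f in M2 M3.
have reach : fine (P (empty_start_reaches A S n z lam t)) <= fine (mu `]y, +oo[%classic) + e2.
  have mQ : measurable [set w | (number_in_system n c
     (interarrival A B alpha n w) (processing S w) t <= y%:E)%E].
    rewrite -[X in measurable X]setTI; apply: emeasurable_fun_infty_c => //.
    apply: measurable_number_in_system => //.
    by move=> j; apply: measurable_funM => //; exact: measurable_funPT.
  have -> : `]y, +oo[%classic = ~` `]-oo, y]%classic :> set R.
    by apply/seteqP; split => q /=; rewrite !in_itv /= andbT ltNge => /negP.
  have -> : fine (mu (~` `]-oo, y]%classic)) = 1 - fine (mu `]-oo, y]).
    by rewrite probability_setC // fineB ?fin_num_measure.
  have mE := measurable_empty_start A S z lam t n0.
  apply: (@le_trans _ _ (1 - fine (P [set w | (number_in_system n c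
     (interarrival A B alpha n w) (processing S w) t <= y%:E)%E]))).
    rewrite -lee_fin EFinB !fineK ?fin_num_measure // -probability_setC //.
    apply: le_measure; rewrite ?inE //; first exact: measurableC.
    move=> w' /= H1 H2; have := le_trans H1 H2; rewrite lee_fin => H3.
    by move: yz; rewrite ltNge H3.
  by have := Ht0 t tt0; slim; lra.
have step1 : Ex C.+1 p m (fun l => (sumn l <= w)%N%:R) <= 2 * (fine (mu `]y, +oo[%classic) + 3 * e2).
  move: quickge main reach earlyJ Cq3; move: (Ex _ _ _ _) (Ex _ _ _ _) (Ex _ _ _ _) => x1 x2 x3; slim; lra.
have step2 := le_trans (le_trans tilt sumle) step1.
have E1 := expR_gt0 (- theta * y1); have E2 := expR_gt0 (g * y0); have E3 := expR_gt0 (- g * y1).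
apply: (@le_trans _ _ (2 * (fine (mu `]y, +oo[%classic) + 3 * e2) + E0 * e1)); last first.
  have -> : E0 * e1 = e / 2 by rewrite /e1; field; rewrite gt_eqF.
  by rewrite /e2; move: e_0; slim; lra.
apply: le_trans (lerD step2 (lexx _)); rewrite /E0 -mulrA -mulrDr ler_wpM2l ?(ltW E1) //.
have H2 := ler_wpM2l (ltW E2) M2; have H3 := ler_wpM2l (ltW E3) M3.
move: M1 H2 H3; rewrite !mulrDl !mulrDr mul1r; move: (expR (g * y0)) (expR (- g * y1)) => x2 x3.
by do 6!move: (_ ^+ _) => ?; slim; lra.
Qed.

End stationary_lower_bound.

(** * Bernoulli inequalities for real powers *)

Section bernoulli.
Context {R : realType}.
Variable alpha : R.
Hypothesis a1 : 1 < alpha.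

(** Young's inequality with one factor equal to 1. *)
Lemma bernoulli_powR (x : R) : 0 <= x -> alpha * x - (alpha - 1) <= x `^ alpha.
Proof.
move=> x0; have a0 : 0 < alpha := lt_trans ltr01 a1.
have ai : 0 < alpha - 1 by rewrite subr_gt0.
have q0 : 0 < alpha / (alpha - 1) by rewrite divr_gt0.
have pq : alpha^-1 + (alpha / (alpha - 1))^-1 = 1 by field; rewrite !gt_eqF.
have := conjugate_powR x0 ler01 a0 q0 pq; rewrite powR1 mulr1 => H.
have := ler_wpM2l (ltW a0) H.
have -> : alpha * (x `^ alpha / alpha + 1 / (alpha / (alpha - 1))) = x `^ alpha + (alpha - 1).
  by field; rewrite !gt_eqF.
lra.
Qed.

(** Splitting [1 + w] into two factors and using the weak inequality on each gains the positive term
    [alpha * (alpha - 1) * u * v]. *)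
Lemma strict_bernoulli (w : R) : 0 < w -> 1 + alpha * w < (1 + w) `^ alpha.
Proof.
move=> w0; pose u := w / 2; have u0 : 0 < u by rewrite divr_gt0.
pose v := u / (1 + u).
have u1 : 0 < 1 + u by rewrite addr_gt0.
have v0 : 0 < v by rewrite divr_gt0.
have -> : 1 + w = (1 + u) * (1 + v) by rewrite /v /u; field; rewrite gt_eqF //; move: w0; lra.
rewrite powRM ?addr_ge0 ?(ltW u0) ?(ltW v0) //.
have H1 := bernoulli_powR (ltW u1).
have v1 : 0 <= 1 + v by rewrite addr_ge0 // ltW.
have H2 := bernoulli_powR v1.
have a0 : 0 < alpha := lt_trans ltr01 a1.
have p1 : 0 <= 1 + alpha * u by rewrite addr_ge0 // mulr_ge0 // ltW.
have p2 : 0 <= 1 + alpha * v by rewrite addr_ge0 // mulr_ge0 // ltW.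
apply: (@lt_le_trans _ _ ((1 + alpha * u) * (1 + alpha * v))); last by apply: ler_pM => //; lra.
have -> : w = u + u by rewrite /u; field.
have vE : v = u - u * v by rewrite /v; field; rewrite gt_eqF.
have uv : 0 < u * v by rewrite mulr_gt0.
have a10 : 0 < alpha - 1 by rewrite subr_gt0.
have K := mulr_gt0 (mulr_gt0 a0 a10) uv.
have auv : alpha * v = alpha * u - alpha * (u * v) by rewrite {1}vE; ring.
have -> : (1 + alpha * u) * (1 + alpha * v) = 1 + alpha * u + alpha * v + alpha * alpha * (u * v) by ring.
rewrite auv; move: (u * v) K => W K; lra.
Qed.

(** Bernoulli at the ratio [(1 + w) / (1 + 2 * w)]; then [alpha < 2] bounds the power by a
    square. *)
Lemma powR_increment (w : R) : 0 < w -> w <= 1 -> alpha < 2 ->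
  (1 + 2 * w) `^ alpha - (1 + w) `^ alpha <= alpha * w * (1 + 2 * w).
Proof.
move=> w0 w1 a2; have a0 : 0 < alpha := lt_trans ltr01 a1.
have X0 : 0 < 1 + 2 * w by rewrite addr_gt0 // mulr_gt0.
have Z0 : 0 < 1 + w by rewrite addr_gt0.
have H := bernoulli_powR (divr_ge0 (ltW Z0) (ltW X0)).
have Xa : 0 < (1 + 2 * w) `^ alpha by rewrite powR_gt0.
have E : (1 + w) `^ alpha = (1 + 2 * w) `^ alpha * ((1 + w) / (1 + 2 * w)) `^ alpha.
  by rewrite -powRM ?(ltW X0) ?divr_ge0 ?(ltW Z0) ?(ltW X0) // mulrC divfK // gt_eqF.
have X2 : (1 + 2 * w) `^ alpha <= (1 + 2 * w) * (1 + 2 * w).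
  apply: (@le_trans _ _ ((1 + 2 * w) `^ 2)); last by rewrite powR_mulrn ?(ltW X0) // expr2.
  by rewrite ler_powR ?ltW //; lra.
rewrite E; apply: (@le_trans _ _ ((1 + 2 * w) `^ alpha * (alpha * w / (1 + 2 * w)))).
  rewrite -{1}[_ `^ alpha]mulr1 -mulrBr ler_wpM2l ?(ltW Xa) //.
  have -> : alpha * w / (1 + 2 * w) = 1 - (alpha * ((1 + w) / (1 + 2 * w)) - (alpha - 1)).
    by field; rewrite gt_eqF.
  by move: H; lra.
rewrite mulrA ler_pdivrMr // [leLHS]mulrC -[leRHS]mulrA; apply: ler_wpM2l => //.
by rewrite mulr_ge0 // ltW.
Qed.

End bernoulli.

(** * Powers of the moment factor at scale [n ^ (1 / alpha)] *)

Section moment_asymptotics.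
Context d0 (Omega0 : measurableType d0) (R : realType) (P0 : probability Omega0 R).
Variables (A0 : {RV P0 >-> R}) (alpha C_A : R).
Hypotheses (hA0 : forall w, 0 <= A0 w) (hEA : ('E_P0[A0] = 1)%E).
Hypotheses (a1 : 1 < alpha) (a2 : alpha < 2) (CA0 : 0 < C_A).
Hypothesis tailA : ((x `^ alpha)%:E * P0 [set w | (x < A0 w)%R])%E @[x --> +oo] --> C_A%:E.
Let kappa := C_A * (alpha * Gamma (- alpha)).
Let nu (n : nat) : R := n%:R `^ alpha^-1.
Let Phi := moment_factor A0.

Lemma kappa_gt0 : 0 < kappa.
Proof. by rewrite mulr_gt0 //; exact: (laplace_int_Gamma a1 a2).2. Qed.

Lemma scaled_powR (th : R) n : (0 < n)%N -> 0 < th -> (th / nu n) `^ alpha = th `^ alpha / n%:R.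
Proof.
move=> n0 th0; have nu0 : 0 < nu n by rewrite powR_gt0 // ltr0n.
have n_0 : 0 < n%:R :> R by rewrite ltr0n.
rewrite powRM ?(ltW th0) ?invr_ge0 ?(ltW nu0) //; congr (_ * _).
have nuA : nu n `^ alpha = n%:R.
  by rewrite /nu -powRrM mulVf ?powRr1 ?(ltW n_0) // gt_eqF // (lt_trans ltr01).
have n_n : n%:R != 0 :> R by rewrite gt_eqF.
apply: (mulIf n_n); rewrite mulVf // -[X in _ * X = _]nuA.
by rewrite -powRM ?invr_ge0 ?(ltW nu0) // mulVf ?powR1 // gt_eqF.
Qed.

(** One factor is at least [1 + q / n], and [1 + y >= exp(y / (1 + y))] turns the power into an
    exponential uniformly in [k]. *)
Lemma moment_lower (th e : R) : 0 < th -> 0 < e -> \forall n \near \oo, forall (k : R) m,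
  0 <= k -> n%:R * k <= m%:R -> expR (k * (kappa * th `^ alpha - e)) <= Phi (th / nu n) ^+ m.
Proof.
move=> th0 e0; have k0 := kappa_gt0; have ta0 : 0 < th `^ alpha by rewrite powR_gt0.
pose e1 := Num.min (e / (4 * th `^ alpha)) (kappa / 2).
have e10 : 0 < e1 by rewrite lt_min !divr_gt0 // mulr_gt0.
have e1e : e1 * th `^ alpha <= e / 4.
  apply: (@le_trans _ _ (e / (4 * th `^ alpha) * th `^ alpha)).
    by rewrite ler_wpM2r ?(ltW ta0) // ge_min lexx.
  by rewrite le_eqVlt; apply/orP; left; apply/eqP; field; rewrite gt_eqF.
have e1k : 2 * e1 <= kappa by rewrite mulrC -ler_pdivlMr // ge_min lexx orbT.
have [s0 s00 Hs0] := laplace_asymptotics hA0 hEA a1 a2 CA0 tailA e10.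
pose q := (kappa - 2 * e1) * th `^ alpha.
have q0 : 0 <= q by rewrite mulr_ge0 ?subr_ge0 // ltW.
have a20 : 0 < 2 - alpha by rewrite subr_gt0.
near=> n => k m kk nk.
have n_0 : (0 < n)%N by near: n; exists 1%N.
have n0 : 0 < n%:R :> R by rewrite ltr0n.
have nu0 : 0 < nu n by rewrite powR_gt0.
have nus : th / s0 + 1 <= nu n by near: n; exact: near_nu.
have nue : th / e1 `^ (2 - alpha)^-1 <= nu n by near: n; exact: near_nu.
have nq : q * q / (e / 2) * 1 <= n%:R.
  by rewrite mulr1 -[leRHS](powRr1 (ltW n0)); near: n; apply: near_powR.
pose s := th / nu n.
have s_0 : 0 < s by rewrite divr_gt0.
have ss0 : s < s0.
  rewrite ltr_pdivrMr // mulrC -ltr_pdivrMr //; move: nus; lra.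
have /andP[H _] := Hs0 s s_0 ss0; rewrite -/kappa in H.
have sa0 : 0 < s `^ alpha by rewrite powR_gt0.
have s2 : s * s <= e1 * s `^ alpha.
  have -> : s * s = s `^ (2 - alpha) * s `^ alpha.
    rewrite -powRD; last by apply/implyP => _; rewrite gt_eqF.
    by rewrite subrK powR_mulrn ?(ltW s_0) // expr2.
  rewrite ler_wpM2r ?(ltW sa0) //.
  have -> : e1 = (e1 `^ (2 - alpha)^-1) `^ (2 - alpha).
    by rewrite -powRrM mulVf ?gt_eqF // powRr1 // ltW.
  apply: ge0_ler_powR; rewrite ?nnegrE ?powR_ge0 ?(ltW a20) ?(ltW s_0) //.
  by move: nue; rewrite ler_pdivrMr ?powR_gt0 // /s ler_pdivrMr // mulrC.
have L0 := laplace_ge0 A0 s.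
have yE : (kappa - 2 * e1) * s `^ alpha = q / n%:R by rewrite /s scaled_powR // mulrA.
have Phi1 : 1 + q / n%:R <= Phi s.
  apply: (@le_trans _ _ ((1 + s) * laplace A0 s)); last by rewrite ler_wpM2r // expR_ge1Dx.
  have s1 : 0 <= 1 + s by rewrite addr_ge0 // ltW.
  have L1 : 1 - s + (kappa - e1) * s `^ alpha <= laplace A0 s by move: H; lra.
  apply: le_trans (ler_wpM2l s1 L1); rewrite -yE.
  have ke : 0 <= kappa - e1 by move: e1k e10; lra.
  have : 0 <= s * ((kappa - e1) * s `^ alpha).
    by apply: mulr_ge0; [exact: ltW | apply: mulr_ge0 => //; exact: ltW].
  by move: s2; lra.
pose yy := q / n%:R.
have yy0 : 0 <= yy by rewrite divr_ge0 // ltW.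
have ey : expR (yy / (1 + yy)) <= 1 + yy.
  have y1 : 0 < 1 + yy by rewrite ltr_wpDr.
  have := expR_ge1Dx (- (yy / (1 + yy))); rewrite expRN.
  have -> : 1 + - (yy / (1 + yy)) = (1 + yy)^-1 by field; rewrite gt_eqF.
  by rewrite lef_pV2 ?posrE ?expR_gt0.
apply: (@le_trans _ _ (expR (yy / (1 + yy)) ^+ m)); last first.
  by apply: lerXn2r; rewrite ?nnegrE ?expR_ge0 ?moment_factor_ge0 //; exact: le_trans ey Phi1.
rewrite -expRM_natl ler_expR.
have y1 : 0 < 1 + yy by rewrite ltr_wpDr.
have yq : 0 <= yy / (1 + yy) by rewrite divr_ge0 // ltW.
apply: (@le_trans _ _ (n%:R * k * (yy / (1 + yy)))); last by rewrite ler_wpM2r.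
have nyy : n%:R * yy = q by rewrite /yy mulrC divfK // gt_eqF.
have -> : n%:R * k * (yy / (1 + yy)) = k * (n%:R * yy / (1 + yy)) by ring.
rewrite nyy.
rewrite ler_wpM2l // ler_pdivlMr //.
have qy : q * yy <= e / 2.
  move: nq; rewrite mulr1 ler_pdivrMr ?divr_gt0 // => nq'.
  by rewrite /yy mulrA ler_pdivrMr // [leRHS]mulrC.
have qE : q = kappa * th `^ alpha - 2 * (e1 * th `^ alpha) by rewrite /q; ring.
have : kappa * th `^ alpha - e <= q - q * yy by rewrite {1}qE; move: e1e qy; lra.
move=> K; apply: (@le_trans _ _ ((q - q * yy) * (1 + yy))); first by rewrite ler_wpM2r // ltW.
have : 0 <= q * yy * yy by apply: mulr_ge0 => //; apply: mulr_ge0.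
lra.
Unshelve. all: by end_near. Qed.

Lemma moment_upper (th e : R) : 0 < th -> 0 < e -> exists2 delta, 0 < delta &
  \forall n \near \oo, forall (k : R) m, 1 <= k -> m%:R <= n%:R * (k + delta) ->
  Phi (th / nu n) ^+ m <= expR (k * (kappa * th `^ alpha + e)).
Proof.
move=> th0 e0; have k0 := kappa_gt0; have ta0 : 0 < th `^ alpha by rewrite powR_gt0.
pose e1 := e / (4 * th `^ alpha).
have e10 : 0 < e1 by rewrite divr_gt0 // mulr_gt0.
have e1e : e1 * th `^ alpha = e / 4 by rewrite /e1; field; rewrite gt_eqF.
have [s0 s00 Hs0] := laplace_asymptotics hA0 hEA a1 a2 CA0 tailA e10.
pose q := kappa * th `^ alpha + e / 4.
have q0 : 0 < q by rewrite addr_gt0 ?divr_gt0 // mulr_gt0.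
exists (e / 4 / q); first by rewrite !divr_gt0.
near=> n => k m k1 mk.
have n_0 : (0 < n)%N by near: n; exists 1%N.
have n0 : 0 < n%:R :> R by rewrite ltr0n.
have nu0 : 0 < nu n by rewrite powR_gt0.
have nus : th / s0 + 1 <= nu n by near: n; exact: near_nu.
pose s := th / nu n.
have s_0 : 0 < s by rewrite divr_gt0.
have ss0 : s < s0.
  rewrite ltr_pdivrMr // mulrC -ltr_pdivrMr //; move: nus; lra.
have /andP[_ H] := Hs0 s s_0 ss0; rewrite -/kappa in H.
have Phi1 : Phi s <= expR (q / n%:R).
  have -> : q / n%:R = s + (- s + (kappa + e1) * s `^ alpha).
    rewrite /s scaled_powR // /q -e1e; ring.
  rewrite expRD ler_wpM2l ?expR_ge0 //; apply: le_trans (expR_ge1Dx _); move: H; lra.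
apply: (@le_trans _ _ (expR (q / n%:R) ^+ m)).
  by apply: lerXn2r; rewrite ?nnegrE ?expR_ge0 ?moment_factor_ge0.
rewrite -expRM_natl ler_expR.
apply: (@le_trans _ _ (n%:R * (k + e / 4 / q) * (q / n%:R))).
  by rewrite ler_wpM2r // divr_ge0 ?ltW.
have -> : n%:R * (k + e / 4 / q) * (q / n%:R) = k * q + e / 4 by field; rewrite !gt_eqF.
have : e / 4 <= k * (e / 4) by rewrite ler_peMl // divr_ge0 // ltW.
by rewrite /q; lra.
Unshelve. all: by end_near. Qed.

(** The excess is read off the Laplace transform through [x - 2 / s <= 2 / s * (exp(- s x) - 1 + s
    x)], whose mean is small for small [s] since [alpha > 1]. *)
Lemma small_excess : exists s l0 : R, [/\ 0 <= s, 0 <= l0, laplace A0 s < 1 &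
  (\int[P0]_w (Num.max (A0 w - l0) 0)%:E <= (8^-1)%:E)%E].
Proof.
have k0 := kappa_gt0; have [s0 s00 Hs0] := laplace_asymptotics hA0 hEA a1 a2 CA0 tailA ltr01.
rewrite -/kappa in Hs0.
have a10 : 0 < alpha - 1 by rewrite subr_gt0.
pose c := 16^-1 / (kappa + 1); have c0 : 0 < c by rewrite divr_gt0 ?invr_gt0 // addr_gt0.
pose s := Num.min (s0 / 2) (c `^ (alpha - 1)^-1).
have s_0 : 0 < s by rewrite lt_min divr_gt0 // powR_gt0.
have ss0 : s < s0 by rewrite gt_min; apply/orP; left; move: s00; lra.
have sc : s `^ (alpha - 1) <= c.
  have -> : c = (c `^ (alpha - 1)^-1) `^ (alpha - 1).
    by rewrite -powRrM mulVf ?gt_eqF // powRr1 // ltW.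
  by apply: ge0_ler_powR; rewrite ?nnegrE ?powR_ge0 ?(ltW a10) ?(ltW s_0) // ge_min lexx orbT.
have /andP[_ H] := Hs0 s s_0 ss0.
have sa : s `^ alpha = s * s `^ (alpha - 1).
  rewrite -[X in _ = X * _](powRr1 (ltW s_0)) -powRD; first by rewrite addrC subrK.
  by apply/implyP => _; rewrite gt_eqF.
have H2 : laplace A0 s - 1 + s <= s / 16.
  apply: le_trans H _; rewrite sa mulrCA ler_wpM2l ?(ltW s_0) //.
  apply: (@le_trans _ _ ((kappa + 1) * c)); first by rewrite ler_wpM2l // addr_ge0 // ltW.
  by rewrite le_eqVlt; apply/orP; left; apply/eqP; rewrite /c; field; rewrite gt_eqF // addr_gt0.
exists s, (2 / s); split; [exact: ltW|by rewrite divr_ge0 // ltW|by move: H2 s_0; lra|].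
have mA0 : measurable_fun setT A0 by exact: measurable_funPT.
have gs0 w : 0 <= expR (- (s * A0 w)) - 1 + s * A0 w by have := expR_ge1Dx (- (s * A0 w)); lra.
have mgs : measurable_fun setT (fun w => expR (- (s * A0 w)) - 1 + s * A0 w).
  apply: measurable_funD; last exact: measurable_funM.
  by apply: measurable_funB => //; apply/measurable_EFinP; exact: measurable_expRA.
apply: (@le_trans _ _ (\int[P0]_w ((2 / s)%:E * (expR (- (s * A0 w)) - 1 + s * A0 w)%:E))%E).
  apply: ge0_le_integral; [exact: measurableT|by move=> w _; rewrite lee_fin le_max lexx orbT| | | ].
  - by apply/measurable_EFinP; apply: measurable_maxr => //; apply: measurable_funB.
  - by apply: measurable_funeM; exact/measurable_EFinP.
  move=> w _; rewrite -EFinM lee_fin ge_max; apply/andP; split; last by rewrite mulr_ge0 ?divr_ge0 // ltW.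
  have E := expR_gt0 (- (s * A0 w)).
  have -> : A0 w - 2 / s = 2 / s * (s * A0 w / 2 - 1) by field; rewrite gt_eqF.
  by rewrite ler_wpM2l ?divr_ge0 ?(ltW s_0) //; have : 0 <= s * A0 w by [rewrite mulr_ge0 // ltW]; lra.
rewrite ge0_integralZl; [|exact: measurableT|exact/measurable_EFinP|by move=> w _; rewrite lee_fin|by rewrite lee_fin divr_ge0 // ltW].
rewrite integral_gs ?(ltW s_0) // -EFinM lee_fin.
apply: (@le_trans _ _ (2 / s * (s / 16))); first by rewrite ler_wpM2l // divr_ge0 // ltW.
by rewrite le_eqVlt; apply/orP; left; apply/eqP; field; rewrite gt_eqF.
Qed.

End moment_asymptotics.

(** * Asymptotic lower bound for the scaled tail *)

Section lower_tail.
Context d0 d (Omega0 : measurableType d0) (Omega : measurableType d) (R : realType).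
Variables (P0 : probability Omega0 R) (P : probability Omega R).
Variables (A0 S0 : {RV P0 >-> R}) (A S : nat -> {RV P >-> R}).
Hypotheses (hA0 : forall w, 0 <= A0 w)
  (hAS : GI_primitives A0 S0 A S) (hEA : ('E_P0[A0] = 1)%E) (S1 : P0 [set w | S0 w = 1] = 1%E).
Variables (alpha C_A B : R) (Q : nat -> probability R R).
Hypotheses (a1 : 1 < alpha) (a2 : alpha < 2) (CA0 : 0 < C_A) (B0 : 0 < B).
Hypothesis tailA : ((x `^ alpha)%:E * P0 [set w | (x < A0 w)%R])%E @[x --> +oo] --> C_A%:E.
Hypothesis stat : \forall n \near \oo, steady_state_Q A S B alpha n (Q n).
Let kappa := C_A * (alpha * Gamma (- alpha)).
Let ts := (B / kappa) `^ (alpha - 1)^-1.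

Ltac slim := clear - hA0 hAS hEA S1 a1 a2 CA0 B0 tailA stat kappa ts.

(** Over a period [K], the tilt by [ts] gives the arrivals a surplus [alpha * B * K], of which the
    slack in the load consumes [B * K]. What is left equals [x] for [K = x / ((alpha - 1) * B)], and
    the cost is [(alpha - 1) * B * ts * K = ts * x]. *)
Theorem lower_tail (eta : R) : 0 < eta -> exists c x0 : R, forall x, x0 <= x -> 0 < x ->
  \forall n \near \oo, ((expR (- (ts + eta) * x - c))%:E <= scaled_tail alpha n (Q n) x)%E.
Proof.
move=> eta0.
have k0 : 0 < kappa := kappa_gt0 a1 a2 CA0.
have a10 : 0 < alpha - 1 by rewrite subr_gt0.
have a_0 : 0 < alpha := lt_trans ltr01 a1.
have ts0 : 0 < ts by rewrite powR_gt0 // divr_gt0.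
have tsB : kappa * ts `^ (alpha - 1) = B.
  by rewrite /ts -powRrM mulVf ?gt_eqF // powRr1 ?divr_ge0 ?(ltW B0) ?(ltW k0) // mulrC divfK // gt_eqF.
pose b := B * ts.
have b0 : 0 < b by rewrite mulr_gt0.
have tsb : kappa * ts `^ alpha = b.
  have -> : ts `^ alpha = ts `^ (alpha - 1) * ts.
    rewrite -[X in _ = _ * X](powRr1 (ltW ts0)) -powRD ?subrK //.
    by apply/implyP => _; rewrite gt_eqF.
  by rewrite mulrA tsB.
(* The constant 13 collects the losses of order [w] in the exponent, added up in [Yw]. *)
pose w := Num.min 1 (eta * (alpha - 1) / (13 * ts)).
have w0 : 0 < w by rewrite lt_min ltr01 /= divr_gt0 ?mulr_gt0.
have w1 : w <= 1 by rewrite ge_min lexx.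
have wE : 13 * w * ts <= eta * (alpha - 1).
  have : w <= eta * (alpha - 1) / (13 * ts) by rewrite ge_min lexx orbT.
  by rewrite ler_pdivlMr ?mulr_gt0 // => H; apply: le_trans H; rewrite le_eqVlt; apply/orP; left; apply/eqP; ring.
(* Tilting beyond [ts] puts the tilted mean above the target; [g] places the lower Chernoff
   correction at [ts] itself. *)
pose th := ts * (1 + w); pose g := w * ts.
have w10 : 0 < 1 + w by rewrite addr_gt0.
have w20 : 0 < 1 + 2 * w by rewrite addr_gt0 // mulr_gt0.
have th0 : 0 < th by rewrite mulr_gt0.
have g0 : 0 < g by rewrite mulr_gt0.
have thmg : th - g = ts by rewrite /th /g; ring.
have thpg : th + g = ts * (1 + 2 * w) by rewrite /th /g; ring.
have gth : g <= th by rewrite -subr_ge0 thmg ltW.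
pose wa := (1 + w) `^ alpha; pose w2a := (1 + 2 * w) `^ alpha.
have wa1 : 1 <= wa by rewrite /wa -[leLHS](powRr0 (1 + w)) ler_powR ?(ltW a_0) // lerDl ltW.
have thb : kappa * th `^ alpha = b * wa.
  by rewrite /th powRM ?(ltW ts0) ?(ltW w10) // mulrA tsb.
have tgb : kappa * (th + g) `^ alpha = b * w2a.
  by rewrite thpg powRM ?(ltW ts0) ?(ltW w20) // mulrA tsb.
(* Strict convexity: the gap [d1] makes the lower correction exponentially smaller than the main
   term. *)
pose d1 := wa - 1 - alpha * w.
have d10 : 0 < d1 by have := strict_bernoulli a1 w0; rewrite /d1 /wa; lra.
pose e := Num.min (b * d1) (b * (w * w)) / 8.
have e0 : 0 < e by rewrite divr_gt0 // lt_min !mulr_gt0.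
have e1 : 8 * e <= b * d1 by rewrite mulrC /e divfK // ge_min lexx.
have e2 : 8 * e <= b * (w * w) by rewrite mulrC /e divfK // ge_min lexx orbT.
(* The upper end of the tilting interval per unit of [B * K]; the additional [w] makes the upper
   correction smaller by [w * w] in [incr]. *)
pose Y1 := alpha * (1 + 2 * w) + w.
have incr : w2a <= wa + w * Y1 - w * w.
  have := powR_increment a1 w0 w1 a2; rewrite -/wa -/w2a /Y1; lra.
have [del1 del10 U1] := moment_upper hA0 hEA a1 a2 CA0 tailA ts0 e0.
have tg0 : 0 < th + g by rewrite addr_gt0.
have [del2 del20 U2] := moment_upper hA0 hEA a1 a2 CA0 tailA tg0 e0.
have L1 := moment_lower hA0 hEA a1 a2 CA0 tailA th0 e0.
have [s [l0 [s0 l00 laps exc]]] := small_excess hA0 hEA a1 a2 CA0 tailA.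
exists (b * (alpha - 1 + 13 * w) + ln 4), ((alpha - 1) * B * (ln 4 / (5 * e))) => x xx0 x0.
near=> n.
have n_0 : (0 < n)%N by near: n; exists 1%N.
have n0 : 0 < n%:R :> R by rewrite ltr0n.
have st : steady_state_Q A S B alpha n (Q n) by near: n; exact: stat.
have HU1 : forall (k : R) m, 1 <= k -> m%:R <= n%:R * (k + del1) ->
  moment_factor A0 (ts / n%:R `^ alpha^-1) ^+ m <= expR (k * (kappa * ts `^ alpha + e)).
  by near: n; exact: U1.
have HU2 : forall (k : R) m, 1 <= k -> m%:R <= n%:R * (k + del2) ->
  moment_factor A0 ((th + g) / n%:R `^ alpha^-1) ^+ m <= expR (k * (kappa * (th + g) `^ alpha + e)).
  by near: n; exact: U2.
have HL1 : forall (k : R) m, 0 <= k -> n%:R * k <= m%:R ->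
  expR (k * (kappa * th `^ alpha - e)) <= moment_factor A0 (th / n%:R `^ alpha^-1) ^+ m.
  by near: n; exact: L1.
have N1 : 2 * B * n%:R `^ alpha^-1 <= n%:R by near: n; exact: near_nu_small.
have N2 : (x + 1) / del1 * n%:R `^ alpha^-1 <= n%:R by near: n; exact: near_nu_small.
have N3 : (x + 1) / del2 * n%:R `^ alpha^-1 <= n%:R by near: n; exact: near_nu_small.
have N4 : 1 <= n%:R `^ alpha^-1 :> R by near: n; exact: near_nu.
have N5 : (2 * l0 + 2) / (e / g) <= n%:R `^ alpha^-1 by near: n; exact: near_nu.
have N6 : 4 * l0 + 4 <= n%:R by rewrite -[leRHS](powRr1 (ltW n0)); near: n; exact: near_powR.
move: N1 N2 N3 N4 N5 HU1 HU2 HL1; rewrite scaled_tailE ?(ltW x0) //.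
have : 0 < n%:R `^ alpha^-1 :> R by rewrite powR_gt0.
have lamE : arrival_rate B alpha n = n%:R - B * n%:R `^ alpha^-1 by [].
move: lamE; move nuE : (n%:R `^ alpha^-1) => nu lamE nu0 N1 N2 N3 N4 N5 HU1 HU2 HL1.
have lam0 : 0 < arrival_rate B alpha n by rewrite lamE; move: N1 n0; slim; lra.
pose q := x / ((alpha - 1) * B).
have q0 : 0 <= q by rewrite divr_ge0 ?mulr_ge0 // ltW.
pose k := Num.truncn q.
have /andP[k1 k2] := truncn_itv q0; rewrite -/k in k1 k2.
pose K : R := k.+1%:R.
have K1 : 1 <= K by rewrite ler1n.
have Kq : K <= q + 1 by rewrite /K -natr1 lerD2r.
have KxB : x <= (alpha - 1) * B * K.
  by move: k2; rewrite -/K /q ltr_pdivrMr ?mulr_gt0 // => /ltW; rewrite mulrC.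
have xnu0 : 0 <= x * nu by rewrite mulr_ge0 ?(ltW nu0) // ltW.
pose z := (Num.truncn (x * nu)).+1.
have /andP[z1 z2] := truncn_itv xnu0; rewrite -/z in z2.
have z3 : z%:R <= x * nu + 1 by rewrite /z -natr1 lerD2r.
have yint : n%:R + x * nu < n%:R + x * nu + 2^-1 by rewrite ltrDl invr_gt0.
have [y /andP[y1 y2] yat] := exists_nonatom (Q n) yint.
have yz : y < (n + z).+1%:R by rewrite -natr1 natrD; move: y2 z2; slim; lra.
pose m := (n * k + (n + z))%N.
have mE : m%:R = n%:R * K + z%:R :> R.
  by rewrite /m !natrD natrM /K -natr1; ring.
(* [e / g] absorbs rounding and overshoot at the price [e] in the exponent. *)
pose Y0 := alpha * B * K + e / g.
have lamk : 2 * l0 + 2 <= arrival_rate B alpha n * k.+1%:R.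
  rewrite -/K; apply: (@le_trans _ _ (arrival_rate B alpha n)); last by rewrite ler_peMr // ltW.
  by rewrite lamE; move: N1 N6; slim; lra.
have nue : 2 * l0 + 2 <= nu * (e / g) by move: N5; rewrite ler_pdivrMr // divr_gt0.
have y0ge : m%:R - arrival_rate B alpha n * k.+1%:R + 2 * l0 + 1 <= nu * Y0.
  rewrite mE lamE -/K /Y0.
  have : x * nu <= (alpha - 1) * B * K * nu by rewrite ler_wpM2r // ltW.
  by move: z3 nue; slim; lra.
have mge : n%:R * K <= m%:R by rewrite mE lerDl.
have mle del : 0 < del -> (x + 1) / del * nu <= n%:R -> m%:R <= n%:R * (K + del).
  move=> del0 H; rewrite mE mulrDr lerD2l; apply: (le_trans z3).
  have H1 := ler_wpM2r (ltW del0) H.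
  have E1 : (x + 1) / del * nu * del = (x + 1) * nu by field; rewrite gt_eqF.
  by rewrite E1 in H1; apply: le_trans H1; move: N4; slim; lra.
have main := @stationary_lower _ _ _ _ _ P0 P A0 S0 A S hA0 hAS hEA S1 B alpha n (Q n) n_0 st lam0
  l0 s l00 exc s0 laps k z nu th g y Y0 (B * K * Y1) nu0 g0 gth yz yat lamk y0ge.
rewrite -/m thmg in main.
have G1 := HL1 K m (le_trans ler01 K1) mge; rewrite thb in G1.
have G2 := HU1 K m K1 (mle _ del10 N2); rewrite tsb in G2.
have G3 := HU2 K m K1 (mle _ del20 N3); rewrite tgb in G3.
pose E1 := expR (K * (b * wa - e)); pose E2 := expR (K * (b * wa - 6 * e)).
have T2 : expR (g * Y0) * moment_factor A0 (ts / nu) ^+ m <= E2.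
  apply: (@le_trans _ _ (expR (g * Y0) * expR (K * (b + e)))); first exact: (ler_wpM2l (expR_ge0 _) G2).
  rewrite -expRD ler_expR.
  have -> : g * Y0 = K * (b * (alpha * w)) + e.
    have ge : g * (e / g) = e by rewrite mulrC divfK // gt_eqF.
    by rewrite /Y0 mulrDr ge; congr (_ + _); rewrite /g /b; ring.
  have eK : e <= K * e by rewrite ler_peMl // ltW.
  have H : K * (b * (alpha * w) + b + 2 * e) <= K * (b * wa - 6 * e).
    rewrite ler_wpM2l ?(le_trans ler01 K1) //.
    have dE : b * d1 = b * wa - b - b * (alpha * w) by rewrite /d1; ring.
    by rewrite dE in e1; move: e1; slim; lra.
  by move: H eK; slim; lra.
have T3 : expR (- g * (B * K * Y1)) * moment_factor A0 ((th + g) / nu) ^+ m <= E2.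
  apply: (@le_trans _ _ (expR (- g * (B * K * Y1)) * expR (K * (b * w2a + e)))).
    exact: (ler_wpM2l (expR_ge0 _) G3).
  rewrite -expRD ler_expR.
  have -> : - g * (B * K * Y1) + K * (b * w2a + e) = K * (b * (w2a - w * Y1) + e).
    by rewrite /g /b; ring.
  rewrite ler_wpM2l ?(le_trans ler01 K1) //.
  have H : b * (w2a - w * Y1) <= b * (wa - w * w) by rewrite ler_wpM2l ?(ltW b0) //; move: incr; slim; lra.
  have -> : b * wa - 6 * e = b * (wa - w * w) + (b * (w * w) - 6 * e) by ring.
  by move: H e2 e0; slim; lra.
(* The lower threshold on [x] is what makes [5 * e * K] at least [ln 4]. *)
have E12 : E2 <= E1 / 4.
  have -> : E2 = E1 * expR (- (5 * e * K)).
    by rewrite /E1 /E2 -expRD; congr expR; ring.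
  rewrite ler_wpM2l ?expR_ge0 // -[leRHS]lnK ?posrE ?invr_gt0 // ler_expR lnV ?posrE // lerN2.
  have Bq : 0 < (alpha - 1) * B by rewrite mulr_gt0.
  have H := le_trans xx0 KxB; rewrite ler_pM2l // in H.
  have e5 : 0 < 5 * e by apply: mulr_gt0.
  by rewrite [5 * e * K]mulrC -ler_pdivrMr.
have E10 : 0 < E1 := expR_gt0 _.
have X1 := expR_gt0 (- th * (B * K * Y1)).
have low : expR (- th * (B * K * Y1)) * (E1 / 2) <= 2 * fine (Q n `]y, +oo[%classic).
  apply: le_trans main; rewrite ler_wpM2l ?(ltW X1) //; move: G1 T2 T3 E12 E10; rewrite -/E1; slim; lra.
have fin : expR (- (ts + eta) * x - (b * (alpha - 1 + 13 * w) + ln 4)) <= fine (Q n `]y, +oo[%classic).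
  have -> : expR (- (ts + eta) * x - (b * (alpha - 1 + 13 * w) + ln 4)) =
      expR (- (ts + eta) * x - b * (alpha - 1 + 13 * w)) / 4.
    rewrite [X in expR X](_ : _ = (- (ts + eta) * x - b * (alpha - 1 + 13 * w)) - ln 4); last by ring.
    by rewrite expRD [expR (- ln 4)]expRN lnK ?posrE.
  suff : expR (- (ts + eta) * x - b * (alpha - 1 + 13 * w)) <= expR (- th * (B * K * Y1)) * E1.
    by move: low; slim; lra.
  rewrite -expRD ler_expR.
  have -> : - th * (B * K * Y1) + K * (b * wa - e) = - (K * (b * ((1 + w) * Y1 - wa) + e)).
    by rewrite /th /b; ring.
  have ew : e <= b * w.
    have : b * (w * w) <= b * w by rewrite ler_wpM2l ?(ltW b0) // ler_piMl // ltW.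
    by move: e2 e0; slim; lra.
  have Yw : (1 + w) * Y1 - wa + w <= alpha - 1 + 13 * w.
    have ww : w * w <= w by rewrite ler_piMl // ltW.
    have aw : alpha * w <= 2 * w by rewrite ler_wpM2r ?(ltW w0) // ltW.
    have aww : alpha * (w * w) <= 2 * w.
      by apply: le_trans aw; rewrite ler_wpM2l // ltW.
    have -> : (1 + w) * Y1 = alpha + 3 * (alpha * w) + w + 2 * (alpha * (w * w)) + w * w by rewrite /Y1; ring.
    by move: wa1 ww aw aww; slim; lra.
  have H1 : K * (b * ((1 + w) * Y1 - wa) + e) <= K * (b * (alpha - 1 + 13 * w)).
    rewrite ler_wpM2l ?(le_trans ler01 K1) //.
    have := ler_wpM2l (ltW b0) Yw; rewrite mulrDr; move: ew; slim; lra.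
  have p0 : 0 <= b * (alpha - 1 + 13 * w).
    by rewrite mulr_ge0 ?(ltW b0) // addr_ge0 ?(ltW a10) // mulr_ge0 // ltW.
  have H2 : K * (b * (alpha - 1 + 13 * w)) <= (q + 1) * (b * (alpha - 1 + 13 * w)) by rewrite ler_wpM2r.
  have H3 : q * (b * (alpha - 1 + 13 * w)) = x * (ts + 13 * w * ts / (alpha - 1)).
    by rewrite /q /b; field; rewrite !gt_eqF.
  have H4 : 13 * w * ts / (alpha - 1) <= eta by rewrite ler_pdivrMr.
  have H5 : x * (ts + 13 * w * ts / (alpha - 1)) <= x * (ts + eta) by rewrite ler_wpM2l ?(ltW x0) // lerD2l.
  rewrite [(q + 1) * _]mulrDl mul1r H3 in H2.
  rewrite mulNr [(ts + eta) * x]mulrC; move: H1 H2 H5; slim; lra.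
apply: (@le_trans _ _ (fine (Q n `]y, +oo[%classic))%:E); first by rewrite lee_fin.
rewrite fineK ?fin_num_measure; last exact: measurable_itv.
apply: le_measure; rewrite ?inE; [exact: measurable_itv|exact: measurable_itv|].
by move=> v /=; rewrite !in_itv /= !andbT; apply: le_lt_trans.
Unshelve. all: by end_near. Qed.

End lower_tail.

(** * Decay rates from bounds that hold eventually *)

Section limsup_bounds.
Context {R : realType} {T : choiceType} {X : filteredType T}.
Variables (F : set_system X) (FF : ProperFilter F).
Implicit Types (f : X -> \bar R) (a : \bar R).

Lemma limf_esup_near_le f a : (\forall x \near F, (f x <= a)%E) -> (limf_esup f F <= a)%E.
Proof.
move=> H; apply: (@le_trans _ _ (ereal_sup (f @` [set x | (f x <= a)%E]))).
  by apply: ereal_inf_lbound; exists [set x | (f x <= a)%E].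
by apply: ge_ereal_sup => _ [x /= fx <-].
Qed.

Lemma limf_esup_near_ge f a : (\forall x \near F, (a <= f x)%E) -> (a <= limf_esup f F)%E.
Proof.
move=> H; apply: le_ereal_inf_tmp => _ [V FV <-].
have [x [ax Vx]] := filter_ex (filterI H FV).
by apply: le_trans ax _; apply: ereal_sup_ubound; exists x.
Qed.

Lemma limf_einf_near_le f a : (\forall x \near F, (f x <= a)%E) -> (limf_einf f F <= a)%E.
Proof.
by move=> H; rewrite leeNl; apply: limf_esup_near_ge; apply: filterS H => x; rewrite leeN2.
Qed.

Lemma limf_einf_near_ge f a : (\forall x \near F, (a <= f x)%E) -> (a <= limf_einf f F)%E.
Proof.
by move=> H; rewrite leeNr; apply: limf_esup_near_le; apply: filterS H => x; rewrite leeN2.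
Qed.

End limsup_bounds.

Section lne_bounds.
Context {R : realType}.

Lemma lne_le_expR (y : \bar R) a : (y <= (expR a)%:E)%E -> (lne y <= a%:E)%E.
Proof.
case: y => [r| |]; rewrite ?leye_eq ?leNye //= lee_fin => ra.
by case: ifPn; rewrite ?leNye // -ltNge => r0; rewrite lee_fin -(ler_expR) lnK ?posrE.
Qed.

Lemma lne_ge_expR (y : \bar R) a : ((expR a)%:E <= y)%E -> (a%:E <= lne y)%E.
Proof.
case: y => [r| |]; rewrite ?leey ?leeNy_eq //= lee_fin => ra.
have r0 : 0 < r := lt_le_trans (expR_gt0 a) ra.
by rewrite [r <= 0]leNgt r0 /= lee_fin -ler_expR lnK ?posrE.
Qed.

End lne_bounds.

Section decay_bounds.
Context {R : realType}.
Variable tail : nat -> R -> \bar R.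

Lemma limn_tail_le theta c x :
  (forall e, 0 < e -> \forall n \near \oo, (tail n x <= (expR (- theta * (x - c)) + e)%:E)%E) ->
  (limn_esup (tail ^~ x) <= (expR (- theta * (x - c)))%:E)%E /\
  (limn_einf (tail ^~ x) <= (expR (- theta * (x - c)))%:E)%E.
Proof.
move=> H; split; apply/lee_addgt0Pr => e e0; rewrite -EFinD.
  exact: (limf_esup_near_le (H e e0)).
exact: (limf_einf_near_le _ (H e e0)).
Qed.

(** The additive [e] is removed by the limit in [n], and the shift [c] by the division by [x]. *)
Lemma decay_le theta : 0 < theta ->
  (exists c, forall x e : R, 0 < x -> 0 < e ->
    \forall n \near \oo, (tail n x <= (expR (- theta * (x - c)) + e)%:E)%E) ->
  (upper_decay tail <= (- theta)%:E)%E /\ (lower_decay tail <= (- theta)%:E)%E.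
Proof.
move=> t0 [c H].
have near_le (g : R -> \bar R) e : 0 < e ->
    (forall x, 0 < x -> (g x <= (expR (- theta * (x - c)))%:E)%E) ->
    \forall x \near +oo, ((x^-1)%:E * lne (g x) <= (- theta + e)%:E)%E.
  move=> e0 Hg; near=> x.
  have x0 : 0 < x by near: x; exact: nbhs_pinfty_gt.
  have xc : theta * c / e <= x by near: x; exact: nbhs_pinfty_ge (num_real _).
  apply: (@le_trans _ _ ((x^-1)%:E * (- theta * (x - c))%:E)%E).
    by apply: lee_wpmul2l; [rewrite lee_fin invr_ge0 ltW|exact/lne_le_expR/Hg].
  rewrite -EFinM lee_fin mulrC ler_pdivrMr //.
  by move: xc; rewrite ler_pdivrMr //; lra.
split; apply/lee_addgt0Pr => e e0; rewrite -EFinD.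
  by apply: limf_esup_near_le; apply: near_le => // x x0; have [] := limn_tail_le (H x ^~ x0).
by apply: limf_einf_near_le; apply: near_le => // x x0; have [] := limn_tail_le (H x ^~ x0).
Unshelve. all: by end_near. Qed.

Lemma decay_ge theta :
  (exists c x0 : R, forall x, x0 <= x -> 0 < x ->
    \forall n \near \oo, ((expR (- theta * x - c))%:E <= tail n x)%E) ->
  forall e, 0 < e ->
  ((- theta - e)%:E <= upper_decay tail)%E /\ ((- theta - e)%:E <= lower_decay tail)%E.
Proof.
move=> [c [x1 H]] e e0.
have near_ge (g : R -> \bar R) :
    (forall x, x1 <= x -> 0 < x -> ((expR (- theta * x - c))%:E <= g x)%E) ->
    \forall x \near +oo, ((- theta - e)%:E <= (x^-1)%:E * lne (g x))%E.
  move=> Hg; near=> x.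
  have x0 : 0 < x by near: x; exact: nbhs_pinfty_gt.
  have x1x : x1 <= x by near: x; exact: nbhs_pinfty_ge (num_real _).
  have xc : c / e <= x by near: x; exact: nbhs_pinfty_ge (num_real _).
  apply: (@le_trans _ _ ((x^-1)%:E * (- theta * x - c)%:E)%E); last first.
    by apply: lee_wpmul2l; [rewrite lee_fin invr_ge0 ltW|exact/lne_ge_expR/Hg].
  rewrite -EFinM lee_fin mulrC ler_pdivlMr //.
  by move: xc; rewrite ler_pdivrMr //; lra.
split.
  by apply: limf_esup_near_ge; apply: near_ge => x h1 h2; exact: limf_esup_near_ge (H x h1 h2).
by apply: limf_einf_near_ge; apply: near_ge => x h1 h2; exact: limf_einf_near_ge (H x h1 h2).
Unshelve. all: by end_near. Qed.

End decay_bounds.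

Lemma deterministic_unit d0 (Omega0 : measurableType d0) (R : realType)
    (P0 : probability Omega0 R) (S0 : {RV P0 >-> R}) :
  (forall w, 0 <= S0 w) -> ('E_P0[S0] = 1)%E -> deterministic S0 ->
  P0 [set w | S0 w = 1] = 1%E.
Proof.
move=> S0_ge0 ES [r Pr]; suff r1 : r = 1 by rewrite r1 in Pr.
have mr : measurable [set w | S0 w = r].
  by rewrite -[X in measurable X]setTI; exact: (measurable_funP S0 measurableT _ (measurable_set1 r)).
have ae : {ae P0, forall w, [set: Omega0] w -> (S0 w)%:E = (cst r%:E) w}.
  exists (~` [set w | S0 w = r]); split.
  - exact: measurableC.
  - by rewrite probability_setC // Pr subee.
  - by move=> w /= nw; apply: contra_not nw => /= -> _.
have E : (\int[P0]_w (S0 w)%:E = \int[P0]_w (cst r%:E) w)%E.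
  apply: ae_eq_integral => //; first exact/measurable_EFinP.
move: ES; rewrite expectation_def E integral_cst //= probability_setT mule1.
by case.
Qed.

Theorem corollary3 (R : realType)
  (d0 d : measure_display)
  (Omega0 : measurableType d0) (P0 : probability Omega0 R)
  (Omega : measurableType d) (P : probability Omega R)
  (A0 S0 : {RV P0 >-> R}) (A S : nat -> {RV P >-> R})
  (alpha C_A : R)
  (hA0 : forall w, 0 <= A0 w) (hS0 : forall w, 0 <= S0 w)
  (hAS : GI_primitives A0 S0 A S)
  (hEA : ('E_P0[A0] = 1)%E) (hES : ('E_P0[S0] = 1)%E)
  (halpha1 : 1 < alpha) (halpha2 : alpha < 2)
  (hC_A : 0 < C_A)
  (htail : ((x `^ alpha)%:E * P0 [set w | (x < A0 w)%R])%E @[x --> +oo]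
             --> C_A%:E)
  (hmoment : exists eps : R, [/\ 0 < eps, eps <= 1 &
     ('E_P0[fun w => (S0 w `^ (1 + eps))%R] < +oo)%E])
  (hQ : forall B : R, 0 < B ->
     \forall n \near \oo, steady_state_Q_exists A S B alpha n)
  (hW : forall B : R, 0 < B ->
     \forall n \near \oo, steady_state_W_exists A S B alpha n) :
  forall (B : R) (Q : nat -> probability R R), 0 < B ->
    (\forall n \near \oo, steady_state_Q A S B alpha n (Q n)) ->
    let tail n x := scaled_tail alpha n (Q n) x in
    (upper_decay tail <= (- decay_rate B C_A alpha)%:E)%E /\
    (deterministic S0 ->
       lower_decay tail = (- decay_rate B C_A alpha)%:E /\
       upper_decay tail = (- decay_rate B C_A alpha)%:E).
Proof.
move=> B Q B0 st tail.
have k0 := kappa_gt0 halpha1 halpha2 hC_A.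
pose ts := decay_rate B C_A alpha; rewrite -/ts.
have tsE : ts = (B / (C_A * (alpha * Gamma (- alpha)))) `^ (alpha - 1)^-1.
  by rewrite /ts /decay_rate mulrA.
have a10 : 0 < alpha - 1 by rewrite subr_gt0.
have ts0 : 0 < ts by rewrite tsE powR_gt0 // divr_gt0.
have tsB : C_A * (alpha * Gamma (- alpha)) * ts `^ (alpha - 1) = B.
  rewrite tsE -powRrM mulVf ?gt_eqF // powRr1 ?divr_ge0 ?(ltW B0) ?(ltW k0) //.
  by rewrite mulrC divfK // gt_eqF.
have [eps [eps0 eps1]] := hmoment; rewrite unlock => moment.
have momentE : (\int[P0]_w (S0 w `^ (1 + eps))%:E =
    (fine (\int[P0]_w (S0 w `^ (1 + eps))%:E))%:E)%E.
  rewrite fineK // ge0_fin_numE //.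
  by apply: integral_ge0 => w _; rewrite lee_fin powR_ge0.
(* Below the critical exponent the load condition is strict; the bound at [ts] follows by letting
   [theta] increase. *)
have le_theta theta : 0 < theta -> theta < ts ->
    (upper_decay tail <= (- theta)%:E)%E /\ (lower_decay tail <= (- theta)%:E)%E.
  move=> th0 thts; apply: decay_le => //.
  apply: (upper_tail hA0 hS0 hAS hEA hES halpha1 halpha2 hC_A B0 htail eps0 eps1 momentE st th0).
  by rewrite -[ltRHS]tsB ltr_pM2l // gt0_ltr_powR // nnegrE ltW.
have le_ts : (upper_decay tail <= (- ts)%:E)%E /\ (lower_decay tail <= (- ts)%:E)%E.
  have half e : 0 < e -> exists theta, [/\ 0 < theta, theta < ts & - theta <= - ts + e].
    move=> e0; exists (Num.max (ts / 2) (ts - e)).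
    rewrite lt_max gt_max divr_gt0 //= lerNl opprD opprK le_max lexx orbT; split => //.
    by apply/andP; split; move: ts0 e0; clear; lra.
  split; apply/lee_addgt0Pr => e /half[th [th0 thts le_e]]; have [le1 le2] := le_theta th th0 thts.
    by apply: (le_trans le1); rewrite -EFinD lee_fin.
  by apply: (le_trans le2); rewrite -EFinD lee_fin.
split; first by case: le_ts.
move=> detS; have S1 := deterministic_unit hS0 hES detS.
have ge_e e : 0 < e ->
    ((- ts - e)%:E <= upper_decay tail)%E /\ ((- ts - e)%:E <= lower_decay tail)%E.
  move=> e0; have e20 : 0 < e / 2 by rewrite divr_gt0.
  have -> : - ts - e = - (ts + e / 2) - e / 2 by rewrite [e in LHS]splitr; ring.
  apply: decay_ge => //; rewrite tsE.
  exact: (lower_tail hA0 hAS hEA S1 halpha1 halpha2 hC_A B0 htail st e20).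
case: le_ts => le1 le2; split; apply/le_anti/andP; split=> //; apply/lee_addgt0Pr => e e0.
  by rewrite -leeBlDr // -EFinD; case: (ge_e e e0).
by rewrite -leeBlDr // -EFinD; case: (ge_e e e0).
Qed.
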